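(* Let $0\le\beta<\alpha\le 1$, $\nu>0$, $T>0$, let $\lambda$ be a real constant, and let $\Omega=\{(x,t): 0<x<1,\ 0<t<T\}$. Let $f(x,t)$ be a given function on $[0,1]\times[0,T]$ such that (i) $f(x,t)$ is four times differentiable with respect to $x$; (ii) for all $t$, $f(0,t)=f_x(0,t)=f_{xx}(0,t)=f_{xxx}(0,t)=0$ and $f(1,t)=f_x(1,t)=f_{xx}(1,t)=0$; (iii) $\dfrac{\partial^4 f(x,t)}{\partial x^4}$ is bounded; (iv) $f(x,t)$ is continuous and continuously differentiable with respect to $t$. Then there exists a unique function $u(x,t)$ satisfying the equation $$\partial_{0t}^{\alpha}u(x,t)+\lambda\,\partial_{0t}^{\beta}u(x,t)=u_{xx}(x,t)+\frac1x u_x(x,t)-\frac{\nu^2}{x^2}u(x,t)+f(x,t)\quad\text{in }\Omega,$$ the regularity conditions $$u,\ u_{xx},\ \partial_{0t}^{\alpha}u\in C(\Omega),\qquad \int_0^1\sqrt{x}\,|u(x,t)|\,dx<+\infty,$$ the boundary conditions $$\lim_{x\to0}x\,u_x(x,t)=0,\qquad u(1,t)=0,$$ and the initial condition $$u(x,0)=0,\qquad 0\le x\le1.$$ Moreover, this solution is represented by $$u(x,t)=\sum_{n=1}^\infty\left[\int_0^t z^{\alpha-1}E_{(\alpha-\beta,\alpha),\alpha}\left(-\lambda z^{\alpha-\beta},-\gamma_n^2z^\alpha\right)f_n(t-z)\,dz\right]J_\nu(\gamma_nx).$$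
   Context: $J_\nu$ is the Bessel function of the first kind of order $\nu$, and $\gamma_n$ ($n=1,2,\dots$) denotes the $n$-th positive zero of $J_\nu$. The Fourier-Bessel coefficients of $f$ are $$f_n(t)=\frac{2}{J_{\nu+1}^2(\gamma_n)}\int_0^1 f(x,t)\,x\,J_\nu(\gamma_nx)\,dx .$$ $\partial_{0t}^{\alpha}$ is the Caputo fractional derivative in $t$: for $0<\alpha<1$, $$\partial_{0t}^{\alpha}g(t)=\frac{1}{\Gamma(1-\alpha)}\int_0^t\frac{g'(z)}{(t-z)^{\alpha}}\,dz,$$ while $\partial_{0t}^{1}g=g'$ and $\partial_{0t}^{0}g=g$. Applied to a function $u(x,t)$, it acts in $t$ for fixed $x$. The two-variable (multinomial) Mittag-Leffler function is $$E_{(\alpha-\beta,\alpha),\rho}(x,y)=\sum_{k=0}^\infty\sum_{i=0}^k\frac{k!}{i!\,(k-i)!}\cdot\frac{x^iy^{k-i}}{\Gamma(\rho+\alpha k-\beta i)} .$$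
   Formalization: The solution u is required to be continuous on the closed rectangle [0,1]×[0,T] rather than only on the open Ω, since with u ∈ C(Ω) alone the values u(x,0), u(1,t), u(0,t) are unrelated to u inside Ω and uniqueness fails. *)

(* Defs.v *)
From HB Require Import structures.
From mathcomp Require Import all_boot all_order all_algebra.
From mathcomp Require Import all_classical all_reals all_analysis.

Set Implicit Arguments.
Unset Strict Implicit.
Unset Printing Implicit Defensive.

Import Order.TTheory GRing.Theory Num.Theory.
Import numFieldTopology.Exports numFieldNormedType.Exports.

Local Open Scope classical_set_scope.
Local Open Scope ring_scope.

(* Euler's integral, which converges only for s > 0.  Every argument below is
   positive: m + nu + 1, rho + alpha k - beta i with i <= k and beta < alpha,
   and 1 - alpha with alpha < 1. *)
Definition Gamma (R : realType) (s : R) : R :=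
  \int[lebesgue_measure]_(t in `]0, +oo[) (t `^ (s - 1) * expR (- t)).

(* Meant for x >= 0 (powR is the real power of a nonnegative base). *)
Definition besselJ (R : realType) (nu x : R) : R :=
  limn (series (fun m : nat =>
    (-1) ^+ m / (m`!%:R * Gamma (m%:R + nu + 1))
      * (x / 2) `^ (2 * m%:R + nu))).

(* For n >= 1 this is the n-th positive zero of J_nu: the zeros are isolated and
   infinitely many, so each infimum is the next zero.  The value 0 at n = 0 only
   starts the recursion. *)
Fixpoint besselJ_zero (R : realType) (nu : R) (n : nat) : R :=
  if n is n'.+1 then
    inf [set x : R | besselJ_zero nu n' < x /\ besselJ nu x = 0]
  else 0.

Definition fourier_bessel_coef (R : realType) (nu : R) (f : R -> R -> R)
    (n : nat) (t : R) : R :=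
  2 / besselJ (nu + 1) (besselJ_zero nu n) ^+ 2 *
  \int[lebesgue_measure]_(x in `[0, 1])
    (f x t * x * besselJ nu (besselJ_zero nu n * x)).

(* E_{(alpha - beta, alpha), rho}(x, y) *)
Definition mittag_leffler2 (R : realType) (alpha beta rho x y : R) : R :=
  limn (series (fun k : nat =>
    \sum_(i < k.+1) 'C(k, i)%:R *
      (x ^+ i * y ^+ (k - i) / Gamma (rho + alpha * k%:R - beta * i%:R)))).

Definition caputo_integrand (R : realType) (alpha : R) (g : R -> R) (t z : R) : R :=
  derive1 g z * (t - z) `^ (- alpha).

(* Order alpha in [0, 1]. *)
Definition caputo (R : realType) (alpha : R) (g : R -> R) (t : R) : R :=
  if alpha == 0 then g t
  else if alpha == 1 then derive1 g t
  else (Gamma (1 - alpha))^-1 *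
       \int[lebesgue_measure]_(z in `]0, t[) caputo_integrand alpha g t z.

(* The derivative and the integral are total functions in the library, so that
   the existence of [caputo alpha g t] has to be stated separately. *)
Definition caputo_derivable (R : realType) (alpha : R) (g : R -> R) (t : R) : Prop :=
  if alpha == 0 then True
  else if alpha == 1 then derivable g t 1
  else (forall z : R, 0 < z < t -> derivable g z 1) /\
       lebesgue_measure.-integrable `]0, t[
         (fun z => (caputo_integrand alpha g t z)%:E).

(* Derivative relative to a set D; on an interval it is one-sided at the
   endpoints, so that it ignores the values of g outside D. *)
Definition derivable_on (R : realType) (D : set R) (g : R -> R) (x : R) : Prop :=
  cvg ((g y - g x) / (y - x) @[y --> within D x^']).

Definition derive_on (R : realType) (D : set R) (g : R -> R) (x : R) : R :=
  lim ((g y - g x) / (y - x) @[y --> within D x^']).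

Definition deriven_on (R : realType) (D : set R) (k : nat) (g : R -> R) : R -> R :=
  iter k (derive_on D) g.

Definition open_rect (R : realType) (T : R) : set (R * R) := `]0, 1[ `*` `]0, T[.

Definition closed_rect (R : realType) (T : R) : set (R * R) := `[0, 1] `*` `[0, T].

Definition admissible_source (R : realType) (T : R) (f : R -> R -> R) : Prop :=
  [/\
    forall t : R, t \in `[0, T] -> forall k, (k < 4)%N ->
      forall x : R, x \in `[0, 1] ->
        derivable_on `[0, 1] (deriven_on `[0, 1] k (f ^~ t)) x,
    forall t : R, t \in `[0, T] ->
      (forall k, (k < 4)%N -> deriven_on `[0, 1] k (f ^~ t) 0 = 0) /\
      (forall k, (k < 3)%N -> deriven_on `[0, 1] k (f ^~ t) 1 = 0),
    exists M : R, forall x t : R, x \in `[0, 1] -> t \in `[0, T] ->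
      `|deriven_on `[0, 1] 4 (f ^~ t) x| <= M
  & [/\ {within closed_rect T, continuous (fun p : R * R => f p.1 p.2)},
        forall x t : R, x \in `[0, 1] -> t \in `[0, T] ->
          derivable_on `[0, T] (f x) t
      & {within closed_rect T, continuous
          (fun p : R * R => derive_on `[0, T] (f p.1) p.2)}]].

Definition satisfies_equation (R : realType) (alpha beta nu lambda T : R)
    (f u : R -> R -> R) : Prop :=
  forall x t : R, x \in `]0, 1[ -> t \in `]0, T[ ->
    [/\ derivable (u ^~ t) x 1, derivable (derive1 (u ^~ t)) x 1,
        caputo_derivable alpha (u x) t, caputo_derivable beta (u x) t
      & caputo alpha (u x) t + lambda * caputo beta (u x) t =
        derive1n 2 (u ^~ t) x + x^-1 * derive1 (u ^~ t) x - nu ^+ 2 / x ^+ 2 * u x t + f x t].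

(* u is required to be continuous up to the boundary, so that the initial and
   boundary values are attained as limits.  Continuity in the open rectangle
   alone would not give uniqueness: for alpha = 1, beta = lambda = 0, the function
   equal to exp (- gamma_1 ^ 2 t) J_nu (gamma_1 x) for t > 0 and to 0 for t = 0
   would be a second solution of the homogeneous problem. *)
Definition regular (R : realType) (alpha T : R) (u : R -> R -> R) : Prop :=
  [/\ {within closed_rect T, continuous (fun p : R * R => u p.1 p.2)},
      {within open_rect T, continuous (fun p : R * R => derive1n 2 (u ^~ p.2) p.1)},
      {within open_rect T, continuous (fun p : R * R => caputo alpha (u p.1) p.2)}
    & forall t : R, t \in `]0, T[ ->
        (\int[lebesgue_measure]_(x in `[0%R, 1%R]) (Num.sqrt x * `|u x t|)%:E < +oo)%E].

Definition boundary_conditions (R : realType) (T : R) (u : R -> R -> R) : Prop :=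
  forall t : R, t \in `]0, T[ ->
    x * derive1 (u ^~ t) x @[x --> 0^'+] --> (0 : R) /\ u 1 t = 0.

Definition initial_condition (R : realType) (u : R -> R -> R) : Prop :=
  forall x : R, x \in `[0, 1] -> u x 0 = 0.

Definition solution (R : realType) (alpha beta nu lambda T : R)
    (f u : R -> R -> R) : Prop :=
  [/\ satisfies_equation alpha beta nu lambda T f u, regular alpha T u,
      boundary_conditions T u & initial_condition u].

Definition solution_coef (R : realType) (alpha beta nu lambda : R)
    (f : R -> R -> R) (n : nat) (t : R) : R :=
  \int[lebesgue_measure]_(z in `[0, t])
    (z `^ (alpha - 1) *
     mittag_leffler2 alpha beta alpha (- lambda * z `^ (alpha - beta))
       (- besselJ_zero nu n ^+ 2 * z `^ alpha) *
     fourier_bessel_coef nu f n (t - z)).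

(* Main.v *)
(* Let L p = p'' + p'/x - nu^2 p/x^2, and let e_n be J_nu(gamma_n x) normalised for the weight x on
   [0, 1].  The e_n are the eigenfunctions, for the eigenvalues gamma_n^-2, of the Green operator G
   of -L.  The energy identity gives sum_n e_n(x)^2 / gamma_n^2 <= 1 / (2 nu), so sum_n gamma_n^-2
   is finite and sum_n c_n e_n converges uniformly when c_n = O(gamma_n^-2).  The e_n are complete:
   if h is orthogonal to all of them and nonzero, the ratios ||G^(k+1) h|| / ||G^k h|| increase to
   some r > 0, so that (G - r)(G + r) G^k h is small compared with G^k h, whereas G - r and G + r are
   bounded below on the orthogonal complement of the e_n.

   Write g_a(z) = z^(a-1) / Gamma(a), so that the Caputo derivative of order rho of u is
   g_(1-rho) * u_t.  The kernel K(z) = z^(alpha-1) E(-lambda z^(alpha-beta), -gamma_n^2 z^alpha)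
   solves K + lambda g_(alpha-beta) * K + gamma_n^2 g_alpha * K = g_alpha, and |K| <= C g_alpha and
   int |K| <= C / gamma_n^2 with C independent of n.  Since f = G h with h bounded, its coefficients
   a_n are O(gamma_n^-2), and u_n = K * a_n can be summed term by term: u_t = sum_n u_n' e_n and
   u = G (sum_n gamma_n^2 u_n e_n).

   For uniqueness, integrate the equation over [d, t]: V = int_d^t v(., s) ds is a bounded solution
   of L V = Z(t) - Z(d) - int_d^t f with Z = g_(1-alpha) * v + lambda g_(1-beta) * v, hence a Green
   potential.  Projecting on e_n and letting d tend to 0, the coefficient y of the difference of two
   solutions satisfies g_(1-alpha) * y + lambda g_(1-beta) * y + gamma_n^2 (1 * y) = 0, which forces
   y = 0, and completeness concludes. *)

From HB Require Import structures.
Require Import Defs.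
From mathcomp Require Import all_boot all_order all_algebra.
From mathcomp Require Import all_classical all_reals all_analysis.
From mathcomp Require Import measurable_realfun ring lra.

Set Implicit Arguments.
Unset Strict Implicit.
Unset Printing Implicit Defensive.

Import Order.TTheory GRing.Theory Num.Theory.
Import numFieldTopology.Exports numFieldNormedType.Exports.

Local Open Scope classical_set_scope.
Local Open Scope ring_scope.

(** * Integrals and convolutions on the half line *)

(** Two difficulties shape the proof. The bounds on K must not depend on gamma_n, whereas summing
    the Mittag-Leffler series gives constants that grow with it. The case lambda = 0 is therefore
    treated first: its kernel r is positive, because at a first zero the equation r = g_alpha - mu
    g_alpha * r, compared with a nearby maximum of r, is contradictory; hence mu r has mass at most
    1. The lambda term is then a perturbation, absorbed in norms weighted by exp (k z), in which
    convolution with g_a is small for k large; this k does not depend on gamma_n. The second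
    difficulty is the weak regularity of an arbitrary solution v. For alpha < 1 its time derivative
    is only known to exist and to make the Caputo integrand integrable, so the fundamental theorem
    of calculus is needed for a derivative that exists everywhere and is integrable. Continuity of
    v_x is not assumed either, and comes from v_xx through difference quotients. Boundedness of V
    singles out the Green potential, since the other homogeneous solution grows like x^(-nu). That
    J_nu has infinitely many zeros is a Sturm comparison with x^(-1/2) sin ((x - a) / 2). *)

Section Affine.
Context {R : realType}.
Notation leb := (@lebesgue_measure R).
Implicit Types a c : R.

Lemma measurable_affine a c : measurable_fun setT (fun x : R => a + c * x).
Proof. by apply: measurable_funD => //; apply: measurable_funM. Qed.

(** Both sides are measures in [A], and they agree on the intervals ]x, y], which determine Lebesgue
    measure. For c < 0 the preimage of such an interval is closed on the left instead, with the same
    length. *)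
Lemma lebesgue_measure_affine a c (A : set R) : c != 0 -> measurable A ->
  leb A = (`|c|%:E * leb ((fun x : R => a + c * x)%R @^-1` A))%E.
Proof.
move=> c0 mA.
pose phi : measurableTypeR R -> measurableTypeR R := fun x => a + c * x.
have mphi : measurable_fun setT phi by exact: measurable_affine.
pose p : {measure set (measurableTypeR R) -> \bar R} :=
  @measure_function_pushforward__canonical__measure_function_Measure _ _ _ _ R leb phi mphi.
pose m := mscale (NngNum (normr_ge0 c)) p.
transitivity (m A); last by [].
apply: lebesgue_measure_unique => // X [[x y] _ <-] /=.
rewrite /m /mscale /p /= /pushforward /=.
rewrite lebesgue_measure_itv /= lte_fin.
have -> : phi @^-1` `]x, y]%classic = (if 0 < c then `](x - a) / c, (y - a) / c]%classic else `[(y - a) / c, (x - a) / c[%classic).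
  have e z : (z * c = c * z) by rewrite mulrC.
  apply/seteqP; split => z /=.
    rewrite in_itv /= /phi => /andP[h1 h2]; case: ltP => hc; rewrite /= in_itv/=.
      by apply/andP; split; rewrite ?ltr_pdivrMr ?ler_pdivlMr// e; lra.
    have hc' : c < 0 by rewrite lt_neqAle c0.
    by apply/andP; split; rewrite ?ltr_ndivlMr ?ler_ndivrMr// e; lra.
  case: ltP => hc; rewrite /= !in_itv/= /phi.
    by rewrite ltr_pdivrMr// ler_pdivlMr// e; lra.
  have hc' : c < 0 by rewrite lt_neqAle c0.
  by rewrite ltr_ndivlMr// ler_ndivrMr// e; lra.
case: (ltP 0 c) => hc.
  rewrite lebesgue_measure_itv /= lte_fin ltr_pM2r ?invr_gt0// ltrD2r.
  case: ifPn => xy; last by rewrite mule0.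
  by rewrite -!EFinD -EFinM gtr0_norm//; congr EFin; field.
have hc' : c < 0 by rewrite lt_neqAle c0.
rewrite lebesgue_measure_itv /= lte_fin ltr_nM2r ?invr_lt0// ltrD2r.
case: ifPn => xy; last by rewrite mule0.
by rewrite -!EFinD -EFinM ltr0_norm//; congr EFin; field.
Qed.

Lemma ge0_integral_affine a c (F : R -> \bar R) : c != 0 ->
  measurable_fun setT F -> (forall x, 0 <= F x)%E ->
  (\int[leb]_x F x = `|c|%:E * \int[leb]_x F (a + c * x)%R)%E.
Proof.
move=> c0 mF F0.
pose phi : measurableTypeR R -> measurableTypeR R := fun x => a + c * x.
have mphi : measurable_fun setT phi by exact: measurable_affine.
pose p : {measure set (measurableTypeR R) -> \bar R} :=
  @measure_function_pushforward__canonical__measure_function_Measure _ _ _ _ R leb phi mphi.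
have -> : (\int[leb]_x F (a + c * x)%R = \int[p]_x F x)%E.
  by rewrite (ge0_integral_pushforward mphi leb measurableT mF).
rewrite -(ge0_integral_mscale p measurableT (NngNum (normr_ge0 c))) //.
apply: eq_measure_integral => A mA _ /=.
by rewrite (lebesgue_measure_affine a c0 mA).
Qed.

Lemma integral_subr a (F : R -> \bar R) : measurable_fun setT F ->
  (\int[leb]_x F (a - x)%R = \int[leb]_x F x)%E.
Proof.
move=> mF; rewrite [LHS]integralE [in RHS]integralE.
have h (G : R -> \bar R) : measurable_fun setT G -> (forall x, 0 <= G x)%E ->
    (\int[leb]_x G x = \int[leb]_x G (a - x)%R)%E.
  move=> mG G0; rewrite (ge0_integral_affine a (_ : -1 != 0) mG G0).
    by rewrite normrN1 mul1e; apply: eq_integral => x _; rewrite mulN1r.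
  by rewrite oppr_eq0 oner_eq0.
congr (_ - _)%E; symmetry.
  have e := h _ (measurable_funepos mF) (funepos_ge0 F).
  by etransitivity; [exact: e|apply: eq_integral => x _; rewrite !funeposE].
have e := h _ (measurable_funeneg mF) (funeneg_ge0 F).
by etransitivity; [exact: e|apply: eq_integral => x _; rewrite !funenegE].
Qed.

Lemma integral_addr a (F : R -> \bar R) : measurable_fun setT F ->
  (\int[leb]_x F (x + a)%R = \int[leb]_x F x)%E.
Proof.
move=> mF; rewrite -(integral_subr 0 mF).
rewrite -(@integral_subr (- a) (fun x => F (x + a)%R)).
  by apply: eq_integral => x _; congr F; lra.
by apply: measurableT_comp => //; exact: measurable_funD.
Qed.
End Affine.

Section PowerIntegral.
Context {R : realType}.
Notation leb := (@lebesgue_measure R).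

Lemma is_derive_powR (a x : R) : 0 < x ->
  is_derive x 1 (fun z : R => z `^ a) (a * x `^ (a - 1)).
Proof.
move=> x0; have xi : x \in `]0, +oo[ by rewrite in_itv /= x0.
apply: DeriveDef; first exact: derivable_powR.
by rewrite -derive1E powR_derive1.
Qed.

Lemma continuous_powR (a x : R) : 0 < x -> {for x, continuous (fun z : R => z `^ a)}.
Proof.
move=> x0; apply: differentiable_continuous; apply/derivable1_diffP.
by have [] := is_derive_powR a x0.
Qed.

Lemma integral_powR_itvcc (a s t : R) : 0 < a -> 0 < s -> s < t ->
  (\int[leb]_(z in `[s, t]) (z `^ (a - 1))%:E = (t `^ a / a - s `^ a / a)%:E)%E.
Proof.
move=> a0 s0 st.
have cF (b : R) : {within `[s, t], continuous (fun z : R => z `^ b)}.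
  apply: continuous_in_subspaceT => z; rewrite inE /= in_itv /= => /andP[sz _].
  by apply: continuous_powR; lra.
have dF (z : R) : 0 < z -> is_derive z 1 (fun z : R => z `^ a / a) (z `^ (a - 1)).
  move=> z0; have := @is_derive_powR a z z0 => h.
  have -> : z `^ (a - 1) = a^-1 *: (a * z `^ (a - 1)).
    by rewrite /GRing.scale /= mulrA mulVf ?mul1r// gt_eqF.
  have -> : (fun z : R => z `^ a / a) = a^-1 \*: (fun z : R => z `^ a).
    by apply/funext => y; rewrite /= mulrC.
  exact: is_deriveZ.
rewrite (@continuous_FTC2 _ _ (fun z : R => z `^ a / a))//.
  split.
  - by move=> z; rewrite in_itv /= => /andP[sz _]; have [] := dF z _ => //; lra.
  - have := cF a; move/(continuous_within_itvP _ st) => [_ h _].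
    by apply: cvgMr_tmp.
  - have := cF a; move/(continuous_within_itvP _ st) => [_ _ h].
    by apply: cvgMr_tmp.
move=> z; rewrite in_itv /= => /andP[sz _].
by rewrite derive1E; have [] := dF z _ => //; lra.
Qed.

End PowerIntegral.

Section PowerIntegral0.
Context {R : realType}.
Notation leb := (@lebesgue_measure R).

Lemma measurable_powR_fun (a : R) : measurable_fun setT (fun z : R => z `^ a).
Proof. exact: measurable_powR. Qed.

(** The integrand is unbounded at 0 when a < 1, so ]0, t] is exhausted by compact intervals and the
    integral is the monotone limit of those of [integral_powR_itvcc]. *)
Lemma integral_powR_itvoc (a t : R) : 0 < a -> 0 < t ->
  (\int[leb]_(z in `]0%R, t]) (z `^ (a - 1))%:E = (t `^ a / a)%:E)%E.
Proof.
move=> a0 t0.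
(* Division by i + 2 rather than i + 1 keeps the lower end strictly below t. *)
pose F (i : nat) : set R := `[t / i.+2%:R, t]%classic.
have Fcup : \bigcup_i F i = `]0, t]%classic.
  apply/seteqP; split => z /=.
    move=> [i _]; rewrite /F /= !in_itv /= => /andP[h ->]; rewrite andbT.
    by apply: lt_le_trans h; rewrite divr_gt0.
  rewrite in_itv /= => /andP[z0 zt].
  exists (Num.truncn (t / z)); rewrite // /F /= in_itv /= zt andbT.
  rewrite ler_pdivrMr// mulrC -ler_pdivrMr//.
  have := truncnS_gt (t / z); rewrite -natr1 -[in X in _ -> X]natr1 -natr1; lra.
have key := @ge0_nondecreasing_set_cvg_integral _ (measurableTypeR R) R F (fun z => (z `^ (a - 1))%:E) leb.
have {}key : (\int[leb]_(z in F i) (z `^ (a - 1))%:E)%E @[i --> \oo] -->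
    (\int[leb]_(z in `]0%R, t]) (z `^ (a - 1))%:E)%E.
  rewrite -Fcup; apply: key.
  - move=> m n mn; apply/subsetPset => z; rewrite /F /= !in_itv /= => /andP[h ->].
    rewrite andbT; apply: le_trans h; rewrite ler_pM2l// lef_pV2 ?posrE ?ltr0n//.
    by rewrite ler_nat !ltnS.
  - by move=> i; exact: measurable_itv.
  - move=> i; apply: measurable_funTS; apply/measurable_EFinP.
    exact: measurable_powR_fun.
  - by move=> i x _; rewrite lee_fin powR_ge0.
have lim : (t `^ a / a - (t / i.+2%:R) `^ a / a) @[i --> \oo] --> (t `^ a / a : R).
  rewrite -[X in _ --> X]subr0 -[X in _ - X](mul0r a^-1).
  apply: cvgB; first exact: cvg_cst.
  apply: cvgMr_tmp.
  have := @powR_cvg0 R a a0; move/cvg_at_rightP; apply; split.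
    by move=> n; rewrite divr_gt0.
  rewrite -[X in _ --> X](mulr0 t); apply: cvgMl_tmp.
  have := (@cvg_harmonic R); rewrite -(cvg_shiftS _); exact.
apply: (cvg_unique _ key) => //.
have -> : (fun i => (\int[leb]_(z in F i) (z `^ (a - 1))%:E)%E) =
    (fun i => (t `^ a / a - (t / i.+2%:R) `^ a / a)%:E).
  apply/funext => i; rewrite integral_powR_itvcc ?divr_gt0//.
  by rewrite ltr_pdivrMr// ltr_pMr// ltr1n.
by apply: cvg_EFin => /=; [exact: nearW|exact: lim].
Qed.

Lemma integrable_powR_itvoo (a t : R) : 0 < a -> 0 < t ->
  leb.-integrable `]0, t[ (fun z : R => (z `^ (a - 1))%:E).
Proof.
move=> a0 t0; apply: (@integrableS _ _ _ leb `]0, t]%classic) => //.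
  by apply: subset_itvl; rewrite bnd_simp.
apply/integrableP; split.
  by apply/measurable_EFinP; apply: measurable_funTS; exact: measurable_powR_fun.
under eq_integral do rewrite /= ger0_norm ?powR_ge0//.
by rewrite integral_powR_itvoc// ltry.
Qed.

Lemma Rintegral_powR_itvoo (a t : R) : 0 < a -> 0 < t ->
  \int[leb]_(z in `]0, t[) (z `^ (a - 1)) = t `^ a / a.
Proof.
move=> a0 t0; rewrite Rintegral_itv_bndo_bndc.
  by rewrite /Rintegral integral_powR_itvoc.
exact: integrable_powR_itvoo.
Qed.
End PowerIntegral0.

Section RealIntegrable.
Context {R : realType}.
Notation leb := (@lebesgue_measure R).
Notation rint D f := (leb.-integrable D (EFin \o f)).
Implicit Types (D : set R) (f g : R -> R).

Lemma rint_measurable D f : rint D f -> measurable_fun D f.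
Proof. by move=> /measurable_int /measurable_EFinP. Qed.

Lemma rint_le D f g : measurable (D : set (measurableTypeR R)) -> measurable_fun D f ->
  (forall x, D x -> `|f x| <= g x) -> rint D g -> rint D f.
Proof.
move=> mD mf fg; apply: le_integrable => //; first exact/measurable_EFinP.
by move=> x Dx /=; rewrite lee_fin (le_trans (fg x Dx))// ler_norm.
Qed.

Lemma rintD D f g : measurable (D : set (measurableTypeR R)) -> rint D f -> rint D g ->
  rint D (fun x => f x + g x).
Proof.
move=> mD If Ig; have := integrableD mD If Ig.
by apply: eq_integrable => // x _ /=; rewrite EFinD.
Qed.

Lemma rintB D f g : measurable (D : set (measurableTypeR R)) -> rint D f -> rint D g ->
  rint D (fun x => f x - g x).
Proof.
move=> mD If Ig; have := integrableB mD If Ig.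
by apply: eq_integrable => // x _ /=; rewrite EFinB.
Qed.

Lemma rintZ D f (k : R) : measurable (D : set (measurableTypeR R)) -> rint D f -> rint D (fun x => k * f x).
Proof.
move=> mD If; have := integrableZl mD k If.
by apply: eq_integrable => // x _ /=; rewrite EFinM.
Qed.

Lemma rintS D E f : measurable (D : set (measurableTypeR R)) -> measurable (E : set (measurableTypeR R)) -> E `<=` D -> rint D f -> rint E f.
Proof. by move=> mD mE ED; exact: integrableS. Qed.

Lemma eq_rint D f g : measurable (D : set (measurableTypeR R)) -> (forall x, D x -> f x = g x) -> rint D f -> rint D g.
Proof.
move=> mD fg; apply: eq_integrable => // x; rewrite inE => Dx /=.
by rewrite fg.
Qed.

Lemma rint_norm D f : rint D f -> rint D (fun x => `|f x|).
Proof. exact: integrable_abse. Qed.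

Lemma rint_patch D f : measurable (D : set (measurableTypeR R)) -> rint setT (f \_ D) <-> rint D f.
Proof.
move=> mD; have := integrable_mkcond (mu := leb) (EFin \o f) mD.
by rewrite restrict_EFin => h; split => ?; apply/h.
Qed.

Lemma rint_bounded (a b : R) f (M : R) : measurable_fun `]a, b[ f ->
  (forall x, a < x < b -> `|f x| <= M) -> rint `]a, b[ f.
Proof.
move=> mf fM; apply: (@rint_le _ _ (cst M)) => //.
apply: measurable_bounded_integrable => //.
  suff : (leb `]a, b[%classic < +oo)%E by [].
  by rewrite lebesgue_measure_itv /=; case: ifP => // _; rewrite ltry.
by exists `|M|; split => // y yM x _ /=; exact: ltW.
Qed.

End RealIntegrable.

(** * Convergence and positivity of Euler's integral *)

Section GammaBasics.
Context {R : realType}.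
Notation leb := (@lebesgue_measure R).
Notation rint D f := (leb.-integrable D (EFin \o f)).

(** Apply y <= exp y to y = t / (2p) and raise to the power p. The resulting exp (t / 2) is absorbed
    by half of the factor exp (-t) of Euler's integral. *)
Lemma powR_le_expR (p t : R) : 0 < p -> 0 <= t -> t `^ p <= (2 * p) `^ p * expR (t / 2).
Proof.
move=> p0 t0.
have h : t <= (2 * p) * expR (t / (2 * p)).
  have p2 : 0 < 2 * p by rewrite mulr_gt0.
  rewrite -ler_pdivrMl// mulrC (le_trans _ (expR_ge1Dx _))//; lra.
have -> : expR (t / 2) = expR (t / (2 * p)) `^ p.
  by rewrite -expRM; congr expR; field; rewrite gt_eqF.
have p2 : 0 <= 2 * p by rewrite mulr_ge0// ltW.
rewrite -powRM ?expR_ge0//.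
by apply: ge0_ler_powR => //; rewrite ?nnegrE ?(ltW p0)// mulr_ge0 ?expR_ge0.
Qed.

Lemma integrable_Gamma (s : R) : 0 < s ->
  rint `]0, +oo[ (fun t : R => t `^ (s - 1) * expR (- t)).
Proof.
move=> s0.
(* Near 0 the power dominates; beyond 1, [powR_le_expR] leaves a multiple of exp (-t / 2), written
   as twice the exponential density of rate 1/2, whose integral is known. *)
pose G := fun t : R => ((fun z : R => z `^ (s - 1)) \_ `]0, 1[) t +
   (2 * (2 * s) `^ s) * exponential_pdf 2^-1 t.
have IG : rint `]0, +oo[ G.
  apply: (@rintS _ setT) => //; apply: rintD => //.
    by apply/rint_patch => //; exact: integrable_powR_itvoo.
  apply: rintZ => //; apply/integrableP; split.
    by apply/measurable_EFinP; exact: measurable_exponential_pdf.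
  under eq_integral do rewrite /= ger0_norm ?exponential_pdf_ge0//.
  by rewrite integral_exponential_pdf ?ltry// invr_gt0.
apply: (rint_le _ _ _ IG) => //.
  apply: measurable_funTS; apply: measurable_funM; first exact: measurable_powR_fun.
  by apply: measurableT_comp => //; exact: measurable_expR.
move=> t /=; rewrite in_itv /= andbT => t0.
rewrite ger0_norm ?mulr_ge0 ?powR_ge0 ?expR_ge0// /G patchE.
have e0 := @exponential_pdf_ge0 R 2^-1 (ltW (_ : 0 < 2^-1)) t.
case: (ltP t 1) => t1.
  rewrite mem_set /= ?in_itv /= ?t0 ?t1//.
  apply: (@le_trans _ _ (t `^ (s - 1))).
    by rewrite ler_piMr ?powR_ge0// expR_le1; lra.
  by rewrite lerDl mulr_ge0// ?mulr_ge0 ?powR_ge0// e0// invr_gt0.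
rewrite memNset /=; last by rewrite in_itv /= => /andP[_]; rewrite ltNge t1.
rewrite [point](_ : _ = 0)// add0r exponential_pdfE; last exact: ltW.
have -> : 2 * (2 * s) `^ s * (2^-1 * expR (- 2^-1 * t)) = (2 * s) `^ s * expR (t / 2) * expR (- t).
  rewrite -[RHS]mulrA -expRD.
  have -> : t / 2 - t = - 2^-1 * t by lra.
  by field.
rewrite ler_pM2r ?expR_gt0//.
apply: le_trans (powR_le_expR s0 (ltW t0)).
by apply: ler_powR => //; lra.
Qed.

Lemma Rintegral_ge_itv (D : set (measurableTypeR R)) (f : R -> R) (a b c : R) :
  measurable D -> rint D f -> (forall x, D x -> 0 <= f x) ->
  `]a, b[ `<=` D -> (forall x, a < x < b -> c <= f x) -> a <= b ->
  c * (b - a) <= \int[leb]_(x in D) f x.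
Proof.
move=> mD If f0 abD fc ab.
have mab : measurable (`]a, b[%classic : set (measurableTypeR R)) by exact: measurable_itv.
have Iab : rint `]a, b[ f by exact: rintS If.
have Ic : rint `]a, b[ (cst c).
  by apply: (@rint_bounded _ _ _ _ `|c|) => // x _; exact: lexx.
have -> : c * (b - a) = \int[leb]_(x in `]a, b[) c.
  rewrite Rintegral_cst//; congr (_ * _).
  have -> : fine (leb `]a, b[%classic) = b - a; last by [].
  rewrite lebesgue_measure_itv /= lte_fin; case: ltP => //= ba.
  by apply/eqP; rewrite eq_sym subr_eq0 eq_le ba ab.
apply: (@le_trans _ _ (\int[leb]_(x in `]a, b[) f x)).
  by apply: le_Rintegral => // x; rewrite /= in_itv /=; exact: fc.
apply: fine_le; [exact: integrable_fin_num Iab|exact: integrable_fin_num If|].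
apply: ge0_subset_integral => //; first exact: measurable_int If.
Qed.

Lemma Gamma_gt0 (s : R) : 0 < s -> 0 < Gamma s.
Proof.
move=> s0; rewrite /Gamma.
(* A lower bound of the integrand on ]1, 2[, where the power is monotone in one direction or the
   other according to the sign of s - 1. *)
pose c : R := (Num.min (1 `^ (s - 1)) (2 `^ (s - 1))) * expR (- 2).
have c0 : 0 < c by rewrite mulr_gt0 ?expR_gt0// lt_min !powR_gt0.
apply: (@lt_le_trans _ _ (c * (2 - 1))); first by rewrite mulr_gt0.
apply: Rintegral_ge_itv => //; first exact: integrable_Gamma.
- by move=> x _; rewrite mulr_ge0 ?powR_ge0 ?expR_ge0.
- by move=> x /=; rewrite !in_itv /= => /andP[h _]; rewrite andbT; lra.
- move=> x /andP[x1 x2]; apply: ler_pM.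
  + by rewrite le_min !powR_ge0.
  + exact: expR_ge0.
  + rewrite ge_min; case: (lerP 1 s) => s1.
      by apply/orP; left; apply: ge0_ler_powR; rewrite ?nnegrE; lra.
    apply/orP; right.
    have -> : s - 1 = - (1 - s) by lra.
    rewrite !powRN lef_pV2 ?posrE ?powR_gt0//; last by lra.
    by apply: ge0_ler_powR; rewrite ?nnegrE; lra.
  + by rewrite ler_expR; lra.
- by lra.
Qed.

End GammaBasics.

(** * Convolution over ]0, t[ *)

HB.lock Definition convol (R : realType) (f g : R -> R) (t : R) : R :=
  \int[lebesgue_measure]_(z in `]0, t[) (f z * g (t - z)).

Lemma convolE (R : realType) (f g : R -> R) (t : R) :
  convol f g t = \int[lebesgue_measure]_(z in `]0, t[) (f z * g (t - z)).
Proof. by rewrite convol.unlock. Qed.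

Section Convolution.
Context {R : realType}.
Notation leb := (@lebesgue_measure R).
Notation rint D f := (leb.-integrable D (EFin \o f)).
Implicit Types (f g h : R -> R) (t : R).

Definition cint f g t := rint `]0, t[ (fun z => f z * g (t - z)).
(** Cutting both factors off at 0 turns the integral over ]0, t[ into one over the whole line, to
    which translations, reflections and Tonelli's theorem apply. *)
Definition pos f := fun z : R => if 0 < z then f z else 0.

Lemma posM f g t (z : R) :
  ((fun z => f z * g (t - z)) \_ `]0, t[) z = pos f z * pos g (t - z).
Proof.
rewrite patchE /pos mem_setE in_itv /= subr_gt0.
rewrite [point](_ : _ = 0)//.
by case: (0 < z); case: (z < t) => //=; rewrite ?mul0r ?mulr0.
Qed.

Lemma convol_full f g t : convol f g t = \int[leb]_z (pos f z * pos g (t - z)).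
Proof.
by rewrite !convolE Rintegral_mkcond; apply: eq_Rintegral => z _; rewrite posM.
Qed.

Lemma cint_full f g t :
  cint f g t <-> rint setT (fun z => pos f z * pos g (t - z)).
Proof.
rewrite /cint -rint_patch//; split; apply: eq_rint => // z _; rewrite posM//.
Qed.

Lemma measurable_pos f : measurable_fun setT f -> measurable_fun setT (pos f).
Proof.
move=> mf; apply: measurable_fun_ifT => //; exact: measurable_fun_ltr.
Qed.

Lemma measurable_sub_comp f t : measurable_fun setT f ->
  measurable_fun setT (fun z : R => f (t - z)).
Proof. by move=> mf; apply: measurableT_comp => //; exact: measurable_funB. Qed.

Lemma convolC f g t : measurable_fun setT f -> measurable_fun setT g ->
  convol f g t = convol g f t.
Proof.
move=> mf mg; rewrite !convol_full /Rintegral; congr fine.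
rewrite -(@integral_subr _ t).
  by apply: eq_integral => z _; rewrite subKr mulrC.
apply/measurable_EFinP; apply: measurable_funM; first exact: measurable_pos.
exact: measurable_sub_comp (measurable_pos mg).
Qed.

Lemma cintC f g t : measurable_fun setT f -> measurable_fun setT g ->
  cint f g t -> cint g f t.
Proof.
move=> mf mg /cint_full /integrableP[m1 i1]; apply/cint_full/integrableP; split.
  apply/measurable_EFinP; apply: measurable_funM; first exact: measurable_pos.
  exact: measurable_sub_comp (measurable_pos mf).
apply: le_lt_trans i1; rewrite -(@integral_subr _ t).
  by rewrite le_eqVlt; apply/orP; left; apply/eqP; apply: eq_integral => z _ /=; rewrite subKr mulrC.
apply: measurableT_comp => //; apply/measurable_EFinP; apply: measurable_funM; first exact: measurable_pos.
exact: measurable_sub_comp (measurable_pos mf).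
Qed.

Lemma measurable_convol_kernel f g : measurable_fun setT f -> measurable_fun setT g ->
  measurable_fun setT (fun p : measurableTypeR R * measurableTypeR R => pos f p.2 * pos g (p.1 - p.2)).
Proof.
move=> mf mg; apply: measurable_funM.
  by apply: measurableT_comp (measurable_pos mf) _; exact: measurable_snd.
apply: measurableT_comp (measurable_pos mg) _.
by apply: measurable_funB; [exact: measurable_fst|exact: measurable_snd].
Qed.

Lemma measurable_convol f g : measurable_fun setT f -> measurable_fun setT g ->
  measurable_fun setT (convol f g).
Proof.
move=> mf mg.
pose F := fun p : measurableTypeR R * measurableTypeR R => (pos f p.2 * pos g (p.1 - p.2))%:E.
have mF : measurable_fun setT F by apply/measurable_EFinP; exact: measurable_convol_kernel.
have -> : convol f g = fun t => fine (\int[leb]_s F^\+ (t, s) - \int[leb]_s F^\- (t, s))%E.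
  apply/funext => t; rewrite convol_full /Rintegral; congr fine.
  by rewrite integralE; congr (_ - _)%E; apply: eq_integral => s _; rewrite ?funeposE ?funenegE.
apply: measurableT_comp => //.
apply: emeasurable_funB.
  apply: (@measurable_fun_fubini_tonelli_F _ _ _ _ _ leb F^\+%E) => //; exact: measurable_funepos.
apply: (@measurable_fun_fubini_tonelli_F _ _ _ _ _ leb F^\-%E) => //; exact: measurable_funeneg.
Qed.

Lemma pos_gt0 f z : 0 < z -> pos f z = f z.
Proof. by rewrite /pos => ->. Qed.

Lemma pos_le0 f z : z <= 0 -> pos f z = 0.
Proof. by rewrite /pos ltNge => ->. Qed.

Lemma convol_nonpos f g t : t <= 0 -> convol f g t = 0.
Proof. by move=> t0; rewrite !convolE set_itv_ge ?Rintegral_set0// bnd_simp -leNgt. Qed.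

Lemma cint_nonpos f g t : t <= 0 -> cint f g t.
Proof.
move=> t0; rewrite /cint set_itv_ge; last by rewrite bnd_simp -leNgt.
exact: integrable_set0.
Qed.

Lemma eq_convol f f' g g' t : (forall z, 0 < z < t -> f z = f' z) ->
  (forall z, 0 < z < t -> g z = g' z) -> convol f g t = convol f' g' t.
Proof.
move=> ff gg; rewrite !convolE; apply: eq_Rintegral => z; rewrite inE /= in_itv /= => /andP[z0 zt].
by rewrite ff ?z0// gg//; lra.
Qed.

Lemma measurable_convand f g t : measurable_fun setT f -> measurable_fun setT g ->
  measurable_fun `]0, t[ (fun z : R => f z * g (t - z)).
Proof.
move=> mf mg; apply: measurable_funTS; apply: measurable_funM => //.
exact: measurable_sub_comp.
Qed.

Lemma cint_le f g F G t : measurable_fun setT f -> measurable_fun setT g ->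
  (forall z, 0 < z < t -> `|f z| <= F z) -> (forall z, 0 < z < t -> `|g z| <= G z) ->
  cint F G t -> cint f g t.
Proof.
move=> mf mg fF gG; apply: rint_le => //; first exact: measurable_convand.
move=> z; rewrite /= in_itv /= => /andP[z0 zt].
by rewrite normrM ler_pM// ?fF ?z0// gG//; lra.
Qed.

Lemma norm_convol_le f g F G t : measurable_fun setT f -> measurable_fun setT g ->
  (forall z, 0 < z < t -> `|f z| <= F z) -> (forall z, 0 < z < t -> `|g z| <= G z) ->
  cint F G t -> `|convol f g t| <= convol F G t.
Proof.
move=> mf mg fF gG IFG; have Ifg := cint_le mf mg fF gG IFG.
rewrite !convolE; apply: (le_trans (le_normr_Rintegral _ Ifg)) => //.
apply: le_Rintegral => //; first exact: rint_norm.
move=> z; rewrite /= in_itv /= => /andP[z0 zt].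
by rewrite normrM ler_pM// ?fF ?z0// gG//; lra.
Qed.

Lemma convol_ge0 f g t : (forall z, 0 < z < t -> 0 <= f z) ->
  (forall z, 0 < z < t -> 0 <= g z) -> 0 <= convol f g t.
Proof.
move=> f0 g0; rewrite convolE; apply: Rintegral_ge0 => z; rewrite /= in_itv /= => /andP[z0 zt].
by rewrite mulr_ge0 ?f0 ?z0// g0//; lra.
Qed.

Lemma cintZl (k : R) f h t : cint f h t -> cint (fun z => k * f z) h t.
Proof. by move=> fh; apply: (eq_rint _ _ (rintZ k _ fh)) => // z _; rewrite mulrA. Qed.

Lemma convolDl f g h t : cint f h t -> cint g h t ->
  convol (fun z => f z + g z) h t = convol f h t + convol g h t.
Proof.
move=> fh gh; rewrite !convolE -RintegralD//.
by apply: eq_Rintegral => z _; rewrite mulrDl.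
Qed.

Lemma convolZl (k : R) f h t : cint f h t -> convol (fun z => k * f z) h t = k * convol f h t.
Proof.
move=> fh; rewrite !convolE -RintegralZl//.
by apply: eq_Rintegral => z _; rewrite mulrA.
Qed.

(** Fubini's theorem for F (z, s) = f s g (z - s) h (t - z), integrated over s first or over z
    first; integrability of F is the last hypothesis. That [f] is integrable against [convol g h] is
    part of the conclusion, and the integration of a Caputo derivative relies on it. *)
Lemma cint_convol_assoc f g h t :
  measurable_fun setT f -> measurable_fun setT g -> measurable_fun setT h ->
  (forall z, 0 < z < t -> cint f g z) -> (forall z, 0 < z < t -> cint g h z) ->
  cint (convol (fun z => `|f z|) (fun z => `|g z|)) (fun z => `|h z|) t ->
  cint f (convol g h) t /\ convol (convol f g) h t = convol f (convol g h) t.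
Proof.
move=> mf mg mh Ifg Igh Ifgh.
pose F := fun p : measurableTypeR R * measurableTypeR R =>
  pos f p.2 * pos g (p.1 - p.2) * pos h (t - p.1).
have mF : measurable_fun setT F.
  apply: measurable_funM; first exact: measurable_convol_kernel.
  apply: measurableT_comp (measurable_pos mh) _.
  by apply: measurable_funB => //; exact: measurable_fst.
have posc (f' g' : R -> R) z : pos (convol f' g') z = \int[leb]_s (pos f' s * pos g' (z - s)).
  by rewrite -convol_full /pos; case: ltP => // z0; rewrite convol_nonpos.
have Ifgz z : z < t -> rint setT (fun s => pos f s * pos g (z - s)).
  move=> zt; apply/cint_full; case: (ltP 0 z) => z0; first by apply: Ifg; rewrite z0.
  exact: cint_nonpos.
have Ighz z : z < t -> rint setT (fun s => pos g s * pos h (z - s)).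
  move=> zt; apply/cint_full; case: (ltP 0 z) => z0; first by apply: Igh; rewrite z0.
  exact: cint_nonpos.
have rint0 (k : R -> R) : (forall s, k s = 0) -> rint setT k.
  by move=> k0; apply: (@eq_rint _ _ (cst 0)) => //; exact: integrable0.
have I1 z : rint setT (fun s => F (z, s)).
  case: (ltP z t) => zt.
    by apply: (eq_rint _ _ (rintZ (pos h (t - z)) _ (Ifgz _ zt))) => // s _; rewrite mulrC.
  by apply: rint0 => s; rewrite /F /= (@pos_le0 h) ?mulr0// subr_le0.
have E1 z : \int[leb]_s F (z, s) = pos (convol f g) z * pos h (t - z).
  case: (ltP z t) => zt.
    by rewrite posc -RintegralZr//; exact: Ifgz.
  rewrite (@pos_le0 h) ?subr_le0// mulr0 /F /=.
  rewrite (@pos_le0 h) ?subr_le0//.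
  by under eq_Rintegral do rewrite mulr0; rewrite Rintegral_cst ?mul0r.
have shift s (k : R -> \bar R) : measurable_fun setT k -> (\int[leb]_z k (z - s)%R = \int[leb]_z k z)%E.
  by move=> mk; rewrite -[RHS](integral_addr (- s)).
have mgh s : measurable_fun setT (fun y : R => pos g y * pos h (t - s - y)).
  by apply: measurable_funM; [exact: measurable_pos|exact: measurable_sub_comp (measurable_pos mh)].
have I2 s : rint setT (fun z => F (z, s)).
  have Fe z : F (z, s) = pos f s * (pos g (z - s) * pos h (t - s - (z - s))).
    by rewrite /F /= -mulrA; congr (_ * (_ * pos h _)); lra.
  case: (ltP 0 s) => s0.
    apply: (@eq_rint _ _ (fun z => pos f s * (pos g (z - s) * pos h (t - s - (z - s))))) => //.
    apply: rintZ => //.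
    have := Ighz (t - s) _ => /(_ _)/integrableP[]; first by lra.
    move=> m1 i1; apply/integrableP; split.
      by apply/measurable_EFinP; apply: (measurableT_comp (mgh s)); exact: measurable_funB.
    rewrite (shift s (abse \o (EFin \o (fun y : R => (pos g y * pos h (t - s - y))%R))))//.
    by apply: measurableT_comp => //; apply/measurable_EFinP.
  by apply: rint0 => z; rewrite /F /= (@pos_le0 f) ?mul0r.
have E2 s : \int[leb]_z F (z, s) = pos f s * pos (convol g h) (t - s).
  case: (ltP 0 s) => s0; last first.
    rewrite (@pos_le0 f)// mul0r /F /= (@pos_le0 f)//.
    by under eq_Rintegral do rewrite !mul0r; rewrite Rintegral_cst ?mul0r.
  rewrite posc -RintegralZl//; last by apply: Ighz; lra.
  rewrite /Rintegral; congr fine.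
  rewrite -(shift s (fun x => (pos f s * (pos g x * pos h (t - s - x)))%:E)); last first.
    by apply/measurable_EFinP; apply: measurable_funM.
  apply: eq_integral => z _; rewrite /F /= -mulrA; congr (_ * (_ * pos h _))%:E; lra.
have IF : (leb \x leb)%E.-integrable setT (EFin \o F).
  apply/integrable12ltyP; first exact/measurable_EFinP.
  move/cint_full : Ifgh => /integrableP[_]; apply: le_lt_trans.
  rewrite le_eqVlt; apply/orP; left; apply/eqP; apply: eq_integral => z _.
  have [zt|zt] := ltP z t; last first.
    rewrite /= (@pos_le0 (fun z => `|h z|)) ?subr_le0// mulr0 normr0.
    by apply: integral0_eq => s _; rewrite /F /= (@pos_le0 h) ?subr_le0// mulr0 normr0.
  have posn (k : R -> R) y : `|pos k y| = pos (fun y => `|k y|) y.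
    by rewrite /pos; case: ifP => // _; rewrite normr0.
  transitivity (`|pos h (t - z)|%:E * \int[leb]_s (`|pos f s * pos g (z - s)|)%:E)%E.
    rewrite -ge0_integralZl//=.
    - by apply: eq_integral => s _; rewrite /F /= -EFinM -normrM mulrC.
    - apply/measurable_EFinP; apply: measurableT_comp => //.
      by apply: measurable_funM; [exact: measurable_pos|exact: measurable_sub_comp (measurable_pos mg)].
  have -> : (\int[leb]_s (`|pos f s * pos g (z - s)|)%:E =
      (pos (convol (fun z => `|f z|) (fun z => `|g z|)) z)%:E)%E.
    rewrite posc /Rintegral fineK.
      by apply: eq_integral => s _; rewrite normrM !posn.
    apply: integrable_fin_num => //.
    apply: (eq_rint _ _ (rint_norm (Ifgz _ zt))) => // s _.
    by rewrite normrM !posn.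
  have p0 : 0 <= pos (convol (fun z => `|f z|) (fun z => `|g z|)) z.
    by rewrite /pos; case: ifP => // _; exact: convol_ge0.
  by rewrite -EFinM /=; congr EFin; rewrite normrM (ger0_norm p0) -posn normr_id mulrC.
split.
  have mFE : measurable_fun setT (EFin \o F) by exact/measurable_EFinP.
  have mk : measurable_fun setT (fun s => pos f s * pos (convol g h) (t - s)).
    apply: measurable_funM; first exact: measurable_pos.
    by apply: measurable_sub_comp; apply: measurable_pos; exact: measurable_convol.
  apply/cint_full/integrableP; split; first exact/measurable_EFinP.
  have fin := (integrable21ltyP leb leb mFE).1 IF.
  apply: (le_lt_trans _ fin).
  apply: ge0_le_integral => //.
  - by apply: measurableT_comp => //; exact/measurable_EFinP.
  - have mA : measurable_fun setT (abse \o (EFin \o F)) by exact: measurableT_comp.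
    exact: (measurable_fun_fubini_tonelli_G _ mA (fun p => abse_ge0 _)).
  - move=> s _.
    have -> : (EFin \o (fun s => pos f s * pos (convol g h) (t - s))) s = (\int[leb]_z (F (z, s))%:E)%E.
      by rewrite /= -E2 /Rintegral fineK//; exact: integrable_fin_num (I2 s).
    by apply: le_abse_integral => //; have /integrableP[] := I2 s.
rewrite !convol_full /Rintegral; congr fine.
transitivity (\int[leb]_z \int[leb]_s (F (z, s))%:E)%E.
  apply: eq_integral => z _.
  by rewrite -E1 /Rintegral fineK//; exact: integrable_fin_num (I1 z).
rewrite (Fubini IF).
apply: eq_integral => s _.
by rewrite -E2 /Rintegral fineK//; exact: integrable_fin_num (I2 s).
Qed.

Lemma convol_assoc f g h t :
  measurable_fun setT f -> measurable_fun setT g -> measurable_fun setT h ->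
  (forall z, 0 < z < t -> cint f g z) -> (forall z, 0 < z < t -> cint g h z) ->
  cint (convol (fun z => `|f z|) (fun z => `|g z|)) (fun z => `|h z|) t ->
  convol (convol f g) h t = convol f (convol g h) t.
Proof. by move=> mf mg mh Ifg Igh Ifgh; have [_] := cint_convol_assoc mf mg mh Ifg Igh Ifgh. Qed.

End Convolution.

(** * Euler's Beta integral and the functional equation of Gamma *)

Section BetaGamma.
Context {R : realType}.
Notation leb := (@lebesgue_measure R).
Notation rint D f := (leb.-integrable D (EFin \o f)).
Implicit Types (f g h : R -> R) (a b t : R).

Lemma ge0_integral_cstM (k : R) f : 0 <= k -> measurable_fun setT f ->
  (forall x, 0 <= f x) ->
  (\int[leb]_x (k * f x)%:E = k%:E * \int[leb]_x (f x)%:E)%E.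
Proof.
move=> k0 mf f0; under eq_integral do rewrite EFinM.
rewrite ge0_integralZl//; first exact/measurable_EFinP.
by move=> x _; rewrite lee_fin.
Qed.

(** The sum of the two endpoint values covers both signs of [p]. *)
Lemma powR_mid_le (p t y : R) : 0 < t -> t / 2 <= y <= t -> y `^ p <= (t / 2) `^ p + t `^ p.
Proof.
move=> t0 /andP[ty yt]; case: (leP 0 p) => p0.
  rewrite (@le_trans _ _ (t `^ p))// ?lerDr ?powR_ge0//.
  by apply: ge0_ler_powR; rewrite ?nnegrE //; lra.
rewrite (@le_trans _ _ ((t / 2) `^ p))// ?lerDl ?powR_ge0//.
rewrite -(opprK p) !(powRN _ (- p)) lef_pV2 ?posrE ?powR_gt0//; try lra.
by apply: ge0_ler_powR; rewrite ?nnegrE //; lra.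
Qed.

Lemma cint_powR_cst a t : 0 < a -> 0 < t -> cint (fun z : R => z `^ (a - 1)) (cst 1) t.
Proof.
move=> a0 t0; apply: (eq_rint _ _ (integrable_powR_itvoo a0 t0)) => // z _.
by rewrite /= mulr1.
Qed.

(** Each of the two singularities is alone in its half of ]0, t[: there the other power is bounded
    by [powR_mid_le]. *)
Lemma cint_powR a b t : 0 < a -> 0 < b -> 0 < t ->
  cint (fun z : R => z `^ (a - 1)) (fun z : R => z `^ (b - 1)) t.
Proof.
move=> a0 b0 t0.
pose M (c : R) := (t / 2) `^ (c - 1) + t `^ (c - 1).
have M0 c : 0 <= M c by rewrite addr_ge0 ?powR_ge0.
have I1 := cint_powR_cst a0 t0.
have I2 : cint (cst 1) (fun z : R => z `^ (b - 1)) t.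
  by apply: cintC => //; exact: cint_powR_cst.
apply: (rint_le _ _ _ (rintD _ (rintZ (M b) _ I1) (rintZ (M a) _ I2))) => //.
  exact: (measurable_convand (measurable_powR_fun (a - 1)) (measurable_powR_fun (b - 1))).
move=> z; rewrite /= in_itv /= mulr1 mul1r => /andP[z0 zt].
rewrite ger0_norm ?mulr_ge0 ?powR_ge0//.
case: (leP z (t / 2)) => zt2.
  rewrite -[leLHS]addr0 lerD ?mulr_ge0 ?powR_ge0// mulrC ler_wpM2r ?powR_ge0//.
  by apply: powR_mid_le => //; lra.
rewrite -[leLHS]add0r lerD ?mulr_ge0 ?powR_ge0// ler_wpM2r ?powR_ge0//.
by apply: powR_mid_le => //; lra.
Qed.

Let bet a b := convol (fun z : R => z `^ (a - 1)) (fun z : R => z `^ (b - 1)) 1.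

Lemma convol_powR_scale a b t : 0 < a -> 0 < b -> 0 < t ->
  convol (fun z : R => z `^ (a - 1)) (fun z : R => z `^ (b - 1)) t =
  t `^ (a + b - 1) * bet a b.
Proof.
move=> a0 b0 t0; rewrite /bet !convol_full.
have mp (c u : R) : measurable_fun setT (fun z : R => pos (fun z : R => z `^ (c - 1)) z).
  by apply: measurable_pos; exact: measurable_powR_fun.
have mK (u : R) : measurable_fun setT (fun z : R => (pos (fun z : R => z `^ (a - 1)) z *
   pos (fun z : R => z `^ (b - 1)) (u - z))%:E).
  apply/measurable_EFinP; apply: measurable_funM; first exact: mp.
  by apply: measurable_sub_comp; exact: mp.
have p0 (c z : R) : 0 <= pos (fun z : R => z `^ (c - 1)) z.
  by rewrite /pos; case: ifP => // _; rewrite powR_ge0.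
have psc (c z : R) : pos (fun z : R => z `^ (c - 1)) (t * z) = t `^ (c - 1) * pos (fun z : R => z `^ (c - 1)) z.
  by rewrite /pos pmulr_rgt0//; case: ifP => z0; rewrite ?mulr0// powRM// ltW.
have IF : rint setT (fun z : R => pos (fun z : R => z `^ (a - 1)) z *
   pos (fun z : R => z `^ (b - 1)) (1 - z)).
  by apply/cint_full; apply: cint_powR.
have tE : t `^ (a + b - 1) = t * (t `^ (a - 1) * t `^ (b - 1)).
  rewrite -powRD; last by rewrite (gt_eqF t0) implybT.
  rewrite -{2}(@powRr1 _ t) ?ltW// -powRD; last by rewrite (gt_eqF t0) implybT.
  by congr powR; lra.
rewrite /Rintegral (ge0_integral_affine 0 (lt0r_neq0 t0) (mK t)); last first.
  by move=> z; rewrite lee_fin mulr_ge0.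
have -> : (\int[leb]_x (pos (fun z : R => z `^ (a - 1)) (0 + t * x)%R *
     pos (fun z : R => z `^ (b - 1)) (t - (0 + t * x))%R)%:E =
   (t `^ (a - 1) * t `^ (b - 1))%:E * \int[leb]_x (pos (fun z : R => z `^ (a - 1)) x *
     pos (fun z : R => z `^ (b - 1)) (1 - x)%R)%:E)%E.
  rewrite -ge0_integral_cstM.
  - apply: eq_integral => x _.
    rewrite add0r (_ : t - t * x = t * (1 - x)); last by ring.
    by rewrite !psc mulrACA.
  - by rewrite mulr_ge0 ?powR_ge0.
  - by have /measurable_EFinP := mK 1.
  - by move=> x; rewrite mulr_ge0.
rewrite gtr0_norm// muleA -EFinM fineM//; last exact: integrable_fin_num IF.
by rewrite tE.
Qed.

(** Euler's argument. The double integral of x^(a-1) exp (-x) y^(b-1) exp (-y) is Gamma a Gamma b.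
    Integrated along the lines x + y = s, it is the integral of exp (-s) times the convolution of
    the two powers at s, that is, the Beta integral times Gamma (a + b). *)
Lemma convol_powR a b t : 0 < a -> 0 < b -> 0 < t ->
  convol (fun z : R => z `^ (a - 1)) (fun z : R => z `^ (b - 1)) t =
  Gamma a * Gamma b / Gamma (a + b) * t `^ (a + b - 1).
Proof.
move=> a0 b0 t0; rewrite convol_powR_scale// mulrC; congr (_ * _).
have G0 : Gamma (a + b) != 0 by rewrite gt_eqF// Gamma_gt0// addr_gt0.
apply: (canRL (mulfK G0)).
pose e (c : R) := fun z : R => z `^ (c - 1) * expR (- z).
have me c : measurable_fun setT (e c).
  apply: measurable_funM; first exact: measurable_powR_fun.
  by apply: measurableT_comp => //; exact: measurable_expR.
have e0 c z : 0 <= pos (e c) z.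
  by rewrite /pos; case: ifP => // _; rewrite mulr_ge0 ?powR_ge0 ?expR_ge0.
have Ie c : 0 < c -> rint setT (pos (e c)).
  move=> c0; apply: (eq_rint _ _ (proj2 (rint_patch _ _) (integrable_Gamma c0))) => //.
  move=> z _; rewrite patchE /pos mem_setE in_itv /= andbT.
  by case: ifP.
have Ge c : 0 < c -> (\int[leb]_z (pos (e c) z)%:E = (Gamma c)%:E)%E.
  move=> c0; rewrite /Gamma Rintegral_mkcond /Rintegral.
  have -> : ((fun t : R => t `^ (c - 1) * expR (- t)) \_ `]0, +oo[) = pos (e c).
    apply/funext => z; rewrite patchE /pos mem_setE in_itv /= andbT.
    by case: ifP.
  by rewrite fineK//; apply: integrable_fin_num => //; exact: Ie.
have key : (\int[leb]_t \int[leb]_z (pos (e a) z * pos (e b) (t - z))%:E = (Gamma a * Gamma b)%:E)%E.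
  pose F := fun p : measurableTypeR R * measurableTypeR R => (pos (e a) p.2 * pos (e b) (p.1 - p.2))%:E.
  have mF : measurable_fun setT F by apply/measurable_EFinP; exact: measurable_convol_kernel.
  have F0 p : (0 <= F p)%E by rewrite lee_fin mulr_ge0.
  transitivity (\int[leb]_z \int[leb]_t (F (t, z)))%E.
    exact: (@fubini_tonelli _ _ _ _ _ leb leb F).
  rewrite /F /=.
  have inn z : (\int[leb]_x (pos (e a) z * pos (e b) (x - z))%:E = (Gamma b * pos (e a) z)%:E)%E.
    rewrite ge0_integral_cstM//; last first.
      by apply: measurableT_comp (measurable_pos (me b)) _; exact: measurable_funB.
    rewrite (integral_addr (- z) (F := fun x => (pos (e b) x)%:E)).
      by rewrite (Ge b b0) -EFinM mulrC.
    by apply/measurable_EFinP; exact: measurable_pos.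
  under eq_integral do rewrite inn.
  rewrite ge0_integral_cstM//; last 2 first.
  - by rewrite ltW// Gamma_gt0.
  - exact: measurable_pos.
  by rewrite (Ge a a0) -EFinM mulrC.
have inner s : (\int[leb]_z (pos (e a) z * pos (e b) (s - z))%:E = (bet a b * pos (e (a + b)) s)%:E)%E.
  case: (leP s 0) => s0.
    rewrite (@pos_le0 _ (e (a + b)))// mulr0; apply: integral0_eq => z _.
    case: (leP z 0) => z0; first by rewrite pos_le0// mul0r.
    by rewrite (@pos_le0 _ (e b)) ?mulr0//; lra.
  have cE : forall z, pos (e a) z * pos (e b) (s - z) = expR (- s) * (pos (fun z : R => z `^ (a - 1)) z *
     pos (fun z : R => z `^ (b - 1)) (s - z)).
    move=> z; rewrite /pos /e; case: ifP => _; case: ifP => _; rewrite ?mul0r ?mulr0//.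
    have -> : expR (- s) = expR (- z) * expR (- (s - z)) by rewrite -expRD; congr expR; lra.
    by ring.
  under eq_integral do rewrite cE EFinM.
  have I := cint_powR a0 b0 s0; move/cint_full : (I) => I'.
  rewrite integralZl//.
  have -> : (\int[leb]_z (pos (fun z : R => z `^ (a - 1)) z *
     pos (fun z : R => z `^ (b - 1)) (s - z)%R)%:E =
     (convol (fun z : R => z `^ (a - 1)) (fun z : R => z `^ (b - 1)) s)%:E)%E.
    by rewrite convol_full /Rintegral fineK//; exact: integrable_fin_num I'.
  by rewrite convol_powR_scale// -EFinM pos_gt0// /e; congr EFin; ring.
move: key; under eq_integral do rewrite inner EFinM.
rewrite (integralZl measurableT (Ie _ (addr_gt0 a0 b0))).
by rewrite (Ge _ (addr_gt0 a0 b0)) -EFinM => -[].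
Qed.

Lemma Gamma1 : Gamma (1 : R) = 1.
Proof.
rewrite /Gamma Rintegral_itv_obnd_cbnd; last exact: integrable_Gamma.
have -> : 1 = fine (1%:E : \bar R) by [].
rewrite -[in RHS](@integral_exponential_pdf R 1)// Rintegral_mkcond /Rintegral.
congr fine; apply: eq_integral => t _; rewrite !patchE !mem_setE !in_itv /= !andbT.
rewrite /exponential_pdf patchE mem_setE in_itv /= andbT.
by rewrite subrr powRr0 !mul1r mulN1r.
Qed.

(** The Beta integral with b = 1 is the integral of z^(a-1) over ]0, 1[, which equals 1 / a. *)
Lemma GammaS a : 0 < a -> Gamma (a + 1) = a * Gamma a.
Proof.
move=> a0.
have G1 := @Gamma_gt0 R (a + 1) (addr_gt0 a0 ltr01); have Ga := Gamma_gt0 a0.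
have h := convol_powR a0 ltr01 ltr01.
have := Rintegral_powR_itvoo a0 (@ltr01 R).
have -> : \int[leb]_(z in `]0, 1[) z `^ (a - 1) = convol (fun z : R => z `^ (a - 1)) (fun z : R => z `^ (1 - 1)) 1.
  by rewrite convolE; apply: eq_Rintegral => z _; rewrite subrr powRr0 mulr1.
rewrite h Gamma1 !powR1 !mulr1 => e.
move: (Gamma a) (Gamma (a + 1)) G1 e => x y y0 e.
have -> : x = y / a by rewrite -(div1r a) -e mulrCA mulfV ?mulr1// gt_eqF.
by rewrite mulrCA mulfV ?mulr1// gt_eqF.
Qed.

End BetaGamma.

(** * Riemann-Liouville kernels and the functions dominated by them *)

HB.lock Definition gk (R : realType) (a z : R) : R := z `^ (a - 1) / Gamma a.

Lemma gkE (R : realType) (a z : R) : gk a z = z `^ (a - 1) / Gamma a.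
Proof. by rewrite gk.unlock. Qed.

Section PowerKernels.
Context {R : realType}.
Implicit Types (f g h : R -> R) (a b t z : R).

Lemma gk_ge0 a z : 0 < a -> 0 <= gk a z.
Proof. by move=> a0; rewrite gkE divr_ge0 ?powR_ge0// ltW// Gamma_gt0. Qed.

Lemma gk_gt0 a z : 0 < a -> 0 < z -> 0 < gk a z.
Proof. by move=> a0 z0; rewrite gkE divr_gt0 ?powR_gt0// Gamma_gt0. Qed.

Lemma gk1 z : gk 1 z = 1.
Proof. by rewrite gkE subrr powRr0 Gamma1 divr1. Qed.

Let gkEf a : gk a = (fun z => (Gamma a)^-1 * z `^ (a - 1)).
Proof. by apply/funext => z; rewrite gkE mulrC. Qed.

Lemma measurable_gk a : measurable_fun setT (gk a).
Proof. by rewrite gkEf; apply: measurable_funM => //; exact: measurable_powR_fun. Qed.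

Lemma cint_gk a b t : 0 < a -> 0 < b -> cint (gk a) (gk b) t.
Proof.
move=> a0 b0; case: (leP t 0) => t0; first exact: cint_nonpos.
rewrite !gkEf; apply: cintZl; apply: cintC.
- exact: measurable_funM.
- exact: measurable_powR_fun.
- by apply: cintZl; exact: cint_powR.
Qed.

Lemma convol_gk a b t : 0 < a -> 0 < b -> 0 < t ->
  convol (gk a) (gk b) t = gk (a + b) t.
Proof.
move=> a0 b0 t0; have mp := @measurable_powR_fun R.
have mZ (c : R) : measurable_fun setT (fun z => (Gamma c)^-1 * z `^ (c - 1)) by exact: measurable_funM.
rewrite {1}(gkEf a) {1}(gkEf b) convolZl; last first.
  by apply: cintC => //; apply: cintZl; exact: cint_powR.
rewrite convolC// convolZl; last exact: cint_powR.
rewrite convolC// convol_powR// gkE.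
have := Gamma_gt0 a0; have := Gamma_gt0 b0; have := Gamma_gt0 (addr_gt0 a0 b0).
move: (Gamma _) (Gamma _) (Gamma _) => x y w x0 y0 w0.
by field; rewrite !gt_eqF.
Qed.

Lemma gk_le a b T : 0 < a -> a <= b -> exists2 C, 0 <= C &
  forall z, 0 < z <= T -> gk b z <= C * gk a z.
Proof.
move=> a0 ab; have b0 : 0 < b by lra.
have p z : 0 < z <= T -> z `^ (b - 1) <= T `^ (b - a) * z `^ (a - 1).
  move=> /andP[z0 zT].
  have -> : z `^ (b - 1) = z `^ (b - a) * z `^ (a - 1).
    by rewrite -powRD; [congr (powR _ _); lra|rewrite (gt_eqF z0) implybT].
  by apply: ler_wpM2r; [exact: powR_ge0|apply: ge0_ler_powR; rewrite ?nnegrE; lra].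
have := Gamma_gt0 a0; have := Gamma_gt0 b0.
move: (Gamma a) (Gamma b) (gkE a) (gkE b) => x y ea eb y0 x0.
exists (T `^ (b - a) * x / y) => [|z /p]; last rewrite ea eb.
  by rewrite divr_ge0 ?(ltW y0)// mulr_ge0 ?powR_ge0// ltW.
move: (z `^ _) (z `^ _) (T `^ _) => u v w h.
have -> : w * x / y * (u / x) = w * u / y by field; rewrite !gt_eqF.
by rewrite ler_pM2r ?invr_gt0.
Qed.

End PowerKernels.

Section Admissible.
Context {R : realType} (T : R).
Notation leb := (@lebesgue_measure R).
Implicit Types (f g h : R -> R) (a b t z C D k : R).

Definition gk_dominated a C f := forall z, 0 < z <= T -> `|f z| <= C * gk a z.

(** A class that contains the kernels g_a and is stable under sums and convolutions: on ]0, T] the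
    singularity at 0 is no worse than that of some g_a with a > 0. Between two such functions
    convolution converges, commutes and associates up to T, with no further integrability condition
    to check. *)
Definition adm f := measurable_fun setT f /\
  exists a C, [/\ 0 < a, 0 <= C & gk_dominated a C f].

Lemma adm_measurable f : adm f -> measurable_fun setT f.
Proof. by case. Qed.
Hint Resolve adm_measurable : core.

Lemma gk_dominated_convol a b C D f g : 0 < a -> 0 < b -> 0 <= C -> 0 <= D ->
  measurable_fun setT f -> measurable_fun setT g ->
  gk_dominated a C f -> gk_dominated b D g -> gk_dominated (a + b) (C * D) (convol f g).
Proof.
move=> a0 b0 C0 D0 mf mg hf hg t /andP[t0 tT].
have I1 := cint_gk t a0 b0.
have I : cint (fun z => C * gk a z) (fun z => D * gk b z) t.
  apply: cintZl; apply: cintC; first by apply: measurable_funM => //; exact: measurable_gk.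
    exact: measurable_gk.
  by apply: cintZl; apply: cintC => //; exact: measurable_gk.
have -> : C * D * gk (a + b) t = convol (fun z => C * gk a z) (fun z => D * gk b z) t.
  have mg' (c : R) : measurable_fun setT (gk c) by exact: (@measurable_gk R).
  rewrite convolZl; last first.
    apply: cintC => //; first exact: measurable_funM.
    by apply: cintZl; exact: cintC.
  rewrite convolC//; last exact: measurable_funM.
  rewrite convolZl; last exact: cintC.
  by rewrite convolC// convol_gk// mulrA.
apply: norm_convol_le => // z /andP[z0 zt]; [apply: hf|apply: hg]; lra.
Qed.

Lemma cint_adm f g t : adm f -> adm g -> t <= T -> cint f g t.
Proof.
move=> [mf [a [C [a0 C0 hf]]]] [mg [b [D [b0 D0 hg]]]] tT.
apply: (@cint_le _ _ _ (fun z => C * gk a z) (fun z => D * gk b z)) => //.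
- by move=> z /andP[z0 zt]; apply: hf; lra.
- by move=> z /andP[z0 zt]; apply: hg; lra.
apply: cintZl; apply: cintC; first by apply: measurable_funM => //; exact: measurable_gk.
  exact: measurable_gk.
by apply: cintZl; apply: cintC; [exact: measurable_gk..|exact: cint_gk].
Qed.

Lemma adm_convol f g : adm f -> adm g -> adm (convol f g).
Proof.
move=> [mf [a [C [a0 C0 hf]]]] [mg [b [D [b0 D0 hg]]]]; split.
  exact: measurable_convol.
exists (a + b), (C * D); split; [exact: addr_gt0|exact: mulr_ge0|].
exact: gk_dominated_convol.
Qed.

Lemma adm_gk a : 0 < a -> adm (gk a).
Proof.
move=> a0; split; first exact: measurable_gk.
exists a, 1; split => // z _; rewrite mul1r ger0_norm//; exact: gk_ge0.
Qed.

Lemma admD f g : adm f -> adm g -> adm (fun z => f z + g z).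
Proof.
(* The smaller order is the more singular one, and the sum is dominated at that order. *)
wlog: f g / (exists a b C D, [/\ 0 < a, a <= b, 0 <= C, 0 <= D & gk_dominated a C f /\ gk_dominated b D g]).
  move=> W hf hg; have [mf [a [C [a0 C0 hf']]]] := hf; have [mg [b [D [b0 D0 hg']]]] := hg.
  case: (lerP a b) => ab; first by apply: W => //; exists a, b, C, D.
  rewrite (_ : (fun _ => _) = (fun z => g z + f z)); last by apply/funext => z; rewrite addrC.
  by apply: W => //; exists b, a, D, C; split => //; exact: ltW.
move=> [a [b [C [D [a0 ab C0 D0 [hf hg]]]]]] [mf _] [mg _]; split; first exact: measurable_funD.
have [E E0 hE] := gk_le T a0 ab.
exists a, (C + D * E); split => //; first by rewrite addr_ge0// mulr_ge0.
move=> z zT; rewrite mulrDl (le_trans (ler_normD _ _))// lerD ?hf//.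
by rewrite (le_trans (hg z zT))// -mulrA ler_wpM2l// hE.
Qed.

Lemma admZ k f : adm f -> adm (fun z => k * f z).
Proof.
move=> [mf [a [C [a0 C0 hf]]]]; split; first exact: measurable_funM.
exists a, (`|k| * C); split => //; first by rewrite mulr_ge0.
by move=> z zT; rewrite normrM -mulrA ler_wpM2l// hf.
Qed.

Lemma admB f g : adm f -> adm g -> adm (fun z => f z - g z).
Proof.
move=> hf hg; rewrite (_ : (fun _ => _) = (fun z => f z + (-1) * g z)).
  by apply: admD => //; exact: admZ.
by apply/funext => z; rewrite mulN1r.
Qed.

Lemma adm_norm f : adm f -> adm (fun z => `|f z|).
Proof.
move=> [mf [a [C [a0 C0 hf]]]]; split; first exact: measurableT_comp.
by exists a, C; split => // z zT; rewrite normr_id hf.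
Qed.

Lemma adm_bounded f M : measurable_fun setT f -> (forall z, 0 < z <= T -> `|f z| <= M) -> adm f.
Proof.
move=> mf fM; split => //; exists 1, (Num.max M 0); split => //; first by rewrite le_max lexx orbT.
by move=> z zT; rewrite gk1 mulr1 le_max fM.
Qed.

Lemma adm_cst (c : R) : adm (cst c).
Proof. exact: (@adm_bounded _ `|c|). Qed.

Lemma convol_assoc_adm f g h t : adm f -> adm g -> adm h -> t <= T ->
  convol (convol f g) h t = convol f (convol g h) t.
Proof.
move=> hf hg hh tT; apply: convol_assoc; try exact: adm_measurable.
- by move=> z /andP[_ zt]; apply: cint_adm => //; lra.
- by move=> z /andP[_ zt]; apply: cint_adm => //; lra.
by apply: cint_adm => //; [apply: adm_convol|]; exact: adm_norm.
Qed.

Lemma convolC_adm f g t : adm f -> adm g -> convol f g t = convol g f t.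
Proof. by move=> [mf _] [mg _]; exact: convolC. Qed.

Lemma convolDl_adm f g h t : adm f -> adm g -> adm h -> t <= T ->
  convol (fun z => f z + g z) h t = convol f h t + convol g h t.
Proof. by move=> *; apply: convolDl; exact: cint_adm. Qed.

Lemma convolZl_adm k f h t : adm f -> adm h -> t <= T ->
  convol (fun z => k * f z) h t = k * convol f h t.
Proof. by move=> *; apply: convolZl; exact: cint_adm. Qed.

Lemma convolDr_adm f g h t : adm f -> adm g -> adm h -> t <= T ->
  convol h (fun z => f z + g z) t = convol h f t + convol h g t.
Proof.
move=> hf hg hh tT; rewrite convolC_adm//; last exact: admD.
by rewrite convolDl_adm// !(convolC_adm _ hh).
Qed.

Lemma convolZr_adm k f h t : adm f -> adm h -> t <= T ->
  convol h (fun z => k * f z) t = k * convol h f t.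
Proof.
move=> hf hh tT; rewrite convolC_adm//; last exact: admZ.
by rewrite convolZl_adm// !(convolC_adm _ hh).
Qed.

Lemma norm_convol_le_adm f g F G t : measurable_fun setT f -> measurable_fun setT g ->
  adm F -> adm G -> t <= T ->
  (forall z, 0 < z < t -> `|f z| <= F z) -> (forall z, 0 < z < t -> `|g z| <= G z) ->
  `|convol f g t| <= convol F G t.
Proof. by move=> mf mg hF hG tT fF gG; apply: norm_convol_le => //; exact: cint_adm. Qed.

Lemma convol_mono f g F G t : adm f -> adm g ->
  adm F -> adm G -> t <= T ->
  (forall z, 0 < z < t -> 0 <= f z <= F z) -> (forall z, 0 < z < t -> 0 <= g z <= G z) ->
  convol f g t <= convol F G t.
Proof.
move=> hf hg hF hG tT fF gG; apply: le_trans (ler_norm _) _.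
apply: norm_convol_le_adm => //; try exact: adm_measurable.
  by move=> z zt; have /andP[? ?] := fF z zt; rewrite ger0_norm.
by move=> z zt; have /andP[? ?] := gG z zt; rewrite ger0_norm.
Qed.

End Admissible.

(** * The Mittag-Leffler kernel *)

Section Halving.
Context {R : realType}.

(** Iterating the hypothesis replaces a constant B by c + B / 2, a map whose fixed point is 2c. The
    initial bound A only has to be finite: its size disappears in the limit, so it may depend on
    parameters of which the final bound is free. *)
Lemma halving_bound (D : R -> Prop) (phi W : R -> R) (c : R) :
  0 <= c -> (forall t, D t -> 0 <= W t) ->
  (exists A, forall t, D t -> `|phi t| <= A * W t) ->
  (forall B, 0 <= B -> (forall t, D t -> `|phi t| <= B * W t) ->
     forall t, D t -> `|phi t| <= (c + B / 2) * W t) ->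
  forall t, D t -> `|phi t| <= 2 * c * W t.
Proof.
move=> c0 W0 [A hA] step.
have it n : forall t, D t -> `|phi t| <= (2 * c + `|A| / 2 ^+ n) * W t.
  elim: n => [|n IH] t Dt.
    rewrite expr0 divr1 (le_trans (hA t Dt))// ler_wpM2r ?W0//.
    by rewrite (le_trans (ler_norm A))// lerDr mulr_ge0.
  have -> : 2 * c + `|A| / 2 ^+ n.+1 = c + (2 * c + `|A| / 2 ^+ n) / 2.
    by rewrite exprS; field; rewrite expf_neq0.
  by apply: step => //; rewrite addr_ge0 ?mulr_ge0// divr_ge0.
move=> t Dt; apply/ler_addgt0Pr => e e0.
have [W0'|Wpos] := leP (W t) 0.
  have -> : W t = 0 by apply/eqP; rewrite eq_le W0' W0.
  have := it 0%N t Dt; have -> : W t = 0 by apply/eqP; rewrite eq_le W0' W0.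
  by rewrite !mulr0 add0r => h; apply: (le_trans h); exact: ltW.
have lim : `|A| / 2 ^+ n @[n --> \oo] --> (0 : R).
  have -> : (fun n => `|A| / 2 ^+ n) = geometric `|A| (2^-1 : R).
    by apply/funext => n; rewrite /geometric /= exprVn.
  by apply: cvg_geometric; rewrite gtr0_norm ?invr_gt0// invf_lt1// ltr1n.
have ew : 0 < e / W t by rewrite divr_gt0.
have := cvgr_lt _ lim _ ew; case => N _ /(_ N) /(_ _)/= hN.
apply: le_trans (it N t Dt) _; rewrite mulrDl lerD2l -ler_pdivlMr//.
by apply/ltW/hN => /=.
Qed.

End Halving.

(** The factor exp (k z) is that of Bielecki's norms: for k large, convolution with g_a is a small
    operator on functions bounded by this weight. The factor g_s admits a singularity at 0; s =
    alpha serves for kernels, s = 1 for bounded functions. *)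
HB.lock Definition wgt (R : realType) (s k z : R) : R := expR (k * z) * gk s z.

Lemma wgtE (R : realType) (s k z : R) : wgt s k z = expR (k * z) * gk s z.
Proof. by rewrite wgt.unlock. Qed.

Section Contraction.
Context {R : realType} (T : R).
Implicit Types (f g h : R -> R) (a s t z B C k eps : R).

Lemma wgt_ge0 s k z : 0 < s -> 0 <= wgt s k z.
Proof. by move=> s0; rewrite wgtE mulr_ge0 ?expR_ge0// gk_ge0. Qed.

Lemma measurable_wgt s k : measurable_fun setT (wgt s k).
Proof.
have -> : wgt s k = (fun z => expR (k * z) * gk s z) by apply/funext => z; rewrite wgtE.
apply: measurable_funM; last exact: measurable_gk.
by apply: measurableT_comp; [exact: measurable_expR|exact: measurable_funM].
Qed.

Definition contracts a s k eps := forall t, 0 < t <= T ->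
  convol (gk a) (wgt s k) t <= eps * wgt s k t.

Lemma adm_wgt s k : 0 < s -> 0 <= k -> adm T (wgt s k).
Proof.
move=> s0 k0; split; first exact: measurable_wgt.
exists s, (expR (k * T)); split => //.
move=> z /andP[z0 zT]; rewrite ger0_norm ?wgt_ge0// wgtE ler_wpM2r ?gk_ge0// ler_expR.
by rewrite ler_wpM2l.
Qed.

(** Half of the exponent is spent on decay: (k z)^(a/2) exp (-k z) is bounded, which yields the
    power k^(-a/2) and leaves the kernel of order a / 2, still integrable at 0. *)
Lemma gk_exp_le a z k : 0 < a -> 0 < z -> 0 < k ->
  gk a z * expR (- (k * z)) <= k `^ (- (a / 2)) * (a `^ (a / 2) * Gamma (a / 2) / Gamma a) * gk (a / 2) z.
Proof.
move=> a0 z0 k0; have a20 : 0 < a / 2 by rewrite divr_gt0.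
have kz : 0 < k * z by rewrite mulr_gt0.
have := powR_le_expR a20 (ltW kz).
have -> : 2 * (a / 2) = a by field.
move=> h.
have h2 : (k * z) `^ (a / 2) * expR (- (k * z)) <= a `^ (a / 2).
  rewrite expRN ler_pdivrMr ?expR_gt0// (le_trans h)// ler_wpM2l ?powR_ge0//.
  by rewrite ler_expR; lra.
have e1 : z `^ (a - 1) = k `^ (- (a / 2)) * (k * z) `^ (a / 2) * z `^ (a / 2 - 1).
  rewrite powRM ?ltW// powRN mulrA mulVf ?mul1r; last by rewrite gt_eqF// powR_gt0.
  by rewrite -powRD; [congr powR; lra|rewrite (gt_eqF z0) implybT].
rewrite !gkE e1.
have := Gamma_gt0 a20; have := Gamma_gt0 a0.
move: (Gamma a) (Gamma (a / 2)) (powR_ge0 k (- (a / 2))) (powR_ge0 z (a / 2 - 1)) => x y.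
move: h2; move: (z `^ _) (k `^ _) ((k * z) `^ _) (expR _) (a `^ _) => u v w e b h2 v0 u0 x0 y0.
have -> : v * w * u / x * e = (v * u / x) * (w * e) by ring.
have -> : v * (b * y / x) * (u / y) = (v * u / x) * b by field; rewrite !gt_eqF.
by rewrite ler_wpM2l// divr_ge0 ?mulr_ge0// ltW.
Qed.

(** Taking exp (k t) out of the convolution leaves g_a(z) exp (-k z), at most k^(-a/2) times a
    multiple of g_(a/2). Convolving the latter with g_s gives g_(a/2 + s), which is at most a
    multiple of g_s on ]0, T]. *)
Lemma gk_contraction a s eps : 0 < a -> 0 < s -> 0 < eps ->
  exists2 k0, 0 < k0 & forall k, k0 <= k -> contracts a s k eps.
Proof.
move=> a0 s0 e0; have a20 : 0 < a / 2 by rewrite divr_gt0.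
have ss : s <= a / 2 + s by lra.
have [C2 C20 hC2] := gk_le T s0 ss.
set C1 := a `^ (a / 2) * Gamma (a / 2) / Gamma a.
have C10 : 0 <= C1.
  have := Gamma_gt0 a20; have := Gamma_gt0 a0; rewrite /C1.
  by move: (Gamma _) (Gamma _) => x y x0 y0; rewrite divr_ge0 ?mulr_ge0 ?powR_ge0// ltW.
(* [M] exceeds C1 C2 / eps, and k >= M^(2/a) makes k^(-a/2) at most 1 / M. *)
pose M := C1 * C2 / eps + 1.
have M0 : 0 < M.
  by apply: ltr_wpDl => //; apply: divr_ge0; [exact: mulr_ge0|exact: ltW].
exists (M `^ (2 / a)); first exact: powR_gt0.
move=> k hk t /andP[t0 tT].
have k0 : 0 < k by apply: lt_le_trans hk; exact: powR_gt0.
have kM : k `^ (- (a / 2)) <= M^-1.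
  rewrite powRN lef_pV2 ?posrE ?powR_gt0//.
  have -> : M = (M `^ (2 / a)) `^ (a / 2).
    rewrite -powRrM (_ : 2 / a * (a / 2) = 1) ?powRr1 ?ltW//.
    by field; rewrite gt_eqF.
  by apply: ge0_ler_powR => //; rewrite ?nnegrE ?powR_ge0//; exact: ltW.
pose F z := expR (k * t) * (k `^ (- (a / 2)) * C1) * gk (a / 2) z.
have adF : adm T F by apply: admZ; exact: adm_gk.
apply: (@le_trans _ _ (convol F (gk s) t)).
  pose G z := expR (- (k * z)) * gk a z.
  pose H z := expR (k * t) * gk s z.
  have -> : convol (gk a) (wgt s k) t = convol (fun z => expR (k * t) * G z) (gk s) t.
    rewrite !convolE; apply: eq_Rintegral => z _; rewrite wgtE /G.
    have -> : expR (k * (t - z)) = expR (k * t) * expR (- (k * z)) by rewrite -expRD; congr expR; ring.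
    by ring.
  have adG : adm T (fun z => expR (k * t) * G z).
    apply: admZ; split.
      apply: measurable_funM; last exact: measurable_gk.
      apply: measurableT_comp; first exact: measurable_expR.
      by apply: measurableT_comp => //; exact: measurable_funM.
    exists a, 1; split => // z /andP[z0 zT]; rewrite mul1r ger0_norm ?mulr_ge0 ?expR_ge0 ?gk_ge0//.
    by rewrite ler_piMl ?gk_ge0// expR_le1 oppr_le0 mulr_ge0// ltW.
  apply: (convol_mono adG (adm_gk T s0) adF (adm_gk T s0) tT) => z /andP[z0 zt].
    rewrite /G /F !mulr_ge0 ?expR_ge0 ?gk_ge0//= -!mulrA ler_wpM2l ?expR_ge0//.
    by have := gk_exp_le a0 z0 k0; rewrite [X in X <= _ -> _]mulrC -!mulrA.
  by rewrite gk_ge0//= lexx.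
rewrite /F (convolZl_adm _ (adm_gk T a20) (adm_gk T s0) tT).
rewrite convol_gk// wgtE.
apply: (@le_trans _ _ (expR (k * t) * (M^-1 * C1) * (C2 * gk s t))).
  apply: ler_pM.
  - by apply: mulr_ge0; [exact: expR_ge0|apply: mulr_ge0; [exact: powR_ge0|exact: C10]].
  - by apply: gk_ge0; exact: addr_gt0.
  - by apply: ler_wpM2l; [exact: expR_ge0|apply: ler_wpM2r].
  - by apply: hC2; rewrite t0.
have g0 := gk_ge0 t s0; have E0 := expR_ge0 (k * t).
have -> : expR (k * t) * (M^-1 * C1) * (C2 * gk s t) = (C1 * C2 / M) * (expR (k * t) * gk s t) by ring.
rewrite ler_wpM2r ?mulr_ge0// ler_pdivrMr// /M mulrDr mulr1 mulrCA mulfV ?gt_eqF// mulr1.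
by rewrite lerDl ltW.
Qed.

Definition wdom s k B f := forall t, 0 < t <= T -> `|f t| <= B * wgt s k t.

Lemma wdom_adm s k B f : 0 < s -> 0 <= k -> 0 <= B -> measurable_fun setT f -> wdom s k B f -> adm T f.
Proof.
move=> s0 k0 B0 mf h; have [_ [a [C [a0 C0 hC]]]] := adm_wgt s0 k0.
split => //; exists a, (B * C); split => //; first exact: mulr_ge0.
move=> z zT; rewrite (le_trans (h z zT))// -mulrA ler_wpM2l//.
by rewrite (le_trans _ (hC z zT))// ler_norm.
Qed.

Lemma wdom_convol a s k B eps f : 0 < a -> 0 < s -> 0 <= k -> 0 <= B ->
  measurable_fun setT f -> contracts a s k eps ->
  wdom s k B f -> wdom s k (eps * B) (convol (gk a) f).
Proof.
move=> a0 s0 k0 B0 mf hc hB t tT; have /andP[t0 tT'] := tT.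
apply: (@le_trans _ _ (convol (gk a) (fun z => B * wgt s k z) t)).
  apply: (norm_convol_le_adm (T := T)) => //.
  - exact: measurable_gk.
  - exact: adm_gk.
  - by apply: admZ; exact: adm_wgt.
  - by move=> z /andP[z0 _]; rewrite ger0_norm// gk_ge0.
  - by move=> z /andP[z0 zt]; apply: hB; rewrite z0; lra.
rewrite (convolZr_adm (T := T))//; [|exact: adm_wgt|exact: adm_gk].
by rewrite [eps * B]mulrC -mulrA ler_wpM2l// hc.
Qed.

End Contraction.

(** * The Neumann series of the kernel *)

Section Kernel.
Context {R : realType} (al de lam mu : R).
Hypothesis al0 : 0 < al.
Hypothesis de0 : 0 < de.
Implicit Types (f g h : R -> R) (t z : R).

(* the exponent al + al k - be i of the paper, with be = al - de *)
Definition kexp (k i : nat) : R := al + (al * (k - i)%:R + de * i%:R).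

(** The operator h -> - lam (g_de * h) - mu (g_al * h), iterated k times on g_al and expanded by the
    binomial formula. The double Mittag-Leffler series is thus a Neumann series. *)
Definition kterm (k : nat) z : R :=
  \sum_(i < k.+1) ('C(k, i)%:R * ((- lam) ^+ i * (- mu) ^+ (k - i))) * gk (kexp k i) z.

Lemma kexp_gt0 k i : 0 < kexp k i.
Proof. by rewrite ltr_wpDr// addr_ge0// mulr_ge0// ltW. Qed.

Lemma measurable_sum_fun (I : Type) (r : seq I) (F : I -> R -> R) :
  (forall i, measurable_fun setT (F i)) -> measurable_fun setT (fun z => \sum_(i <- r) F i z).
Proof.
move=> mF; elim: r => [|i r IH].
  rewrite (_ : (fun _ => _) = cst 0)//; apply/funext => z; exact: big_nil.
rewrite (_ : (fun _ => _) = (fun z => F i z + \sum_(i <- r) F i z)).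
  exact: measurable_funD.
by apply/funext => z; rewrite big_cons.
Qed.

Lemma adm_sum (T : R) (I : Type) (r : seq I) (F : I -> R -> R) :
  (forall i, adm T (F i)) -> adm T (fun z => \sum_(i <- r) F i z).
Proof.
move=> mF; elim: r => [|i r IH].
  rewrite (_ : (fun _ => _) = cst 0); first exact: adm_cst.
  by apply/funext => z; exact: big_nil.
rewrite (_ : (fun _ => _) = (fun z => F i z + \sum_(i <- r) F i z)).
  exact: admD.
by apply/funext => z; rewrite big_cons.
Qed.

Lemma convol_sum (T t : R) (I : Type) (r : seq I) (F : I -> R -> R) g :
  adm T g -> (forall i, adm T (F i)) -> t <= T ->
  convol g (fun z => \sum_(i <- r) F i z) t = \sum_(i <- r) convol g (F i) t.
Proof.
move=> hg hF tT; elim: r => [|i r IH].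
  rewrite big_nil; have -> : (fun z : R => \sum_(i <- [::]) F i z) = (fun z => 0 * cst 0 z).
    by apply/funext => z; rewrite big_nil mul0r.
  by rewrite (convolZr_adm _ _ hg tT) ?mul0r//; exact: adm_cst.
have -> : (fun z : R => \sum_(i <- i :: r) F i z) = (fun z => F i z + \sum_(i <- r) F i z).
  by apply/funext => z; rewrite big_cons.
by rewrite big_cons (convolDr_adm _ _ hg tT)// ?IH//; exact: adm_sum.
Qed.

Lemma adm_kterm (T : R) k : adm T (kterm k).
Proof. by apply: adm_sum => i; apply: admZ; apply: adm_gk; exact: kexp_gt0. Qed.

Lemma kterm0 z : kterm 0 z = gk al z.
Proof.
rewrite /kterm big_ord_recl big_ord0 addr0 bin0 !expr0 !mul1r /kexp /=.
by rewrite !mulr0 !addr0.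
Qed.

(** Convolution with g_a adds a to the order of every kernel, and Pascal's rule regroups the two
    shifted sums. *)
Lemma ktermS k t : 0 < t ->
  kterm k.+1 t = - (lam * convol (gk de) (kterm k) t + mu * convol (gk al) (kterm k) t).
Proof.
move=> t0.
have cE a : 0 < a -> convol (gk a) (kterm k) t =
    \sum_(i < k.+1) ('C(k, i)%:R * ((- lam) ^+ i * (- mu) ^+ (k - i))) * gk (a + kexp k i) t.
  move=> a0; rewrite (convol_sum (T := t))//; last 2 first.
  - exact: adm_gk.
  - by move=> i; apply: admZ; apply: adm_gk; exact: kexp_gt0.
  apply: eq_bigr => i _; rewrite (convolZr_adm (T := t))//.
  - by rewrite convol_gk//; exact: kexp_gt0.
  - by apply: adm_gk; exact: kexp_gt0.
  - exact: adm_gk.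
rewrite !cE// opprD -!mulNr !big_distrr /= /kterm.
rewrite big_ord_recl /= bin0 expr0 mul1r subn0.
under eq_bigr => i _ do rewrite /bump /= add1n binS natrD !mulrDl subSS.
rewrite big_split /= addrA addrC; congr (_ + _).
  apply: eq_bigr => i _; rewrite exprS (_ : kexp _ _ = de + kexp k i).
    by ring.
  by rewrite /kexp subSS -natr1; ring.
rewrite big_ord_recr /= bin_small// !mul0r addr0.
rewrite [in RHS]big_ord_recl /= bin0 expr0 !mul1r subn0; congr (_ + _).
  rewrite exprS -mulrA; congr (_ * (_ * gk _ _)).
  by rewrite /kexp !subn0 -natr1; ring.
apply: eq_bigr => i _; rewrite /bump /= add1n.
have ik : (i < k)%N by [].
rewrite (_ : (k - i = (k - i.+1).+1)%N); last by rewrite -subSn// subSS.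
rewrite (exprS (- mu)) (_ : kexp _ _ = al + kexp k i.+1); first by ring.
rewrite /kexp (_ : (k.+1 - i.+1 = (k - i.+1).+1)%N); last by rewrite subSS subnSK.
by rewrite -natr1; ring.
Qed.

End Kernel.

Section SeriesTail.
Context {R : realType}.

Lemma series_dominated (a b : nat -> R) : (forall k, `|a k| <= b k) -> cvgn (series b) ->
  cvgn (series a) /\ forall N, `|limn (series a) - series a N| <= limn (series b) - series b N.
Proof.
move=> ab cb.
have b0 k : 0 <= b k by apply: le_trans (ab k).
have ca : cvgn (series a).
  apply: normed_cvg; apply: series_le_cvg cb => // k /=; exact: normr_ge0.
split => // N.
have ndb : nondecreasing_seq (series b).
  by apply/nondecreasing_seqP => n; rewrite /series /= big_nat_recr//= lerDl.
have hM M : (N <= M)%N -> `|series a M - series a N| <= limn (series b) - series b N.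
  move=> NM; have := nondecreasing_cvgn_le ndb cb M => h.
  apply: (@le_trans _ _ (series b M - series b N)); last by rewrite lerB.
  rewrite !sub_series_geq//; apply: le_trans (ler_norm_sum _ _ _) _.
  by apply: ler_sum => i _.
have c2 : `|series a M - series a N| @[M --> \oo] --> `|limn (series a) - series a N|.
  by apply: cvg_norm; apply: cvgB => //; exact: cvg_cst.
apply: (cvgr_to_le c2); by exists N.
Qed.

Lemma series_half_pow (W : R) : series (fun k => 2^-1 ^+ k * W) @ \oo --> 2 * W.
Proof.
have -> : (fun k => 2^-1 ^+ k * W) = geometric W (2^-1 : R).
  by apply/funext => k; rewrite /geometric /= mulrC.
have -> : 2 * W = W * (1 - 2^-1)^-1 by field.
by apply: cvg_geometric_series; rewrite gtr0_norm ?invr_gt0// invf_lt1// ltr1n.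
Qed.

Lemma series_half_powE (W : R) N : series (fun k => 2^-1 ^+ k * W) N = 2 * W - 2 * 2^-1 ^+ N * W.
Proof.
elim: N => [|N IH]; first by rewrite /series /= big_geq// expr0; ring.
by move: IH; rewrite /series /= big_nat_recr//= => ->; rewrite exprS; field.
Qed.

Lemma series_half_dominated (a : nat -> R) (W : R) : (forall k, `|a k| <= 2^-1 ^+ k * W) ->
  cvgn (series a) /\ forall N, `|limn (series a) - series a N| <= 2 * 2^-1 ^+ N * W.
Proof.
move=> h; have c : series (fun k => 2^-1 ^+ k * W) @ \oo --> 2 * W by exact: series_half_pow.
have [|ca ha] := series_dominated h; first by apply/cvg_ex; exists (2 * W).
split => // N; apply: le_trans (ha N) _.
rewrite (cvg_lim _ c)// series_half_powE.
by rewrite opprB addrC subrK.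
Qed.

Lemma cvg_bigsum (U : Type) (F : set_system U) (FF : Filter F) (I : Type) (r : seq I)
  (f : I -> U -> R) (l : I -> R) : (forall i, f i @ F --> l i) ->
  (fun x => \sum_(i <- r) f i x) @ F --> \sum_(i <- r) l i.
Proof.
move=> fl; elim: r => [|i r IH].
  rewrite big_nil (_ : (fun _ => _) = cst 0); first exact: cvg_cst.
  by apply/funext => x; exact: big_nil.
rewrite big_cons (_ : (fun _ => _) = (fun x => f i x + \sum_(j <- r) f j x)).
  exact: cvgD.
by apply/funext => x; rewrite big_cons.
Qed.

Lemma half_pow_eq0 (x C : R) : (forall N, `|x| <= 2^-1 ^+ N * C) -> x = 0.
Proof.
move=> h; apply/eqP; rewrite -normr_le0.
have c : 2^-1 ^+ N * C @[N --> \oo] --> (0 : R).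
  rewrite -[X in _ --> X](mul0r C); apply: cvgMr_tmp.
  by apply: cvg_expr; rewrite gtr0_norm ?invr_gt0// invf_lt1// ltr1n.
by apply: (cvgr_to_ge c); exists 0%N.
Qed.

End SeriesTail.

Section KernelSeries.
Context {R : realType} (al de lam mu : R).
Hypothesis al0 : 0 < al.
Hypothesis de0 : 0 < de.
Implicit Types (f g h : R -> R) (t z T : R).
Notation tk := (kterm al de lam mu).

(* z ^ (al - 1) E_(de, al),al (- lam z ^ de, - mu z ^ al) *)
Definition kern z := if 0 < z then limn (series (fun k => tk k z)) else 0.

(** With eps = 1 / (2 (|lam| + |mu| + 1)) each step of the recursion [ktermS] halves the weighted
    norm. The rate k obtained here depends on mu, so these bounds are not uniform over the modes. *)
Lemma kterm_wdom T : exists2 k, 0 <= k & exists2 eps,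
  [/\ 0 <= eps, contracts T de al k eps, contracts T al al k eps & (`|lam| + `|mu|) * eps <= 2^-1] &
  forall n, wdom T al k (2^-1 ^+ n) (tk n).
Proof.
pose eps : R := (2 * (`|lam| + `|mu| + 1))^-1.
have l0 : 0 <= `|lam| + `|mu| by rewrite addr_ge0.
have e0 : 0 < eps by rewrite invr_gt0 mulr_gt0// ltr_wpDl.
have [k1 k10 h1] := @gk_contraction R T de al eps de0 al0 e0.
have [k2 k20 h2] := @gk_contraction R T al al eps al0 al0 e0.
pose k := Num.max k1 k2.
have k0 : 0 <= k by rewrite le_max ltW.
have c1 : contracts T de al k eps by apply: h1; rewrite le_max lexx.
have c2 : contracts T al al k eps by apply: h2; rewrite le_max lexx orbT.
have le2 : (`|lam| + `|mu|) * eps <= 2^-1.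
  rewrite /eps invfM mulrCA -{2}[2^-1]mulr1 ler_wpM2l ?invr_ge0// ler_pdivrMr ?mul1r ?lerDl// ltr_wpDl.
exists k => //; exists eps; first by split => //; exact: ltW.
elim=> [|n IH] t tT.
  rewrite kterm0 expr0 mul1r ger0_norm ?gk_ge0// wgtE ler_peMl ?gk_ge0//.
  have /andP[t0 _] := tT; have := expR_ge1Dx (k * t).
  by apply: le_trans; rewrite lerDl mulr_ge0// ltW.
have /andP[t0 tT'] := tT.
rewrite ktermS// normrN (le_trans (ler_normD _ _))// !normrM.
have mt : measurable_fun setT (tk n) by have [] := adm_kterm lam mu al0 de0 T n.
have b0 : 0 <= 2^-1 ^+ n :> R by rewrite exprn_ge0// invr_ge0.
have i1 := wdom_convol de0 al0 k0 b0 mt c1 IH tT.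
have i2 := wdom_convol al0 al0 k0 b0 mt c2 IH tT.
apply: (@le_trans _ _ (`|lam| * (eps * 2^-1 ^+ n * wgt al k t) + `|mu| * (eps * 2^-1 ^+ n * wgt al k t))).
  by apply: lerD; rewrite ler_wpM2l.
rewrite -mulrDl !mulrA exprS; apply: ler_wpM2r; first exact: wgt_ge0.
by apply: ler_wpM2r.
Qed.

Lemma kern_wdom T : exists2 k, 0 <= k & exists2 eps,
  [/\ 0 <= eps, contracts T de al k eps, contracts T al al k eps & (`|lam| + `|mu|) * eps <= 2^-1] &
  forall N, wdom T al k (2 * 2^-1 ^+ N) (fun z => kern z - \sum_(j < N) tk j z).
Proof.
have [k k0 [eps he hk]] := kterm_wdom T.
exists k => //; exists eps => // N z zT; have /andP[z0 _] := zT.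
rewrite /kern z0.
have [_ h] := @series_half_dominated R (tk ^~ z) (wgt al k z) (fun j => hk j z zT).
by have := h N; rewrite /series /= big_mkord.
Qed.

Lemma kern_cvg z : 0 < z -> series (fun k => tk k z) @ \oo --> kern z.
Proof.
move=> z0; rewrite /kern z0.
have [k k0 [eps he hk]] := kterm_wdom z.
have zz : 0 < z <= z by rewrite z0 lexx.
by have [c _] := @series_half_dominated R (tk ^~ z) (wgt al k z) (fun j => hk j z zz).
Qed.

Lemma measurable_kern : measurable_fun setT kern.
Proof.
apply: (@measurable_fun_cvg _ _ _ _ (fun N => pos (fun z => series (fun k => tk k z) N))).
  move=> N; apply: measurable_pos; rewrite /series /=.
  by apply: measurable_sum_fun => k; have [] := adm_kterm lam mu al0 de0 1 k.
move=> z _; rewrite /pos; case: (ltP 0 z) => z0; first exact: kern_cvg.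
by rewrite /kern ltNge z0; exact: cvg_cst.
Qed.

Lemma adm_kern T : adm T kern.
Proof.
have [k k0 [eps he hk]] := kern_wdom T.
apply: (wdom_adm al0 k0 _ measurable_kern (B := 2)) => // t tT.
have := hk 0%N t tT; by rewrite big_ord0 subr0 expr0 mulr1.
Qed.

(** The partial sums satisfy S_(N+1) = g_al - lam (g_de * S_N) - mu (g_al * S_N) exactly. The defect
    of the limit thus consists of remainders only, and these are of size 2^(-N). *)
Lemma kern_eq t : 0 < t ->
  kern t + lam * convol (gk de) kern t + mu * convol (gk al) kern t = gk al t.
Proof.
move=> t0; apply/eqP; rewrite -subr_eq0; apply/eqP.
have [k k0 [eps [e0 c1 c2 le2] hk]] := kern_wdom t.
have tt : 0 < t <= t by rewrite t0 lexx.
apply: (@half_pow_eq0 _ _ (2 * wgt al k t)) => N.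
pose S n z := \sum_(j < n) tk j z.
have adS n : adm t (S n) by apply: adm_sum => j; exact: adm_kterm.
have adK := adm_kern t.
have cS a n : 0 < a -> convol (gk a) (S n) t = \sum_(j < n) convol (gk a) (tk j) t.
  by move=> a0; apply: (convol_sum (T := t)) => // [|i]; [exact: adm_gk|exact: adm_kterm].
have SE : S N.+1 t = gk al t - (lam * convol (gk de) (S N) t + mu * convol (gk al) (S N) t).
  rewrite /S big_ord_recl kterm0 !cS// !big_distrr /= -big_split /= -sumrN; congr (_ + _).
  by apply: eq_bigr => i _; rewrite /bump /= add1n ktermS.
have rE a : 0 < a -> convol (gk a) kern t = convol (gk a) (fun z => kern z - S N z) t + convol (gk a) (S N) t.
  move=> a0; rewrite -(convolDr_adm (T := t))//; last 2 first.
  - exact: admB.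
  - exact: adm_gk.
  by apply: eq_convol => // z _; rewrite subrK.
have -> : kern t + lam * convol (gk de) kern t + mu * convol (gk al) kern t - gk al t =
  (kern t - S N.+1 t) + (lam * convol (gk de) (fun z => kern z - S N z) t + mu * convol (gk al) (fun z => kern z - S N z) t).
  by rewrite SE !rE//; ring.
have mr : measurable_fun setT (fun z => kern z - S N z) by have [] := admB adK (adS N).
have b0 : 0 <= 2 * 2^-1 ^+ N :> R by rewrite mulr_ge0// exprn_ge0// invr_ge0.
have i1 := wdom_convol de0 al0 k0 b0 mr c1 (hk N) tt.
have i2 := wdom_convol al0 al0 k0 b0 mr c2 (hk N) tt.
have i3 := hk N.+1 t tt.
apply: le_trans (ler_normD _ _) _.
have i4 : `|lam * convol (gk de) (fun z => kern z - S N z) t + mu * convol (gk al) (fun z => kern z - S N z) t| <=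
   (`|lam| + `|mu|) * eps * (2 * 2^-1 ^+ N * wgt al k t).
  rewrite (le_trans (ler_normD _ _))// !normrM.
  apply: (@le_trans _ _ (`|lam| * (eps * (2 * 2^-1 ^+ N) * wgt al k t) + `|mu| * (eps * (2 * 2^-1 ^+ N) * wgt al k t))).
    by apply: lerD; rewrite ler_wpM2l.
  by rewrite -mulrDl !mulrA.
apply: le_trans (lerD i3 i4) _.
have W0 : 0 <= wgt al k t by exact: wgt_ge0.
have p0 : 0 <= 2^-1 ^+ N :> R by rewrite exprn_ge0// invr_ge0.
apply: (@le_trans _ _ (2 * 2^-1 ^+ N.+1 * wgt al k t + 2^-1 * (2 * 2^-1 ^+ N * wgt al k t))).
  by rewrite lerD2l; apply: ler_wpM2r => //; rewrite mulr_ge0// mulr_ge0.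
by rewrite exprS le_eqVlt; apply/orP; left; apply/eqP; field.
Qed.

Lemma continuous_gk a z : 0 < z -> {for z, continuous (gk a : R -> R)}.
Proof.
move=> z0; have -> : gk a = (fun y : R => y `^ (a - 1) * (Gamma a)^-1) by apply/funext => y; rewrite gkE.
by apply: cvgMr_tmp; exact: continuous_powR.
Qed.

Lemma continuous_kterm n z : 0 < z -> {for z, continuous (tk n)}.
Proof.
move=> z0; rewrite /kterm; apply: cvg_bigsum => i; apply: cvgMl_tmp; exact: continuous_gk.
Qed.

(** Convergence is locally uniform: near z the weight in [kern_wdom] stays below its value at z plus
    1. *)
Lemma continuous_kern z : 0 < z -> {for z, continuous kern}.
Proof.
move=> z0; apply/cvgrPdist_le => /= e e0.
have [k k0 [eps _ hk]] := kern_wdom (2 * z).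
have cW : {for z, continuous (wgt al k)}.
  have -> : wgt al k = (fun z => expR (k * z) * gk al z) by apply/funext => y; rewrite wgtE.
  apply: cvgM; last exact: continuous_gk.
  by apply: continuous_comp; [exact: mulrl_continuous|exact: continuous_expR].
pose M := wgt al k z + 1.
have M0 : 0 < M by rewrite ltr_wpDl// wgt_ge0.
have nM : \forall y \near z, wgt al k y <= M.
  by have := cvgr_le _ cW M => /(_ _); apply; rewrite /M ltrDl.
have ny : \forall y \near z, 0 < y <= 2 * z.
  near=> y; apply/andP; split.
    by near: y; exact: lt_nbhsr.
  apply: ltW; near: y; apply: lt_nbhsl; lra.
have [N hN] : exists N, 2 * 2^-1 ^+ N * M <= e / 3.
  have c : 2 * 2^-1 ^+ N * M @[N --> \oo] --> (0 : R).
    rewrite -[X in _ --> X](mul0r M); apply: cvgMr_tmp; rewrite -[X in _ --> X](mulr0 2); apply: cvgMl_tmp.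
    by apply: cvg_expr; rewrite gtr0_norm ?invr_gt0// invf_lt1// ltr1n.
  have := cvgr_le _ c (e / 3) => /(_ _)[]; first by rewrite divr_gt0.
  by move=> N _ h; exists N; exact: (h N (leqnn N)).
have cS : {for z, continuous (fun y => \sum_(j < N) tk j y)}.
  by apply: cvg_bigsum => i; exact: continuous_kterm.
have dist y : 0 < y <= 2 * z -> wgt al k y <= M -> `|kern y - \sum_(j < N) tk j y| <= e / 3.
  move=> y1 y2; apply: le_trans (hk N y y1) _; apply: le_trans hN.
  by rewrite ler_wpM2l// mulr_ge0// exprn_ge0// invr_ge0.
have dz : `|kern z - \sum_(j < N) tk j z| <= e / 3.
  by apply: dist; [lra|rewrite lerDl].
near=> y.
have d1 : `|kern y - \sum_(j < N) tk j y| <= e / 3 by apply: dist; near: y.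
have d2 : `|\sum_(j < N) tk j z - \sum_(j < N) tk j y| <= e / 3.
  by near: y; apply: (cvgrPdist_le _ _).1 cS _ _; rewrite divr_gt0.
have -> : kern z - kern y = (kern z - \sum_(j < N) tk j z) + (\sum_(j < N) tk j z - \sum_(j < N) tk j y)
   - (kern y - \sum_(j < N) tk j y) by ring.
apply: le_trans (ler_normB _ _) _; apply: le_trans (lerD (ler_normD _ _) (lexx _)) _.
by lra.
Unshelve. all: by end_near. Qed.

End KernelSeries.

(** * Positivity of the kernel for lam = 0 *)

Section ResolventPositive.
Context {R : realType} (al mu : R).
Hypothesis al0 : 0 < al.
Hypothesis al1 : al <= 1.
Hypothesis mu0 : 0 < mu.
Notation leb := (@lebesgue_measure R).
Notation rint D f := (leb.-integrable D (EFin \o f)).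
Implicit Types (f g h : R -> R) (t z T : R).

(** The function z^(al-1) E_(al,al) (- mu z^al), which solves r + mu (g_al * r) = g_al. *)
Definition res := kern al al 0 mu.

Lemma adm_res T : adm T res.
Proof. exact: adm_kern. Qed.

Lemma res_eq t : 0 < t -> res t + mu * convol (gk al) res t = gk al t.
Proof. by move=> t0; rewrite -(kern_eq 0 mu al0 al0 t0) mul0r addr0. Qed.

Lemma gk_add_exp (a b z : R) : 0 < a -> 0 < b -> 0 < z ->
  gk (a + b) z = z `^ b * (Gamma a / Gamma (a + b)) * gk a z.
Proof.
move=> a0 b0 z0; rewrite !gkE.
have -> : z `^ (a + b - 1) = z `^ b * z `^ (a - 1).
  by rewrite -powRD; [congr powR; lra|rewrite (gt_eqF z0) implybT].
have := Gamma_gt0 a0; have := Gamma_gt0 (addr_gt0 a0 b0).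
move: (Gamma _) (Gamma _) => x y x0 y0.
by field; rewrite !gt_eqF.
Qed.

(** The correction mu (g_al * r) is O(g_(2 al)), that is, t^al g_al(t) up to a constant, hence
    smaller than g_al near 0. *)
Lemma res_gt0_near0 : exists2 eta, 0 < eta & forall t, 0 < t <= eta -> 0 < res t.
Proof.
have [k k0 [eps _ hk]] := kern_wdom 0 mu al0 al0 1.
pose C := 2 * expR k.
have C0 : 0 <= C by rewrite mulr_ge0// expR_ge0.
have d1 : gk_dominated 1 al C res.
  move=> z z1; have := hk 0%N z z1; rewrite big_ord0 subr0 expr0 mulr1 => /le_trans; apply.
  rewrite wgtE /C -mulrA ler_wpM2l// ler_wpM2r ?gk_ge0// ler_expR.
  by rewrite ler_piMr//; lra.
have d2 : gk_dominated 1 (al + al) (1 * C) (convol (gk al) res).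
  apply: gk_dominated_convol => //; first exact: measurable_gk.
    by have [] := adm_res 1.
  by move=> z _; rewrite mul1r ger0_norm// gk_ge0.
pose D := mu * C * (Gamma al / Gamma (al + al)).
have D0 : 0 <= D.
  have := Gamma_gt0 al0; have := Gamma_gt0 (addr_gt0 al0 al0); rewrite /D.
  move: (Gamma _) (Gamma _) => x y x0 y0.
  by apply: mulr_ge0; [apply: mulr_ge0 => //; exact: ltW|apply: divr_ge0; exact: ltW].
have D1 : 0 < (D + 1)^-1 by rewrite invr_gt0 ltr_wpDl.
exists (Num.min 1 ((D + 1)^-1 `^ al^-1)); first by rewrite lt_min ltr01 powR_gt0.
move=> t /andP[t0]; rewrite le_min => /andP[t1 tD].
have t01 : 0 < t <= 1 by rewrite t0.
have h := d2 t t01; rewrite mul1r in h.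
have ta : t `^ al <= (D + 1)^-1.
  have -> : (D + 1)^-1 = ((D + 1)^-1 `^ al^-1) `^ al.
    by rewrite -powRrM mulVf ?gt_eqF// powRr1// ltW.
  by apply: ge0_ler_powR => //; rewrite ?nnegrE ?powR_ge0//; exact: ltW.
have g0 : 0 < gk al t by exact: gk_gt0.
have -> : res t = gk al t - mu * convol (gk al) res t by rewrite -(res_eq t0) addrK.
rewrite subr_gt0; apply: le_lt_trans (ler_norm _) _; rewrite normrM gtr0_norm//.
apply: (@le_lt_trans _ _ (mu * (C * gk (al + al) t))); first by rewrite ler_wpM2l// ltW.
rewrite gk_add_exp//.
have -> : mu * (C * (t `^ al * (Gamma al / Gamma (al + al)) * gk al t)) = t `^ al * D * gk al t by rewrite /D; ring.
rewrite gtr_pMl//; apply: (@le_lt_trans _ _ ((D + 1)^-1 * D)); first by rewrite ler_wpM2r.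
by rewrite mulrC ltr_pdivrMr ?mul1r ?ltrDl// ltr_wpDl.
Qed.

Lemma Rintegral_gk_itv t : 0 < t -> \int[leb]_(z in `]0, t[) gk al z = gk (al + 1) t.
Proof.
move=> t0; rewrite -(convol_gk al0 ltr01 t0).
by rewrite convolE; apply: eq_Rintegral => z _; rewrite gk1 mulr1.
Qed.

(** Before t the two integrands are compared pointwise through the ratio c; on [t, t0[ the function
    is at most M, and the kernel has integral g_(al+1)(t0 - t) there. *)
Lemma convol_split_le f t t0 c M : measurable_fun setT f -> 0 < t -> t < t0 -> 0 <= M ->
  cint f (gk al) t0 -> cint f (gk al) t ->
  (forall s, 0 < s < t -> 0 <= f s) -> (forall s, t <= s < t0 -> f s <= M) ->
  (forall s, 0 < s < t -> gk al (t0 - s) <= c * gk al (t - s)) ->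
  convol f (gk al) t0 <= c * convol f (gk al) t + M * gk (al + 1) (t0 - t).
Proof.
move=> mf tp tt0 M0 I0 It f0 fM gc.
have tt : 0 < t0 - t by rewrite subr_gt0.
pose G := (gk al) \_ `]0, t0 - t].
have IG : rint setT G.
  apply/rint_patch => //.
  have /integrableP[m1 i1] : rint `]0, t0 - t[ (gk al).
    by apply: (eq_rint _ _ (cint_gk (t0 - t) al0 ltr01)) => // z _; rewrite gk1 mulr1.
  apply/integrableP; split; first by apply/measurable_EFinP; apply: measurable_funTS; exact: measurable_gk.
  rewrite -integral_itv_bndo_bndc//.
  by apply: measurableT_comp => //; exact: measurable_int IG.
have mG : measurable_fun setT G by exact: rint_measurable IG.
have GE : \int[leb]_z G z = gk (al + 1) (t0 - t).
  rewrite -Rintegral_mkcond -Rintegral_itv_bndo_bndc ?Rintegral_gk_itv//.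
  by apply: (eq_rint _ _ (cint_gk (t0 - t) al0 ltr01)) => // z _; rewrite gk1 mulr1.
have IGr : rint setT (fun s => G (t0 - s)).
  move/integrableP : IG => [_ i1]; apply/integrableP; split.
    by apply/measurable_EFinP; exact: measurable_sub_comp.
  rewrite (integral_subr t0 (F := abse \o (EFin \o G)))//.
  by apply: measurableT_comp => //; exact/measurable_EFinP.
have GrE : \int[leb]_s G (t0 - s) = gk (al + 1) (t0 - t).
  rewrite -GE /Rintegral (integral_subr t0 (F := EFin \o G))//.
  exact/measurable_EFinP.
rewrite -GrE !convol_full.
move/cint_full : It => It; move/cint_full : I0 => I0.
rewrite -RintegralZl// -RintegralZl// -RintegralD//; [|exact: rintZ..].
apply: le_Rintegral => //; first by apply: rintD => //; exact: rintZ.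
move=> s _; rewrite /G patchE mem_setE in_itv /= [point](_ : _ = 0)//.
case: (leP s 0) => s0.
  rewrite !(pos_le0 _ s0) !mul0r mulr0 add0r; case: ifP => _; rewrite ?mulr0//.
  by rewrite mulr_ge0// gk_ge0.
rewrite !(pos_gt0 _ s0).
case: (leP t0 s) => st0.
  rewrite (@pos_le0 _ (gk al) (t0 - s)) ?subr_le0// mulr0.
  rewrite (@pos_le0 _ (gk al) (t - s)) ?subr_le0; last by lra.
  rewrite !mulr0 add0r; case: ifP => _; rewrite ?mulr0//.
  by rewrite mulr_ge0// gk_ge0.
rewrite (@pos_gt0 _ (gk al) (t0 - s)) ?subr_gt0//.
case: (ltP s t) => st.
  rewrite ifF; last by apply/negP => /andP[_]; lra.
  rewrite mulr0 addr0 (@pos_gt0 _ (gk al) (t - s)) ?subr_gt0// mulrCA ler_wpM2l ?f0 ?s0//.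
  by apply: gc; rewrite s0.
rewrite (@pos_le0 _ (gk al) (t - s)) ?subr_le0// !mulr0 add0r ifT; last by apply/andP; split; lra.
by rewrite ler_wpM2r ?gk_ge0// fM// st.
Qed.

(** Since al <= 1 the power z^(al-1) is nonincreasing, and (t0 - s) / (t - s) >= t0 / t. *)
Lemma gk_ratio_le (t t0 s : R) : 0 < s -> s < t -> t < t0 ->
  gk al (t0 - s) <= gk al t0 / gk al t * gk al (t - s).
Proof.
move=> s0 st tt0.
have tp : 0 < t by lra. have t0p : 0 < t0 by lra.
have a1 : 0 < t0 - s by lra. have a2 : 0 < t - s by lra.
rewrite mulrAC ler_pdivlMr ?gk_gt0// !gkE.
have := Gamma_gt0 al0; move: (Gamma al) => G G0.
rewrite mulrACA [leRHS]mulrACA ler_pM2r ?mulr_gt0 ?invr_gt0//.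
have e : al - 1 = - (1 - al) by lra.
rewrite e !powRN -!invfM lef_pV2 ?posrE ?mulr_gt0 ?powR_gt0//.
have l1 := ltW a1; have l2 := ltW a2; have l3 := ltW tp; have l4 := ltW t0p.
rewrite -!powRM//.
have l5 : 0 <= 1 - al by rewrite subr_ge0.
apply: ge0_ler_powR; rewrite ?nnegrE ?mulr_ge0//.
nra.
Qed.

(** Let t0 be the first point with r <= 0 and m a maximum point of r on [t0 - d, t0]. Comparing the
    equations of r at t0 and at m through [convol_split_le] gives r(t0) >= r(m) (g_al(t0) / g_al(m)
    - mu g_(al+1)(d)). The ratio is at least 1/2 because m >= t0 / 2, and d is chosen with mu
    g_(al+1)(d) < 1/2, so r(t0) > 0. *)
Lemma res_gt0 t : 0 < t -> 0 < res t.
Proof.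
move=> tp; rewrite ltNge; apply/negP => rt.
pose A := [set y : R | 0 < y /\ res y <= 0].
have At : A t by [].
have [eta eta0 heta] := res_gt0_near0.
have lbA : lbound A eta.
  move=> y [y0 ry]; rewrite leNgt; apply/negP => ye.
  by have := heta y; rewrite y0 ltW// => /(_ isT); rewrite ltNge ry.
have hA : has_inf A by split; [exists t|exists eta].
pose t0 := inf A.
have t0e : eta <= t0 by apply: lb_le_inf lbA; exists t.
have t0p : 0 < t0 by apply: lt_le_trans t0e.
have pos0 s : 0 < s < t0 -> 0 < res s.
  move=> /andP[s0 st]; rewrite ltNge; apply/negP => rs.
  have : t0 <= s by apply: ge_inf => //; case: hA.
  by rewrite leNgt st.
have r0 : res t0 <= 0.
  rewrite leNgt; apply/negP => r0.
  have c0 : {for t0, continuous res} by exact: continuous_kern.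
  have := cvgr_gt _ c0 0 r0 => -[e /= e0 he].
  have : lbound A (t0 + e).
    move=> y [y0 ry]; rewrite leNgt; apply/negP => ye.
    have : t0 <= y by apply: ge_inf => //; by case: hA.
    move=> ty; have := he y; rewrite /ball_ /= ler0_norm ?subr_le0// opprB.
    move=> /(_ _); rewrite -/res => h; have : 0 < res y by apply: h; lra.
    by rewrite ltNge ry.
  move/lb_le_inf => /(_ (ex_intro _ t At)).
  by rewrite -/t0 gerDl leNgt e0.
have [d [d0 dt hd]] : exists d, [/\ 0 < d, d <= t0 / 2 & mu * gk (al + 1) d < 2^-1].
  have G0 := @Gamma_gt0 R (al + 1) (addr_gt0 al0 ltr01).
  pose q := Gamma (al + 1) / (2 * mu) / 2.
  have q0 : 0 < q by rewrite !divr_gt0// mulr_gt0.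
  exists (Num.min (t0 / 2) (q `^ al^-1)); split.
  - by rewrite lt_min divr_gt0//= powR_gt0.
  - by rewrite ge_min lexx.
  - have h : (Num.min (t0 / 2) (q `^ al^-1)) `^ al <= q.
      have qE : (q `^ al^-1) `^ al = q by rewrite -powRrM mulVf ?gt_eqF// powRr1// ltW.
      rewrite -[leRHS]qE.
      apply: ge0_ler_powR; rewrite ?nnegrE ?powR_ge0 ?ge_min ?lexx ?orbT//; first exact: ltW.
      by rewrite le_min powR_ge0 divr_ge0// ltW.
    rewrite gkE addrK; move: h; move: (_ `^ al) => w; rewrite /q.
    move: (Gamma _) G0 => G G0 h.
    rewrite mulrA ltr_pdivrMr//; apply: (@le_lt_trans _ _ (mu * (G / (2 * mu) / 2))).
      by rewrite ler_wpM2l// ltW.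
    have -> : mu * (G / (2 * mu) / 2) = G / 4 by field; rewrite gt_eqF.
    lra.
have cres : {within `[t0 - d, t0], continuous res}.
  apply: continuous_in_subspaceT => z; rewrite inE /= in_itv /= => /andP[z1 _].
  by apply: continuous_kern => //; lra.
have td : t0 - d <= t0 by lra.
have [m] := EVT_max td cres.
rewrite in_itv /= => /andP[m1 m2] hm.
have rm : 0 < res m.
  apply: (@lt_le_trans _ _ (res (t0 - d))).
    by apply: pos0; apply/andP; split; lra.
  by apply: hm; rewrite in_itv /= lexx /=; lra.
have mt0 : m < t0.
  by rewrite lt_neqAle m2 andbT; apply/negP => /eqP e; move: rm; rewrite e ltNge r0.
have mp : 0 < m by lra.
have dm : t0 - m <= d by lra.
have dm0 : 0 <= t0 - m by lra.
have m0' : 0 <= m by lra.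
have mt : 2^-1 <= m / t0 by rewrite ler_pdivlMr//; lra.
have mt1 : m <= t0 by lra.
have [mr _] := adm_res 1.
have I y : cint res (gk al) y by apply: (cint_adm (T := y)) => //; [exact: adm_res|exact: adm_gk].
have H1 : convol res (gk al) t0 <= gk al t0 / gk al m * convol res (gk al) m + res m * gk (al + 1) (t0 - m).
  apply: (convol_split_le mr mp mt0 (ltW rm) (I _) (I _)).
  - by move=> s /andP[s0 sm]; apply/ltW/pos0/andP; split; lra.
  - by move=> s /andP[s0 sm]; apply: hm; rewrite in_itv /=; apply/andP; split; lra.
  - by move=> s /andP[s0 sm]; exact: gk_ratio_le.
have e0 : mu * convol res (gk al) t0 = gk al t0 - res t0.
  rewrite convolC//; last exact: measurable_gk.
  by rewrite -(res_eq t0p) addrAC subrr add0r.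
have em : mu * convol res (gk al) m = gk al m - res m.
  rewrite convolC//; last exact: measurable_gk.
  by rewrite -(res_eq mp) addrAC subrr add0r.
have gd : gk (al + 1) (t0 - m) <= gk (al + 1) d.
  rewrite !gkE addrK ler_pM2r ?invr_gt0 ?Gamma_gt0 ?addr_gt0//.
  by apply: ge0_ler_powR => //; rewrite ?nnegrE//; exact: ltW.
have g1 : 0 < gk al t0 by exact: gk_gt0.
have g2 : 0 < gk al m by exact: gk_gt0.
have half : 2^-1 <= gk al t0 / gk al m.
  rewrite !gkE; have := Gamma_gt0 al0; move: (Gamma al) => G G0.
  have -> : t0 `^ (al - 1) / G / (m `^ (al - 1) / G) = t0 `^ (al - 1) / m `^ (al - 1).
    by field; rewrite !gt_eqF// powR_gt0.
  have e : al - 1 = - (1 - al) by rewrite opprB.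
  rewrite e !powRN invrK mulrC -powRN.
  have -> : m `^ (1 - al) * t0 `^ (- (1 - al)) = (m / t0) `^ (1 - al).
    by rewrite powRM ?invr_ge0 ?(ltW t0p)// -(powR_inv1 (ltW t0p)) -powRrM mulN1r.
  apply: le_trans mt _; rewrite -[leLHS]powRr1; last by rewrite divr_ge0// ltW.
  apply: ger_powR; last by rewrite gerBl ltW.
  by rewrite divr_gt0//= ler_pdivrMr// mul1r.
have H2 : gk al t0 - res t0 <= gk al t0 / gk al m * (gk al m - res m) + res m * (mu * gk (al + 1) (t0 - m)).
  rewrite -e0 -em; apply: (@le_trans _ _ (mu * (gk al t0 / gk al m * convol res (gk al) m + res m * gk (al + 1) (t0 - m)))).
    by rewrite ler_pM2l.
  by rewrite le_eqVlt; apply/orP; left; apply/eqP; ring.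
have H3 : res m * (mu * gk (al + 1) (t0 - m)) < res m * 2^-1.
  by rewrite ltr_pM2l//; apply: le_lt_trans hd; rewrite ler_wpM2l// ltW.
have H4 : gk al t0 / gk al m * (gk al m - res m) = gk al t0 - gk al t0 / gk al m * res m.
  by field; rewrite gt_eqF.
have H5 : res m * 2^-1 <= gk al t0 / gk al m * res m by rewrite mulrC ler_pM2r.
rewrite H4 in H2; move: H2 H3 H5 r0.
move: (res m * (mu * _)) (res m / 2) (gk al t0 / gk al m * res m) (gk al t0) (res t0).
by clear; move=> a b c e g *; lra.
Qed.

End ResolventPositive.

(** * Bounds on the kernel that are uniform in mu *)

Section KernelBounds.
Context {R : realType} (al : R).
Hypothesis al0 : 0 < al.
Hypothesis al1 : al <= 1.
Implicit Types (f g h : R -> R) (t z T de lam mu : R).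

Lemma convol_gkD (a b T t : R) f : 0 < a -> 0 < b -> adm T f -> t <= T ->
  convol (gk a) (convol (gk b) f) t = convol (gk (a + b)) f t.
Proof.
move=> a0 b0 hf tT; rewrite -(convol_assoc_adm (T := T))//; [|exact: adm_gk..].
by apply: eq_convol => // z /andP[z0 _]; rewrite convol_gk.
Qed.

(** Convolving r + mu (g_al * r) = g_al with g_(1-al) gives g_(1-al) * r + mu (g_1 * r) = 1, and the
    first term is nonnegative because r is. For al = 1 the equation of r already has this form. *)
Lemma res_int mu t : 0 < mu -> 0 < t -> mu * convol (gk 1) (res al mu) t <= 1.
Proof.
move=> mu0 t0.
have r0 (z : R) : 0 < z -> 0 <= res al mu z by move=> z0; apply/ltW/res_gt0.
have adr := adm_res mu al0 t.
case: (ltP al 1) => al1'.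
  have a1 : 0 < 1 - al by rewrite subr_gt0.
  have : convol (gk (1 - al)) (fun z => res al mu z + mu * convol (gk al) (res al mu) z) t = 1.
    transitivity (gk 1 t); last exact: gk1.
    have -> : gk 1 t = gk (1 - al + al) t by rewrite subrK.
    rewrite -(convol_gk a1 al0 t0); apply: eq_convol => // z /andP[z0 _].
    exact: res_eq.
  have adc : adm t (convol (gk al) (res al mu)) by apply: adm_convol => //; exact: adm_gk.
  rewrite (convolDr_adm (T := t))//; [|exact: admZ|exact: adm_gk].
  rewrite (convolZr_adm (T := t))//; [|exact: adm_gk].
  rewrite (convol_gkD a1 al0 adr)// subrK => h; rewrite -[leRHS]h.
  rewrite lerDr; apply: convol_ge0 => z /andP[z0 _]; last exact: r0.
  exact: gk_ge0.
have e : al = 1 by apply/eqP; rewrite eq_le al1.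
have g1 : gk al t = 1 by rewrite e gk1.
have h := res_eq mu al0 t0; rewrite g1 in h.
have -> : convol (gk 1) (res al mu) t = convol (gk al) (res al mu) t by rewrite e.
by rewrite -[leRHS]h lerDr r0.
Qed.

Lemma res_convol mu t : 0 < t -> mu * convol (res al mu) (gk al) t = gk al t - res al mu t.
Proof.
move=> t0; have [mr _] := adm_res mu al0 t.
rewrite convolC//; last exact: measurable_gk.
by rewrite -(res_eq mu al0 t0) addrAC subrr add0r.
Qed.

(** Variation of constants: h -> h - mu (r * h) inverts h -> h + mu (g_al * h), and is applied to
    the equation of [kern] with the lam term moved to the right. What remains contains mu only
    through r and mu r, and mu r has mass at most 1. *)
Lemma kern_eq_res de lam mu t : 0 < de -> 0 < t ->
  kern al de lam mu t = res al mu t - lam * (convol (gk de) (kern al de lam mu) t -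
     mu * convol (res al mu) (convol (gk de) (kern al de lam mu)) t).
Proof.
move=> de0 t0; set K := kern al de lam mu; set r := res al mu.
have adr : adm t r := adm_res mu al0 t.
have adK : adm t K by exact: adm_kern.
have adg a : 0 < a -> adm t (gk a) by move=> a0; exact: adm_gk.
have adgK a : 0 < a -> adm t (convol (gk a) K) by move=> a0; apply: adm_convol => //; exact: adg.
have K1 : K t + lam * convol (gk de) K t + mu * convol (gk al) K t = gk al t by exact: kern_eq.
have E : convol r (fun z => K z + lam * convol (gk de) K z + mu * convol (gk al) K z) t = convol r (gk al) t.
  by apply: eq_convol => // z /andP[z0 _]; exact: kern_eq.
have E3 : mu * convol r (convol (gk al) K) t = convol (gk al) K t - convol r K t.
  rewrite -(convol_assoc_adm (T := t))//; last exact: adg.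
  rewrite -(convolZl_adm (T := t))//; last by apply: adm_convol => //; exact: adg.
  have -> : convol (fun z => mu * convol r (gk al) z) K t = convol (fun z => gk al z + (-1) * r z) K t.
    by apply: eq_convol => // z /andP[z0 _]; rewrite res_convol// mulN1r.
  rewrite (convolDl_adm (T := t))//; [|exact: adg|exact: admZ].
  by rewrite (convolZl_adm (T := t))// mulN1r.
have E1 := res_convol mu t0.
rewrite (convolDr_adm (T := t))// in E; last 2 first.
- by apply: admD => //; apply: admZ; exact: adgK.
- by apply: admZ; exact: adgK.
rewrite (convolDr_adm (T := t))// in E; last by apply: admZ; exact: adgK.
rewrite !(convolZr_adm (T := t))// in E; [|exact: adgK..].
rewrite E3 -/r in E.
have E2 : mu * (convol r K t + lam * convol r (convol (gk de) K) t + (convol (gk al) K t - convol r K t)) = gk al t - r t.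
  by rewrite E -/r.
have -> : r t = gk al t - mu * (convol r K t + lam * convol r (convol (gk de) K) t + (convol (gk al) K t - convol r K t)).
  by rewrite E2 opprB addrC subrK.
by rewrite -K1; ring.
Qed.

Lemma expR_weight_le (k t z : R) : 0 <= k -> z < t -> expR (k * z) <= expR (k * t).
Proof. by move=> k0 zt; rewrite ler_expR ler_wpM2l// ltW. Qed.

(* [mu * res] has total mass at most 1 and convolves g_al below g_al, so it acts
   as a contraction on both weighted spaces. *)
Lemma wdom_res_convol s T k B mu f : (s == al) || (s == 1) -> 0 <= k -> 0 <= B -> 0 < mu ->
  measurable_fun setT f -> wdom T s k B f -> wdom T s k B (fun t => mu * convol (res al mu) f t).
Proof.
move=> hs k0 B0 mu0 mf hf t /andP[t0 tT].
have s0 : 0 < s by case/orP: hs => /eqP ->.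
have adr : adm T (res al mu) by exact: adm_res.
have r0 (z : R) : 0 < z -> 0 <= res al mu z by move=> z0; apply/ltW/res_gt0.
have key : mu * convol (res al mu) (gk s) t <= gk s t.
  case/orP: hs => /eqP ->.
    by rewrite res_convol// gerBl r0.
  rewrite gk1 convolC; [exact: res_int|by case: adr|exact: measurable_gk].
rewrite normrM gtr0_norm//.
have h1 : `|convol (res al mu) f t| <= convol (res al mu) (fun z => B * expR (k * t) * gk s z) t.
  apply: (norm_convol_le_adm (T := T)) => //; first by case: adr.
  - by apply: admZ; exact: adm_gk.
  - by move=> z /andP[z0 _]; rewrite ger0_norm// r0.
  - move=> z /andP[z0 zt]; have zT : 0 < z <= T by rewrite z0 (le_trans _ tT)// ltW.
    apply: le_trans (hf z zT) _; rewrite wgtE -mulrA ler_wpM2l// ler_wpM2r ?gk_ge0//.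
    exact: expR_weight_le.
rewrite (convolZr_adm (T := T))// in h1; last exact: adm_gk.
apply: (@le_trans _ _ (mu * (B * expR (k * t) * convol (res al mu) (gk s) t))).
  by rewrite ler_pM2l.
rewrite mulrCA -mulrA wgtE ler_wpM2l// ler_wpM2l// expR_ge0//.
Qed.

(** Two applications of [halving_bound] to [kern_eq_res]: to |K| with the weight of order al, and to
    the primitive g_1 * |K| with that of order 1. The inhomogeneous terms are r <= g_al and g_1 * r
    <= 1 / mu; the lam term halves the norm at a rate k depending on al, de, lam and T, but not on
    mu. *)
Lemma kern_bounds de lam T : 0 < de -> exists2 C, 0 < C & forall mu, 0 < mu ->
  (forall t, 0 < t <= T -> `|kern al de lam mu t| <= C * gk al t) /\
  (forall t, 0 < t <= T -> convol (gk 1) (fun z => `|kern al de lam mu z|) t <= C / mu).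
Proof.
move=> de0.
(* A factor 4 and not 2: the lam term of [kern_eq_res] has two pieces, each of norm at most eps. *)
pose eps : R := (4 * (`|lam| + 1))^-1.
have e0 : 0 < eps by rewrite invr_gt0 mulr_gt0// ltr_wpDl.
have le4 : `|lam| * (2 * eps) <= 2^-1.
  rewrite /eps invfM; have -> : `|lam| * (2 * (4^-1 * (`|lam| + 1)^-1)) = 2^-1 * (`|lam| / (`|lam| + 1)) by field; rewrite gt_eqF// ltr_wpDl.
  by rewrite ler_piMr// ler_pdivrMr ?mul1r ?lerDl// ltr_wpDl.
have [k1 k10 h1] := @gk_contraction R T de al eps de0 al0 e0.
have [k2 k20 h2] := @gk_contraction R T de 1 eps de0 ltr01 e0.
pose k := Num.max k1 k2.
have k0 : 0 <= k by rewrite le_max ltW.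
have c1 : contracts T de al k eps by apply: h1; rewrite le_max lexx.
have c2 : contracts T de 1 k eps by apply: h2; rewrite le_max lexx orbT.
pose C := 2 * expR (k * T).
have C0 : 0 < C by rewrite mulr_gt0 ?expR_gt0.
have expk1 (z : R) : 0 < z -> 1 <= expR (k * z).
  by move=> z0; apply: le_trans (expR_ge1Dx _); rewrite lerDl mulr_ge0// ltW.
exists C => // mu mu0; set K := kern al de lam mu; set r := res al mu.
have adK : adm T K by exact: adm_kern.
have mK : measurable_fun setT K by case: adK.
have adr : adm T r by exact: adm_res.
have r0 (z : R) : 0 < z -> 0 <= r z by move=> z0; apply/ltW/res_gt0.
have KE t : 0 < t -> K t = r t - lam * (convol (gk de) K t - mu * convol r (convol (gk de) K) t).
  exact: kern_eq_res.
have adaK : adm T (fun z => `|K z|) by exact: adm_norm.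
have mgd f : measurable_fun setT f -> measurable_fun setT (convol (gk de) f).
  by move=> mf; apply: measurable_convol => //; exact: measurable_gk.
have half_of B (x : R) : 0 <= B -> 0 <= x -> `|lam| * (2 * (eps * B) * x) <= B / 2 * x.
  move=> B0 x0; have -> : `|lam| * (2 * (eps * B) * x) = `|lam| * (2 * eps) * (B * x) by ring.
  have -> : B / 2 * x = 2^-1 * (B * x) by ring.
  by rewrite ler_wpM2r// mulr_ge0.
split=> t tT.
  have W : forall t, 0 < t <= T -> `|K t| <= 2 * 1 * wgt al k t.
    apply: halving_bound => //.
    - by move=> y _; exact: wgt_ge0.
    (* This a priori bound depends on mu, which is harmless in [halving_bound]. *)
    - have [q q0 [e _ hq]] := kern_wdom lam mu al0 de0 T.
      exists (2 * expR (q * T)) => y yT; have := hq 0%N y yT.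
      rewrite big_ord0 subr0 expr0 mulr1 => /le_trans; apply.
      have /andP[y0 yT'] := yT.
      rewrite -mulrA ler_wpM2l// !wgtE; apply: ler_pM; rewrite ?expR_ge0 ?gk_ge0//.
        by rewrite ler_expR ler_wpM2l.
      by rewrite ler_peMl ?gk_ge0// expk1.
    - move=> B B0 hB y yT; have /andP[y0 yT'] := yT.
      have i1 := wdom_convol de0 al0 k0 B0 mK c1 hB.
      have eB : 0 <= eps * B by rewrite mulr_ge0// ltW.
      have i2 := @wdom_res_convol al T k (eps * B) mu _ _ k0 eB mu0 (mgd _ mK) i1.
      have {}i2 := i2 (introT orP (or_introl (eqxx _))) y yT; have {}i1 := i1 y yT.
      rewrite KE// (le_trans (ler_normB _ _))// mulrDl lerD//.
        rewrite mul1r ger0_norm ?r0// wgtE; apply: (@le_trans _ _ (gk al y)).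
          by rewrite -(res_eq mu al0 y0) lerDl mulr_ge0 ?(ltW mu0)//; apply: convol_ge0 => z /andP[z0 _]; [exact: gk_ge0|exact: r0].
        by rewrite ler_peMl ?gk_ge0// expk1.
      rewrite normrM; apply: le_trans (half_of _ _ B0 (wgt_ge0 k y al0)).
      rewrite ler_wpM2l// (le_trans (ler_normB _ _))//.
      by rewrite [leRHS](_ : _ = eps * B * wgt al k y + eps * B * wgt al k y); [exact: lerD|ring].
  have /andP[t0 tT'] := tT.
  rewrite (le_trans (W t tT))// mulr1 wgtE mulrA ler_wpM2r ?gk_ge0// /C ler_wpM2l//.
  by rewrite ler_expR ler_wpM2l.
pose M := convol (gk 1) (fun z => `|K z|).
have adM : adm T M by apply: adm_convol => //; exact: adm_gk.
have mM : measurable_fun setT M by case: adM.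
have ad1 : adm T (gk 1 : R -> R) by exact: adm_gk.
have adgK : adm T (convol (gk de) (fun z => `|K z|)) by apply: adm_convol => //; exact: adm_gk.
have M0 z : 0 < z -> 0 <= M z by move=> z0; apply: convol_ge0 => y _; rewrite ?gk1.
have W : forall t, 0 < t <= T -> `|M t| <= 2 * mu^-1 * wgt 1 k t.
  apply: halving_bound => //.
  - by rewrite invr_ge0 ltW.
  - by move=> y _; exact: wgt_ge0.
  - have [_ [a [D [a0 D0 hD]]]] := adaK.
    have a1 : 1 <= 1 + a by rewrite lerDl ltW.
    have [E E0 hE] := @gk_le R 1 (1 + a) T ltr01 a1.
    exists (D * E) => y yT.
    have h : gk_dominated T (1 + a) (1 * D) M.
      apply: gk_dominated_convol => //; first exact: measurable_gk.
        by case: adaK.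
      by move=> z zT; rewrite gk1 normr1 mulr1.
    have /andP[y0 yT'] := yT.
    apply: le_trans (h y yT) _; rewrite mul1r -mulrA ler_wpM2l//.
    apply: le_trans (hE y yT) _; rewrite ler_wpM2l// wgtE gk1 mulr1 expk1//.
  - move=> B B0 hB y yT; have /andP[y0 yT'] := yT.
    have i1 := wdom_convol de0 ltr01 k0 B0 mM c2 hB.
    have eB : 0 <= eps * B by rewrite mulr_ge0// ltW.
    have i2 := @wdom_res_convol 1 T k (eps * B) mu _ _ k0 eB mu0 (mgd _ mM) i1.
    have {}i2 := i2 (introT orP (or_intror (eqxx _))) y yT; have {}i1 := i1 y yT.
    rewrite ger0_norm ?M0//.
    (* [G] majorizes |K| by [kern_eq_res]; its convolution with g_1 is expressed through [M] by
       moving g_1 next to |K|. *)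
    pose G z := r z + `|lam| * (convol (gk de) (fun z => `|K z|) z + mu * convol r (convol (gk de) (fun z => `|K z|)) z).
    have adrg : adm T (convol r (convol (gk de) (fun z => `|K z|))) by exact: adm_convol.
    have adG : adm T G.
      by apply: admD => //; apply: admZ; apply: admD => //; exact: admZ.
    have KG z : 0 < z < y -> 0 <= `|K z| <= G z.
      move=> /andP[z0 zy]; rewrite normr_ge0/= KE// (le_trans (ler_normB _ _))// ger0_norm ?r0// lerD2l.
      have zT : z <= T by rewrite (le_trans _ yT')// ltW.
      have n1 z' : 0 < z' <= z -> `|convol (gk de) K z'| <= convol (gk de) (fun z => `|K z|) z'.
        move=> /andP[z'0 z'z]; apply: (norm_convol_le_adm (T := T)) => //.
        - exact: measurable_gk.
        - exact: adm_gk.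
        - exact: le_trans z'z zT.
        - by move=> x /andP[x0 _]; rewrite ger0_norm// gk_ge0.
      rewrite normrM ler_wpM2l// (le_trans (ler_normB _ _))// lerD//.
        by apply: n1; rewrite z0 lexx.
      rewrite normrM gtr0_norm// ler_pM2l//.
      apply: (norm_convol_le_adm (T := T)) => //; first by case: adr.
      - exact: mgd.
      - by move=> x /andP[x0 _]; rewrite ger0_norm// r0.
      - by move=> x /andP[x0 xz]; apply: n1; rewrite x0 ltW.
    have : M y <= convol (gk 1) G y.
      apply: (convol_mono (T := T)) => // z /andP[z0 _].
      by rewrite gk1 ler01 lexx.
    rewrite /G (convolDr_adm (T := T))//; last first.
      by apply: admZ; apply: admD => //; exact: admZ.
    rewrite (convolZr_adm (T := T))//; last by apply: admD => //; exact: admZ.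
    rewrite (convolDr_adm (T := T))//; last exact: admZ.
    rewrite (convolZr_adm (T := T))//.
    have adgd : adm T (gk de) by exact: adm_gk.
    have E1 z : z <= T -> convol (gk 1) (convol (gk de) (fun z => `|K z|)) z = convol (gk de) M z.
      move=> zT; rewrite -(convol_assoc_adm (T := T))// -[RHS](convol_assoc_adm (T := T))//.
      by apply: eq_convol => // w _; exact: (convolC_adm (T := T)).
    have E2 : convol (gk 1) (convol r (convol (gk de) (fun z => `|K z|))) y = convol r (convol (gk de) M) y.
      rewrite -(convol_assoc_adm (T := T))//.
      have -> : convol (convol (gk 1) r) (convol (gk de) (fun z => `|K z|)) y = convol (convol r (gk 1)) (convol (gk de) (fun z => `|K z|)) y.
        by apply: eq_convol => // w _; exact: (convolC_adm (T := T)).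
      rewrite (convol_assoc_adm (T := T))//; apply: eq_convol => // w /andP[w0 wy].
      by apply: E1; rewrite (le_trans _ yT')// ltW.
    rewrite E1// E2 => /le_trans; apply; rewrite mulrDl lerD//.
      rewrite -[leLHS]mulr1; apply: ler_pM; rewrite ?wgtE ?gk1 ?mulr1 ?expk1//.
        by apply: convol_ge0 => z /andP[z0 _]; rewrite ?gk1// r0.
      by rewrite -div1r ler_pdivlMr// mulrC; exact: res_int.
    apply: le_trans (half_of _ _ B0 (wgt_ge0 k y ltr01)).
    rewrite ler_wpM2l//.
    rewrite [leRHS](_ : _ = eps * B * wgt 1 k y + eps * B * wgt 1 k y); last by ring.
    by apply: lerD; apply: le_trans (ler_norm _) _.
have /andP[t0 tT'] := tT.
apply: (le_trans (ler_norm _)); apply: (le_trans (W t tT)).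
rewrite wgtE gk1 mulr1 /C mulrAC ler_wpM2r ?invr_ge0 ?(ltW mu0)// ler_wpM2l// ler_expR ler_wpM2l//.
Qed.

End KernelBounds.

(** * Volterra equations *)

Section ConvolContinuity.
Context {R : realType}.
Notation leb := (@lebesgue_measure R).
Notation rint D f := (leb.-integrable D (EFin \o f)).
Implicit Types (f g h : R -> R) (t z T C D : R).

Lemma rint_scale (c : R) h : 0 < c -> rint setT h ->
  rint setT (fun x => h (c * x)) /\ \int[leb]_x h x = c * \int[leb]_x h (c * x).
Proof.
move=> c0 Ih; have mh : measurable_fun setT h by exact: rint_measurable Ih.
have mEh : measurable_fun setT (EFin \o h) by exact/measurable_EFinP.
have mhc : measurable_fun setT (fun x : R => h (c * x)).
  by apply: measurableT_comp => //; exact: measurable_funM.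
have scl (G : R -> \bar R) : measurable_fun setT G -> (forall x, 0 <= G x)%E ->
    (\int[leb]_x G x = c%:E * \int[leb]_x G (c * x)%R)%E.
  move=> mG G0; rewrite (ge0_integral_affine 0 (lt0r_neq0 c0) mG G0) gtr0_norm//.
  by congr (_ * _)%E; apply: eq_integral => x _; rewrite add0r.
have Ihc : rint setT (fun x => h (c * x)).
  move/integrableP : Ih => [_]; rewrite scl//; last exact: measurableT_comp.
  move=> h1; apply/integrableP; split; first exact/measurable_EFinP.
  move: h1; rewrite muleC -lte_pdivlMr//; move/lt_le_trans; apply; exact: leey.
split => //.
have fE (k : R -> R) : rint setT k -> \int[leb]_x k x =
   fine (\int[leb]_x ((EFin \o k)^\+)%E x) - fine (\int[leb]_x ((EFin \o k)^\-)%E x).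
  move=> Ik; rewrite /Rintegral integralE fineB//.
    by apply: integrable_pos_fin_num.
  by apply: integrable_neg_fin_num.
rewrite fE// fE// mulrBr.
have e1 : (\int[leb]_x ((EFin \o h)^\+)%E x = c%:E * \int[leb]_x ((EFin \o (fun x => h (c * x)%R))^\+)%E x)%E.
  rewrite scl//; last exact: measurable_funepos.
  by congr (_ * _)%E; apply: eq_integral => x _; rewrite !funeposE.
have e2 : (\int[leb]_x ((EFin \o h)^\-)%E x = c%:E * \int[leb]_x ((EFin \o (fun x => h (c * x)%R))^\-)%E x)%E.
  rewrite scl//; last exact: measurable_funeneg.
  by congr (_ * _)%E; apply: eq_integral => x _; rewrite !funenegE.
rewrite e1 e2 !fineM//; [exact: integrable_neg_fin_num|exact: integrable_pos_fin_num].
Qed.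

Lemma convol_scale f g t : 0 < t -> cint f g t ->
  rint `]0, 1[ (fun r => f (t * r) * g (t * (1 - r))) /\
  convol f g t = t * \int[leb]_(r in `]0, 1[) (f (t * r) * g (t * (1 - r))).
Proof.
move=> t0 /cint_full I; have [I1 E] := rint_scale t0 I.
have e r : pos f (t * r) * pos g (t - t * r) = ((fun r => f (t * r) * g (t * (1 - r))) \_ `]0, 1[) r.
  rewrite patchE mem_setE in_itv /= /pos pmulr_rgt0// (_ : t - t * r = t * (1 - r)); last by ring.
  rewrite pmulr_rgt0// subr_gt0 [point](_ : _ = 0)//.
  by case: (0 < r); case: (r < 1); rewrite /= ?mul0r ?mulr0.
split.
  by apply/rint_patch => //; apply: eq_rint I1 => // r _; exact: e.
rewrite convol_full E; congr (_ * _); rewrite [RHS]Rintegral_mkcond.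
by apply: eq_Rintegral => r _; exact: e.
Qed.

(** The substitution z = s r brings the integrals to the fixed interval ]0, 1[; for s in ]t / 2, T[
    the integrand is dominated by a multiple of g_a(r) g_b(1 - r). *)
Lemma convol_continuous T f g : adm T f -> adm T g ->
  (forall z, 0 < z < T -> {for z, continuous f}) ->
  (forall z, 0 < z < T -> {for z, continuous g}) ->
  forall t, 0 < t < T -> {for t, continuous (convol f g)}.
Proof.
move=> hf hg cf cg t /andP[t0 tT].
have [mf [a [C [a0 C0 hC]]]] := hf; have [mg [b [D [b0 D0 hD]]]] := hg.
pose G r := (C * D * ((t / 2) `^ (a - 1) + T `^ (a - 1)) * ((t / 2) `^ (b - 1) + T `^ (b - 1))) *
   (gk a r * gk b (1 - r)).
pose F s r := f (s * r) * g (s * (1 - r)).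
have IG : rint `]0, 1[ G.
  by apply: rintZ => //; exact: cint_gk.
have cI : {in (`]t / 2, T[%classic : set R), continuous (fun s => \int[leb]_(r in `]0, 1[) F s r)}.
  apply: (@continuity_under_integral R _ (measurableTypeR R) leb F `]0, 1[ _ _ _ _ _ G) => //.
  - move=> s; rewrite /= in_itv /= => /andP[s1 s2].
    have s0 : 0 < s by lra.
    by have [] := @convol_scale f g s s0 (cint_adm hf hg (ltW s2)).
  - apply: aeW => r; rewrite /= in_itv /= => /andP[r0 r1] s; rewrite inE /= in_itv /= => /andP[s1 s2].
    have s0 : 0 < s by lra.
    have sr (x : R) : 0 < x < 1 -> 0 < s * x < T.
      move=> /andP[x0 x1]; rewrite mulr_gt0//= (lt_trans _ s2)// gtr_pMr//.
    have ct (k : R -> R) (x : R) : 0 < x < 1 -> (forall z, 0 < z < T -> {for z, continuous k}) ->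
       {for s, continuous (fun y : R => k (y * x))}.
      move=> hx ck; apply: continuous_comp; first exact: mulrr_continuous.
      by apply: ck; exact: sr.
    apply: cvgM.
      by apply: (ct f) => //; rewrite r0.
    by apply: (ct g) => //; apply/andP; split; lra.
  - move=> s; rewrite /= in_itv /= => /andP[s1 s2]; apply: aeW => r; rewrite /= in_itv /= => /andP[r0 r1].
    have s0 : 0 < s by lra.
    have bd (k : R -> R) (c E x : R) : 0 < c -> 0 <= E -> gk_dominated T c E k -> 0 < x < 1 ->
       `|k (s * x)| <= E * ((t / 2) `^ (c - 1) + T `^ (c - 1)) * gk c x.
      move=> c0 E0 hk /andP[x0 x1].
      have sx : 0 < s * x by rewrite mulr_gt0.
      have sxT : s * x <= T by rewrite (le_trans _ (ltW s2))// ler_piMr// ltW.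
      have h := hk (s * x) _; apply: le_trans (h _) _; first by rewrite sx.
      rewrite -mulrA ler_wpM2l// !gkE powRM ?(ltW s0) ?(ltW x0)// mulrA.
      have G0 := Gamma_gt0 c0; move: (Gamma c) G0 => Gc G0.
      rewrite ler_wpM2r ?invr_ge0 ?(ltW G0)// ler_wpM2r ?powR_ge0//.
      case: (leP 0 (c - 1)) => c1.
        rewrite (@le_trans _ _ (T `^ (c - 1)))// ?lerDr ?powR_ge0//.
        by apply: ge0_ler_powR => //; rewrite ?nnegrE; lra.
      rewrite (@le_trans _ _ ((t / 2) `^ (c - 1)))// ?lerDl ?powR_ge0//.
      have -> : c - 1 = - (1 - c) by lra.
      rewrite !powRN lef_pV2 ?posrE ?powR_gt0//; last by lra.
      by apply: ge0_ler_powR => //; rewrite ?nnegrE; lra.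
    rewrite /F /G normrM.
    apply: (@le_trans _ _ ((C * ((t / 2) `^ (a - 1) + T `^ (a - 1)) * gk a r) * (D * ((t / 2) `^ (b - 1) + T `^ (b - 1)) * gk b (1 - r)))).
      by apply: ler_pM => //; apply: bd => //; apply/andP; split; lra.
    by rewrite le_eqVlt; apply/orP; left; apply/eqP; ring.
have ti : t \in (`]t / 2, T[%classic : set R) by rewrite inE /= in_itv /=; apply/andP; split; lra.
have c2 : {for t, continuous (fun s : R => s * \int[leb]_(r in `]0, 1[) F s r)}.
  by apply: cvgM; [exact: cvg_id|exact: cI].
have : {near nbhs t, (fun s : R => s * \int[leb]_(r in `]0, 1[) F s r) =1 convol f g}.
  near=> s; have s0 : 0 < s by near: s; exact: lt_nbhsr.
  have sT : s < T by near: s; exact: lt_nbhsl.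
  by have [_ ->] := @convol_scale f g s s0 (cint_adm hf hg (ltW sT)).
move/near_eq_cvg => h; change (convol f g x @[x --> t] --> convol f g t).
have [_ ->] := @convol_scale f g t t0 (cint_adm hf hg (ltW tT)).
by apply: cvg_trans c2; apply: h.
Unshelve. all: by end_near. Qed.

End ConvolContinuity.

Section Volterra.
Context {R : realType}.
Implicit Types (f g h : R -> R) (t z T C D : R).

(** [halving_bound] with c = 0: any finite bound on Y improves to 0. *)
Lemma volterra_unique (al de lam mu T : R) (Y : R -> R) : 0 < al -> 0 < de ->
  measurable_fun setT Y -> (exists A, forall t, 0 < t <= T -> `|Y t| <= A) ->
  (forall t, 0 < t <= T -> Y t + lam * convol (gk de) Y t + mu * convol (gk al) Y t = 0) ->
  forall t, 0 < t <= T -> Y t = 0.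
Proof.
move=> al0 de0 mY [A hA] hY.
pose eps : R := (2 * (`|lam| + `|mu| + 1))^-1.
have l0 : 0 <= `|lam| + `|mu| by rewrite addr_ge0.
have e0 : 0 < eps by rewrite invr_gt0 mulr_gt0// ltr_wpDl.
have le2 : (`|lam| + `|mu|) * eps <= 2^-1.
  rewrite /eps invfM mulrCA -{2}[2^-1]mulr1 ler_wpM2l ?invr_ge0// ler_pdivrMr ?mul1r ?lerDl// ltr_wpDl//.
have [k1 k10 h1] := @gk_contraction R T de 1 eps de0 ltr01 e0.
have [k2 k20 h2] := @gk_contraction R T al 1 eps al0 ltr01 e0.
pose k := Num.max k1 k2.
have k0 : 0 <= k by rewrite le_max ltW.
have c1 : contracts T de 1 k eps by apply: h1; rewrite le_max lexx.
have c2 : contracts T al 1 k eps by apply: h2; rewrite le_max lexx orbT.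
have H : forall t, 0 < t <= T -> `|Y t| <= 2 * 0 * wgt 1 k t.
  apply: halving_bound => //.
  - by move=> t _; exact: wgt_ge0.
  - exists `|A| => t tT; apply: le_trans (hA t tT) _; apply: le_trans (ler_norm A) _.
    rewrite ler_peMr// wgtE gk1 mulr1; apply: le_trans (expR_ge1Dx _); rewrite lerDl mulr_ge0//.
    by have /andP[t0 _] := tT; exact: ltW.
  - move=> B B0 hB t tT.
    have i1 := wdom_convol de0 ltr01 k0 B0 mY c1 hB tT.
    have i2 := wdom_convol al0 ltr01 k0 B0 mY c2 hB tT.
    have -> : Y t = - (lam * convol (gk de) Y t + mu * convol (gk al) Y t).
      by apply/eqP; rewrite -subr_eq0 opprK addrA hY.
    rewrite normrN (le_trans (ler_normD _ _))// !normrM add0r.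
    apply: (@le_trans _ _ (`|lam| * (eps * B * wgt 1 k t) + `|mu| * (eps * B * wgt 1 k t))).
      by apply: lerD; rewrite ler_wpM2l.
    have W0 : 0 <= wgt 1 k t by exact: wgt_ge0.
    move: (wgt 1 k t) W0 => w w0.
    have -> : `|lam| * (eps * B * w) + `|mu| * (eps * B * w) = (`|lam| + `|mu|) * eps * (B * w) by ring.
    have -> : B / 2 * w = 2^-1 * (B * w) by ring.
    by rewrite ler_wpM2r// mulr_ge0.
by move=> t tT; apply/eqP; rewrite -normr_le0; have := H t tT; rewrite mulr0 mul0r.
Qed.

End Volterra.

(** * Calculus on open intervals *)

Lemma near_cst_cvg_eq {R : realType} {U : Type} (F : set_system U) {FF : ProperFilter F}
    (f : U -> R) (c l : R) :
  (\forall x \near F, f x = c) -> f x @[x --> F] --> l -> l = c.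
Proof.
move=> fc fl; apply: (@cvg_unique R (@Rhausdorff R) (f @ F) _ l c fl).
exact: cvg_near_cst.
Qed.

Section OpenIntegral.
Context {R : realType}.
Notation leb := (@lebesgue_measure R).
Implicit Types (f g h F : R -> R) (a b c x y : R).

(** Integrals, continuity and derivatives are taken on open intervals, because a two-sided
    derivative at an endpoint would involve values outside the domain. *)
Definition oint a b f : R := \int[leb]_(x in `]a, b[) f x.
Definition ointb a b f := leb.-integrable `]a, b[ (EFin \o f).
Definition con a b f := forall x, a < x < b -> f y @[y --> x] --> f x.

Lemma ooP a b x : (`]a, b[%classic : set R) x <-> a < x < b.
Proof. by rewrite /= in_itv. Qed.

Lemma eq_oint a b f g : (forall x, a < x < b -> f x = g x) -> oint a b f = oint a b g.
Proof. by move=> fg; apply: eq_Rintegral => x; rewrite inE => /ooP; exact: fg. Qed.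

Lemma eq_ointb a b f g : (forall x, a < x < b -> f x = g x) -> ointb a b f -> ointb a b g.
Proof. by move=> fg; apply: eq_rint => // x /ooP; exact: fg. Qed.

Lemma ointbD a b f g : ointb a b f -> ointb a b g -> ointb a b (fun x => f x + g x).
Proof. exact: rintD. Qed.

Lemma ointbB a b f g : ointb a b f -> ointb a b g -> ointb a b (fun x => f x - g x).
Proof. exact: rintB. Qed.

Lemma ointbZ a b k f : ointb a b f -> ointb a b (fun x => k * f x).
Proof. exact: rintZ. Qed.

Lemma ointb_norm a b f : ointb a b f -> ointb a b (fun x => `|f x|).
Proof. exact: rint_norm. Qed.

Lemma ointbS a b c d f : a <= c -> d <= b -> ointb a b f -> ointb c d f.
Proof.
move=> ac db; apply: rintS => // x /ooP/andP[x1 x2]; apply/ooP.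
by rewrite (le_lt_trans ac x1) (lt_le_trans x2 db).
Qed.

Lemma ointD a b f g : ointb a b f -> ointb a b g ->
  oint a b (fun x => f x + g x) = oint a b f + oint a b g.
Proof. by move=> If Ig; rewrite /oint RintegralD. Qed.

Lemma ointB a b f g : ointb a b f -> ointb a b g ->
  oint a b (fun x => f x - g x) = oint a b f - oint a b g.
Proof. by move=> If Ig; rewrite /oint RintegralB. Qed.

Lemma ointZ a b k f : ointb a b f -> oint a b (fun x => k * f x) = k * oint a b f.
Proof. by move=> If; rewrite /oint RintegralZl. Qed.

Lemma le_oint a b f g : ointb a b f -> ointb a b g ->
  (forall x, a < x < b -> f x <= g x) -> oint a b f <= oint a b g.
Proof. by move=> If Ig fg; apply: le_Rintegral => // x /ooP; exact: fg. Qed.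

Lemma oint_ge0 a b f : (forall x, a < x < b -> 0 <= f x) -> 0 <= oint a b f.
Proof. by move=> f0; apply: Rintegral_ge0 => x /ooP; exact: f0. Qed.

Lemma norm_oint_le a b f g : ointb a b f -> ointb a b g ->
  (forall x, a < x < b -> `|f x| <= g x) -> `|oint a b f| <= oint a b g.
Proof.
move=> If Ig fg; apply: le_trans (le_normr_Rintegral _ _) _ => //.
by apply: le_oint => //; exact: ointb_norm.
Qed.

Lemma oint_cst a b c : a <= b -> oint a b (fun=> c) = c * (b - a).
Proof.
move=> ab; rewrite /oint Rintegral_cst//; congr (_ * _).
rewrite -[LHS]/(fine (leb `]a, b[%classic)) lebesgue_measure_itv /= lte_fin.
case: ltP => ba; first by rewrite -EFinD.
by rewrite (_ : a = b) ?subrr//; apply/eqP; rewrite eq_le ab ba.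
Qed.

Lemma ointb_cst a b c : ointb a b (fun=> c).
Proof. by apply: (@rint_bounded _ _ _ _ `|c|) => // x _. Qed.

Lemma norm_oint_le_cst a b f M : a <= b -> ointb a b f ->
  (forall x, a < x < b -> `|f x| <= M) -> `|oint a b f| <= M * (b - a).
Proof.
by move=> ab If fM; rewrite -oint_cst//; apply: norm_oint_le => //; exact: ointb_cst.
Qed.

Lemma con_measurable a b f : con a b f -> measurable_fun `]a, b[ f.
Proof.
move=> cf; apply: open_continuous_measurable_fun => // x; rewrite inE => /ooP.
exact: cf.
Qed.

Lemma con_ointb a b f M : con a b f -> (forall x, a < x < b -> `|f x| <= M) -> ointb a b f.
Proof. by move=> cf; apply: rint_bounded; exact: con_measurable. Qed.

Lemma conS a b c d f : a <= c -> d <= b -> con a b f -> con c d f.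
Proof.
by move=> ac db cf x /andP[x1 x2]; apply: cf; rewrite (le_lt_trans ac x1) (lt_le_trans x2 db).
Qed.

Lemma oint_split a b c f : a < c < b -> ointb a b f -> oint a b f = oint a c f + oint c b f.
Proof.
move=> /andP[ac cb] If; rewrite {1}/oint.
have := @Rintegral_itvB R f (BRight a) (BLeft b) c If.
rewrite !bnd_simp => /(_ (ltW ac) cb).
rewrite -Rintegral_itv_bndo_bndc; last by apply: ointbS If => //; exact: ltW.
by rewrite /oint => <-; rewrite addrC subrK.
Qed.

Lemma ftc_deriv a b f x : a < x < b -> ointb a b f -> f y @[y --> x] --> f x ->
  is_derive x 1 (fun y => oint a y f) (f x).
Proof.
move=> /andP[ax xb] If cf; pose u := (x + b) / 2.
have xu : x < u by rewrite /u; lra.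
have ub : u < b by rewrite /u; lra.
have Iu : leb.-integrable [set` Interval (BRight a) (BRight u)] (EFin \o f).
  apply: (rintS (D := `]a, b[)) => // y /=; rewrite !in_itv /= => /andP[-> h] /=; exact: le_lt_trans ub.
have [|h1 h2] := @continuous_FTC1 R f (BRight a) x u xu Iu _ cf.
  exact: ax.
have dF : is_derive x 1 (fun y => \int[leb]_(t in [set` Interval (BRight a) (BRight y)]) f t) (f x).
  by rewrite -h2 derive1E; exact: derivableP.
apply: near_eq_is_derive dF; near=> y; rewrite /oint Rintegral_itv_bndo_bndc//.
apply: (rintS (D := `]a, b[)) If => // z; rewrite /= !in_itv /= => /andP[-> /= h]; apply: lt_trans h _.
near: y; exact: lt_nbhsl.
Unshelve. all: by end_near. Qed.


Let closed_int a b f : ointb a b f -> leb.-integrable `[a, b] (EFin \o (f \_ `]a, b[)).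
Proof. by move=> If; apply: (rintS (D := setT)) => //; apply/rint_patch. Qed.

Let closed_oint a b f y : a < y <= b -> ointb a b f ->
  parameterized_integral leb a y (f \_ `]a, b[) = oint a y f.
Proof.
move=> /andP[ay yb] If; rewrite /parameterized_integral /oint.
rewrite -(Rintegral_itv_obnd_cbnd (r := a) (b := BRight y)); last first.
  by apply: (rintS (D := setT)) => //; apply/rint_patch.
rewrite -Rintegral_itv_bndo_bndc; last first.
  by apply: (rintS (D := setT)) => //; apply/rint_patch.
apply: eq_Rintegral => x; rewrite inE => /ooP/andP[ax xy]; rewrite patchE mem_set//.
by apply/ooP; rewrite ax (lt_le_trans xy).
Qed.

Lemma oint_cvg_left a b f : a < b -> ointb a b f -> oint a x f @[x --> a^'+] --> 0.
Proof.
move=> ab If; have h := parameterized_integral_cvg_left ab (closed_int If).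
have {h} : parameterized_integral leb a x (f \_ `]a, b[) @[x --> a^'+] --> 0.
  exact: cvg_at_right_filter.
apply: cvg_trans; apply: near_eq_cvg; near=> x.
by rewrite closed_oint//; apply/andP; split; [near: x; exact: nbhs_right_gt|near: x; exact: nbhs_right_le].
Unshelve. all: by end_near. Qed.

Lemma oint_cvg_right a b f : a < b -> ointb a b f -> oint a x f @[x --> b^'-] --> oint a b f.
Proof.
move=> ab If; have := parameterized_integral_cvg_at_left ab (closed_int If).
rewrite closed_oint//; last by rewrite ab lexx.
apply: cvg_trans; apply: near_eq_cvg; near=> x.
by rewrite closed_oint//; apply/andP; split; [near: x; exact: nbhs_left_gt|near: x; exact: nbhs_left_le].
Unshelve. all: by end_near. Qed.

Lemma is_derive_cvg F d x : is_derive x 1 F d -> F y @[y --> x] --> F x.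
Proof. by move=> [dF _]; apply/differentiable_continuous/derivable1_diffP. Qed.

Lemma is_derive_con F f a b : (forall x, a < x < b -> is_derive x 1 F (f x)) -> con a b F.
Proof. by move=> dF x /dF; exact: is_derive_cvg. Qed.

Lemma oo_MVT F f a b x y : (forall x, a < x < b -> is_derive x 1 F (f x)) ->
  a < x -> x < y -> y < b -> exists2 c, x < c < y & F y - F x = f c * (y - x).
Proof.
move=> dF ax xy yb; have [||c] := @MVT R F f x y xy.
- by move=> z; rewrite in_itv /= => /andP[xz zy]; apply: dF; rewrite (lt_trans ax)// (lt_trans zy).
- apply: continuous_in_subspaceT => z; rewrite inE /= in_itv /= => /andP[xz zy].
  by apply: is_derive_cvg (dF z _); rewrite (lt_le_trans ax)// (le_lt_trans zy).
- by rewrite in_itv /= => h1 h2; exists c.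
Qed.

Lemma oo_cst F a b x y : (forall x, a < x < b -> is_derive x 1 F 0) ->
  a < x < b -> a < y < b -> F x = F y.
Proof.
move=> dF /andP[ax xb] /andP[ay yb].
wlog xy : x y ax xb ay yb / x <= y.
  by move=> h; case: (leP x y) => [|/ltW] xy; [exact: h|apply/esym; exact: h].
move: xy; rewrite le_eqVlt => /predU1P[->//|xy].
have [c _] := oo_MVT dF ax xy yb; rewrite mul0r => /eqP.
by rewrite subr_eq0 => /eqP.
Qed.

(** F minus the indefinite integral of f is constant on ]a, b[; comparing its limits at the two ends
    requires nothing of F at a and b themselves. *)
Lemma ftc_oo a b F f la lb : a < b -> ointb a b f -> con a b f ->
  (forall x, a < x < b -> is_derive x 1 F (f x)) ->
  F x @[x --> a^'+] --> la -> F x @[x --> b^'-] --> lb -> oint a b f = lb - la.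
Proof.
move=> ab If cf dF Fa Fb.
pose G x := F x - oint a x f; pose m := (a + b) / 2.
have mab : a < m < b by apply/andP; split; rewrite /m; lra.
have GE x : a < x < b -> G x = G m.
  move=> xab; apply: (@oo_cst G a b) => // y yab.
  have d1 := dF y yab; have d2 := ftc_deriv yab If (cf y yab).
  by rewrite -(subrr (f y)); apply: is_deriveB.
have Ga : G x @[x --> a^'+] --> la by rewrite -(subr0 la); apply: cvgB => //; exact: oint_cvg_left If.
have Gb : G x @[x --> b^'-] --> lb - oint a b f by apply: cvgB => //; exact: oint_cvg_right If.
have E1 : la = G m.
  apply: near_cst_cvg_eq Ga; near=> x; apply: GE.
  by apply/andP; split; near: x; [exact: nbhs_right_gt|exact: nbhs_right_lt].
have E2 : lb - oint a b f = G m.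
  apply: near_cst_cvg_eq Gb; near=> x; apply: GE.
  by apply/andP; split; near: x; [exact: nbhs_left_gt|exact: nbhs_left_lt].
by rewrite E1 -E2 opprB addrC subrK.
Unshelve. all: by end_near. Qed.

Lemma ftc_deriv_left a b f x : a < x < b -> ointb a b f -> con a b f ->
  is_derive x 1 (fun y => oint y b f) (- f x).
Proof.
move=> xab If cf; have d := ftc_deriv xab If (cf x xab).
have d2 : is_derive x 1 (fun y => oint a b f - oint a y f) (- f x).
  by rewrite -(sub0r (f x)); apply: is_deriveB.
have /andP[ax xb] := xab.
apply: near_eq_is_derive d2; near=> y; rewrite (@oint_split a b y f)//.
  by rewrite addrAC subrr add0r.
by apply/andP; split; near: y; [exact: lt_nbhsr|exact: lt_nbhsl].
Unshelve. all: by end_near. Qed.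

Lemma oint_cvg_right0 a b f : a < b -> ointb a b f -> oint x b f @[x --> b^'-] --> 0.
Proof.
move=> ab If; rewrite -(subrr (oint a b f)).
have h : (oint a b f - oint a x f) @[x --> b^'-] --> oint a b f - oint a b f.
  by apply: cvgB; [exact: cvg_cst|exact: oint_cvg_right].
apply: cvg_trans h; apply: near_eq_cvg; near=> x.
rewrite (@oint_split a b x f)//; first by rewrite addrAC subrr add0r.
by apply/andP; split; near: x; [exact: nbhs_left_gt|exact: nbhs_left_lt].
Unshelve. all: by end_near. Qed.

Lemma oint_eq0 a b f : ointb a b f -> con a b f -> (forall x, a < x < b -> 0 <= f x) ->
  oint a b f = 0 -> forall x, a < x < b -> f x = 0.
Proof.
move=> If cf f0 f00 x xab; have /andP[ax xb] := xab.
have E y : a < y < b -> oint a y f = 0.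
  move=> yab; have /andP[ay yb] := yab.
  have h1 : 0 <= oint a y f.
    by apply: oint_ge0 => z /andP[z1 z2]; rewrite f0// z1 (lt_trans z2).
  have h2 : 0 <= oint y b f.
    by apply: oint_ge0 => z /andP[z1 z2]; rewrite f0// z2 (lt_trans ay).
  by move: f00; rewrite (oint_split yab If); lra.
have d := ftc_deriv xab If (cf x xab).
have d2 : is_derive x 1 (fun=> 0 : R) (f x).
  apply: near_eq_is_derive d; near=> y; rewrite E//.
  by apply/andP; split; near: y; [exact: lt_nbhsr|exact: lt_nbhsl].
by rewrite -(@derive_val _ _ _ _ _ _ _ d2) derive_cst.
Unshelve. all: by end_near. Qed.

Lemma oint_cauchy a b f g : ointb a b (fun x => f x ^+ 2) -> ointb a b (fun x => g x ^+ 2) ->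
  ointb a b (fun x => f x * g x) ->
  oint a b (fun x => f x * g x) ^+ 2 <= oint a b (fun x => f x ^+ 2) * oint a b (fun x => g x ^+ 2).
Proof.
move=> If Ig Ifg.
set A := oint a b (fun x => f x ^+ 2); set B := oint a b (fun x => g x ^+ 2).
set C := oint a b (fun x => f x * g x).
have H (s t : R) : 0 <= s ^+ 2 * A - 2 * s * t * C + t ^+ 2 * B.
  have -> : s ^+ 2 * A - 2 * s * t * C + t ^+ 2 * B =
      oint a b (fun x => s ^+ 2 * f x ^+ 2 - 2 * s * t * (f x * g x) + t ^+ 2 * g x ^+ 2).
    rewrite ointD ?ointB ?ointZ//; first [exact: ointbZ|apply: ointbB; exact: ointbZ].
  apply: oint_ge0 => x _.
  have -> : s ^+ 2 * f x ^+ 2 - 2 * s * t * (f x * g x) + t ^+ 2 * g x ^+ 2 = (s * f x - t * g x) ^+ 2 by ring.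
  exact: sqr_ge0.
have B0 : 0 <= B by apply: oint_ge0 => x _; exact: sqr_ge0.
have A0 : 0 <= A by apply: oint_ge0 => x _; exact: sqr_ge0.
move: B0; rewrite le_eqVlt => /predU1P[B0|B0]; last first.
  have h : 0 <= B * (A * B - C ^+ 2).
    by apply: le_trans (H B C) _; rewrite le_eqVlt; apply/orP; left; apply/eqP; ring.
  by move: h; rewrite pmulr_rge0// subr_ge0.
suff -> : C = 0 by rewrite expr0n /= -B0 mulr0.
(* When B = 0 the form at s = 1 is A - 2 t C, and this t would make it -1. *)
apply/eqP/negPn/negP => C0; have := H 1 ((A + 1) / (2 * C)).
have -> : 1 ^+ 2 * A - 2 * 1 * ((A + 1) / (2 * C)) * C + ((A + 1) / (2 * C)) ^+ 2 * B = - 1.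
  by rewrite -B0; field.
by rewrite lerNr oppr0 ler10.
Qed.

End OpenIntegral.

(** Interchange of limits under uniform convergence, along an arbitrary filter: it serves for
    Fourier-Bessel series on the closed rectangle as well as for difference quotients. *)
Lemma cvg_unif_limit {R : realType} {U : Type} (F : set_system U) {FF : Filter F}
    (S : nat -> U -> R) (s : nat -> R) (g : U -> R) (l : R) (tau : nat -> R) :
  (forall n, S n x @[x --> F] --> s n) -> (forall n, \forall x \near F, `|S n x - g x| <= tau n) ->
  (forall n, `|s n - l| <= tau n) -> tau n @[n --> \oo] --> 0 -> g x @[x --> F] --> l.
Proof.
move=> Ss Sg sl tau0; apply/cvgrPdist_le => e e0.
have e3 : 0 < e / 3 by rewrite divr_gt0.
have [N _ hN] := (cvgr0Pnorm_le _).1 tau0 _ e3.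
have {hN} tN : tau N <= e / 3 by apply: le_trans (ler_norm _) (hN N (leqnn _)).
near=> x.
have h1 : `|s N - S N x| <= e / 3 by near: x; exact: (cvgrPdist_le _ _).1 (Ss N) _ e3.
have h2 : `|S N x - g x| <= tau N by near: x; exact: Sg.
have h3 := sl N.
have -> : l - g x = - (s N - l) + (s N - S N x) + (S N x - g x) by lra.
apply: le_trans (ler_normD _ _) _; apply: le_trans (lerD (ler_normD _ _) (lexx _)) _.
by rewrite normrN; lra.
Unshelve. all: by end_near. Qed.

(** * Bessel functions and their zeros *)

Section DerivativeRules.
Context {R : realType}.
Implicit Types (f g : R -> R) (x d df dg k : R).

Lemma derD f g x df dg d : is_derive x 1 f df -> is_derive x 1 g dg -> d = df + dg ->
  is_derive x 1 (fun y => f y + g y) d.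
Proof. by move=> h1 h2 ->; exact: is_deriveD. Qed.

Lemma derB f g x df dg d : is_derive x 1 f df -> is_derive x 1 g dg -> d = df - dg ->
  is_derive x 1 (fun y => f y - g y) d.
Proof. by move=> h1 h2 ->; exact: is_deriveB. Qed.

Lemma derM f g x df dg d : is_derive x 1 f df -> is_derive x 1 g dg ->
  d = df * g x + f x * dg -> is_derive x 1 (fun y => f y * g y) d.
Proof.
move=> h1 h2 ->; have := is_deriveM h1 h2.
by rewrite /GRing.scale /= [g x * df]mulrC addrC.
Qed.

Lemma derZ k f x df d : is_derive x 1 f df -> d = k * df -> is_derive x 1 (fun y => k * f y) d.
Proof. by move=> h ->; have := is_deriveZ k h. Qed.

Lemma derC f g x df dg d : is_derive (g x) 1 f df -> is_derive x 1 g dg ->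
  d = df * dg -> is_derive x 1 (fun y => f (g y)) d.
Proof. by move=> h1 h2 ->; exact: is_derive1_comp. Qed.

Lemma der_id x : is_derive x 1 (fun y : R => y) 1.
Proof. exact: is_derive_id. Qed.

Lemma der_cst k x : is_derive x 1 (fun=> k) 0.
Proof. exact: is_derive_cst. Qed.

Lemma der_powR a x d : 0 < x -> d = a * x `^ a / x -> is_derive x 1 (fun y : R => y `^ a) d.
Proof.
move=> x0 ->; have := @is_derive_powR R a x x0.
have -> : x `^ (a - 1) = x `^ a / x by rewrite powRD ?(gt_eqF x0) ?implybT// powR_inv1// ltW.
by rewrite mulrA.
Qed.

Lemma der_inv x d : x != 0 -> d = - (x ^- 2) -> is_derive x 1 (fun y : R => y^-1) d.
Proof.
move=> x0 ->; have h := @is_deriveV R id x 1 1 x0 (der_id x).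
by move: h; rewrite /GRing.scale /= mulr1.
Qed.

End DerivativeRules.

Local Opaque Gamma.

Section BesselSeries.
Context {R : realType}.
Implicit Types (nu mu s x : R) (m n : nat).

(* J_nu x = (x / 2) ^ nu * Phi nu (x ^ 2 / 4) *)
Definition besc nu m : R := (-1) ^+ m / (m`!%:R * Gamma (m%:R + nu + 1)).
Definition Phi nu s : R := limn (pseries (besc nu) s).

(** Gamma is not monotone in general, but along the functional equation every factor m + nu + 1 is
    at least 1. This gives the comparison of the Bessel series with the exponential series. *)
Lemma Gamma_ge nu m : 0 <= nu -> Gamma (nu + 1) <= Gamma (m%:R + nu + 1).
Proof.
move=> nu0; elim: m => [|m IH]; first by rewrite add0r.
rewrite -natr1 (_ : m%:R + 1 + nu + 1 = (m%:R + nu + 1) + 1); last by ring.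
have m0 : 0 <= m%:R :> R by [].
rewrite (@GammaS R (m%:R + nu + 1)); last by lra.
apply: le_trans IH _; rewrite ler_peMl//; last by lra.
by apply/ltW/Gamma_gt0; lra.
Qed.

Lemma pseries_besc_cvg nu s : 0 <= nu -> cvgn (pseries (besc nu) s).
Proof.
move=> nu0; have G0 : 0 < Gamma (nu + 1) by apply: Gamma_gt0; lra.
apply: normed_cvg; rewrite /normed_series_of /=.
apply: (@series_le_cvg _ _ (fun m => (Gamma (nu + 1))^-1 * exp_coeff `|s| m)).
- by move=> m.
- by move=> m; rewrite mulr_ge0 ?invr_ge0 ?(ltW G0)// /exp_coeff /= mulr_ge0// exprn_ge0.
- move=> m; rewrite normrM normrX /besc normrM normrX normrN1 expr1n mul1r.
  rewrite /exp_coeff /= normfV normrM (ger0_norm (ler0n _ _)).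
  have Gm := Gamma_ge m nu0; rewrite (ger0_norm (le_trans (ltW G0) Gm)) invfM.
  have -> : m`!%:R^-1 / Gamma (m%:R + nu + 1) * `|s| ^+ m =
    (Gamma (m%:R + nu + 1))^-1 * (`|s| ^+ m / m`!%:R) by ring.
  apply: ler_wpM2r; first by rewrite mulr_ge0// exprn_ge0.
  by move: Gm G0; move: (Gamma (m%:R + nu + 1)) => G Gm G0; rewrite lef_pV2 ?posrE// (lt_le_trans G0).
- have -> : series (fun m => (Gamma (nu + 1))^-1 * exp_coeff `|s| m) =
     (Gamma (nu + 1))^-1 *: series (exp_coeff `|s|).
    by apply/funext => n; rewrite /series /= -mulr_sumr.
  by apply: is_cvgZr; exact: is_cvg_series_exp_coeff.
Qed.

(** The coefficient form of Phi_nu' = - Phi_(nu+1). *)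
Lemma besc_diffs nu : pseries_diffs (besc nu) = (fun m => - besc (nu + 1) m).
Proof.
apply/funext => m; rewrite /pseries_diffs /besc factS natrM exprS.
have m0 : (m.+1%:R : R) != 0 by rewrite pnatr_eq0.
rewrite (_ : m.+1%:R + nu + 1 = m%:R + (nu + 1) + 1); last by rewrite -natr1; ring.
have f0 : (m`!%:R : R) != 0 by rewrite pnatr_eq0 -lt0n fact_gt0.
rewrite !invfM; move: ((Gamma _)^-1) ((-1) ^+ m) => G e.
by move: (m.+1%:R) (m`!%:R) m0 f0 => a b a0 b0; field; rewrite a0 b0.
Qed.

Lemma pseriesS (c : nat -> R) s n : pseries c s n.+1 = pseries c s n + c n * s ^+ n.
Proof. by rewrite /pseries -seriesSr. Qed.

Lemma pseries1 (c : nat -> R) s : pseries c s 1 = c 0%N.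
Proof. by rewrite /pseries seriesSr /= /series /= big_geq// add0r expr0 mulr1. Qed.

Lemma pseries_at0 (c : nat -> R) : limn (pseries c 0) = c 0%N.
Proof.
apply/cvg_lim => //; apply: cvg_near_cst; exists 1%N => // -[//|n] _.
by elim: n => [|n IH]; rewrite ?pseries1// pseriesS IH expr0n /= mulr0 addr0.
Qed.

Lemma pseries_rec (c0 c1 c2 : nat -> R) k s n :
  (forall m, k * c1 m.+1 - c0 m.+1 = c2 m) -> k * c1 0%N = c0 0%N ->
  s * pseries c2 s n = k * pseries c1 s n.+1 - pseries c0 s n.+1.
Proof.
move=> h h0; elim: n => [|n IH].
  by rewrite !pseries1 h0 subrr /pseries /series /= big_geq ?mulr0.
rewrite pseriesS (pseriesS c1 s n.+1) (pseriesS c0 s n.+1) mulrDr IH -h exprS; ring.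
Qed.

Lemma pseriesN (c : nat -> R) s : pseries (fun m => - c m) s = (fun n => - pseries c s n).
Proof.
by apply/funext => n; rewrite /pseries /series /= -sumrN; apply: eq_bigr => i _; rewrite mulNr.
Qed.

Lemma is_derive_Phi nu s : 0 <= nu -> is_derive s 1 (Phi nu) (- Phi (nu + 1) s).
Proof.
move=> nu0; have nu1 : 0 <= nu + 1 by lra.
have cN (mu : R) : 0 <= mu -> forall z : R, cvgn (pseries (fun m => - besc mu m) z).
  by move=> mu0 z; rewrite pseriesN; apply: is_cvgN; exact: pseries_besc_cvg.
have -> : - Phi (nu + 1) s = limn (pseries (pseries_diffs (besc nu)) s).
  rewrite besc_diffs pseriesN /Phi; apply/esym/cvg_lim => //; apply: cvgN.
  exact: pseries_besc_cvg.
apply: (@pseries_snd_diffs _ _ (`|s| + 1)).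
- exact: pseries_besc_cvg.
- by rewrite besc_diffs; exact: cN.
- rewrite besc_diffs.
  have -> : pseries_diffs (fun m => - besc (nu + 1) m) = (fun m => besc (nu + 1 + 1) m).
    apply/funext => m; have := congr1 (fun h => - h m) (besc_diffs (nu + 1)).
    by rewrite /= opprK => <-; rewrite /pseries_diffs mulrN.
  by apply: pseries_besc_cvg; lra.
- by rewrite [ltRHS]ger0_norm ?addr_ge0// ltrDl.
Qed.

(** The three-term recurrence of Bessel functions, for the orders nu, nu + 1 and nu + 2; with it,
    two differentiations of x^nu Phi_nu yield Bessel's equation. *)
Lemma Phi_rec nu s : 0 <= nu -> s * Phi (nu + 2) s = (nu + 1) * Phi (nu + 1) s - Phi nu s.
Proof.
move=> nu0.
have E n : s * pseries (besc (nu + 2)) s n =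
   (nu + 1) * pseries (besc (nu + 1)) s n.+1 - pseries (besc nu) s n.+1.
  have key m : (nu + 1) * besc (nu + 1) m.+1 - besc nu m.+1 = besc (nu + 2) m.
    rewrite /besc -natr1 (_ : m%:R + 1 + (nu + 1) + 1 = m%:R + nu + 2 + 1); last by ring.
    rewrite (_ : m%:R + 1 + nu + 1 = m%:R + nu + 2); last by ring.
    rewrite (_ : m%:R + (nu + 2) + 1 = m%:R + nu + 2 + 1); last by ring.
    have m0 : 0 <= m%:R :> R by [].
    have g0 : 0 < m%:R + nu + 2 by lra.
    have G0 := Gamma_gt0 g0; rewrite GammaS// factS natrM exprS -natr1.
    have f0 : (m`!%:R : R) != 0 by rewrite pnatr_eq0 -lt0n fact_gt0.
    have m1 : (m%:R : R) + 1 != 0 by lra.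
    move: (Gamma _) G0 ((-1) ^+ m) f0 m1 => G G0 e; move: (m`!%:R) => F f0 m1.
    field; rewrite ?f0 ?m1 ?(lt0r_neq0 G0) ?(lt0r_neq0 g0) /=.
    lra.
  apply: pseries_rec => //.
  have g0 : 0 < nu + 1 by lra.
  have G0 := Gamma_gt0 g0; rewrite /besc !expr0 !fact0 !add0r (GammaS g0).
  by move: (Gamma _) G0 => G G0; field; rewrite !gt_eqF.
have cP mu : 0 <= mu -> pseries (besc mu) s n @[n --> \oo] --> Phi mu s.
  by move=> mu0; exact: pseries_besc_cvg.
have nu1 : 0 <= nu + 1 by lra.
have nu2 : 0 <= nu + 2 by lra.
have h1 : s * pseries (besc (nu + 2)) s n @[n --> \oo] --> s * Phi (nu + 2) s.
  by apply: cvgMr; exact: cP.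
have h2 : (nu + 1) * pseries (besc (nu + 1)) s n.+1 - pseries (besc nu) s n.+1 @[n --> \oo] -->
    (nu + 1) * Phi (nu + 1) s - Phi nu s.
  apply: cvgB.
    by apply: cvgMr; have := cP _ nu1; rewrite -(cvg_shiftS (pseries (besc (nu + 1)) s)).
  by have := cP _ nu0; rewrite -(cvg_shiftS (pseries (besc nu) s)).
apply: (@cvg_unique R (@Rhausdorff R) _ _ _ _ _ h2).
by apply: cvg_trans h1; apply: near_eq_cvg; apply: nearW => n; rewrite E.
Qed.

Lemma Phi0 nu : 0 <= nu -> Phi nu 0 = (Gamma (nu + 1))^-1.
Proof.
by move=> nu0; rewrite /Phi pseries_at0 /besc fact0 expr0 !mul1r add0r.
Qed.

Lemma continuous_Phi nu s : 0 <= nu -> Phi nu y @[y --> s] --> Phi nu s.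
Proof. by move=> nu0; apply: is_derive_cvg; exact: is_derive_Phi. Qed.

(* A multiple of J_nu (sqrt mu * x), and x times its derivative. *)
Definition jf nu mu x : R := x `^ nu * Phi nu (mu / 4 * x ^+ 2).
Definition jd nu mu x : R := nu * jf nu mu x - mu / 2 * x ^+ 2 * (x `^ nu * Phi (nu + 1) (mu / 4 * x ^+ 2)).

Lemma der_Phi_sqr nu mu x : 0 <= nu ->
  is_derive x 1 (fun y => Phi nu (mu / 4 * y ^+ 2)) (- (mu / 2 * x) * Phi (nu + 1) (mu / 4 * x ^+ 2)).
Proof.
move=> nu0; apply: (derC (g := fun y => mu / 4 * y ^+ 2) (dg := mu / 4 * (1 * x + x * 1)) (is_derive_Phi _ nu0)).
  exact: (derZ (k := mu / 4) (derM (der_id x) (der_id x) erefl) erefl).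
by move: (Phi _ _) => p; field.
Qed.

Lemma is_derive_jf nu mu x : 0 <= nu -> 0 < x -> is_derive x 1 (jf nu mu) (jd nu mu x / x).
Proof.
move=> nu0 x0; apply: (derM (der_powR x0 erefl) (der_Phi_sqr mu x nu0)).
rewrite /jd /jf; move: (Phi nu _) (Phi (nu + 1) _) => p q.
by field; rewrite gt_eqF.
Qed.

(** With [is_derive_jf], this is Bessel's equation x (x j')' = (nu^2 - mu x^2) j as a first-order
    system for the pair j, x j'. *)
Lemma is_derive_jd nu mu x : 0 <= nu -> 0 < x ->
  is_derive x 1 (jd nu mu) (nu ^+ 2 * jf nu mu x / x - mu * x * jf nu mu x).
Proof.
move=> nu0 x0; have nu1 : 0 <= nu + 1 by lra.
apply: (derB (derZ (k := nu) (is_derive_jf mu nu0 x0) erefl)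
  (derM (derZ (k := mu / 2) (derM (der_id x) (der_id x) erefl) erefl)
    (derM (der_powR x0 erefl) (der_Phi_sqr mu x nu1) erefl) erefl)).
have := Phi_rec (mu / 4 * x ^+ 2) nu0; rewrite (_ : nu + 1 + 1 = nu + 2); last by ring.
rewrite /jd /jf; move: (Phi nu _) (Phi (nu + 1) _) (Phi (nu + 2) _) (x `^ nu) => p q r z h.
have {h} -> : p = (nu + 1) * q - mu / 4 * x ^+ 2 * r by rewrite h; ring.
by field; rewrite gt_eqF.
Qed.

Lemma besselJ_jf nu c x : 0 < nu -> 0 < c -> 0 <= x ->
  besselJ nu (c * x) = (c / 2) `^ nu * jf nu (c ^+ 2) x.
Proof.
move=> nu0 c0; rewrite le_eqVlt => /predU1P[<-|x0].
  rewrite mulr0 /jf powR0 ?gt_eqF// mul0r mulr0 /besselJ.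
  apply/cvg_lim => //; apply: cvg_near_cst; apply: nearW => n.
  rewrite seriesEnat /= big1// => m _; rewrite mul0r powR0 ?mulr0//.
  by rewrite gt_eqF// ltr_wpDl.
have cx : 0 < c * x / 2 by rewrite divr_gt0// mulr_gt0.
rewrite /jf mulrA -powRM ?ltW// ?divr_gt0//; have -> : c / 2 * x = c * x / 2 by field.
rewrite /besselJ; apply/cvg_lim => //.
have h : (c * x / 2) `^ nu * pseries (besc nu) (c ^+ 2 / 4 * x ^+ 2) n @[n --> \oo] -->
   (c * x / 2) `^ nu * Phi nu (c ^+ 2 / 4 * x ^+ 2).
  by apply: cvgMr; apply: pseries_besc_cvg; exact: ltW.
apply: cvg_trans h; apply: near_eq_cvg; apply: nearW => n.
rewrite /pseries /series /= mulr_sumr; apply: eq_bigr => m _.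
rewrite powRD; last by rewrite (gt_eqF cx) implybT.
rewrite -natrM powR_mulrn ?ltW// exprM -/(besc nu m) mulrCA [X in _ = _ * X]mulrC.
by congr (_ * (_ * _ ^+ _)); field.
Qed.

End BesselSeries.

Local Opaque Gamma Phi.

(** * Simplicity, isolation and infinity of the zeros *)

Section BesselZeros.
Context {R : realType}.
Variable nu : R.
Hypothesis nu0 : 0 < nu.
Implicit Types (mu x z c : R).

Let nu0' : 0 <= nu. Proof. exact: ltW. Qed.
Let nu1 : 0 <= nu + 1. Proof. by rewrite addr_ge0. Qed.

Lemma Phi_bound (ka mu : R) : 0 <= ka -> exists2 M, 0 <= M &
  forall x, 0 <= x <= 1 -> `|Phi ka (mu / 4 * x ^+ 2)| <= M.
Proof.
move=> ka0; have [|c _ h] := @EVT_max R (fun x => `|Phi ka (mu / 4 * x ^+ 2)|) 0 1 ler01.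
  apply: continuous_subspaceT => x; apply: cvg_norm.
  exact: is_derive_cvg (der_Phi_sqr mu x ka0).
by exists `|Phi ka (mu / 4 * c ^+ 2)| => // x hx; apply: h; rewrite in_itv.
Qed.

Lemma jf_bound mu : exists2 M, 0 <= M & forall x, 0 <= x <= 1 ->
  `|jf nu mu x| <= M * x `^ nu /\ `|jd nu mu x| <= M * x `^ nu.
Proof.
have [A A0 hA] := Phi_bound mu nu0'; have [B B0 hB] := Phi_bound mu nu1.
exists (A + nu * A + `|mu| / 2 * B).
  by rewrite !addr_ge0// ?mulr_ge0// ?divr_ge0.
move=> x x01; have P0 := powR_ge0 x nu.
have f1 : `|jf nu mu x| <= A * x `^ nu.
  by rewrite /jf normrM (ger0_norm P0) mulrC ler_wpM2r// hA.
have h1 : 0 <= nu * (A * x `^ nu) by rewrite !mulr_ge0.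
have h2 : 0 <= `|mu| / 2 * B * x `^ nu by rewrite !mulr_ge0// divr_ge0.
have h3 : 0 <= A * x `^ nu by rewrite mulr_ge0.
have e : (A + nu * A + `|mu| / 2 * B) * x `^ nu = A * x `^ nu + nu * (A * x `^ nu) + `|mu| / 2 * B * x `^ nu by ring.
rewrite e; split; first by rewrite (le_trans f1)// -addrA lerDl addr_ge0.
apply: (@le_trans _ _ (nu * (A * x `^ nu) + `|mu| / 2 * B * x `^ nu)); last first.
  by rewrite -addrA lerDr.
rewrite /jd (le_trans (ler_normB _ _))//.
apply: lerD; first by rewrite normrM (gtr0_norm nu0) ler_wpM2l.
rewrite normrM (_ : `|x `^ nu * _| = x `^ nu * `|Phi (nu + 1) (mu / 4 * x ^+ 2)|); last first.
  by rewrite normrM (ger0_norm P0).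
rewrite -[leRHS]mulrA; have /andP[x0 x1] := x01.
apply: ler_pM => //; first by rewrite mulr_ge0.
  rewrite !normrM normfV [`|2|]ger0_norm// ler_piMr// ?divr_ge0//.
  by rewrite (ger0_norm x0) mulr_ile1.
by rewrite mulrC ler_wpM2r// hB.
Qed.

Lemma cvg0_powR_dom (f : R -> R) M : (forall x, 0 <= x <= 1 -> `|f x| <= M * x `^ nu) ->
  f x @[x --> 0^'+] --> 0.
Proof.
move=> h; apply/norm_cvg0P.
apply: (@squeeze_cvgr _ _ _ _ (cst 0) (fun x => M * x `^ nu)).
- near=> x; rewrite normr_ge0 /= h//; apply/andP; split; near: x.
    exact: nbhs_right_ge.
  exact: nbhs_right_le.
- exact: cvg_cst.
- by rewrite -[X in _ --> X](mulr0 M); apply: cvgMr; exact: powR_cvg0.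
Unshelve. all: by end_near. Qed.

Lemma jf_cvg0 mu : jf nu mu x @[x --> 0^'+] --> 0.
Proof. by have [M _ h] := jf_bound mu; apply: cvg0_powR_dom => x /h[]; eauto. Qed.

Lemma jd_cvg0 mu : jd nu mu x @[x --> 0^'+] --> 0.
Proof. by have [M _ h] := jf_bound mu; apply: cvg0_powR_dom => x /h[]; eauto. Qed.

Lemma con_jf mu b : con 0 b (jf nu mu).
Proof. by move=> x /andP[x0 _]; apply: is_derive_cvg (is_derive_jf mu nu0' x0). Qed.

Lemma bounded_jf mu : exists M, forall x, 0 < x < 1 -> `|jf nu mu x| <= M.
Proof.
have [M M0 h] := jf_bound mu; exists M => x /andP[x0 x1].
have [|h1 _] := h x; first by rewrite !ltW.
apply: le_trans h1 _; have p1 : (1 : R) `^ nu = 1 by rewrite powR1.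
rewrite ler_piMr// -p1.
by apply: ge0_ler_powR; rewrite ?nnegrE ?ltW.
Qed.

Lemma ointb_sqr_jf mu : ointb 0 1 (fun x => x * jf nu mu x ^+ 2).
Proof.
have [M h] := bounded_jf mu; apply: (@con_ointb _ _ _ _ (M ^+ 2)).
  by move=> x hx; apply: cvgM; [exact: cvg_id|rewrite expr2; apply: cvgM; exact: con_jf hx].
move=> x hx; have /andP[x0 x1] := hx; rewrite normrM (gtr0_norm x0) normrX.
have M0 : 0 <= M by apply: le_trans (h x hx).
rewrite -[leRHS]mul1r; apply: ler_pM; rewrite ?(ltW x0) ?(ltW x1) ?exprn_ge0//.
by rewrite lerXn2r ?nnegrE// h.
Qed.

(** Lommel's integral: (x j')^2 + (mu x^2 - nu^2) j^2 has derivative 2 mu x j^2, tends to 0 at 0,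
    and equals (x j')^2 at 1 when j(1) = 0. *)
Lemma jf_norm mu : jf nu mu 1 = 0 ->
  2 * mu * oint 0 1 (fun x => x * jf nu mu x ^+ 2) = jd nu mu 1 ^+ 2.
Proof.
move=> j1; rewrite -ointZ; last exact: ointb_sqr_jf.
pose F x := jd nu mu x * jd nu mu x + (mu * (x * x) - nu * nu) * (jf nu mu x * jf nu mu x).
have dF x : 0 < x -> is_derive x 1 F (2 * mu * (x * jf nu mu x ^+ 2)).
  move=> x0; have dj := is_derive_jf mu nu0' x0; have dd := is_derive_jd mu nu0' x0.
  apply: (derD (derM dd dd erefl) (derM (derB (derZ (k := mu) (derM (der_id x) (der_id x) erefl) erefl) (der_cst (nu * nu) x) erefl) (derM dj dj erefl) erefl)).
  by move: (jf nu mu x) (jd nu mu x) => p d; field; rewrite gt_eqF.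
have -> : jd nu mu 1 ^+ 2 = F 1 - 0 by rewrite /F j1; ring.
apply: (@ftc_oo R 0 1 F); first exact: ltr01.
- by apply: ointbZ; exact: ointb_sqr_jf.
- move=> x hx; apply: cvgMr; apply: cvgM; [exact: cvg_id|rewrite expr2; apply: cvgM; exact: con_jf hx].
- by move=> x /andP[x0 _]; exact: dF.
- rewrite [X in _ --> X](_ : 0 = 0 * 0 + (mu * (0 * 0) - nu * nu) * (0 * 0)); last by ring.
  have j0 := jf_cvg0 mu; have d0 := jd_cvg0 mu.
  have x0 : (x : R) @[x --> 0^'+] --> 0 by apply: cvg_at_right_filter; exact: cvg_id.
  apply: cvgD; first exact: cvgM.
  by apply: cvgM; [apply: cvgB; [apply: cvgMr; exact: cvgM|exact: cvg_cst]|exact: cvgM].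
- by apply: cvg_at_left_filter; apply: is_derive_cvg (dF 1 ltr01).
Qed.

Lemma Phi_pos_near0 : exists2 d, 0 < d & forall s, 0 <= s < d -> 0 < Phi nu s.
Proof.
have P0 : 0 < Phi nu 0 by rewrite Phi0// invr_gt0 Gamma_gt0// ltr_wpDl.
have c0 := @continuous_Phi R nu 0 nu0'.
have [d /= d0 h] : \forall s \near 0, 0 < Phi nu s by exact: cvgr_gt c0 _ P0.
exists d => // s /andP[s0 sd]; apply: h => /=.
by rewrite sub0r normrN ger0_norm.
Qed.

Lemma Phi_lt_near0 mu : 0 < mu -> exists2 d, 0 < d & forall x, 0 < x < d -> 0 < Phi nu (mu / 4 * x ^+ 2).
Proof.
move=> mu0; have [d d0 h] := Phi_pos_near0.
exists (Num.min 1 (d / mu)); first by rewrite lt_min ltr01 divr_gt0.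
move=> x /andP[x0]; rewrite lt_min => /andP[x1 xd]; apply: h.
rewrite ltr_pdivlMr// in xd.
have x2 : x ^+ 2 <= x by rewrite expr2 ler_piMl// ltW.
have x20 : 0 <= x ^+ 2 by exact: sqr_ge0.
by apply/andP; split; nra.
Qed.

Lemma jf_sqr_gt0 mu : 0 < mu -> 0 < oint 0 1 (fun x => x * jf nu mu x ^+ 2).
Proof.
move=> mu0; rewrite lt_neqAle; apply/andP; split; last first.
  by apply: oint_ge0 => x /andP[x0 _]; rewrite mulr_ge0 ?sqr_ge0// ltW.
apply/eqP => /esym E; have [d d0 h] := Phi_lt_near0 mu0.
pose x := Num.min 2^-1 (d / 2).
have x0 : 0 < x by rewrite lt_min invr_gt0 ltr0n divr_gt0.
have x12 : x <= 2^-1 by rewrite ge_min lexx.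
have xd2 : x <= d / 2 by rewrite ge_min lexx orbT.
have x01 : 0 < x < 1 by rewrite x0; lra.
have xd : 0 < x < d by rewrite x0; lra.
have : x * jf nu mu x ^+ 2 = 0.
  apply: (oint_eq0 (ointb_sqr_jf mu) _ _ E x01).
    by move=> y hy; apply: cvgM; [exact: cvg_id|rewrite expr2; apply: cvgM; exact: con_jf hy].
  by move=> y /andP[y0 _]; rewrite mulr_ge0 ?sqr_ge0// ltW.
apply/eqP; rewrite mulf_eq0 (gt_eqF x0)/= expf_eq0 /= /jf mulf_eq0.
by rewrite gt_eqF ?powR_gt0//= gt_eqF// h.
Qed.

Lemma besselJ_eq0 x : 0 < x -> (besselJ nu x == 0) = (Phi nu (4^-1 * x ^+ 2) == 0).
Proof.
move=> x0; have := @besselJ_jf R nu 1 x nu0 ltr01 (ltW x0).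
rewrite mul1r expr1n /jf div1r => ->; rewrite !mulf_eq0.
by rewrite !(gt_eqF (powR_gt0 _ _)) ?invr_gt0// div1r.
Qed.

Lemma jf_at1 z : jf nu (z ^+ 2) 1 = Phi nu (4^-1 * z ^+ 2).
Proof. by rewrite /jf powR1 mul1r expr1n mulr1 [z ^+ 2 / 4]mulrC. Qed.

Lemma jd_at1 z : jd nu (z ^+ 2) 1 = nu * Phi nu (4^-1 * z ^+ 2) - z ^+ 2 / 2 * Phi (nu + 1) (4^-1 * z ^+ 2).
Proof. by rewrite /jd jf_at1 powR1 expr1n mul1r !mulr1 [z ^+ 2 / 4]mulrC. Qed.

(** Positive zeros are simple: if Phi_(nu+1) vanished too, x j' would vanish at 1 and [jf_norm]
    would make the norm of j zero. *)
Lemma Phi1_neq0 z : 0 < z -> Phi nu (4^-1 * z ^+ 2) = 0 -> Phi (nu + 1) (4^-1 * z ^+ 2) != 0.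
Proof.
move=> z0 P0; have z20 : 0 < z ^+ 2 by rewrite exprn_gt0.
have := jf_sqr_gt0 z20; have := @jf_norm (z ^+ 2); rewrite jf_at1 jd_at1 => /(_ P0) E I0.
apply/eqP => P1; move: E; rewrite P0 P1 !mulr0 subrr expr0n /= => /eqP.
by rewrite mulf_eq0 (gt_eqF I0) mulf_eq0 (gt_eqF z20) pnatr_eq0.
Qed.

(** Between two zeros the derivative of Phi_nu (x^2 / 4), which is - x / 2 times Phi_(nu+1) (x^2 /
    4), would vanish; [Phi1_neq0] and continuity exclude this near c > 0. Near c = 0, Phi_nu is
    positive. *)
Lemma besselJ_zero_isolated c : 0 <= c -> (c = 0 \/ besselJ nu c = 0) ->
  exists2 d, 0 < d & forall x, c < x < c + d -> besselJ nu x != 0.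
Proof.
rewrite le_eqVlt => /predU1P[<-|c0].
  move=> _; have [d d0 h] := @Phi_lt_near0 1 ltr01.
  exists d => // x; rewrite add0r => xd; have /andP[x0 _] := xd.
  by rewrite besselJ_eq0// gt_eqF//; have := h x xd; rewrite div1r.
move=> [c00|/eqP]; first by rewrite c00 ltxx in c0.
rewrite besselJ_eq0// => /eqP Pc.
have P1 := Phi1_neq0 c0 Pc.
have cP : Phi (nu + 1) (4^-1 * x ^+ 2) @[x --> c] --> Phi (nu + 1) (4^-1 * c ^+ 2).
  by have := is_derive_cvg (der_Phi_sqr 1 c nu1); rewrite div1r.
have [d /= d0 h] : \forall x \near c, Phi (nu + 1) (4^-1 * x ^+ 2) != 0.
  exact: (cvgr_neq0 _ cP).
exists d => // x /andP[cx xd].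
rewrite besselJ_eq0; last exact: lt_trans cx.
apply/eqP => Px.
have dP y : 0 < y < x + 1 -> is_derive y 1 (fun y => Phi nu (4^-1 * y ^+ 2)) (- (2^-1 * y) * Phi (nu + 1) (4^-1 * y ^+ 2)).
  by move=> _; have := der_Phi_sqr 1 y nu0'; rewrite !div1r.
have x1 : x < x + 1 by rewrite ltrDl.
have [y /andP[cy yx]] := oo_MVT dP c0 cx x1.
rewrite Pc Px subrr => /esym/eqP; rewrite !mulf_eq0 oppr_eq0 !mulf_eq0 subr_eq0 (gt_eqF cx) orbF.
rewrite invr_eq0 pnatr_eq0 /= (gt_eqF (lt_trans c0 cy)) /=.
apply/negP; apply: h => /=; rewrite ltr0_norm ?subr_lt0// opprB ltrBlDl (lt_trans yx)//.
Qed.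


(** The function x^(-1/2) sin ((x - a) / 2) solves Bessel's equation of order 1/2 with mu = 1/4, so
    it oscillates more slowly than J_nu for large x. The second formula differentiates x times its
    derivative. *)
Lemma sturm_test (x a : R) : 0 < x -> let th := (x - a) / 2 in let q := x `^ (- 2^-1) in
  is_derive x 1 (fun y => y `^ (- 2^-1) * sin ((y - a) / 2)) (q * (- 2^-1 * sin th + 2^-1 * x * cos th) / x) /\
  is_derive x 1 (fun y => y `^ (- 2^-1) * (- 2^-1 * sin ((y - a) / 2) + 2^-1 * y * cos ((y - a) / 2)))
    (q * sin th * (4^-1 / x - x / 4)).
Proof.
move=> x0 th q; have dth : is_derive x 1 (fun y : R => (y - a) / 2) (2^-1).
  apply: (derM (derB (der_id x) (der_cst a x) erefl) (der_cst 2^-1 x)).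
  by rewrite subr0 mul1r mulr0 addr0.
have dq : is_derive x 1 (fun y : R => y `^ (- 2^-1)) (- 2^-1 * q / x) by exact: der_powR.
have ds : is_derive x 1 (fun y : R => sin ((y - a) / 2)) (cos th * 2^-1).
  exact: (derC (f := sin) (g := fun y : R => (y - a) / 2) (is_derive_sin _) dth erefl).
have dc : is_derive x 1 (fun y : R => cos ((y - a) / 2)) (- sin th * 2^-1).
  exact: (derC (f := cos) (g := fun y : R => (y - a) / 2) (is_derive_cos _) dth erefl).
split.
  apply: (derM dq ds); rewrite -/th.
  by rewrite -/q; clear dq ds dc; move: q (sin th) (cos th) => p s c; field; rewrite gt_eqF.
apply: (derM dq (derD (derZ (k := - 2^-1) ds erefl) (derM (derZ (k := 2^-1) (der_id x) erefl) dc erefl) erefl)).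
rewrite -/th -/q; clear dq ds dc.
by move: q (sin th) (cos th) => p s c; field; rewrite gt_eqF.
Qed.

(** On one arch [a, a + 2 pi] of the test function psi, x times the Wronskian of sg j and psi has
    derivative sg j psi ((nu^2 - 1/4) / x - 3 x / 4), which is <= 0 under the condition on a. Yet it
    is negative at a and positive at the other end, since psi vanishes at both ends with opposite
    slopes. *)
Lemma no_positive_arch (a sg : R) : 0 < a -> 4 * nu ^+ 2 <= 3 * a ^+ 2 ->
  (forall x, a <= x -> 0 < sg * jf nu 1 x) -> False.
Proof.
move=> a0 hnu hp; pose b := a + 2 * pi.
have pi0 := @pi_gt0 R; have ab : a < b by rewrite /b; lra.
pose psi (x : R) := x `^ (- 2^-1) * sin ((x - a) / 2).
pose E (x : R) := x `^ (- 2^-1) * (- 2^-1 * sin ((x - a) / 2) + 2^-1 * x * cos ((x - a) / 2)).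
pose W x := sg * jd nu 1 x * psi x - sg * jf nu 1 x * E x.
pose dW x := sg * jf nu 1 x * psi x * ((nu ^+ 2 - 4^-1) / x - 3 / 4 * x).
have dWE x : 0 < x -> is_derive x 1 W (dW x).
  move=> x0; have [h1 h2] := sturm_test a x0.
  have dj := is_derive_jf 1 nu0' x0; have dd := is_derive_jd 1 nu0' x0.
  apply: (derB (derM (derZ (k := sg) dd erefl) h1 erefl) (derM (derZ (k := sg) dj erefl) h2 erefl)).
  rewrite /dW /psi.
  move: (jf nu 1 x) (jd nu 1 x) (sin _) (cos _) (powR _ _) => p d s c r.
  by field; rewrite gt_eqF.
have dW0 x : a < x < b -> dW x <= 0.
  move=> /andP[ax xb]; have x0 : 0 < x by exact: lt_trans ax.
  rewrite /dW mulr_ge0_le0//.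
    rewrite mulr_ge0 ?(ltW (hp _ (ltW ax)))// mulr_ge0 ?powR_ge0// sin_ge0_pi//.
    by apply/andP; split; rewrite /b in xb; lra.
  rewrite subr_le0 ler_pdivrMr// -mulrA.
  have xx : a * a <= x * x by apply: ler_pM => //; exact: ltW.
  move: hnu; rewrite !expr2; lra.
have b1 : b < b + 1 by rewrite ltrDl.
have dW1 x : 0 < x < b + 1 -> is_derive x 1 W (dW x) by move=> /andP[x0 _]; exact: dWE.
have [c cab cE] := oo_MVT dW1 a0 ab b1.
have Wa : W a < 0.
  rewrite /W /psi /E subrr mul0r sin0 cos0 !mulr0 !add0r oppr_lt0 mulr1.
  by rewrite mulr_gt0 ?hp// !mulr_gt0 ?powR_gt0 ?invr_gt0.
have Wb : 0 < W b.
  rewrite /W /psi /E (_ : (b - a) / 2 = pi); last by rewrite /b; field.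
  rewrite sinpi cospi !mulr0 !add0r mulrN1 !mulrN opprK.
  by rewrite mulr_gt0 ?hp ?(ltW ab)// !mulr_gt0 ?powR_gt0 ?invr_gt0// (lt_trans a0 ab).
have : W b - W a <= 0 by rewrite cE mulr_le0_ge0 ?dW0// subr_ge0 ltW.
by rewrite leNgt subr_gt0 (lt_trans Wa Wb).
Qed.

Lemma besselJ_zero_above c : exists z, [/\ c < z, 0 < z & besselJ nu z = 0].
Proof.
(* This a exceeds c, and 2 nu <= a implies 4 nu^2 <= 3 a^2. *)
apply: contrapT => Hno; pose a : R := `|c| + 1 + 2 * nu.
have ca : c < a by rewrite /a; have := ler_norm c; have := nu0; lra.
have a0 : 0 < a by rewrite /a; have := normr_ge0 c; have := nu0; lra.
have anu : 2 * nu <= a by rewrite /a; have := normr_ge0 c; have := nu0; lra.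
have nz x : a <= x -> jf nu 1 x != 0.
  move=> ax; have x0 : 0 < x by exact: lt_le_trans ax.
  apply/eqP => j0; apply: Hno; exists x; split => //; first exact: lt_le_trans ax.
  have := @besselJ_jf R nu 1 x nu0 ltr01 (ltW x0).
  by rewrite mul1r expr1n j0 mulr0.
have cj x : a <= x -> {within `[a, x], continuous (jf nu 1)}.
  move=> ax; apply: continuous_in_subspaceT => y; rewrite inE /= in_itv /= => /andP[ay _].
  by apply: is_derive_cvg (is_derive_jf 1 nu0' (lt_le_trans a0 ay)).
have h4 : 4 * nu ^+ 2 <= 3 * a ^+ 2.
  have : (2 * nu) * (2 * nu) <= a * a by apply: ler_pM => //; rewrite mulr_ge0.
  have : 0 <= a * a by rewrite mulr_ge0// ltW.
  rewrite !expr2; clear Hno nz cj; clearbody a; lra.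
have := nz a (lexx a); rewrite neq_lt => /orP[ja|ja].
- apply: (@no_positive_arch a (-1)) => // x ax; rewrite mulN1r oppr_gt0.
  rewrite ltNge le_eqVlt eq_sym (negbTE (nz x ax)) /=; apply/negP => jx.
  have [|z] := @IVT R (jf nu 1) a x 0 ax (cj x ax).
    by rewrite ge_min (ltW ja) /= le_max (ltW jx) orbT.
  by rewrite in_itv /= => /andP[az _] jz; have := nz z az; rewrite jz eqxx.
- apply: (@no_positive_arch a 1) => // x ax; rewrite mul1r.
  rewrite ltNge le_eqVlt (negbTE (nz x ax)) /=; apply/negP => jx.
  have [|z] := @IVT R (jf nu 1) a x 0 ax (cj x ax).
    by rewrite ge_min (ltW jx) orbT /= le_max (ltW ja).
  by rewrite in_itv /= => /andP[az _] jz; have := nz z az; rewrite jz eqxx.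
Qed.

(** The set of zeros above c is nonempty by [besselJ_zero_above]; its infimum exceeds c because c is
    isolated, and it is a zero by continuity. The recursion of [besselJ_zero] therefore runs through
    consecutive zeros. *)
Lemma besselJ_next_zero c : 0 <= c -> (c = 0 \/ besselJ nu c = 0) ->
  let i := inf [set x : R | c < x /\ besselJ nu x = 0] in
  [/\ c < i, besselJ nu i = 0 & forall z, c < z -> besselJ nu z = 0 -> i <= z].
Proof.
move=> c0 hc; set S := [set x : R | _]; set i := inf S => j.
have [d d0 hd] := besselJ_zero_isolated c0 hc.
have Sd x : S x -> c + d <= x.
  move=> [cx Jx]; rewrite leNgt; apply/negP => xd.
  by have := hd x; rewrite cx xd Jx eqxx => /(_ isT).
have S0 : nonempty S by have [z [cz _ Jz]] := besselJ_zero_above c; exists z.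
have lS : has_lbound S by exists (c + d) => x; exact: Sd.
have ci : c < i.
  by apply: (@lt_le_trans _ _ (c + d)); [rewrite ltrDl|exact: lb_le_inf].
have i0 : 0 < i by exact: le_lt_trans ci.
split => //; last by move=> z cz Jz; apply: ge_inf.
apply/eqP; rewrite besselJ_eq0//; apply/negPn/negP => Pi.
have cP : Phi nu (4^-1 * x ^+ 2) @[x --> i] --> Phi nu (4^-1 * i ^+ 2).
  by have := is_derive_cvg (der_Phi_sqr 1 i nu0'); rewrite div1r.
have [e /= e0 he] : \forall x \near i, Phi nu (4^-1 * x ^+ 2) != 0.
  exact: (cvgr_neq0 _ cP).
have [x [cx Jx] xe] := inf_adherent e0 (conj S0 lS).
have ix : i <= x by apply: ge_inf.
have x0 : 0 < x by exact: lt_le_trans ix.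
move/eqP : Jx; rewrite besselJ_eq0//; apply/negP; apply: he => /=.
by rewrite distrC ger0_norm ?subr_ge0// ltrBlDl.
Qed.

Let gam := besselJ_zero nu.

Lemma besselJ_zero_spec n : [/\ 0 <= gam n, gam n < gam n.+1, besselJ nu (gam n.+1) = 0
  & forall z, gam n < z -> besselJ nu z = 0 -> gam n.+1 <= z].
Proof.
elim: n => [|n [g0 g1 g2 g3]].
  by have [] := @besselJ_next_zero 0 (lexx 0) (or_introl erefl); split.
have g10 : 0 <= gam n.+1 by exact: ltW (le_lt_trans g0 g1).
by have [] := @besselJ_next_zero (gam n.+1) g10 (or_intror g2); split.
Qed.

Lemma besselJ_zero_gt0 n : 0 < gam n.+1.
Proof. by have [h1 h2 _ _] := besselJ_zero_spec n; exact: le_lt_trans h2. Qed.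

Lemma besselJ_zero_ltn m n : (m < n)%N -> gam m < gam n.
Proof.
elim: n => // n IH; rewrite ltnS leq_eqVlt => /predU1P[->|/IH h]; have [_ h2 _ _] := besselJ_zero_spec n => //.
exact: lt_trans h2.
Qed.

Lemma besselJ_zero_inj m n : gam m = gam n -> m = n.
Proof.
by move=> h; case: (ltngtP m n) => // /besselJ_zero_ltn; rewrite h ltxx.
Qed.

Lemma besselJ_zero_exhaust z N : 0 < z -> besselJ nu z = 0 -> z < gam N -> exists n, z = gam n.+1.
Proof.
move=> z0 Jz; elim: N => [|N IH] zN; first by rewrite /gam /= ltNge ltW in zN.
have [_ _ _ h] := besselJ_zero_spec N.
case: (ltgtP z (gam N)) => [/IH//|zN'|zE].
  by have := h z zN' Jz; rewrite leNgt zN.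
case: N zE {IH zN h} => [zE|N zE]; last by exists N.
by rewrite zE /gam /= ltxx in z0.
Qed.

End BesselZeros.

(** * The Green operator *)

Section Green.
Context {R : realType}.
Variable nu : R.
Hypothesis nu0 : 0 < nu.
Implicit Types (f g h k p D : R -> R) (x y z s q M c : R).

Definition bcont h := con 0 1 h /\ exists M, forall x, 0 < x < 1 -> `|h x| <= M.
Definition ip h k : R := oint 0 1 (fun x => x * (h x * k x)).
(* green h is the solution p of - (p'' + p' / x - nu ^ 2 p / x ^ 2) = h with p 1 = 0 which is bounded
   at 0, obtained by two integrations of - (x ^ (2 nu + 1) (x ^ (- nu) p)')' = x ^ (nu + 1) h, and
   gD h = x p'. *)
Definition wA h y : R := oint 0 y (fun z => z `^ (nu + 1) * h z).
Definition gB h x : R := oint x 1 (fun y => y `^ (- (2 * nu + 1)) * wA h y).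
Definition green h x : R := x `^ nu * gB h x.
Definition gD h x : R := nu * green h x - x `^ (- nu) * wA h x.

Lemma pow_add x a b : 0 < x -> x `^ (a + b) = x `^ a * x `^ b.
Proof. by move=> x0; rewrite powRD// (gt_eqF x0) implybT. Qed.

Lemma pow_le_min x y a : 0 < x -> x <= y -> y <= 1 -> y `^ a <= x `^ (Num.min a 0).
Proof.
move=> x0 xy y1; have y0 : 0 < y by exact: lt_le_trans xy.
have [a0|a0] := leP 0 a.
  by rewrite powRr0 -(powRr0 y); apply: ger_powR => //; rewrite y0.
have pE z : z `^ a = (z `^ (- a))^-1 by rewrite -powRN opprK.
rewrite !pE lef_pV2 ?posrE ?powR_gt0//.
by apply: ge0_ler_powR => //; rewrite ?nnegrE ?oppr_ge0 ltW.
Qed.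

Lemma pow_le1 x a : 0 <= a -> 0 <= x <= 1 -> x `^ a <= 1.
Proof.
move=> a0 /andP[x0 x1]; have p1 : (1 : R) `^ a = 1 by rewrite powR1.
by rewrite -p1; apply: ge0_ler_powR; rewrite ?nnegrE.
Qed.

Lemma cvg_mul_id h x : h y @[y --> x] --> h x -> (y * h y) @[y --> x] --> x * h x.
Proof. by move=> ch; apply: cvgM; [exact: cvg_id|]. Qed.

Lemma bcont_bound h : bcont h -> exists2 M, 0 <= M & forall x, 0 < x < 1 -> `|h x| <= M.
Proof.
move=> [_ [M hM]]; exists M => //; apply: le_trans (hM 2^-1 _) => //.
by apply/andP; split; lra.
Qed.

Lemma bcontD h k : bcont h -> bcont k -> bcont (fun x => h x + k x).
Proof.
move=> [ch [M hM]] [ck [N hN]]; split; first by move=> x hx; apply: cvgD; [exact: ch|exact: ck].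
exists (M + N) => x hx; rewrite (le_trans (ler_normD _ _))// lerD//; [exact: hM|exact: hN].
Qed.

Lemma bcontM h k : bcont h -> bcont k -> bcont (fun x => h x * k x).
Proof.
move=> [ch [M hM]] [ck [N hN]]; split; first by move=> x hx; apply: cvgM; [exact: ch|exact: ck].
by exists (M * N) => x hx; rewrite normrM ler_pM//; [exact: hM|exact: hN].
Qed.

Lemma bcont_cst c : bcont (fun=> c).
Proof. by split; [move=> x _; exact: cvg_cst|exists `|c|]. Qed.

Lemma bcontZ c h : bcont h -> bcont (fun x => c * h x).
Proof. by move=> bh; apply: (bcontM (bcont_cst c)). Qed.

Lemma bcontB h k : bcont h -> bcont k -> bcont (fun x => h x - k x).
Proof.
move=> bh /(bcontZ (-1)) bk; have := bcontD bh bk.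
by under [X in bcont X -> _]eq_fun do rewrite mulN1r.
Qed.

Lemma bcont_id : bcont (fun x => x).
Proof.
by split; [move=> x _; exact: cvg_id|exists 1 => x /andP[x0 x1]; rewrite gtr0_norm// ltW].
Qed.

Lemma bcont_ointb h a b : 0 <= a -> b <= 1 -> bcont h -> ointb a b h.
Proof.
by move=> a0 b1 [ch [M hM]]; apply: (ointbS a0 b1); exact: con_ointb hM.
Qed.

Lemma bcont_ip h k : bcont h -> bcont k -> ointb 0 1 (fun x => x * (h x * k x)).
Proof. by move=> bh bk; apply: bcont_ointb => //; apply: bcontM bcont_id (bcontM bh bk). Qed.

Lemma ipC h k : ip h k = ip k h.
Proof. by apply: eq_oint => x _; rewrite (mulrC (h x)). Qed.

Lemma ipDl h k g : bcont h -> bcont k -> bcont g -> ip (fun x => h x + k x) g = ip h g + ip k g.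
Proof.
move=> bh bk bg; rewrite /ip -ointD; [|exact: bcont_ip..].
by apply: eq_oint => x _; rewrite mulrDl mulrDr.
Qed.

Lemma ipZl c h g : bcont h -> bcont g -> ip (fun x => c * h x) g = c * ip h g.
Proof.
move=> bh bg; rewrite /ip -ointZ; last exact: bcont_ip.
by apply: eq_oint => x _; ring.
Qed.

Lemma ipBl h k g : bcont h -> bcont k -> bcont g -> ip (fun x => h x - k x) g = ip h g - ip k g.
Proof.
move=> bh bk bg; rewrite /ip -ointB; [|exact: bcont_ip..].
by apply: eq_oint => x _; ring.
Qed.

Lemma ip_ge0 h : 0 <= ip h h.
Proof. by apply: oint_ge0 => x /andP[x0 _]; rewrite mulr_ge0 ?(ltW x0)// -expr2 sqr_ge0. Qed.

Lemma ip_eq0 h : bcont h -> ip h h = 0 -> forall x, 0 < x < 1 -> h x = 0.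
Proof.
move=> bh h0 x hx; have /andP[x0 _] := hx.
have [c _] := bcontM bcont_id (bcontM bh bh).
have := oint_eq0 (bcont_ip bh bh) c _ h0 hx => /(_ _)/eqP; rewrite !mulf_eq0 (gt_eqF x0) orbb /=.
move=> H; apply/eqP/H => y /andP[y0 _]; by rewrite mulr_ge0 ?(ltW y0)// -expr2 sqr_ge0.
Qed.

Lemma ip_cauchy h k : bcont h -> bcont k -> ip h k ^+ 2 <= ip h h * ip k k.
Proof.
move=> bh bk.
have sq x : 0 < x < 1 -> x `^ 2^-1 * x `^ 2^-1 = x.
  by move=> /andP[x0 _]; rewrite -pow_add// (_ : 2^-1 + 2^-1 = 1 :> R) ?powRr1 ?ltW//; lra.
have b2 : bcont (fun x => x `^ 2^-1).
  split; first by move=> x /andP[x0 _]; exact: continuous_powR.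
  by exists 1 => x /andP[x0 x1]; rewrite ger0_norm ?powR_ge0// pow_le1// !ltW.
have E f g : ip f g = oint 0 1 (fun x => (x `^ 2^-1 * f x) * (x `^ 2^-1 * g x)).
  by apply: eq_oint => x hx; rewrite mulrACA sq.
rewrite 3!E; have I f g : bcont f -> bcont g -> ointb 0 1 (fun x => (x `^ 2^-1 * f x) * (x `^ 2^-1 * g x)).
  by move=> bf bg; apply: bcont_ointb => //; apply: bcontM; exact: bcontM.
by apply: (@oint_cauchy R 0 1 (fun x => x `^ 2^-1 * h x) (fun x => x `^ 2^-1 * k x)); exact: I.
Qed.

Lemma wA_bcont h : bcont h -> bcont (fun z => z `^ (nu + 1) * h z).
Proof.
move=> bh; apply: bcontM => //; split; first by move=> x /andP[x0 _]; exact: continuous_powR.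
by exists 1 => x /andP[x0 x1]; rewrite ger0_norm ?powR_ge0// pow_le1 ?addr_ge0// !ltW.
Qed.

Lemma wA_le h M s y : 0 <= s -> bcont h -> (forall x, 0 < x < 1 -> `|h x| <= M * x `^ s) ->
  0 < y <= 1 -> `|wA h y| <= M * y `^ (nu + (s + 2)).
Proof.
move=> s0 bh hM /andP[y0 y1].
have M0 : 0 <= M.
  have h12 : 0 < (2^-1 : R) < 1 by apply/andP; split; lra.
  by have := le_trans (normr_ge0 _) (hM _ h12); rewrite pmulr_lge0// powR_gt0.
have -> : M * y `^ (nu + (s + 2)) = M * (y `^ (nu + 1) * y `^ s) * (y - 0).
  by rewrite subr0 -mulrA -{4}(powRr1 (ltW y0)) -!pow_add//; congr (_ * _ `^ _); ring.
apply: norm_oint_le_cst; first exact: ltW.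
  by apply: bcont_ointb => //; exact: wA_bcont.
move=> z /andP[z0 zy]; rewrite normrM (ger0_norm (powR_ge0 _ _)).
have z1 : 0 < z < 1 by rewrite z0 (lt_le_trans zy).
rewrite [leRHS]mulrCA; apply: ler_pM; rewrite ?powR_ge0//.
  by apply: ge0_ler_powR; rewrite ?nnegrE ?addr_ge0// ltW.
apply: le_trans (hM z z1) _; rewrite ler_wpM2l//.
by apply: ge0_ler_powR; rewrite ?nnegrE// ltW.
Qed.

Lemma wA_le_bound h M y : bcont h -> (forall x, 0 < x < 1 -> `|h x| <= M) ->
  0 < y <= 1 -> `|wA h y| <= M * y `^ (nu + 2).
Proof.
move=> bh hM hy; have := @wA_le h M 0 y (lexx 0) bh _ hy; rewrite add0r; apply.
by move=> x hx; rewrite powRr0 mulr1 hM.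
Qed.

Lemma is_derive_wA h x : bcont h -> 0 < x < 1 -> is_derive x 1 (wA h) (x `^ (nu + 1) * h x).
Proof.
move=> bh hx; have bw := wA_bcont bh.
by apply: (ftc_deriv hx (bcont_ointb _ _ bw)) => //; have [c _] := bw; exact: c.
Qed.

Lemma con_gBi h : bcont h -> con 0 1 (fun y => y `^ (- (2 * nu + 1)) * wA h y).
Proof.
move=> bh x hx; have /andP[x0 x1] := hx; apply: cvgM; first exact: continuous_powR.
exact: is_derive_cvg (is_derive_wA bh hx).
Qed.

Lemma gBi_le h M q x y : 0 <= M -> (forall y, 0 < y < 1 -> `|wA h y| <= M * y `^ (nu + q)) ->
  0 < x -> x <= y -> y < 1 ->
  `|y `^ (- (2 * nu + 1)) * wA h y| <= M * x `^ (Num.min (q - 1 - nu) 0).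
Proof.
move=> M0 hM x0 xy y1; have y0 : 0 < y by exact: lt_le_trans xy.
rewrite normrM (ger0_norm (powR_ge0 _ _)).
apply: (@le_trans _ _ (M * y `^ (q - 1 - nu))); last by rewrite ler_wpM2l// pow_le_min// ltW.
have -> : M * y `^ (q - 1 - nu) = y `^ (- (2 * nu + 1)) * (M * y `^ (nu + q)).
  by rewrite mulrCA -pow_add//; congr (_ * _ `^ _); ring.
by rewrite ler_wpM2l ?powR_ge0// hM// y0.
Qed.

Lemma wA_crude h : bcont h -> exists2 M, 0 <= M & forall y, 0 < y < 1 -> `|wA h y| <= M * y `^ (nu + 2).
Proof.
move=> bh; have [M M0 hM] := bcont_bound bh; exists M => // y /andP[y0 y1].
by apply: wA_le_bound => //; rewrite y0 ltW.
Qed.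

Lemma ointb_gBi h x : bcont h -> 0 < x -> ointb x 1 (fun y => y `^ (- (2 * nu + 1)) * wA h y).
Proof.
move=> bh x0; have [M M0 hM] := wA_crude bh.
apply: (@con_ointb _ _ _ _ (M * x `^ (Num.min (2 - 1 - nu) 0))).
  by apply: conS (con_gBi bh) => //; exact: ltW.
by move=> y /andP[xy y1]; apply: gBi_le => //; exact: ltW.
Qed.

(** Bounding the integral by the supremum times the length costs one power of x, q - 1 instead of q,
    but spares the logarithm of the critical case q = nu. *)
Lemma green_le h M q x : bcont h -> 0 <= M -> (forall y, 0 < y < 1 -> `|wA h y| <= M * y `^ (nu + q)) ->
  0 < x < 1 -> `|green h x| <= M * x `^ (Num.min (q - 1) nu).
Proof.
move=> bh M0 hM /andP[x0 x1]; rewrite /green normrM (ger0_norm (powR_ge0 _ _)).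
have -> : x `^ (Num.min (q - 1) nu) = x `^ nu * x `^ (Num.min (q - 1 - nu) 0).
  rewrite -pow_add// addr_minr addr0; congr (_ `^ _).
  by rewrite addrCA subrr addr0.
rewrite mulrCA ler_wpM2l ?powR_ge0//.
apply: (@le_trans _ _ (M * x `^ (Num.min (q - 1 - nu) 0) * (1 - x))).
  apply: norm_oint_le_cst; [exact: ltW|exact: ointb_gBi|].
  by move=> y /andP[xy y1]; apply: gBi_le => //; exact: ltW.
by rewrite ler_piMr ?mulr_ge0 ?powR_ge0//; lra.
Qed.

Lemma is_derive_gB h x : bcont h -> 0 < x < 1 ->
  is_derive x 1 (gB h) (- (x `^ (- (2 * nu + 1)) * wA h x)).
Proof.
move=> bh /andP[x0 x1]; have x20 : 0 < x / 2 by rewrite divr_gt0.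
have hx : x / 2 < x < 1 by apply/andP; split; lra.
apply: (ftc_deriv_left hx (ointb_gBi bh x20)).
by apply: conS (con_gBi bh) => //; exact: ltW.
Qed.

(** The equation x (x p')' - nu^2 p = - x^2 h as a first-order system for p and x p'. *)
Lemma green_pair h x : bcont h -> 0 < x < 1 ->
  is_derive x 1 (green h) (gD h x / x) /\
  is_derive x 1 (gD h) (nu ^+ 2 * green h x / x - x * h x).
Proof.
move=> bh hx; have /andP[x0 x1] := hx; have dB := is_derive_gB bh hx; have dA := is_derive_wA bh hx.
have e1 : x `^ (- (2 * nu + 1)) = x `^ (- nu) * x `^ (- nu) / x.
  rewrite -(powR_inv1 (ltW x0)) -!pow_add//; congr (_ `^ _); ring.
have e2 : x `^ nu * x `^ (- nu) = 1 by rewrite -pow_add// subrr powRr0.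
have e3 : x `^ (nu + 1) = x `^ nu * x by rewrite pow_add// powRr1// ltW.
have d1 : is_derive x 1 (green h) (gD h x / x).
  apply: (derM (der_powR x0 erefl) dB); rewrite /gD /green e1.
  transitivity ((nu * (x `^ nu * gB h x) - (x `^ nu * x `^ (- nu)) * x `^ (- nu) * wA h x) / x).
    by rewrite e2 mul1r.
  ring.
split; first exact: d1.
apply: (derB (derZ (k := nu) d1 erefl) (derM (der_powR x0 erefl) dA erefl)).
rewrite e3 (_ : x `^ (- nu) * _ = (x `^ nu * x `^ (- nu)) * (x * h x)); last by ring.
by rewrite e2 /gD; field; rewrite gt_eqF.
Qed.

Lemma bcont_green h : bcont h -> bcont (green h).
Proof.
move=> bh; split.
  by move=> x hx; have [d _] := green_pair bh hx; exact: is_derive_cvg d.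
have [M M0 hM] := wA_crude bh; exists M => x hx; apply: le_trans (green_le bh M0 hM hx) _.
have /andP[x0 x1] := hx; rewrite ler_piMr// pow_le1//; last by rewrite !ltW.
rewrite le_min (ltW nu0) andbT; lra.
Qed.


Lemma cvg0_dom_left (f : R -> R) M s : 0 < s -> (forall x, 0 < x < 1 -> `|f x| <= M * x `^ s) ->
  f x @[x --> 0^'+] --> 0.
Proof.
move=> s0 h; apply/norm_cvg0P.
apply: (@squeeze_cvgr _ _ _ _ (cst 0) (fun x => M * x `^ s)).
- near=> x; rewrite normr_ge0 /= h//; apply/andP; split; near: x.
    exact: nbhs_right_gt.
  exact: nbhs_right_lt.
- exact: cvg_cst.
- by rewrite -[X in _ --> X](mulr0 M); apply: cvgMr; exact: powR_cvg0.
Unshelve. all: by end_near. Qed.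

Lemma green_crude h : bcont h -> exists2 M, 0 <= M & forall x, 0 < x < 1 -> `|green h x| <= M * x `^ (Num.min 1 nu).
Proof.
move=> bh; have [M M0 hM] := wA_crude bh; exists M => // x hx.
by apply: le_trans (green_le bh M0 hM hx) _; rewrite (_ : 2 - 1 = 1 :> R)//; lra.
Qed.

Lemma min1nu_gt0 : 0 < Num.min 1 nu. Proof. by rewrite lt_min ltr01. Qed.

Lemma green_cvg0 h : bcont h -> green h x @[x --> 0^'+] --> 0.
Proof.
by move=> bh; have [M M0 hM] := green_crude bh; exact: cvg0_dom_left min1nu_gt0 hM.
Qed.

Lemma gB_cvg1 h : bcont h -> gB h x @[x --> 1^'-] --> 0.
Proof.
move=> bh; have h2 : 0 < (2^-1 : R) by [].
have I := ointb_gBi bh h2; have h21 : (2^-1 : R) < 1 by lra.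
exact: oint_cvg_right0 h21 I.
Qed.

Lemma green_cvg1 h : bcont h -> green h x @[x --> 1^'-] --> 0.
Proof.
move=> bh; rewrite -[X in _ --> X](mulr0 (1 `^ nu)); apply: cvgM; last exact: gB_cvg1.
by apply: cvg_at_left_filter; exact: continuous_powR.
Qed.

Lemma wAA_le h k : bcont h -> bcont k -> exists2 M, 0 <= M & forall x, 0 < x < 1 ->
  `|x `^ (- (2 * nu + 1)) * (wA h x * wA k x)| <= M * x `^ 3.
Proof.
move=> bh bk; have [M M0 hM] := wA_crude bh; have [N N0 hN] := wA_crude bk.
exists (M * N); first exact: mulr_ge0.
move=> x hx; have /andP[x0 x1] := hx.
rewrite normrM (ger0_norm (powR_ge0 _ _)) normrM.
have -> : M * N * x `^ 3 = x `^ (- (2 * nu + 1)) * ((M * x `^ (nu + 2)) * (N * x `^ (nu + 2))).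
  rewrite (_ : (3 : R) = - (2 * nu + 1) + ((nu + 2) + (nu + 2))); last by ring.
  by rewrite !(pow_add _ _ x0); ring.
by rewrite ler_wpM2l ?powR_ge0// ler_pM// ?hM ?hN.
Qed.

Lemma ointb_wAA h k : bcont h -> bcont k ->
  ointb 0 1 (fun x => x `^ (- (2 * nu + 1)) * (wA h x * wA k x)).
Proof.
move=> bh bk; have [M M0 hM] := wAA_le bh bk.
apply: (@con_ointb _ _ _ _ M).
  move=> x hx; have /andP[x0 x1] := hx; apply: cvgM; first exact: continuous_powR.
  by apply: cvgM; [exact: is_derive_cvg (is_derive_wA bh hx)|exact: is_derive_cvg (is_derive_wA bk hx)].
move=> x hx; apply: le_trans (hM x hx) _; have /andP[x0 x1] := hx.
by rewrite ler_piMr// pow_le1// !ltW.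
Qed.

(** Integration by parts, [wA k] being a primitive of x^(nu+1) k. The boundary terms vanish: [wA k]
    times [gB h] is O(x^2) at 0, and [gB h] tends to 0 at 1. The right-hand side is symmetric and
    nonnegative on the diagonal, whence symmetry and positivity of the Green operator. *)
Lemma ip_greenE h k : bcont h -> bcont k ->
  ip (green h) k = oint 0 1 (fun x => x `^ (- (2 * nu + 1)) * (wA h x * wA k x)).
Proof.
move=> bh bk; apply/eqP; rewrite -subr_eq0; apply/eqP.
have I1 := bcont_ip (bcont_green bh) bk; have I2 := ointb_wAA bh bk.
rewrite /ip -ointB//.
have E x : 0 < x < 1 -> x * (green h x * k x) = (x `^ (nu + 1) * k x) * gB h x.
  by move=> /andP[x0 _]; rewrite pow_add// powRr1 ?ltW// /green; ring.
rewrite [RHS](_ : 0 = 0 - 0); last by rewrite subrr.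
apply: (@ftc_oo R 0 1 (fun x => wA k x * gB h x)); first exact: ltr01.
- exact: ointbB.
- move=> x hx; apply: cvgB.
    have [c _] := bcontM bcont_id (bcontM (bcont_green bh) bk); exact: c.
  have /andP[x0 x1] := hx; apply: cvgM; first exact: continuous_powR.
  by apply: cvgM; [exact: is_derive_cvg (is_derive_wA bh hx)|exact: is_derive_cvg (is_derive_wA bk hx)].
- move=> x hx; rewrite (E x hx); apply: (derM (is_derive_wA bk hx) (is_derive_gB bh hx)); ring.
- have [M M0 hM] := wA_crude bk; have [N N0 hN] := green_crude bh.
  apply: (@cvg0_dom_left _ (M * N) 2) => // x hx; have /andP[x0 x1] := hx.
  have -> : wA k x * gB h x = x `^ (- nu) * (wA k x * green h x).
    rewrite /green (_ : _ * (_ * _) = (x `^ (- nu) * x `^ nu) * (wA k x * gB h x)); last by ring.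
    by rewrite -pow_add// addNr powRr0 mul1r.
  rewrite normrM (ger0_norm (powR_ge0 _ _)) normrM.
  apply: (@le_trans _ _ (x `^ (- nu) * ((M * x `^ (nu + 2)) * (N * 1)))).
    rewrite ler_wpM2l ?powR_ge0// ler_pM// ?hM//.
    by rewrite (le_trans (hN x hx))// ler_wpM2l// pow_le1 ?(ltW min1nu_gt0)// !ltW.
  rewrite [leLHS](_ : _ = M * N * (x `^ (- nu) * x `^ (nu + 2))); last by ring.
  by rewrite -pow_add// addrA addNr add0r.
- rewrite -[X in _ --> X](mulr0 (wA k 1)); apply: cvgM; last exact: gB_cvg1.
  exact: oint_cvg_right ltr01 (bcont_ointb (lexx _) (lexx _) (wA_bcont bk)).
Qed.

Lemma green_sym h k : bcont h -> bcont k -> ip (green h) k = ip h (green k).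
Proof.
move=> bh bk; rewrite (ip_greenE bh bk) ipC (ip_greenE bk bh); apply: eq_oint => x _.
by rewrite (mulrC (wA h x)).
Qed.

Lemma ip_green_ge0 h : bcont h -> 0 <= ip (green h) h.
Proof.
move=> bh; rewrite ip_greenE//; apply: oint_ge0 => x _.
by rewrite mulr_ge0 ?powR_ge0// -expr2 sqr_ge0.
Qed.

Lemma oint_powN_le x : 0 < x < 1 -> ointb x 1 (fun y => y `^ (- (2 * nu + 1))) /\
  oint x 1 (fun y => y `^ (- (2 * nu + 1))) <= x `^ (- (2 * nu)) / (2 * nu).
Proof.
move=> /andP[x0 x1].
have cf : con x 1 (fun y => y `^ (- (2 * nu + 1))).
  by move=> y /andP[xy _]; apply: continuous_powR; exact: lt_trans xy.
have If : ointb x 1 (fun y => y `^ (- (2 * nu + 1))).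
  apply: (con_ointb cf (M := x `^ (Num.min (- (2 * nu + 1)) 0))).
  by move=> y /andP[xy y1]; rewrite ger0_norm ?powR_ge0// pow_le_min// ltW.
split => //.
have n20 : 2 * nu != 0 by rewrite mulf_neq0// gt_eqF.
pose F (y : R) := - (2 * nu)^-1 * y `^ (- (2 * nu)).
have dF y : 0 < y -> is_derive y 1 F (y `^ (- (2 * nu + 1))).
  move=> y0; apply: (derZ (der_powR y0 erefl)).
  rewrite opprD pow_add// powR_inv1 ?ltW//.
  by move: (powR _ _) => p; field; rewrite gt_eqF//= gt_eqF.
rewrite (_ : oint x 1 _ = F 1 - F x).
  rewrite /F powR1 mulr1 mulNr opprK addrC mulrC lerBlDr lerDl invr_ge0.
  by rewrite mulr_ge0// ltW.
apply: (ftc_oo x1 If cf); first by move=> y /andP[xy _]; apply: dF; exact: lt_trans xy.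
- by apply: cvg_at_right_filter; exact: is_derive_cvg (dF x x0).
- by apply: cvg_at_left_filter; exact: is_derive_cvg (dF 1 ltr01).
Qed.

(** Cauchy-Schwarz for [gB], with the weight y^(-(2 nu + 1)) split evenly between the factors. The
    weight has integral at most x^(-2 nu) / (2 nu), which cancels the square of the prefactor x^nu;
    the other factor is at most the energy, by [ip_greenE]. *)
Lemma green_energy h x : bcont h -> 0 < x < 1 -> green h x ^+ 2 <= ip (green h) h / (2 * nu).
Proof.
move=> bh hx; have /andP[x0 x1] := hx; have [I1 h1] := oint_powN_le hx.
pose r (y : R) := y `^ (- (2 * nu + 1) / 2).
have rr y : 0 < y -> r y * r y = y `^ (- (2 * nu + 1)).
  by move=> y0; rewrite /r -pow_add//; congr (_ `^ _); field.
have EB : gB h x = oint x 1 (fun y => r y * (r y * wA h y)).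
  by apply: eq_oint => y /andP[xy _]; rewrite mulrA rr// (lt_trans x0).
have I2 : ointb x 1 (fun y => y `^ (- (2 * nu + 1)) * (wA h y * wA h y)).
  by apply: ointbS (ointb_wAA bh bh) => //; exact: ltW.
have h2 : oint x 1 (fun y => y `^ (- (2 * nu + 1)) * (wA h y * wA h y)) <= ip (green h) h.
  rewrite ip_greenE// (oint_split hx (ointb_wAA bh bh)) lerDr; apply: oint_ge0 => y _.
  by rewrite mulr_ge0 ?powR_ge0// -expr2 sqr_ge0.
have cs : gB h x ^+ 2 <= x `^ (- (2 * nu)) / (2 * nu) * ip (green h) h.
  rewrite EB; apply: (@le_trans _ _ (oint x 1 (fun y => r y ^+ 2) * oint x 1 (fun y => (r y * wA h y) ^+ 2))).
    apply: oint_cauchy.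
    - by apply: eq_ointb I1 => y /andP[xy _]; rewrite expr2 rr// (lt_trans x0).
    - by apply: eq_ointb I2 => y /andP[xy _]; rewrite exprMn !expr2 rr// (lt_trans x0).
    - by apply: eq_ointb (ointb_gBi bh x0) => y /andP[xy _]; rewrite mulrA rr// (lt_trans x0).
  apply: ler_pM; [by apply: oint_ge0 => y _; exact: sqr_ge0..| |].
    by rewrite (le_trans _ h1)// (@eq_oint _ _ _ _ (fun y => y `^ (- (2 * nu + 1)))) // => y /andP[xy _]; rewrite expr2 rr// (lt_trans x0).
  rewrite (le_trans _ h2)// (@eq_oint _ _ _ _ (fun y => y `^ (- (2 * nu + 1)) * (wA h y * wA h y)))// => y /andP[xy _].
  by rewrite exprMn !expr2 rr// (lt_trans x0).
rewrite /green exprMn.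
apply: le_trans (ler_wpM2l (sqr_ge0 _) cs) _.
have -> : (x `^ nu) ^+ 2 * (x `^ (- (2 * nu)) / (2 * nu) * ip (green h) h) =
  (x `^ nu * x `^ nu * x `^ (- (2 * nu))) * (ip (green h) h / (2 * nu)) by rewrite expr2; ring.
rewrite -!pow_add// (_ : nu + nu + - (2 * nu) = 0) ?powRr0 ?mul1r//; ring.
Qed.

(** The bound on D - nu p excludes the homogeneous solution x^(-nu), for which this quantity is - 2
    nu x^(-nu). It makes x^nu (D - nu p) tend to 0 at 0, so that this function is - [wA h]; a second
    integration uses the limit at 1. *)
Lemma green_unique p D h M : bcont h ->
  (forall x, 0 < x < 1 -> is_derive x 1 p (D x / x)) ->
  (forall x, 0 < x < 1 -> is_derive x 1 D (nu ^+ 2 * p x / x - x * h x)) ->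
  (forall x, 0 < x < 1 -> `|D x - nu * p x| <= M) ->
  p x @[x --> 1^'-] --> 0 -> forall x, 0 < x < 1 -> p x = green h x.
Proof.
move=> bh dp dD hM p1.
have e1 y : 0 < y -> y `^ (- (2 * nu + 1)) = y `^ (- nu) * y `^ (- nu) / y.
  move=> y0; rewrite -(powR_inv1 (ltW y0)) -!pow_add//; congr (_ `^ _); ring.
have e2 y : 0 < y -> y `^ nu * y `^ (- nu) = 1 by move=> y0; rewrite -pow_add// subrr powRr0.
pose F y := - (y `^ nu * (D y - nu * p y)).
have dF y : 0 < y < 1 -> is_derive y 1 F (y `^ (nu + 1) * h y).
  move=> hy; have /andP[y0 y1] := hy.
  have := derM (der_powR y0 erefl) (derB (dD y hy) (derZ (k := nu) (dp y hy) erefl) erefl) erefl => /(_ nu).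
  move/(derZ (k := -1)) => /(_ (y `^ (nu + 1) * h y)).
  rewrite (_ : (fun y => -1 * _) = F); last by apply/funext => z; rewrite mulN1r.
  apply; rewrite pow_add// powRr1 ?ltW//.
  by move: (powR _ _) (p y) (D y) (h y) => a b c d; field; rewrite gt_eqF.
have AF y : 0 < y < 1 -> wA h y = F y.
  move=> hy; have /andP[y0 y1] := hy; rewrite -[RHS]subr0.
  apply: (@ftc_oo R 0 y F _ 0 (F y) y0).
  - by apply: bcont_ointb => //; [exact: ltW|exact: wA_bcont].
  - by have [c _] := wA_bcont bh; apply: conS c => //; exact: ltW.
  - by move=> z /andP[z0 zy]; apply: dF; rewrite z0 (lt_trans zy).
  - apply: (@cvg0_dom_left _ M nu nu0) => z hz; rewrite normrN normrM (ger0_norm (powR_ge0 _ _)) mulrC.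
    by rewrite ler_wpM2r ?powR_ge0// hM.
  - by apply: cvg_at_left_filter; exact: is_derive_cvg (dF y hy).
pose G y := y `^ (- nu) * p y.
have dG y : 0 < y < 1 -> is_derive y 1 G (- (y `^ (- (2 * nu + 1)) * wA h y)).
  move=> hy; have /andP[y0 y1] := hy; apply: (derM (der_powR y0 erefl) (dp y hy)).
  rewrite AF// e1// /F.
  transitivity ((y `^ nu * y `^ (- nu)) * y `^ (- nu) * (D y - nu * p y) / y); first by ring.
  by rewrite e2//; ring.
move=> x hx; have /andP[x0 x1] := hx.
have : - gB h x = 0 - G x.
  rewrite -mulN1r -ointZ; last exact: ointb_gBi.
  apply: (@ftc_oo R x 1 G _ (G x) 0 x1).
  - by apply: ointbZ; exact: ointb_gBi.
  - by move=> y /andP[xy y1]; apply: cvgMr; apply: con_gBi => //; rewrite (lt_trans x0).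
  - by move=> y /andP[xy y1]; rewrite mulN1r; apply: dG; rewrite (lt_trans x0).
  - by apply: cvg_at_right_filter; exact: is_derive_cvg (dG x hx).
  - rewrite -[X in _ --> X](mulr0 (1 `^ (- nu))); apply: cvgM => //.
    by apply: cvg_at_left_filter; exact: continuous_powR.
rewrite sub0r => /oppr_inj E; rewrite /green E /G mulrA e2// mul1r//.
Qed.

Lemma wAD h k y : bcont h -> bcont k -> y <= 1 -> wA (fun x => h x + k x) y = wA h y + wA k y.
Proof.
move=> bh bk y1; rewrite /wA -ointD; [|by apply: bcont_ointb => //; exact: wA_bcont..].
by apply: eq_oint => x _; rewrite mulrDr.
Qed.

Lemma wAZ c h y : bcont h -> y <= 1 -> wA (fun x => c * h x) y = c * wA h y.
Proof.
move=> bh y1; rewrite /wA -ointZ; last by apply: bcont_ointb => //; exact: wA_bcont.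
by apply: eq_oint => x _; ring.
Qed.

Lemma greenD h k x : bcont h -> bcont k -> 0 < x -> green (fun x => h x + k x) x = green h x + green k x.
Proof.
move=> bh bk x0; rewrite /green -mulrDr /gB -ointD; [|exact: ointb_gBi..].
by congr (_ * _); apply: eq_oint => y /andP[_ y1]; rewrite wAD ?ltW// mulrDr.
Qed.

Lemma greenZ c h x : bcont h -> 0 < x -> green (fun x => c * h x) x = c * green h x.
Proof.
move=> bh x0; rewrite /green [RHS]mulrCA /gB -(ointZ c (ointb_gBi bh x0)).
by congr (_ * _); apply: eq_oint => y /andP[_ y1]; rewrite wAZ ?ltW//; ring.
Qed.

Lemma eq_green h k x : 0 < x -> (forall x, 0 < x < 1 -> h x = k x) -> green h x = green k x.
Proof.
move=> x0 hk; rewrite /green; congr (_ * _); rewrite /gB; apply: eq_oint => y /andP[xy y1].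
congr (_ * _); rewrite /wA; apply: eq_oint => z /andP[z0 zy]; rewrite hk// z0 (lt_trans zy)//.
Qed.

(** Cauchy-Schwarz, with z^(nu+1) split as z^(1/2) z^(nu + 1/2) so that the first factor supplies
    the weight of the norm. *)
Lemma wA_L2 h y : bcont h -> 0 < y < 1 -> `|wA h y| <= Num.sqrt (ip h h) * y `^ (nu + 1).
Proof.
move=> bh /andP[y0 y1].
have E : wA h y = oint 0 y (fun z => (z `^ 2^-1 * h z) * z `^ (nu + 2^-1)).
  apply: eq_oint => z /andP[z0 _].
  rewrite (_ : nu + 1 = 2^-1 + (nu + 2^-1)); last by field.
  by rewrite (pow_add 2^-1 _ z0) mulrAC.
have bp a : 0 <= a -> bcont (fun z => z `^ a).
  move=> a0; split; first by move=> x /andP[x0 _]; exact: continuous_powR.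
  by exists 1 => x /andP[x0 x1]; rewrite ger0_norm ?powR_ge0// pow_le1// !ltW.
have n2 : 0 <= nu + 2^-1 by rewrite addr_ge0// ltW.
have b1 : bcont (fun z => z `^ 2^-1 * h z) by apply: bcontM => //; exact: bp.
have b2 := bp _ n2.
have I f g : bcont f -> bcont g -> ointb 0 y (fun z => f z * g z).
  by move=> bf bg; apply: bcont_ointb => //; [exact: ltW|exact: bcontM].
have sqE (f : R -> R) : (fun z => f z ^+ 2) = (fun z => f z * f z) by apply/funext => z; rewrite expr2.
have cs : wA h y ^+ 2 <= ip h h * (y `^ (2 * nu + 1) * y).
  rewrite E; apply: le_trans (oint_cauchy _ _ _) _; rewrite ?sqE; [exact: I..|].
  apply: ler_pM; [by apply: oint_ge0 => z _; rewrite -expr2 sqr_ge0..| |].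
    have hy : 0 < y < 1 by rewrite y0.
    rewrite /ip (oint_split hy (bcont_ip bh bh)).
    rewrite (@eq_oint _ _ _ _ (fun x => x * (h x * h x))) ?lerDl.
      by apply: oint_ge0 => z /andP[z0 _]; rewrite mulr_ge0 ?(ltW (lt_trans y0 z0))// -expr2 sqr_ge0.
    move=> z /andP[z0 _]; rewrite mulrACA -pow_add// (_ : 2^-1 + 2^-1 = 1 :> R) ?powRr1 ?ltW//; lra.
  rewrite -[X in _ * X]subr0 -oint_cst ?(ltW y0)//; apply: le_oint; [exact: I|exact: ointb_cst|].
  move=> z /andP[z0 zy]; rewrite -pow_add// (_ : nu + 2^-1 + (nu + 2^-1) = 2 * nu + 1); last by field.
  by apply: ge0_ler_powR; rewrite ?nnegrE ?addr_ge0 ?mulr_ge0// ltW.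
have i0 := ip_ge0 h; have n1 : 0 <= y `^ (nu + 1) := powR_ge0 _ _.
rewrite -(@ler_pXn2r _ 2)// ?nnegrE ?mulr_ge0 ?sqrtr_ge0//.
rewrite -normrX ger0_norm ?sqr_ge0// exprMn sqr_sqrtr// expr2.
apply: le_trans cs _; rewrite (_ : y `^ (2 * nu + 1) * y = y `^ (nu + 1) ^+ 2)//.
rewrite expr2 -{2}(powRr1 (ltW y0)) -!pow_add//; congr (_ `^ _); ring.
Qed.

End Green.

(** * Fourier-Bessel functions *)

Local Opaque Gamma Phi.

Section Eigenfunctions.
Context {R : realType}.
Variable nu : R.
Hypothesis nu0 : 0 < nu.
Implicit Types (h k : R -> R) (x y z c : R) (n m N : nat).
Local Notation ip := (@ip R).

Let nu0' : 0 <= nu. Proof. exact: ltW. Qed.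

(** Numbered from 0: [gam 0] is the first positive zero, since [besselJ_zero nu 0] only starts the
    recursion. *)
Definition gam n := besselJ_zero nu n.+1.
(* The factor makes ef n of norm 1 for the weight x on [0, 1]. *)
Definition efc n : R := Num.sqrt 2 / besselJ (nu + 1) (gam n).
Definition ef n x : R := efc n * besselJ nu (gam n * x).

Lemma gam_gt0 n : 0 < gam n. Proof. exact: besselJ_zero_gt0. Qed.
Lemma gam2_gt0 n : 0 < gam n ^+ 2. Proof. by rewrite exprn_gt0// gam_gt0. Qed.

Lemma besselJ_gam n : besselJ nu (gam n) = 0.
Proof. by have [] := besselJ_zero_spec nu0 n. Qed.

Lemma Phi_gam n : Phi nu (4^-1 * gam n ^+ 2) = 0.
Proof. by apply/eqP; rewrite -besselJ_eq0 ?gam_gt0// besselJ_gam. Qed.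

Lemma jf_gam n : jf nu (gam n ^+ 2) 1 = 0.
Proof. by rewrite jf_at1 Phi_gam. Qed.

Let kn n : R := efc n * (gam n / 2) `^ nu.

Lemma efE n x : 0 <= x -> ef n x = kn n * jf nu (gam n ^+ 2) x.
Proof. by move=> x0; rewrite /ef besselJ_jf// ?gam_gt0// mulrA. Qed.

Lemma besselJ1_gam n : besselJ (nu + 1) (gam n) = (gam n / 2) `^ (nu + 1) * Phi (nu + 1) (4^-1 * gam n ^+ 2).
Proof.
have n1 : 0 < nu + 1 by rewrite addr_gt0.
have := @besselJ_jf R (nu + 1) (gam n) 1 n1 (gam_gt0 n) ler01.
by rewrite mulr1 jf_at1.
Qed.

Lemma besselJ1_gam_neq0 n : besselJ (nu + 1) (gam n) != 0.
Proof.
rewrite besselJ1_gam mulf_neq0 ?(gt_eqF (powR_gt0 _ _)) ?divr_gt0 ?gam_gt0//.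
by rewrite Phi1_neq0 ?gam_gt0// Phi_gam.
Qed.

Lemma ef1 n : ef n 1 = 0.
Proof. by rewrite /ef mulr1 besselJ_gam mulr0. Qed.

Lemma bcont_jf mu : bcont (jf nu mu).
Proof. by split; [exact: con_jf|exact: bounded_jf]. Qed.

Lemma eq_bcont h k : (forall x, 0 < x < 1 -> h x = k x) -> bcont h -> bcont k.
Proof.
move=> hk [ch [M hM]]; split; last by exists M => x hx; rewrite -hk// hM.
move=> x hx; rewrite -(hk x hx); apply: cvg_trans (ch x hx); apply: near_eq_cvg.
have /andP[x0 x1] := hx; near=> y; rewrite hk//.
by apply/andP; split; near: y; [exact: lt_nbhsr|exact: lt_nbhsl].
Unshelve. all: by end_near. Qed.

Lemma bcont_ef n : bcont (ef n).
Proof.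
apply: (@eq_bcont (fun x => kn n * jf nu (gam n ^+ 2) x)).
  by move=> x /andP[x0 _]; rewrite efE// ltW.
by apply: bcontZ; exact: bcont_jf.
Qed.

Lemma eq_ip h h' k k' : (forall x, 0 < x < 1 -> h x = h' x) -> (forall x, 0 < x < 1 -> k x = k' x) ->
  ip h k = ip h' k'.
Proof. by move=> hh kk; apply: eq_oint => x hx; rewrite hh// kk. Qed.

Lemma ef_norm n : ip (ef n) (ef n) = 1.
Proof.
set mu := gam n ^+ 2; set P := Phi (nu + 1) (4^-1 * mu).
have P0 : P != 0 by rewrite Phi1_neq0 ?gam_gt0// Phi_gam.
have c0 := gam_gt0 n; have a0 : 0 < (gam n / 2) `^ nu by apply: powR_gt0; rewrite divr_gt0.
have I2 := jf_norm nu0 (jf_gam n); rewrite jd_at1 Phi_gam mulr0 sub0r -/mu -/P in I2.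
rewrite (@eq_ip _ (fun x => kn n * jf nu mu x) _ (fun x => kn n * jf nu mu x)); [|by move=> x /andP[x0 _]; rewrite efE// ltW..].
rewrite ipZl; [|exact: bcont_jf|by apply: bcontZ; exact: bcont_jf].
rewrite ipC ipZl; [|exact: bcont_jf|exact: bcont_jf].
have -> : ip (jf nu mu) (jf nu mu) = oint 0 1 (fun x => x * jf nu mu x ^+ 2).
  by apply: eq_oint => x _; rewrite expr2.
move: (oint _ _ _) I2 => I I2.
(* By [jf_norm], 2 mu I = (mu P / 2)^2, because x j' equals - mu P / 2 at 1. *)
have -> : I = mu * P ^+ 2 / 8.
  have m0 : mu != 0 by rewrite gt_eqF// gam2_gt0.
  apply: (mulfI (_ : 2 * mu != 0)); first by rewrite mulf_neq0.
  by rewrite I2; field.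
rewrite /kn /efc besselJ1_gam pow_add ?divr_gt0// powRr1 ?divr_ge0 ?(ltW c0)// -/mu -/P.
have s2 : Num.sqrt 2 * Num.sqrt 2 = 2 :> R by rewrite -expr2 sqr_sqrtr.
move: (_ `^ _) a0 (Num.sqrt 2) s2 => a a0 s s2.
transitivity (s * s / 2); last by rewrite s2 divff.
rewrite /mu; field.
by rewrite ?P0 ?(gt_eqF a0) ?(gt_eqF c0).
Qed.

Lemma ef_cvg1 n : ef n x @[x --> 1^'-] --> 0.
Proof.
have c : kn n * jf nu (gam n ^+ 2) x @[x --> 1^'-] --> kn n * 0.
  apply: cvgMr; rewrite -(jf_gam n); apply: cvg_at_left_filter.
  exact: is_derive_cvg (is_derive_jf _ nu0' ltr01).
rewrite mulr0 in c; apply: cvg_trans c; apply: near_eq_cvg; near=> x.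
by rewrite efE//; near: x; exact: nbhs_left_ge.
Unshelve. all: by end_near. Qed.

Lemma green_ef n x : 0 < x < 1 -> green nu (ef n) x = ef n x / gam n ^+ 2.
Proof.
move=> hx; have /andP[x0 x1] := hx; have g0 := gam2_gt0 n.
have E : forall y, 0 < y < 1 -> kn n * jf nu (gam n ^+ 2) y = green nu (fun y => gam n ^+ 2 * ef n y) y.
  have [M M0 hM] := jf_bound nu0 (gam n ^+ 2).
  apply: (@green_unique R nu nu0 _ (fun y => kn n * jd nu (gam n ^+ 2) y) _ (`|kn n| * (M + nu * M))).
  - by apply: bcontZ; exact: bcont_ef.
  - by move=> z /andP[z0 _]; apply: (derZ (is_derive_jf _ nu0' z0)); rewrite mulrA.
  - move=> z /andP[z0 _]; apply: (derZ (is_derive_jd _ nu0' z0)); rewrite efE ?ltW//.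
    by move: (jf _ _ _) (kn n) => p q; ring.
  - move=> z /andP[z0 z1]; have hz : 0 <= z <= 1 by rewrite !ltW.
    have [h1 h2] := hM z hz; have p1 := @pow_le1 R z nu nu0' hz.
    have hMz : M * z `^ nu <= M by rewrite ler_piMr.
    rewrite mulrCA -mulrBr normrM ler_wpM2l// (le_trans (ler_normB _ _))// lerD//.
      exact: le_trans hMz.
    by rewrite normrM (gtr0_norm nu0) ler_wpM2l// (le_trans h1).
  - have := @ef_cvg1 n; apply: cvg_trans; apply: near_eq_cvg; near=> z.
    by rewrite efE//; near: z; exact: nbhs_left_ge.
have := E x hx; rewrite -(efE _ (ltW x0)) (greenZ nu0 _ (bcont_ef n) x0).
by move=> ->; rewrite mulrAC divff ?mul1r// gt_eqF.
Unshelve. all: by end_near. Qed.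

Lemma ef_orth n m : n != m -> ip (ef n) (ef m) = 0.
Proof.
move=> nm; have bn := bcont_ef n; have bm := bcont_ef m.
have eg a x : 0 < x < 1 -> green nu (ef a) x = (gam a ^+ 2)^-1 * ef a x.
  by move=> hx; rewrite green_ef// mulrC.
have ez a b : ip (green nu (ef a)) (ef b) = (gam a ^+ 2)^-1 * ip (ef a) (ef b).
  rewrite -(ipZl _ (bcont_ef a) (bcont_ef b)); exact: eq_ip (eg a) _.
have /eqP : (gam n ^+ 2)^-1 * ip (ef n) (ef m) = (gam m ^+ 2)^-1 * ip (ef n) (ef m).
  exact: (etrans (esym (ez n m)) (etrans (green_sym nu0 bn bm) (etrans (ipC _ _)
    (etrans (ez m n) (congr1 _ (ipC _ _)))))).
rewrite -subr_eq0 -mulrBl mulf_eq0 => /orP[|/eqP//].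
rewrite subr_eq0 (inj_eq invr_inj) eqrXn2 ?(ltW (gam_gt0 _))// => /eqP/(besselJ_zero_inj nu0)[] h.
by rewrite h eqxx in nm.
Qed.

Lemma ef_ortho n m : ip (ef n) (ef m) = (n == m)%:R.
Proof. by case: eqVneq => [->|/ef_orth//]; exact: ef_norm. Qed.

Lemma bcont_sum (I : Type) (r : seq I) (F : I -> R -> R) :
  (forall i, bcont (F i)) -> bcont (fun x => \sum_(i <- r) F i x).
Proof.
move=> bF; elim: r => [|i r IH].
  by under eq_fun do rewrite big_nil; exact: bcont_cst.
by under eq_fun do rewrite big_cons; exact: bcontD.
Qed.

Lemma ip_suml (I : Type) (r : seq I) (F : I -> R -> R) h : (forall i, bcont (F i)) -> bcont h ->
  ip (fun x => \sum_(i <- r) F i x) h = \sum_(i <- r) ip (F i) h.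
Proof.
move=> bF bh; elim: r => [|i r IH].
  rewrite big_nil (@eq_ip _ (fun x => 0 * h x) _ h)//; last by move=> x _; rewrite big_nil mul0r.
  by rewrite ipZl// mul0r.
rewrite big_cons -IH -ipDl//; last exact: bcont_sum.
by apply: eq_ip => // x _; rewrite big_cons.
Qed.

Lemma ip_sumr (I : Type) (r : seq I) (F : I -> R -> R) h : (forall i, bcont (F i)) -> bcont h ->
  ip h (fun x => \sum_(i <- r) F i x) = \sum_(i <- r) ip h (F i).
Proof. by move=> bF bh; rewrite ipC ip_suml//; apply: eq_bigr => i _; rewrite ipC. Qed.

Lemma green_sum (I : Type) (r : seq I) (F : I -> R -> R) x : (forall i, bcont (F i)) -> 0 < x ->
  green nu (fun x => \sum_(i <- r) F i x) x = \sum_(i <- r) green nu (F i) x.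
Proof.
move=> bF x0; elim: r => [|i r IH].
  rewrite big_nil (@eq_green _ _ _ (fun x => 0 * 0))//; last by move=> y _; rewrite big_nil mul0r.
  by rewrite greenZ ?mul0r//; exact: bcont_cst.
rewrite big_cons -IH -(greenD nu0 (bF i) (bcont_sum r bF) x0).
by apply: eq_green => // y _; rewrite big_cons.
Qed.

(** Take h to be the sum of e_n(x) e_n over n < N. Both G h at x and the energy of h equal the sum S
    in question, so [green_energy] reads S^2 <= S / (2 nu). *)
Lemma ef_sum_sqr_le N x : 0 < x < 1 -> \sum_(n < N) (ef n x / gam n) ^+ 2 <= (2 * nu)^-1.
Proof.
move=> hx; have /andP[x0 x1] := hx; set S := \sum_(n < N) _.
pose h y := \sum_(n < N) ef n x * ef n y.
have be n (c : R) : bcont (fun y => c * ef n y) by apply: bcontZ; exact: bcont_ef.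
have bh : bcont h by apply: bcont_sum => n; exact: be.
have gE y : 0 < y < 1 -> green nu h y = \sum_(n < N) (ef n x / gam n ^+ 2) * ef n y.
  move=> hy; have /andP[y0 _] := hy; rewrite green_sum//.
  apply: eq_bigr => n _; rewrite greenZ ?green_ef//; last exact: bcont_ef.
  by rewrite mulrCA mulrC mulrA.
have SE : green nu h x = S.
  by rewrite gE//; apply: eq_bigr => n _; rewrite exprMn exprVn expr2; ring.
have IE : ip (green nu h) h = S.
  rewrite (@eq_ip _ (fun y => \sum_(n < N) (ef n x / gam n ^+ 2) * ef n y) _ h)// ip_suml//.
  apply: eq_bigr => n _; rewrite ipZl//; last exact: bcont_ef.
  rewrite /h ip_sumr//; last exact: bcont_ef.
  rewrite (bigD1 n)//= big1 ?addr0; last first.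
    move=> m mn; rewrite ipC ipZl; [|exact: bcont_ef..].
    by rewrite ef_ortho (_ : (m == n :> nat) = false) ?mulr0//; exact/negbTE.
  rewrite ipC ipZl; [|exact: bcont_ef..].
  by rewrite ef_norm mulr1 exprMn exprVn expr2; ring.
have := green_energy nu0 bh hx; rewrite SE IE.
have : 0 <= S by apply: sumr_ge0 => n _; exact: sqr_ge0.
rewrite le_eqVlt => /predU1P[<- _|S0]; first by rewrite invr_ge0 mulr_ge0.
by rewrite expr2 ler_pM2l.
Qed.

(** Integration of [ef_sum_sqr_le] against the weight x <= 1, each e_n having norm 1. *)
Lemma gam_sum_le N : \sum_(n < N) (gam n ^+ 2)^-1 <= (2 * nu)^-1.
Proof.
have b n : bcont (fun x => (ef n x / gam n) ^+ 2).
  under eq_fun do rewrite expr2 mulrC; apply: bcontM; under eq_fun do rewrite mulrC; apply: bcontZ; exact: bcont_ef.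
have E : \sum_(n < N) (gam n ^+ 2)^-1 = ip (fun x => \sum_(n < N) (ef n x / gam n) ^+ 2) (fun=> 1).
  rewrite ip_suml//; last exact: bcont_cst.
  apply: eq_bigr => n _; rewrite (_ : _^-1 = (gam n ^+ 2)^-1 * ip (ef n) (ef n)); last by rewrite ef_norm mulr1.
  rewrite -ipZl; [|exact: bcont_ef..].
  by apply: eq_oint => x _; rewrite exprMn exprVn expr2; ring.
rewrite E -[leRHS]mulr1 -[X in _ * X]subr0 -oint_cst//; apply: le_oint.
- by apply: bcont_ip; [exact: bcont_sum|exact: bcont_cst].
- exact: ointb_cst.
- move=> x hx; have /andP[x0 x1] := hx; rewrite mulr1; apply: le_trans (ef_sum_sqr_le N hx).
  by rewrite ler_piMl ?(ltW x1)//; apply: sumr_ge0 => n _; exact: sqr_ge0.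
Qed.

Lemma gam_unbounded z : exists n, z < gam n.
Proof.
apply: contrapT => H; have hz n : gam n <= z.
  by rewrite leNgt; apply/negP => h; apply: H; exists n.
have z0 : 0 < z by exact: lt_le_trans (gam_gt0 0) (hz 0%N).
have [N hN] : exists N, (2 * nu)^-1 < N%:R * (z ^+ 2)^-1.
  exists (Num.bound (z ^+ 2 / (2 * nu))); rewrite ltr_pdivlMr ?exprn_gt0// mulrC.
  by apply: le_lt_trans (archi_boundP _); rewrite ?divr_ge0 ?sqr_ge0// mulr_ge0.
have := gam_sum_le N; rewrite leNgt => /negP; apply; apply: lt_le_trans hN _.
rewrite mulr_natl -[N in X in X <= _]card_ord -sumr_const; apply: ler_sum => n _.
rewrite lef_pV2 ?posrE ?exprn_gt0 ?gam_gt0//.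
by rewrite lerXn2r ?nnegrE ?(ltW z0) ?(ltW (gam_gt0 _)).
Qed.

(** By [gam_sum_le] the zeros produced by the recursion cannot accumulate, so none is missed. *)
Lemma zero_is_gam z : 0 < z -> besselJ nu z = 0 -> exists n, z = gam n.
Proof.
move=> z0 Jz; have [N hN] := gam_unbounded z.
exact: (besselJ_zero_exhaust nu0 z0 Jz hN).
Qed.

End Eigenfunctions.

Lemma cvg_near_le {R : realType} {U : Type} (F : set_system U) {FF : ProperFilter F}
    (f : U -> R) (c l : R) :
  (\forall x \near F, f x <= c) -> f x @[x --> F] --> l -> l <= c.
Proof. by move=> fc fl; exact: (@closed_cvg U R F _ f (fun y => y <= c) (@closed_le R c) fc l fl). Qed.

(** * Completeness of the eigenfunctions *)

Section Completeness.
Context {R : realType}.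
Variable nu : R.
Hypothesis nu0 : 0 < nu.
Implicit Types (g h k q d : R -> R) (x y z c : R) (n m N : nat).
Local Notation ip := (@ip R).
Local Notation green := (@green R nu).
Local Notation wA := (@wA R nu).
Local Notation ef := (@ef R nu).

Let nu0' : 0 <= nu. Proof. exact: ltW. Qed.
Let nu1 : 0 <= nu + 1. Proof. by rewrite addr_ge0. Qed.

(** The Volterra part of the Green operator: x^(-nu) G h is a constant minus [volt h], the integral
    now starting at 0. Its convergence there is ensured by h = O(x^nu). *)
Definition volt h x : R := oint 0 x (fun y => y `^ (- (2 * nu + 1)) * wA h y).

Lemma volt_ointb h B : bcont h -> (forall x, 0 < x < 1 -> `|h x| <= B * x `^ nu) ->
  ointb 0 1 (fun y => y `^ (- (2 * nu + 1)) * wA h y).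
Proof.
move=> bh hB; apply: (@con_ointb _ _ _ _ B); first exact: con_gBi.
have B0 : 0 <= B.
  have h12 : 0 < (2^-1 : R) < 1 by apply/andP; split; lra.
  by have := le_trans (normr_ge0 _) (hB _ h12); rewrite pmulr_lge0// powR_gt0.
move=> y /andP[y0 y1]; rewrite normrM (ger0_norm (powR_ge0 _ _)).
apply: (@le_trans _ _ (y `^ (- (2 * nu + 1)) * (B * y `^ (nu + (nu + 2))))).
  by rewrite ler_wpM2l ?powR_ge0// wA_le// y0 ltW.
rewrite mulrCA -pow_add// ler_piMr// pow_le1//; last by rewrite !ltW.
by rewrite (_ : - (2 * nu + 1) + (nu + (nu + 2)) = 1)//; ring.
Qed.

Lemma green_volt h B : bcont h -> (forall x, 0 < x < 1 -> `|h x| <= B * x `^ nu) ->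
  exists b, forall x, 0 < x < 1 -> x `^ (- nu) * green h x = b - volt h x.
Proof.
move=> bh hB; have I := volt_ointb bh hB.
exists (oint 0 1 (fun y => y `^ (- (2 * nu + 1)) * wA h y)) => x hx.
have /andP[x0 x1] := hx; rewrite /green mulrA -pow_add// addNr powRr0 mul1r.
by rewrite (oint_split hx I) /volt /gB addrAC subrr add0r.
Qed.

Lemma voltD h k B C x : bcont h -> bcont k -> (forall x, 0 < x < 1 -> `|h x| <= B * x `^ nu) ->
  (forall x, 0 < x < 1 -> `|k x| <= C * x `^ nu) -> 0 < x < 1 ->
  volt (fun x => h x + k x) x = volt h x + volt k x.
Proof.
move=> bh bk hB hC /andP[x0 x1]; rewrite /volt -ointD.
- by apply: eq_oint => y /andP[_ yx]; rewrite wAD ?mulrDr//; exact: ltW (lt_trans yx x1).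
- by apply: ointbS (volt_ointb bh hB) => //; exact: ltW.
- by apply: ointbS (volt_ointb bk hC) => //; exact: ltW.
Qed.

Lemma voltZ h B c x : bcont h -> (forall x, 0 < x < 1 -> `|h x| <= B * x `^ nu) -> 0 < x < 1 ->
  volt (fun x => c * h x) x = c * volt h x.
Proof.
move=> bh hB /andP[x0 x1]; rewrite /volt -ointZ.
- by apply: eq_oint => y /andP[_ yx]; rewrite wAZ ?(ltW (lt_trans yx x1))//; ring.
- by apply: ointbS (volt_ointb bh hB) => //; exact: ltW.
Qed.

Lemma wA_jf mu y : 0 < y <= 1 ->
  mu * wA (jf nu mu) y = y `^ nu * (mu / 2 * y ^+ 2 * (y `^ nu * Phi (nu + 1) (mu / 4 * y ^+ 2))).
Proof.
move=> /andP[y0 y1].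
rewrite /wA -ointZ; last by apply: bcont_ointb => //; apply: wA_bcont => //; exact: bcont_jf.
pose F z := z `^ nu * (nu * jf nu mu z - jd nu mu z).
transitivity (F y - 0); last by rewrite subr0 /F /jd opprB addrC subrK.
have [M M0 hM] := jf_bound nu0 mu.
have dF z : 0 < z -> is_derive z 1 F (mu * (z `^ (nu + 1) * jf nu mu z)).
  move=> z0; apply: (derM (der_powR z0 erefl) (derB (derZ (k := nu) (is_derive_jf mu nu0' z0) erefl) (is_derive_jd mu nu0' z0) erefl)).
  rewrite pow_add// powRr1 ?ltW//; move: (powR _ _) (jf _ _ _) (jd _ _ _) => a b c.
  by field; rewrite gt_eqF.
apply: (@ftc_oo R 0 y F _ 0 (F y) y0).
- by apply: ointbZ; apply: bcont_ointb => //; apply: wA_bcont => //; exact: bcont_jf.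
- have [c _] := bcontZ mu (wA_bcont nu0 (bcont_jf nu0 mu)); exact: conS c.
- by move=> z /andP[z0 zy]; exact: dF.
- apply: (@cvg0_dom_left _ _ (nu * M + M) nu nu0) => z /andP[z0 z1].
  have hz : 0 <= z <= 1 by rewrite !ltW.
  have [h1 h2] := hM z hz; have p1 := @pow_le1 R z nu nu0' hz.
  have hMz : M * z `^ nu <= M by rewrite ler_piMr.
  rewrite normrM (ger0_norm (powR_ge0 _ _)) mulrC ler_wpM2r ?powR_ge0//.
  rewrite (le_trans (ler_normB _ _))// lerD//; last exact: le_trans hMz.
  by rewrite normrM (gtr0_norm nu0) ler_wpM2l// (le_trans h1).
- by apply: cvg_at_left_filter; exact: is_derive_cvg (dF y y0).
Qed.

(** The function j with parameter mu solves the homogeneous Volterra equation with initial value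
    Phi_nu(0): the derivative of Phi_nu (mu x^2 / 4) is - mu times the integrand of [volt]. *)
Lemma volt_jf mu x : 0 < x < 1 -> Phi nu (mu / 4 * x ^+ 2) = Phi nu 0 - mu * volt (jf nu mu) x.
Proof.
move=> hx; have /andP[x0 x1] := hx; have [M M0 hM] := jf_bound nu0 mu.
have bj := bcont_jf nu0 mu.
have hB y : 0 < y < 1 -> `|jf nu mu y| <= M * y `^ nu.
  by move=> /andP[y0 y1]; have [|//] := hM y; rewrite !ltW.
have I : ointb 0 x (fun y => y `^ (- (2 * nu + 1)) * wA (jf nu mu) y).
  by apply: ointbS (volt_ointb bj hB) => //; exact: ltW.
have E : (-1) * (mu * volt (jf nu mu) x) = Phi nu (mu / 4 * x ^+ 2) - Phi nu 0.
  rewrite mulrA -ointZ//.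
  apply: (@ftc_oo R 0 x (fun y => Phi nu (mu / 4 * y ^+ 2)) _ _ _ x0).
  - exact: ointbZ.
  - move=> y /andP[y0 yx]; apply: cvgMr; apply: con_gBi => //.
    by rewrite y0 (lt_trans yx).
  - move=> y /andP[y0 yx].
    rewrite (_ : -1 * mu * _ = - (mu / 2 * y) * Phi (nu + 1) (mu / 4 * y ^+ 2)).
      exact: der_Phi_sqr.
    have h1 : 0 < y <= 1 by rewrite y0 ltW// (lt_trans yx).
    rewrite (_ : -1 * mu * _ = - (y `^ (- (2 * nu + 1)) * (mu * wA (jf nu mu) y))); last by ring.
    rewrite (wA_jf mu h1).
    have -> : y `^ (- (2 * nu + 1)) = y `^ (- nu) * y `^ (- nu) / y.
      rewrite -(powR_inv1 (ltW y0)) -!pow_add//; congr (_ `^ _); ring.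
    transitivity ((y `^ nu * y `^ (- nu)) * (y `^ nu * y `^ (- nu)) * (- (mu / 2 * y)) * Phi (nu + 1) (mu / 4 * y ^+ 2)).
      by move: (y `^ nu) (y `^ (- nu)) (Phi _ _) => a b p; field; rewrite gt_eqF.
    by rewrite -pow_add// subrr powRr0 !mul1r.
  - have h0 : Phi nu (mu / 4 * y ^+ 2) @[y --> 0] --> Phi nu (mu / 4 * 0 ^+ 2).
      exact: is_derive_cvg (der_Phi_sqr mu 0 nu0').
    by move: h0; rewrite expr0n /= mulr0 => h0; apply: cvg_at_right_filter.
  - apply: cvg_at_left_filter; exact: is_derive_cvg (der_Phi_sqr mu x nu0').
by rewrite mulN1r in E; rewrite E addrC subrK.
Qed.

(** Halving again, with the weight exp (2 mu x) x^nu: the rate 2 mu is the one for which mu times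
    [volt] has norm at most 1/2. *)
Lemma volt_gronwall (mu de A : R) d : 0 < mu -> 0 <= de -> bcont d ->
  (forall x, 0 < x < 1 -> `|d x| <= A * x `^ nu) ->
  (forall x, 0 < x < 1 -> `|d x| <= (mu * `|volt d x| + de) * x `^ nu) ->
  forall x, 0 < x < 1 -> `|d x| <= 2 * de * expR (2 * mu) * x `^ nu.
Proof.
move=> mu0 de0 bd hA hd x hx.
pose W (t : R) := expR (2 * mu * t) * t `^ nu.
have H : forall t, 0 < t < 1 -> `|d t| <= 2 * de * W t.
  apply: (@halving_bound R (fun t => 0 < t < 1) d W de) => //.
  - by move=> t _; rewrite mulr_ge0 ?expR_ge0 ?powR_ge0.
  - exists `|A| => t ht; have /andP[t0 t1] := ht; apply: le_trans (hA t ht) _; rewrite /W mulrA.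
    apply: ler_wpM2r; first exact: powR_ge0.
    apply: le_trans (ler_norm A) _; rewrite ler_peMr// -expR0 ler_expR.
    by rewrite !mulr_ge0// ltW.
  - move=> B B0 hB t ht; have /andP[t0 t1] := ht; apply: le_trans (hd t ht) _; rewrite /W mulrA.
    apply: ler_wpM2r; first exact: powR_ge0.
    have wB y : 0 < y < 1 -> `|y `^ (- (2 * nu + 1)) * wA d y| <= B * expR (2 * mu * y).
      move=> /andP[y0 y1]; rewrite normrM (ger0_norm (powR_ge0 _ _)).
      have wy : `|wA d y| <= B * expR (2 * mu * y) * y `^ (2 * nu + 1) * (y - 0).
        apply: norm_oint_le_cst; first exact: ltW.
          by apply: bcont_ointb => //; [exact: ltW|exact: wA_bcont].
        move=> z /andP[z0 zy]; rewrite normrM (ger0_norm (powR_ge0 _ _)).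
        apply: (@le_trans _ _ (z `^ (nu + 1) * (B * (expR (2 * mu * z) * z `^ nu)))).
          by rewrite ler_wpM2l ?powR_ge0// hB// z0 (lt_trans zy).
        rewrite (_ : _ * (B * _) = B * expR (2 * mu * z) * (z `^ (nu + 1) * z `^ nu)); last by ring.
        rewrite -pow_add// (_ : nu + 1 + nu = 2 * nu + 1); last by ring.
        apply: ler_pM; rewrite ?mulr_ge0 ?expR_ge0 ?powR_ge0//.
          by rewrite ler_wpM2l// ler_expR ler_wpM2l ?mulr_ge0 ?(ltW mu0) ?(ltW zy).
        by apply: ge0_ler_powR; rewrite ?nnegrE ?addr_ge0 ?mulr_ge0 ?(ltW z0) ?(ltW y0) ?(ltW zy).
      apply: le_trans (ler_wpM2l (powR_ge0 _ _) wy) _; rewrite subr0.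
      rewrite (_ : _ * (_ * _) = B * expR (2 * mu * y) * ((y `^ (- (2 * nu + 1)) * y `^ (2 * nu + 1)) * y)); last by ring.
      rewrite -pow_add// addNr powRr0 mul1r ler_piMr ?(ltW y1)// mulr_ge0 ?expR_ge0//.
    pose E (y : R) := B / (2 * mu) * expR (2 * mu * y).
    have m20 : 2 * mu != 0 by rewrite mulf_neq0 ?gt_eqF.
    have dE y : is_derive y 1 E (B * expR (2 * mu * y)).
      apply: (derZ (derC (is_derive_expR (2 * mu * y)) (derZ (k := 2 * mu) (der_id y) erefl) erefl)).
      by move: (expR _) => e; field; rewrite gt_eqF.
    have cE y : B * expR (2 * mu * z) @[z --> y] --> B * expR (2 * mu * y).
      by apply: cvgMr; apply: is_derive_cvg (derC (is_derive_expR (2 * mu * y)) (derZ (k := 2 * mu) (der_id y) erefl) erefl).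
    have IE : ointb 0 t (fun y => B * expR (2 * mu * y)).
      apply: (@con_ointb _ _ _ _ (B * expR (2 * mu * t))) => [y _|y /andP[y0 yt]]; first exact: cE.
      rewrite ger0_norm ?mulr_ge0 ?expR_ge0// ler_wpM2l// ler_expR ler_wpM2l ?(ltW yt)//.
      by rewrite mulr_ge0// ltW.
    have hV : `|volt d t| <= B / (2 * mu) * expR (2 * mu * t).
      apply: (@le_trans _ _ (oint 0 t (fun y => B * expR (2 * mu * y)))).
        apply: norm_oint_le => //.
          by apply: ointbS (volt_ointb bd hA) => //; exact: ltW.
        by move=> y /andP[y0 yt]; apply: wB; rewrite y0 (lt_trans yt).
      rewrite (@ftc_oo R 0 t E _ (E 0) (E t))//.
      - by rewrite lerBlDr lerDl /E mulr0 expR0 mulr1 divr_ge0// mulr_ge0// ltW.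
      - by apply: cvg_at_right_filter; exact: is_derive_cvg (dE 0).
      - by apply: cvg_at_left_filter; exact: is_derive_cvg (dE t).
    have e1 : 1 <= expR (2 * mu * t) by rewrite -expR0 ler_expR !mulr_ge0// ltW.
    have hm : mu * `|volt d t| <= B / 2 * expR (2 * mu * t).
      rewrite (_ : B / 2 * _ = mu * (B / (2 * mu) * expR (2 * mu * t))); first by rewrite ler_wpM2l// ltW.
      by move: (expR _) => e; field; rewrite gt_eqF.
    rewrite addrC mulrDl lerD//; by rewrite ler_peMr.
apply: le_trans (H x hx) _; rewrite /W mulrA; apply: ler_wpM2r; first exact: powR_ge0.
apply: ler_wpM2l; first by rewrite mulr_ge0.
have /andP[x0 x1] := hx.
by rewrite ler_expR ler_piMr ?(ltW x1)// mulr_ge0// ltW.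
Qed.


Definition pdom B h := forall x, 0 < x < 1 -> `|h x| <= B * x `^ nu.

Lemma pdom_ge0 B h : pdom B h -> 0 <= B.
Proof.
move=> hB; have h12 : 0 < (2^-1 : R) < 1 by apply/andP; split; lra.
by have := le_trans (normr_ge0 _) (hB _ h12); rewrite pmulr_lge0// powR_gt0.
Qed.

Lemma pdomD A B h k : pdom A h -> pdom B k -> pdom (A + B) (fun x => h x + k x).
Proof.
move=> hA hB x hx; rewrite mulrDl (le_trans (ler_normD _ _))// lerD//; [exact: hA|exact: hB].
Qed.

Lemma pdomZ A c h : pdom A h -> pdom (`|c| * A) (fun x => c * h x).
Proof. by move=> hA x hx; rewrite normrM -mulrA ler_wpM2l// hA. Qed.

Lemma pdom_le A h x : pdom A h -> 0 < x < 1 -> `|h x| <= A.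
Proof.
move=> hA hx; have /andP[x0 x1] := hx; apply: le_trans (hA x hx) _.
by rewrite ler_piMr ?(pdom_ge0 hA)// pow_le1// !ltW.
Qed.

Lemma pdom_jf mu : exists A, pdom A (jf nu mu).
Proof.
have [M M0 hM] := jf_bound nu0 mu; exists M => x /andP[x0 x1].
by have [|//] := hM x; rewrite !ltW.
Qed.

Lemma ip_norm_le h k A B : bcont h -> bcont k -> (forall x, 0 < x < 1 -> `|h x| <= A) ->
  (forall x, 0 < x < 1 -> `|k x| <= B) -> `|ip h k| <= A * B.
Proof.
move=> bh bk hA hB; rewrite -[leRHS]mulr1 -[X in _ * X]subr0; apply: norm_oint_le_cst => //.
  exact: bcont_ip.
move=> x hx; have /andP[x0 x1] := hx; rewrite normrM -[leRHS]mul1r ler_pM//.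
  by rewrite gtr0_norm// ltW.
by rewrite normrM ler_pM// ?hA ?hB.
Qed.

(* On the orthogonal complement of the eigenfunctions, [green - r] is bounded below: a solution of
   [green q - r q = w] differs by a multiple of [jf nu (1/r)] from a solution of a Volterra equation,
   and this multiple is controlled by the value at 1 or by the orthogonality. *)
Lemma green_bounded_below (r : R) : 0 < r -> exists2 C, 0 <= C & forall q (N de : R), bcont q -> pdom N q ->
  (forall n, ip q (ef n) = 0) -> q x @[x --> 1^'-] --> 0 -> 0 <= de ->
  pdom de (fun x => green q x - r * q x) -> forall x, 0 < x < 1 -> `|q x| <= C * de.
Proof.
move=> r0; pose mu := r^-1; have mu0 : 0 < mu by rewrite invr_gt0.
have [A hj] := pdom_jf mu; have bj := bcont_jf nu0 mu; have A0 := pdom_ge0 hj.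
pose K := 2 * mu * expR (2 * mu).
have K0 : 0 <= K by rewrite !mulr_ge0 ?expR_ge0// ltW.
have Q0 : 0 < Phi nu 0 by rewrite Phi0// invr_gt0 Gamma_gt0// ltr_wpDl.
have main q (N de : R) : bcont q -> pdom N q -> 0 <= de -> pdom de (fun x => green q x - r * q x) ->
    exists c, bcont (fun x => q x - c * jf nu mu x) /\ pdom (K * de) (fun x => q x - c * jf nu mu x).
  move=> bq hN de0 hw; have [b hb] := green_volt bq hN.
  (* Both q and c j satisfy Volterra equations. This c makes their constants agree, so that the
     difference d solves one whose only source is - mu (G q - r q). *)
  pose c := mu * b / Phi nu 0; exists c; pose d x := q x - c * jf nu mu x.
  have bcj : bcont (fun x => - c * jf nu mu x) by exact: bcontZ.
  have hcj := pdomZ (- c) hj.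
  have dE x : d x = q x + - c * jf nu mu x by rewrite /d mulNr.
  have bd : bcont d by apply: eq_bcont (bcontD bq bcj) => x _; rewrite dE.
  have hd : pdom (N + `|- c| * A) d by move=> x hx; rewrite dE; exact: (pdomD hN hcj hx).
  have Vd x : 0 < x < 1 -> volt d x = volt q x - c * volt (jf nu mu) x.
    move=> hx; have := voltD bq bcj hN hcj hx; rewrite (voltZ _ bj hj hx) mulNr => <-.
    by congr (volt _ x); apply/funext => y; rewrite dE.
  split => //; rewrite (_ : K * de = 2 * (mu * de) * expR (2 * mu)); last by rewrite /K; ring.
  apply: (volt_gronwall mu0 _ bd hd); first by rewrite mulr_ge0// ltW.
  move=> x hx; have /andP[x0 x1] := hx.
  have P0 : 0 < x `^ nu by rewrite powR_gt0.
  have e2 : x `^ nu * x `^ (- nu) = 1 by rewrite -pow_add// subrr powRr0.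
  have key : d x = - mu * (volt d x * x `^ nu) - mu * (green q x - r * q x).
    have hV := volt_jf mu hx; have hG := hb x hx.
    rewrite (Vd x hx) /d /jf.
    have -> : green q x = x `^ nu * (b - volt q x) by rewrite -hG mulrA e2 mul1r.
    rewrite hV /c /mu.
    have rr : r * q x = r * q x by [].
    move: (Phi nu 0) Q0 (volt _ _) (volt _ _) (x `^ nu) (q x) => P PP v w p y.
    by field; rewrite ?gt_eqF.
  rewrite key (le_trans (ler_normB _ _))// mulrDl lerD//.
    by rewrite !normrM normrN (gtr0_norm mu0) (gtr0_norm P0) mulrA.
  rewrite normrM (gtr0_norm mu0) -mulrA ler_wpM2l ?(ltW mu0)//; exact: hw.
(* If j vanishes at 1, then mu is some gam_n^2 and c is estimated through the orthogonality of q to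
   e_n; otherwise it is estimated by letting x tend to 1, where q tends to 0. *)
have [j1|j1] := eqVneq (jf nu mu 1) 0.
  have sm : Num.sqrt mu ^+ 2 = mu by rewrite sqr_sqrtr// ltW.
  have z0 : 0 < Num.sqrt mu by rewrite sqrtr_gt0.
  have [n zn] : exists n, Num.sqrt mu = gam nu n.
    by apply: zero_is_gam => //; apply/eqP; rewrite besselJ_eq0// -jf_at1 sm j1.
  have Ij : 0 < ip (jf nu mu) (jf nu mu).
    have := jf_sqr_gt0 nu0 mu0; congr (0 < _); apply: eq_oint => x _; by rewrite expr2.
  pose kn := efc nu n * (gam nu n / 2) `^ nu.
  have knE x : 0 < x < 1 -> ef n x = kn * jf nu mu x.
    by move=> /andP[x0 _]; rewrite (efE nu0 _ (ltW x0)) -zn sm zn.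
  have kn0 : kn != 0.
    apply/eqP => k0; have := ef_norm nu0 n.
    rewrite (@eq_ip _ _ (fun x => kn * jf nu mu x) _ (ef n))//.
    by rewrite ipZl ?k0 ?mul0r//; [move/eqP; rewrite eq_sym oner_eq0|exact: bcont_ef].
  exists (K + K * A / ip (jf nu mu) (jf nu mu) * A).
    by rewrite addr_ge0 ?mulr_ge0// ?invr_ge0// ltW.
  move=> q N de bq hN qo _ de0 hw x hx; have [c [bd hd]] := main q N de bq hN de0 hw.
  have qj : ip q (jf nu mu) = 0.
    have := qo n; rewrite ipC (@eq_ip _ _ (fun x => kn * jf nu mu x) _ q)// ipZl// ipC => /eqP.
    by rewrite mulf_eq0 (negbTE kn0) => /eqP.
  have cE : c * ip (jf nu mu) (jf nu mu) = - ip (fun x => q x - c * jf nu mu x) (jf nu mu).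
    rewrite -ipZl// ipBl//; last exact: bcontZ.
    by rewrite qj sub0r opprK.
  have c_le : `|c| <= K * A / ip (jf nu mu) (jf nu mu) * de.
    have cI : `|c| * ip (jf nu mu) (jf nu mu) = `|ip (fun x => q x - c * jf nu mu x) (jf nu mu)|.
      by rewrite -{1}(gtr0_norm Ij) -normrM cE normrN.
    rewrite mulrAC ler_pdivlMr// cI.
    apply: le_trans (ip_norm_le bd bj (fun y hy => pdom_le hd hy) (fun y hy => pdom_le hj hy)) _.
    by rewrite mulrAC.
  have -> : q x = (q x - c * jf nu mu x) + c * jf nu mu x by rewrite subrK.
  rewrite (le_trans (ler_normD _ _))// mulrDl lerD//; first exact: pdom_le hd hx.
  by rewrite normrM mulrAC ler_pM//; exact: pdom_le hj hx.
exists (K + K / `|jf nu mu 1| * A).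
  by apply: addr_ge0 => //; apply: mulr_ge0 => //; apply: mulr_ge0 => //; rewrite invr_ge0.
move=> q N de bq hN _ q1 de0 hw x hx; have [c [bd hd]] := main q N de bq hN de0 hw.
have c_le : `|c| <= K / `|jf nu mu 1| * de.
  rewrite mulrAC ler_pdivlMr ?normr_gt0// -normrM.
  have cj : jf nu mu y @[y --> 1^'-] --> jf nu mu 1.
    apply: cvg_at_left_filter; exact: is_derive_cvg (is_derive_jf mu nu0' ltr01).
  have cd : `|q y - c * jf nu mu y| @[y --> 1^'-] --> `|0 - c * jf nu mu 1|.
    by apply: cvg_norm; apply: cvgB => //; exact: cvgMr.
  rewrite -[X in `|X|]opprK normrN -[- (c * _)]sub0r.
  apply: (cvg_near_le _ cd).
  near=> y; apply: (pdom_le hd); apply/andP; split; near: y; [exact: nbhs_left_gt|exact: nbhs_left_lt].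
have -> : q x = (q x - c * jf nu mu x) + c * jf nu mu x by rewrite subrK.
rewrite (le_trans (ler_normD _ _))// mulrDl lerD//; first exact: pdom_le hd hx.
by rewrite normrM mulrAC ler_pM//; exact: pdom_le hj hx.
Unshelve. all: by end_near. Qed.


Definition giter m h := iter m green h.

Lemma bcont_giter m h : bcont h -> bcont (giter m h).
Proof. by move=> bh; elim: m => // m IH; exact: bcont_green. Qed.

(** The first application of G turns the norm into a pointwise bound, by [wA_L2]; each further one
    gains a power of x, up to the limit nu imposed by the homogeneous solution x^nu. *)
Lemma giter_smooth m h x : bcont h -> 0 < x < 1 ->
  `|giter m.+1 h x| <= Num.sqrt (ip h h) * x `^ (Num.min m%:R nu).
Proof.
move=> bh; elim: m x => [|m IH] x hx.
  have := @green_le R nu nu0 h (Num.sqrt (ip h h)) 1 x bh (sqrtr_ge0 _) _ hx.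
  by rewrite subrr; apply => y hy; exact: wA_L2.
have m0 : 0 <= Num.min m%:R nu by rewrite le_min ler0n.
have := @green_le R nu nu0 (giter m.+1 h) (Num.sqrt (ip h h)) (Num.min m%:R nu + 2) x (bcont_giter _ bh) (sqrtr_ge0 _) _ hx.
move=> H; apply: le_trans (H _) _.
  by move=> y /andP[y0 y1]; apply: wA_le => //; [exact: bcont_giter|rewrite y0 ltW].
rewrite ler_wpM2l ?sqrtr_ge0// (_ : Num.min (Num.min m%:R nu + 2 - 1) nu = Num.min m.+1%:R nu)//.
rewrite -natr1; case: (leP (m%:R : R) nu) => mn; first by congr Num.min; ring.
by rewrite !min_r//; lra.
Qed.

Lemma giterD m n h : giter m (giter n h) = giter (m + n) h.
Proof. by rewrite /giter iterD. Qed.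

Lemma giter_combo m h k c x : bcont h -> bcont k -> 0 < x < 1 ->
  giter m (fun x => h x - c * k x) x = giter m h x - c * giter m k x.
Proof.
move=> bh bk; elim: m x => // m IH x hx; have /andP[x0 _] := hx.
rewrite /giter !iterS -/(giter m _) -/(giter m h) -/(giter m k).
rewrite (eq_green nu x0 IH) -mulNr -(greenZ nu0 (- c) (bcont_giter m bk) x0).
rewrite -(greenD nu0 (bcont_giter m bh) (bcontZ (- c) (bcont_giter m bk)) x0).
by apply: eq_green => // y _; rewrite mulNr.
Qed.

Lemma green_inj h : bcont h -> (forall x, 0 < x < 1 -> green h x = 0) -> forall x, 0 < x < 1 -> h x = 0.
Proof.
move=> bh g0 x hx; have nz y : 0 < y < 1 -> \forall z \near y, 0 < z < 1.
  move=> /andP[y0 y1]; near=> z.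
  by apply/andP; split; near: z; [exact: lt_nbhsr|exact: lt_nbhsl].
have D0 y : 0 < y < 1 -> gD nu h y = 0.
  move=> hy; have [d _] := green_pair nu0 bh hy; have /andP[y0 _] := hy.
  have d2 : is_derive y 1 (fun=> 0 : R) (gD nu h y / y).
    apply: near_eq_is_derive d; have := nz y hy; apply: filterS => z hz; exact: g0.
  have := @derive_val _ _ _ _ _ _ _ d2; rewrite derive_cst => /esym/eqP.
  by rewrite mulf_eq0 invr_eq0 (gt_eqF y0) orbF => /eqP.
have [_ d] := green_pair nu0 bh hx; have /andP[x0 _] := hx.
have d2 : is_derive x 1 (fun=> 0 : R) (nu ^+ 2 * green h x / x - x * h x).
  apply: near_eq_is_derive d; have := nz x hx; apply: filterS => z hz; exact: D0.
have := @derive_val _ _ _ _ _ _ _ d2; rewrite derive_cst g0// mulr0 mul0r sub0r => /esym/eqP.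
by rewrite oppr_eq0 mulf_eq0 (gt_eqF x0) => /eqP.
Unshelve. all: by end_near. Qed.

Lemma ip_green_le h : bcont h -> ip (green h) (green h) <= ip h h.
Proof.
move=> bh; have bg := bcont_green nu0 bh.
have H x : 0 < x < 1 -> `|green h x| <= Num.sqrt (ip h h).
  move=> hx; have := @giter_smooth 0 h x bh hx.
  by rewrite min_l// powRr0 mulr1.
apply: le_trans (ler_norm _) _; apply: le_trans (ip_norm_le bg bg H H) _.
by rewrite -expr2 sqr_sqrtr// ip_ge0.
Qed.

Lemma giter_orth m h n : bcont h -> ip h (ef n) = 0 -> ip (giter m h) (ef n) = 0.
Proof.
move=> bh h0; elim: m => // m IH; have bm := bcont_giter m bh.
transitivity (ip (giter m h) (green (ef n))); first by apply: green_sym => //; exact: bcont_ef.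
transitivity (ip (fun x => (gam nu n ^+ 2)^-1 * ef n x) (giter m h)).
  by rewrite ipC; apply: eq_ip => // x hx; rewrite green_ef// mulrC.
by rewrite ipZl//; [rewrite ipC IH mulr0|exact: bcont_ef].
Qed.

Lemma ip_combo_sqr h k c : bcont h -> bcont k ->
  ip (fun x => h x + c * k x) (fun x => h x + c * k x) = ip h h + 2 * c * ip h k + c ^+ 2 * ip k k.
Proof.
move=> bh bk; have bck := bcontZ c bk; have bs := bcontD bh bck.
rewrite (ipDl bh bck bs) (ipZl _ bk bs) (ipC h (fun x => _)) (ipC k (fun x => _)).
rewrite (ipDl bh bck bh) (ipDl bh bck bk) (ipZl _ bk bh) (ipZl _ bk bk) (ipC k h).
ring.
Qed.

Theorem ef_complete g : bcont g -> (forall n, ip g (ef n) = 0) -> forall x, 0 < x < 1 -> g x = 0.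
Proof.
move=> bg go; apply: ip_eq0 => //; apply: contrapT => /eqP g0.
pose a (k : nat) := ip (giter k g) (giter k g).
have aE (k : nat) : a k = ip (giter k g) (giter k g) by [].
clearbody a.
have bi (k : nat) := bcont_giter k bg.
have a0 (k : nat) : 0 < a k.
  elim: k => [|k IH]; rewrite aE; first by rewrite lt_neqAle eq_sym g0 ip_ge0.
  rewrite lt_neqAle ip_ge0 andbT eq_sym; apply/eqP => ak.
  have /(green_inj (bi k)) h0 := ip_eq0 (bi k.+1) ak.
  move: IH; rewrite aE (@eq_ip _ _ (fun x => 0 * g x) _ (giter k g))//; last by move=> x hx; rewrite mul0r h0.
  by rewrite ipZl// mul0r ltxx.
pose rho (k : nat) := a k.+1 / a k.
have rho0 (k : nat) : 0 < rho k by rewrite divr_gt0.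
have ip2 (k : nat) : ip (giter k g) (giter k.+2 g) = a k.+1.
  by rewrite aE; exact: esym (green_sym nu0 (bi k) (bi k.+1)).
have ipos (k : nat) : 0 <= ip (giter k.+1 g) (giter k g) by exact: (ip_green_ge0 nu0 (bi k)).
have rhoS (k : nat) : rho k <= rho k.+1.
  have h : a k.+1 ^+ 2 <= a k * a k.+2 by rewrite -ip2 !aE; exact: ip_cauchy.
  by rewrite /rho ler_pdivlMr// mulrAC ler_pdivrMr// -expr2 mulrC.
have rho1 (k : nat) : rho k <= 1 by rewrite /rho ler_pdivrMr// mul1r !aE; exact: (ip_green_le (bi k)).
have ndr : nondecreasing_seq rho by apply/nondecreasing_seqP.
have cvr : rho n @[n --> \oo] --> limn rho.
  by apply: nondecreasing_is_cvgn => //; exists 1 => _ [k _ <-].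
pose s := limn rho.
have rs (k : nat) : rho k <= s by apply: nondecreasing_cvgn_le => //; apply/cvg_ex; exists s.
have s0 : 0 < s by exact: lt_le_trans (rho0 0%N) (rs 0%N).
pose r := Num.sqrt s; have r0 : 0 < r by rewrite sqrtr_gt0.
have r2 : r * r = s by rewrite -expr2 sqr_sqrtr// ltW.
have [C C0 hC] := green_bounded_below r0.
(* After m + 1 applications of G a function is O(x^nu), as [green_bounded_below] demands. *)
pose m := Num.bound nu.
have num : nu <= m%:R by apply/ltW/archi_boundP.
(* The squared norm of (G^2 - s) G^k g divided by that of G^k g. It tends to s^2 - 2 s^2 + s^2 = 0
   as the ratios [rho] tend to s. *)
pose eps (k : nat) := rho k.+1 * rho k - 2 * s * rho k + s * s.
have epsE (k : nat) : ip (fun x => giter k.+2 g x - s * giter k g x) (fun x => giter k.+2 g x - s * giter k g x) = a k * eps k.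
  have := ip_combo_sqr (- s) (bi k.+2) (bi k).
  rewrite (ipC (giter k.+2 g) (giter k g)) ip2 -!aE.
  under [X in ip X _]eq_fun do rewrite mulNr; under [X in ip _ X]eq_fun do rewrite mulNr.
  move=> ->.
  rewrite /eps /rho; have ak := a0 k; have ak1 := a0 k.+1.
  by move: (a k) (a k.+1) (a k.+2) ak ak1 => x y z x0 y0; field; rewrite !gt_eqF.
have eps0 (k : nat) : 0 <= eps k.
  have : 0 <= a k * eps k by rewrite -epsE ip_ge0.
  by rewrite pmulr_rge0.
(* The ratios being nondecreasing, G^j loses at most the factor rho_0^j in squared norm. *)
have ak_ge (k j : nat) : rho 0%N ^+ j * a k <= a (j + k)%N.
  elim: j => [|j IH]; first by rewrite expr0 mul1r.
  rewrite exprS -mulrA; apply: (@le_trans _ _ (rho 0%N * a (j + k)%N)).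
    by rewrite ler_wpM2l// ltW.
  rewrite addSn -[a (j + k).+1](divfK (lt0r_neq0 (a0 (j + k)%N))).
  by rewrite ler_wpM2r ?(ltW (a0 _))//; exact: ndr.
have key (k : nat) : s * rho 0%N ^+ m.+1 <= C ^+ 2 * eps k.
  (* Here q = (G + r) G^(m+1+k) g, so that (G - r) q = G^(m+1) (G^2 - s) G^k g is small. Since G is
     positive, G + r multiplies norms by at least r, which is [I2]. *)
  pose q x := giter (m.+1 + k).+1 g x + r * giter (m.+1 + k) g x.
  have b1 : bcont (fun x => r * giter (m.+1 + k) g x) by exact: bcontZ.
  have bq : bcont q by exact: bcontD.
  pose w x := giter k.+2 g x - s * giter k g x.
  have bw : bcont w by apply: bcontB => //; exact: bcontZ.
  have minm : Num.min (m%:R : R) nu = nu by rewrite min_r.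
  have dom (j : nat) : exists N : R, pdom N (giter (m.+1 + j) g).
    exists (Num.sqrt (ip (giter j g) (giter j g))) => x hx; rewrite /giter iterD.
    by have := @giter_smooth m (giter j g) x (bi j) hx; rewrite minm.
  have [N1 hN1] := dom k.+1; have [N0 hN0] := dom k.
  have hq : pdom (N1 + `|r| * N0) q.
    by apply: pdomD; [move: hN1; rewrite addnS|exact: pdomZ].
  have qw x : 0 < x < 1 -> green q x - r * q x = giter m.+1 w x.
    move=> hx; have /andP[x0 _] := hx.
    rewrite /w giter_combo// /q greenD// greenZ//.
    rewrite !giterD 2!(addnS m.+1) -r2.
    change (green (giter (m.+1 + k).+1 g) x) with (giter (m.+1 + k).+2 g x).
    change (green (giter (m.+1 + k) g) x) with (giter (m.+1 + k).+1 g x).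
    move: (giter _.+2 g x) (giter _.+1 g x) (giter _ g x) => u v t; ring.
  have de0 := sqrtr_ge0 (ip w w).
  have hw : pdom (Num.sqrt (ip w w)) (fun x => green q x - r * q x).
    by move=> x hx; rewrite qw//; have := @giter_smooth m w x bw hx; rewrite minm.
  have qo n : ip q (ef n) = 0.
    have be := bcont_ef nu0 n; rewrite (ipDl (bi _) b1 be) (ipZl _ (bi _) be).
    transitivity (0 + r * 0 : R); last by rewrite mulr0 addr0.
    congr (_ + _ * _); [exact: (giter_orth (m.+1 + k).+1 bg (go n))|exact: (giter_orth (m.+1 + k) bg (go n))].
  have q1 : q x @[x --> 1^'-] --> 0.
    rewrite -[X in _ --> X]addr0 -[X in _ --> _ + X](mulr0 r); apply: cvgD; first exact: (green_cvg1 nu0 (bi (m.+1 + k)%N)).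
    by apply: cvgMr; exact: (green_cvg1 nu0 (bi (m + k)%N)).
  have hb := hC q _ _ bq hq qo q1 de0 hw.
  have I1 : ip q q <= C ^+ 2 * (a k * eps k).
    apply: le_trans (ler_norm _) _; apply: le_trans (ip_norm_le bq bq hb hb) _.
    by rewrite mulrACA -!expr2 sqr_sqrtr ?ip_ge0// epsE.
  have I2 : s * a (m.+1 + k)%N <= ip q q.
    have g1 := ipos (m.+1 + k)%N.
    have Eq : ip q q = a (m.+1 + k).+1 + 2 * r * ip (giter (m.+1 + k).+1 g) (giter (m.+1 + k) g) + s * a (m.+1 + k)%N.
      by rewrite (aE (m.+1 + k).+1) (aE (m.+1 + k)%N) -r2 -expr2; exact: (ip_combo_sqr r (bi (m.+1 + k).+1) (bi (m.+1 + k)%N)).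
    rewrite Eq; move: (ip (giter _ g) _) (a _.+1) (ltW (a0 (m.+1 + k).+1)) (a (m.+1 + k)%N) g1 => u v v0 v' u0.
    have : 0 <= 2 * r * u by rewrite !mulr_ge0// ltW.
    lra.
  have := le_trans I2 I1; have := ak_ge k m.+1; move=> h1 h2.
  have : s * rho 0%N ^+ m.+1 * a k <= C ^+ 2 * eps k * a k.
    rewrite -mulrA -[leRHS]mulrA (mulrC (eps k)); apply: le_trans h2.
    by rewrite ler_wpM2l// ltW.
  by rewrite ler_pM2r.
have ce : C ^+ 2 * eps k @[k --> \oo] --> 0.
  rewrite -[X in _ --> X](mulr0 (C ^+ 2)); apply: cvgMr.
  rewrite [X in _ --> X](_ : 0 = s * s - 2 * s * s + s * s); last by ring.
  apply: cvgD; last exact: cvg_cst.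
  apply: cvgB; last by apply: cvgMr.
  by apply: cvgM => //; have := cvr; rewrite -(cvg_shiftS rho).
have : s * rho 0%N ^+ m.+1 <= 0.
  rewrite -oppr_ge0 -[leRHS]sub0r -[X in _ - X]opprK.
  have ce2 : - (C ^+ 2 * eps k) @[k --> \oo] --> - 0 by exact: cvgN.
  have := cvg_near_le (c := - (s * rho 0%N ^+ m.+1)) _ ce2; rewrite oppr0 sub0r opprK.
  apply; apply: nearW => k; by rewrite lerN2.
by rewrite leNgt mulr_gt0// exprn_gt0.
Qed.

End Completeness.

(** * Functions with an integrable derivative *)

Section EverywhereDerivative.
Context {R : realType}.
Notation leb := (@lebesgue_measure R).
Implicit Types (V v psi : R -> R) (a b c d x y s t : R).

Section OpenMajorant.
Variables (c d eta : R) (psi : R -> R).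
Hypotheses (cd : c < d) (eta0 : 0 < eta).
Let D : set (measurableTypeR R) := `[c, d[%classic.
Hypotheses (Ipsi : leb.-integrable D (EFin \o psi)) (psi0 : forall x, D x -> 0 <= psi x).

(** The layers E_k, where psi lies between k eta and (k + 1) eta, are covered by open sets U_k of
    nearly the same measure, and G(t) sums (k + 1) eta times the measure of U_k in [c, t[. Openness
    makes the slopes of G to the right of a point s of E_k at least (k + 1) eta > psi(s). The total
    exceeds the integral of psi by at most eta (d - c) for the discretization and eta for the
    coverings. *)
Lemma open_majorant : exists G : R -> R, [/\ G c = 0,
  G d <= \int[leb]_(x in D) psi x + eta * (d - c) + eta,
  (forall s t, s <= t -> t <= d -> G s <= G t) &
  forall s, c <= s < d -> \forall t \near s^'+, t <= d -> psi s * (t - s) <= G t - G s].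
Proof.
have mD : measurable D by exact: measurable_itv.
have mpsi : measurable_fun D psi by exact: rint_measurable Ipsi.
pose lev k : R := k.+1%:R * eta.
pose E k : set (measurableTypeR R) := D `&` psi @^-1` `[k%:R * eta, lev k[%classic.
have mE k : measurable (E k) by apply: mpsi => //; exact: measurable_itv.
have lev0 k : 0 < lev k by rewrite mulr_gt0.
have muD : (leb D < +oo)%E by rewrite lebesgue_measure_itv /= lte_fin cd -EFinB ltry.
have muE k : (leb (E k) < +oo)%E.
  by apply: le_lt_trans muD; apply: le_measure; rewrite ?inE//; exact: subIsetl.
have [U hU] : {U : nat -> set R & forall k, [/\ open (U k), E k `<=` U k &
    (leb (U k `\` E k) < (eta / (2 ^ k.+1)%:R / lev k)%:E)%E]}.
  have H k : {Uk : set R | [/\ open Uk, E k `<=` Uk & (leb (Uk `\` E k) < (eta / (2 ^ k.+1)%:R / lev k)%:E)%E]}.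
    apply: cid; apply: (lebesgue_regularity_outer (mE k) (muE k)).
    by rewrite !divr_gt0// ltr0n expn_gt0.
  by exists (fun k => sval (H k)) => k; exact: (svalP (H k)).
have mU k : measurable (U k : set (measurableTypeR R)) by have [oU _ _] := hU k; exact: open_measurable.
pose u t k := ((lev k)%:E * leb (U k `&` `[c, t[%classic))%E.
have u0 t k : (0 <= u t k)%E by rewrite mule_ge0// lee_fin ltW.
pose S t := (\sum_(k <oo) u t k)%E.
have S0 t : (0 <= S t)%E by apply: nneseries_ge0.
have Sc : S c = 0%E.
  by apply: eseries0 => k _ _; rewrite /u set_itv_ge ?setI0 ?measure0 ?mule0// bnd_simp ltxx.
have Sd : (S d <= (\int[leb]_(x in D) psi x + eta * (d - c) + eta)%:E)%E.
  have h1 k : (u d k <= \int[leb]_(x in E k) (psi x + eta)%:E + (eta / (2 ^ k.+1)%:R)%:E)%E.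
    have h2 : (leb (U k `&` `[c, d[%classic) <= leb (E k) + (eta / (2 ^ k.+1)%:R / lev k)%:E)%E.
      have [_ EU lU] := hU k.
      apply: (@le_trans _ _ (leb (E k `|` (U k `\` E k)))).
        apply: le_measure; rewrite ?inE.
        - by apply: measurableI => //; exact: measurable_itv.
        - by apply: measurableU => //; exact: measurableD.
        - by move=> x [Ux _]; case: (pselect (E k x)) => h; [left|right].
      apply: le_trans (measureU2 _ _ _) _ => //; first exact: measurableD.
      by apply: leeD => //; exact: ltW.
    apply: (@le_trans _ _ ((lev k)%:E * (leb (E k) + (eta / (2 ^ k.+1)%:R / lev k)%:E))%E).
      by rewrite /u lee_wpmul2l// lee_fin ltW.
    rewrite ge0_muleDr ?lee_fin ?divr_ge0 ?(ltW eta0) ?(ltW (lev0 _))//.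
    rewrite -EFinM mulrCA divff ?mulr1 ?(gt_eqF (lev0 k))//.
    apply: leeD => //; rewrite -integral_cst//.
    apply: ge0_le_integral => //.
    - by move=> x _; rewrite lee_fin ltW.
    - apply/measurable_EFinP/measurable_funD => //; apply: measurable_funS mpsi => //; exact: subIsetl.
    - by move=> x [_]; rewrite /= in_itv /= => /andP[h _]; rewrite lee_fin /lev -natr1 mulrDl mul1r lerD2r.
  apply: (@le_trans _ _ (\sum_(k <oo) (\int[leb]_(x in E k) (psi x + eta)%:E + (eta / (2 ^ k.+1)%:R)%:E))%E).
    by apply: lee_nneseries.
  apply: le_trans (epsilon_trick _ _ _) _; last 1 first.
  - rewrite EFinD; apply: leeD => //.
    have tE : trivIset setT E.
      apply/trivIsetP => i j _ _ ij; rewrite /E setIACA setIid.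
      apply/seteqP; split => // x /=.
      rewrite !in_itv /= => -[_ [/andP[i1 i2] /andP[j1 j2]]].
      have := le_lt_trans i1 j2; have := le_lt_trans j1 i2; rewrite !ltr_pM2r// !ltr_nat !ltnS => ji ij'.
      by move: ij; rewrite eqn_leq ij' ji.
    have UE : \bigcup_k E k = D.
      apply/seteqP; split => [x [k _ []]//|x Dx].
      have p0 : 0 <= psi x / eta by rewrite divr_ge0 ?psi0// ltW.
      have /andP[h1' h2'] := truncn_itv p0.
      exists (Num.truncn (psi x / eta)) => //; split => //=; rewrite in_itv /= /lev.
      by rewrite -ler_pdivlMr// h1' -ltr_pdivrMr.
    rewrite -ge0_integral_bigcup//.
    + rewrite UE; have Ic : leb.-integrable D (EFin \o (cst eta)).
        by apply: measurable_bounded_integrable => //; exists `|eta|; split => // y yM x _ /=; exact: ltW.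
      have -> : (\int[leb]_(x in D) (psi x + eta)%:E)%E = (\int[leb]_(x in D) ((EFin \o psi) x + (EFin \o cst eta) x))%E.
        by apply: eq_integral => x _ /=; rewrite EFinD.
      rewrite integralD// [X in (_ + X <= _)%E](_ : _ = (eta * (d - c))%:E); last first.
        rewrite /= integral_cst// [X in (_ * X)%E](_ : _ = (d - c)%:E) ?EFinM//.
        by rewrite -[LHS]/(leb `[c, d[%classic) lebesgue_measure_itv /= lte_fin cd EFinB.
      rewrite EFinD leeD2r// /Rintegral fineK//.
      exact: integrable_fin_num.
    + rewrite UE; apply/measurable_EFinP/measurable_funD => //.
    + by rewrite UE => x Dx; rewrite lee_fin addr_ge0 ?psi0// ltW.
  - by move=> k; apply: integral_ge0 => x [Dx _]; rewrite lee_fin addr_ge0 ?psi0// ltW.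
  - exact: ltW.
have mI x y : measurable (`[x, y[%classic : set (measurableTypeR R)) by exact: measurable_itv.
have Smono s t : s <= t -> (S s <= S t)%E.
  move=> st; apply: lee_nneseries => // k _; rewrite /u lee_wpmul2l ?lee_fin ?(ltW (lev0 k))//.
  apply: le_measure; rewrite ?inE; [exact: measurableI|exact: measurableI|].
  by apply: setIS => x; rewrite /= !in_itv /= => /andP[-> xs]; exact: lt_le_trans st.
have Sfin t : t <= d -> S t \is a fin_num.
  by move=> td; rewrite ge0_fin_numE// (le_lt_trans (le_trans (Smono t d td) Sd))// ltry.
have Sinc s t k : c <= s -> s < t -> `[s, t[ `<=` U k -> (S s + (lev k * (t - s))%:E <= S t)%E.
  move=> cs st sU; pose w j := ((lev j)%:E * leb (U j `&` `[s, t[%classic))%E.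
  have w0 j : (0 <= w j)%E by rewrite mule_ge0// lee_fin ltW.
  have -> : S t = (\sum_(j <oo) (u s j + w j))%E.
    apply: eq_eseriesr => j _; rewrite /u /w -ge0_muleDr// -measureU//; [|exact: measurableI|exact: measurableI|].
    - rewrite -setIUr; congr (_ * leb (_ `&` _))%E; apply/seteqP; split => x /=; rewrite !in_itv /=.
        by move=> /andP[-> xt]; case: (ltP x s) => xs; [left|right].
      by case=> /andP[h1 h2]; [rewrite h1 (lt_trans h2)|rewrite h2 (le_trans cs)].
    - apply/seteqP; split => // x [[_ +] [_ +]]; rewrite /= !in_itv /= => /andP[_ xs] /andP[sx _].
      by rewrite ltNge sx in xs.
  rewrite nneseriesD//; apply: leeD => //; rewrite (@nneseriesD1 _ _ k)//.
  have -> : w k = (lev k * (t - s))%:E.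
    rewrite /w (_ : U k `&` _ = `[s, t[%classic); last by apply/setIidPr.
    by rewrite lebesgue_measure_itv /= lte_fin st -EFinB -EFinM.
  by rewrite leeDl//; apply: nneseries_ge0.
exists (fine \o S); split => /=.
- by rewrite Sc.
- by rewrite -lee_fin fineK// Sfin.
- move=> s t st td; apply: fine_le; [by apply: Sfin; exact: le_trans td|exact: Sfin|exact: Smono].
move=> s /andP[cs sd].
have Ds : D s by rewrite /D /= in_itv /= cs.
have p0 : 0 <= psi s / eta by rewrite divr_ge0 ?psi0// ltW.
have /andP[h1 h2] := truncn_itv p0; set k := Num.truncn (psi s / eta) in h1 h2.
have psk : psi s <= lev k by rewrite /lev -ler_pdivrMr// ltW.
have Es : E k s.
  by split => //=; rewrite in_itv /= /lev -ler_pdivlMr// h1 -ltr_pdivrMr.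
have [oU EU _] := hU k; have Us := EU s Es.
have [e /= e0 he] : nbhs s (U k) by exact: open_nbhs_nbhs.
near=> t => td.
have st : s < t by near: t; exact: nbhs_right_gt.
have tse : t < s + e by near: t; apply: nbhs_right_lt; rewrite ltrDl.
have sU : `[s, t[ `<=` U k.
  move=> x; rewrite /= in_itv /= => /andP[sx xt]; apply: he => /=.
  by rewrite distrC ger0_norm ?subr_ge0// ltrBlDl (lt_trans xt).
have := Sinc s t k cs st sU.
rewrite -[S s](fineK (Sfin s (ltW sd))) -[S t](fineK (Sfin t td)) -EFinD lee_fin => /= h.
have : psi s * (t - s) <= lev k * (t - s) by rewrite ler_wpM2r// subr_ge0 ltW.
lra.
Unshelve. all: by end_near. Qed.

End OpenMajorant.

(** Continuous induction on the points t where V(t) - V(c) <= G(t) + eta (t - c), for G from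
    [open_majorant]. Their supremum is one of them because V is continuous and G nondecreasing, and
    it cannot be below d because of the slopes at that point. Then eta tends to 0. *)
Lemma increment_le_majorant V dV psi c d : c < d -> leb.-integrable `[c, d[ (EFin \o psi) ->
  (forall x, c <= x <= d -> is_derive x 1 V (dV x)) ->
  (forall x, c <= x < d -> 0 <= psi x) -> (forall x, c <= x < d -> dV x <= psi x) ->
  V d - V c <= \int[leb]_(x in `[c, d[) psi x.
Proof.
move=> cd Ipsi dVE psi0 dVpsi.
have Dp x : (`[c, d[%classic : set R) x -> 0 <= psi x by rewrite /= in_itv /=; exact: psi0.
have main (eta : R) : 0 < eta -> V d - V c <= \int[leb]_(x in `[c, d[) psi x + eta * (d - c) + eta + eta * (d - c).
  move=> eta0; have [G [Gc Gd Gm Gi]] := open_majorant cd eta0 Ipsi Dp.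
  pose H t := V t - V c <= G t + eta * (t - c).
  suff Hd : H d by rewrite (le_trans Hd)// lerD2r.
  pose A := [set t | c <= t <= d /\ H t].
  have Ac : A c by split; [rewrite lexx ltW|rewrite /H !subrr Gc mulr0 addr0].
  have ubA : has_ubound A by exists d => t [/andP[]].
  have supA : has_sup A by split => //; exists c.
  pose s := sup A.
  have cs : c <= s by exact: ub_le_sup.
  have sd : s <= d by apply: ge_sup; [exists c|move=> t [/andP[]]].
  have cV x : c <= x <= d -> V y @[y --> x] --> V x by move=> hx; exact: is_derive_cvg (dVE x hx).
  have As : A s.
    split; first by rewrite cs.
    rewrite /H -subr_ge0; apply/ler_addgt0Pl => e e0; rewrite -lerBlDr sub0r.
    have hs : c <= s <= d by rewrite cs.
    have [r /= r0 hr] : \forall y \near s, `|V s - V y| <= e by exact: (cvgrPdist_le _ _).1 (cV s hs) _ e0.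
    have [t [/andP[ct td] Ht] st] := sup_adherent r0 supA.
    have ts : t <= s by apply: ub_le_sup => //; split=> //; rewrite ct.
    have h1 : `|V s - V t| <= e.
      by apply: hr => /=; rewrite ger0_norm ?subr_ge0// ltrBlDl -ltrBlDr.
    have h2 : V s - V t <= e by rewrite (le_trans (ler_norm _)).
    have h3 := Gm t s ts sd; rewrite /H in Ht.
    have h4 : eta * (t - c) <= eta * (s - c) by rewrite ler_pM2l// lerD2r.
    by move: h2 h3 Ht h4; move: (eta * _) (eta * _) (G _) (G _) (V _) (V _) (V _) => *; lra.
  have [sd'|] := ltP s d; last by move=> ds; rewrite (_ : d = s)//; [have [] := As|apply/eqP; rewrite eq_le ds sd].
  have hs : c <= s < d by rewrite cs.
  have Gs := Gi s hs.
  have hs' : c <= s <= d by rewrite cs.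
  have Vs : \forall t \near s^'+, V t - V s <= (dV s + eta) * (t - s).
    have ds := dVE s hs'.
    have [dd dE] := ds.
    have : h^-1 *: (V (h *: 1 + s) - V s) @[h --> 0^'] --> dV s.
      by move: dd; rewrite /derivable => /cvg_ex[l hl]; rewrite -dE; move: (hl) => /cvg_lim; rewrite /derive => -> //.
    move=> /cvgrPdist_le /(_ _ eta0)[e /= e0 he].
    near=> t; have st : s < t by near: t; exact: nbhs_right_gt.
    have tse : t < s + e by near: t; apply: nbhs_right_lt; rewrite ltrDl.
    have hh : 0 < t - s by rewrite subr_gt0.
    have := he (t - s); rewrite /= sub0r normrN gtr0_norm// ltrBlDl => /(_ tse).
    rewrite gt_eqF// => /(_ isT); rewrite /GRing.scale /= mulr1 subrK => h.
    have : (t - s)^-1 * (V t - V s) <= dV s + eta.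
      by move: h; rewrite distrC => /(le_trans (ler_norm _)); rewrite lerBlDl.
    by rewrite mulrC ler_pdivrMr.
  exfalso; have [t [st [td [h1 h2]]]] : exists t, s < t /\ t <= d /\ (V t - V s <= (dV s + eta) * (t - s)) /\
      (t <= d -> psi s * (t - s) <= G t - G s).
    near (s^'+) => t; exists t; split; first by near: t; exact: nbhs_right_gt.
    split; first by near: t; exact: nbhs_right_le.
    by split; near: t.
  have : t <= s.
    apply: ub_le_sup => //; split; first by rewrite td andbT (le_trans cs)// ltW.
    rewrite /H; have [_ Hs] := As; rewrite /H in Hs; have {}h2 := h2 td.
    have h3 : dV s * (t - s) <= psi s * (t - s) by rewrite ler_wpM2r ?subr_ge0 ?(ltW st)// dVpsi.
    have -> : eta * (t - c) = eta * (t - s) + eta * (s - c) by ring.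
    move: h1; rewrite mulrDl.
    by move: h2 Hs h3; move: (eta * _) (eta * _) (G _) (G _) (V _) (V _) (V _) (psi s * _) (dV s * _) => *; lra.
  by rewrite leNgt st.
apply/ler_addgt0Pr => e e0.
pose k := 2 * (d - c) + 1; have k0 : 0 < k by rewrite ltr_wpDl// mulr_ge0// subr_ge0 ltW.
have := main (e / k) (divr_gt0 e0 k0).
have -> : \int[leb]_(x in `[c, d[) psi x + e / k * (d - c) + e / k + e / k * (d - c) = \int[leb]_(x in `[c, d[) psi x + e / k * k.
  by rewrite /k; move: (Rintegral _ _ _) => I; ring.
by rewrite divfK// gt_eqF.
Unshelve. all: by end_near. Qed.

(** [increment_le_majorant] wants psi >= 0: dv is truncated below at - n and n x is added to v.
    Dominated convergence then removes the truncation. *)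
Lemma increment_le_oint v dv a b c d : a < c -> c < d -> d < b -> ointb a b dv ->
  (forall x, a < x < b -> is_derive x 1 v (dv x)) -> v d - v c <= oint c d dv.
Proof.
move=> ac cd db Idv dvE.
have Icd : ointb c d dv by apply: ointbS Idv; exact: ltW.
have I1 : leb.-integrable `[c, d[ (EFin \o dv).
  apply: (rintS (D := `]a, b[)) => // x; rewrite /= !in_itv /= => /andP[cx xd].
  by rewrite (lt_le_trans ac cx) (lt_trans xd db).
have mdv : measurable_fun `[c, d[ dv by exact: rint_measurable I1.
pose ph (n : nat) x := Num.max (dv x) (- n%:R).
have mph n : measurable_fun `[c, d[ (ph n) by apply: measurable_maxr.
have phn n x : `|ph n x| <= `|dv x|.
  have n0 : 0 <= n%:R :> R by [].
  rewrite /ph; case: (leP (dv x) (- n%:R)) => // h.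
  by rewrite normrN ger0_norm// ler0_norm; lra.
have Iph n : leb.-integrable `[c, d[ (EFin \o ph n).
  apply: (rint_le (g := fun x => `|dv x|)) => //; exact: rint_norm.
have inc n : v d - v c <= \int[leb]_(x in `[c, d[) ph n x.
  have In : leb.-integrable `[c, d[ (EFin \o (cst (n%:R : R))).
    apply: measurable_bounded_integrable => //.
      suff : (leb `[c, d[%classic < +oo)%E by [].
      by rewrite lebesgue_measure_itv /= lte_fin cd -EFinB ltry.
    by exists `|n%:R|; split => // y yM x _ /=; exact: ltW.
  have : (v d + n%:R * d) - (v c + n%:R * c) <= \int[leb]_(x in `[c, d[) (ph n x + n%:R).
    apply: (@increment_le_majorant (fun x => v x + n%:R * x) (fun x => dv x + n%:R)) => //.
    - exact: rintD.
    - move=> x /andP[cx xd]; apply: (derD (dvE x _) (derZ (k := n%:R) (der_id x) erefl)).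
        by rewrite (lt_le_trans ac cx) (le_lt_trans xd db).
      by rewrite mulr1.
    - by move=> x _; rewrite /ph -lerBlDr sub0r le_max lexx orbT.
    - by move=> x _; rewrite lerD2r /ph le_max lexx.
  have -> : \int[leb]_(x in `[c, d[) (ph n x + n%:R) = \int[leb]_(x in `[c, d[) ph n x + n%:R * (d - c).
    rewrite RintegralD// Rintegral_cst//; congr (_ + _ * _).
    by rewrite -[LHS]/(fine (leb `[c, d[%classic)) lebesgue_measure_itv /= lte_fin cd -EFinB.
  by move: (Rintegral _ _ _) => I; lra.
have cvI : \int[leb]_(x in `[c, d[) ph n x @[n --> \oo] --> \int[leb]_(x in `[c, d[) dv x.
  apply: fine_cvg; rewrite /Rintegral fineK; last exact: integrable_fin_num.
  apply: (@dominated_cvg _ _ _ leb _ _ (fun n x => (ph n x)%:E) _ (fun x => `|dv x|%:E)) => //.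
  - by move=> n; exact: (measurable_int leb (Iph n)).
  - move=> x _; apply: cvg_near_cst; near=> n; rewrite /ph max_l// lerNl.
    by near: n; exact: nbhs_infty_ger.
  - exact: rint_norm I1.
  - by move=> n x _; rewrite lee_fin.
have : v d - v c <= \int[leb]_(x in `[c, d[) dv x.
  rewrite -lerN2; apply: cvg_near_le (cvgN cvI); apply: nearW => n; by rewrite lerN2.
by rewrite -(Rintegral_itv_obnd_cbnd (r := c) (b := BLeft d))//.
Unshelve. all: by end_near. Qed.

(* Rudin, Real and Complex Analysis, Theorem 7.21: no continuity of the derivative is needed. *)
Lemma ftc_derivable v dv a b c d : a < c -> c < d -> d < b -> ointb a b dv ->
  (forall x, a < x < b -> is_derive x 1 v (dv x)) -> oint c d dv = v d - v c.
Proof.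
move=> ac cd db Idv dvE; apply/eqP; rewrite eq_le (increment_le_oint ac cd db Idv dvE) andbT.
have Icd : ointb c d dv by apply: ointbS Idv; exact: ltW.
have := @increment_le_oint (fun x => -1 * v x) (fun x => -1 * dv x) a b c d ac cd db (ointbZ _ Idv).
rewrite ointZ// !mulN1r opprK => h; rewrite -lerN2 opprB addrC; apply: h => x hx.
exact: derZ (dvE x hx) _.
Qed.

End EverywhereDerivative.

(** * The modes of the solution *)

Local Opaque Gamma.

(* Riemann-Liouville integral of order s; it is the identity, not a convolution, at s = 0. *)
Definition fint {R : realType} (s : R) (f : R -> R) (t : R) : R :=
  if s == 0 then f t else convol (gk s) f t.

Section Modes.
Context {R : realType} (al de lam T mu : R).
Hypotheses (al0 : 0 < al) (al1 : al <= 1) (de0 : 0 < de) (T0 : 0 < T) (mu0 : 0 < mu).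
Implicit Types (f g h da : R -> R) (s t z C M : R).
Notation K := (kern al de lam mu).

Lemma fint_adm s f : 0 <= s -> adm T f -> adm T (fint s f).
Proof.
rewrite /fint => s0 af; case: eqVneq => [_|sn] //.
by apply: adm_convol => //; apply: adm_gk; rewrite lt_neqAle eq_sym sn.
Qed.

Lemma fint_gk s a t : 0 <= s -> 0 < a -> 0 < t -> fint s (gk a) t = gk (s + a) t.
Proof.
rewrite /fint => s0 a0 t0; case: eqVneq => [->|sn]; first by rewrite add0r.
by rewrite convol_gk// lt_neqAle eq_sym sn.
Qed.

Lemma fintD s f g t : 0 <= s -> adm T f -> adm T g -> t <= T ->
  fint s (fun z => f z + g z) t = fint s f t + fint s g t.
Proof.
rewrite /fint => s0 af ag tT; case: eqVneq => // sn.
by apply: (convolDr_adm af ag) tT; apply: adm_gk; rewrite lt_neqAle eq_sym sn.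
Qed.

Lemma fintZ s k f t : 0 <= s -> adm T f -> t <= T -> fint s (fun z => k * f z) t = k * fint s f t.
Proof.
rewrite /fint => s0 af tT; case: eqVneq => // sn.
by apply: (convolZr_adm k af) tT; apply: adm_gk; rewrite lt_neqAle eq_sym sn.
Qed.

Lemma norm_fint_le s f F t : 0 <= s -> measurable_fun setT f -> adm T F -> 0 < t <= T ->
  (forall z, 0 < z <= T -> `|f z| <= F z) -> `|fint s f t| <= fint s F t.
Proof.
rewrite /fint => s0 mf aF /andP[t0 tT] fF; case: eqVneq => [_|sn]; first by rewrite fF ?t0.
have sp : 0 < s by rewrite lt_neqAle eq_sym sn.
apply: (@norm_convol_le_adm R T) => //; [exact: measurable_gk|exact: adm_gk|..].
  by move=> z /andP[z0 _]; rewrite ger0_norm// gk_ge0.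
by move=> z /andP[z0 zt]; apply: fF; rewrite z0 (le_trans (ltW zt)).
Qed.

Lemma fint_convol s a f t : 0 <= s -> 0 < a -> adm T f -> 0 < t <= T ->
  fint s (convol (gk a) f) t = convol (gk (s + a)) f t.
Proof.
rewrite /fint => s0 a0 af /andP[t0 tT]; case: eqVneq => [->|sn]; first by rewrite add0r.
by rewrite (convol_gkD _ a0 af tT)// lt_neqAle eq_sym sn.
Qed.

Lemma fint_continuous s f : 0 <= s -> adm T f -> (forall z, 0 < z < T -> {for z, continuous f}) ->
  forall t, 0 < t < T -> {for t, continuous (fint s f)}.
Proof.
rewrite /fint => s0 af cf t tT; case: eqVneq => [_|sn]; first exact: cf.
have sp : 0 < s by rewrite lt_neqAle eq_sym sn.
apply: (convol_continuous (adm_gk _ sp) af _ cf tT).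
by move=> z /andP[z0 _]; exact: continuous_gk.
Qed.

Variables (a0 : R) (da : R -> R).
Hypothesis ada : adm T da.

(* With a = a0 + 1 * da a Fourier-Bessel coefficient of f and mu = gamma_n ^ 2, umode is the
   coefficient of the solution u and qmode that of its time derivative. *)
Definition amode t : R := a0 + convol (gk 1) da t.
Definition qmode t : R := a0 * K t + convol K da t.
Definition umode t : R := convol K amode t.

Let aK : adm T K. Proof. exact: adm_kern. Qed.
Let ag s : 0 < s -> adm T (gk s). Proof. exact: adm_gk. Qed.

Lemma adm_amode : adm T amode.
Proof. by apply: admD; [exact: adm_cst|apply: adm_convol => //; exact: ag]. Qed.

Lemma adm_qmode : adm T qmode.
Proof. by apply: admD; [exact: admZ|exact: adm_convol]. Qed.

(** Since K * (a0 + 1 * da) = 1 * (a0 K + K * da), the function [qmode], which may be as singular at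
    0 as g_al, is the time derivative of [umode]. *)
Lemma umodeE t : 0 < t <= T -> umode t = convol (gk 1) qmode t.
Proof.
move=> /andP[t0 tT]; have g1 := ag ltr01.
rewrite /umode /amode /qmode.
rewrite (convolDr_adm (adm_cst T a0) (adm_convol g1 ada) aK tT).
rewrite (convolDr_adm (admZ a0 aK) (adm_convol aK ada) g1 tT) (convolZr_adm a0 aK g1 tT).
congr (_ + _).
  rewrite (convolC_adm t g1 aK) -(convolZr_adm a0 g1 aK tT).
  by apply: eq_convol => // z _; rewrite gk1 mulr1.
rewrite -(convol_assoc_adm aK g1 ada tT) -(convol_assoc_adm g1 aK ada tT).
by apply: eq_convol => // z _; exact: convolC_adm aK g1.
Qed.

Lemma qmode_eq t : 0 < t <= T -> qmode t + lam * convol (gk de) qmode t + mu * convol (gk al) qmode t =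
  a0 * gk al t + convol (gk al) da t.
Proof.
move=> /andP[t0 tT]; have gd := ag de0; have ga := ag al0.
have E (s : R) : 0 < s -> convol (gk s) qmode t = a0 * convol (gk s) K t + convol (convol (gk s) K) da t.
  move=> s0; have gs := ag s0.
  rewrite /qmode (convolDr_adm (admZ a0 aK) (adm_convol aK ada) gs tT) (convolZr_adm a0 aK gs tT).
  by rewrite (convol_assoc_adm gs aK ada tT).
rewrite !E// /qmode.
have dK := adm_convol gd aK; have alK := adm_convol ga aK.
have -> : convol (gk al) da t = convol K da t + lam * convol (convol (gk de) K) da t + mu * convol (convol (gk al) K) da t.
  rewrite -(convolZl_adm lam dK ada tT) -(convolZl_adm mu alK ada tT).
  rewrite -(convolDl_adm aK (admZ lam dK) ada tT) -(convolDl_adm (admD aK (admZ lam dK)) (admZ mu alK) ada tT).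
  by apply: eq_convol => // z /andP[z0 _]; rewrite kern_eq.
by rewrite -(kern_eq lam mu al0 de0 t0); ring.
Qed.

(** [qmode_eq] integrated to the order 1 - al. With de = al - be the order 1 - al + de is 1 - be, so
    that the first two terms are the Caputo derivatives of [umode]. *)
Lemma mode_eq t : 0 < t <= T ->
  fint (1 - al) qmode t + lam * fint (1 - al + de) qmode t + mu * umode t = amode t.
Proof.
move=> tT; have /andP[t0 tT'] := tT; have s0 : 0 <= 1 - al by rewrite subr_ge0.
have aq := adm_qmode; have gd := ag de0; have ga := ag al0.
have dq := adm_convol gd aq; have alq := adm_convol ga aq.
have sd : 1 - al + de != 0 by rewrite gt_eqF// ltr_wpDl.
have -> : fint (1 - al + de) qmode t = fint (1 - al) (convol (gk de) qmode) t.
  by rewrite (fint_convol s0 de0 aq tT) {1}/fint (negbTE sd).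
have -> : umode t = fint (1 - al) (convol (gk al) qmode) t.
  by rewrite (fint_convol s0 al0 aq tT) subrK umodeE.
have alD := admD aq (admZ lam dq).
rewrite -(fintZ lam s0 dq tT') -(fintZ mu s0 alq tT') -(fintD s0 aq (admZ lam dq) tT').
rewrite -(fintD s0 alD (admZ mu alq) tT').
have -> : amode t = fint (1 - al) (fun z => a0 * gk al z + convol (gk al) da z) t.
  rewrite (fintD s0 (admZ a0 ga) (adm_convol ga ada) tT') (fintZ a0 s0 ga tT').
  by rewrite (fint_gk s0 al0 t0) (fint_convol s0 al0 ada tT) subrK gk1 mulr1.
rewrite /fint; case: eqVneq => [_|_]; first exact: qmode_eq.
by apply: eq_convol => // z /andP[z0 zt]; rewrite qmode_eq// z0 (le_trans (ltW zt)).
Qed.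

Lemma continuous_qmode : (forall z, 0 < z < T -> {for z, continuous da}) ->
  forall t, 0 < t < T -> {for t, continuous qmode}.
Proof.
move=> cda t tT; have /andP[t0 _] := tT.
have cK z : 0 < z -> {for z, continuous K} by exact: continuous_kern.
apply: cvgD; first by apply: cvgMr; exact: cK.
by apply: (convol_continuous aK ada _ cda tT) => z /andP[z0 _]; exact: cK.
Qed.

Lemma umode_oint t : 0 < t <= T -> umode t = oint 0 t qmode.
Proof.
move=> tT; have /andP[t0 tT'] := tT; rewrite umodeE// (convolC_adm _ (ag ltr01) adm_qmode).
by rewrite convolE; apply: eq_oint => z _; rewrite gk1 mulr1.
Qed.

Lemma ointb_adm f : adm T f -> ointb 0 T f.
Proof.
move=> af; have := cint_adm af (ag ltr01) (lexx T).
by apply: eq_rint => // z _; rewrite gk1 mulr1.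
Qed.

Lemma umode_nonpos t : t <= 0 -> umode t = 0.
Proof. exact: convol_nonpos. Qed.

Lemma is_derive_umode t : (forall z, 0 < z < T -> {for z, continuous da}) -> 0 < t < T ->
  is_derive t 1 umode (qmode t).
Proof.
move=> cda tT; have d := ftc_deriv tT (ointb_adm adm_qmode) (continuous_qmode cda tT).
have /andP[t0 tT'] := tT; apply: near_eq_is_derive d; near=> s; rewrite umode_oint//.
by apply/andP; split; near: s; [exact: lt_nbhsr|exact: le_nbhsl || (apply: filterS (lt_nbhsl tT') => s /ltW)].
Unshelve. all: by end_near. Qed.

End Modes.

Section ModeBounds.
Context {R : realType} (al de lam T : R).
Hypotheses (al0 : 0 < al) (al1 : al <= 1) (de0 : 0 < de) (T0 : 0 < T).
Implicit Types (da : R -> R) (s t z C M : R).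

(** The term a0 K is bounded pointwise by a multiple of a0 g_al and keeps the decay of a0 in n. In K
    * da only a bound on da is available, and the mass of K supplies the factor 1 / mu. *)
Lemma mode_bounds : exists2 C, 0 <= C & forall mu a0 da M0 M B, 0 < mu -> adm T da -> `|a0| <= M0 ->
  (forall z, 0 < z <= T -> `|da z| <= M) -> (forall t, 0 < t <= T -> `|amode a0 da t| <= B) ->
  forall t, 0 < t <= T -> `|qmode al de lam mu a0 da t| <= C * (M0 * gk al t + M / mu) /\
     `|umode al de lam mu a0 da t| <= C * B / mu.
Proof.
have [C C0 hC] := kern_bounds al0 al1 lam T de0; exists C; first exact: ltW.
move=> mu a0 da M0 M B mu0 ada ha hda hA t tT; have /andP[t0 tT'] := tT.
have [h1 h2] := hC mu mu0; have aK : adm T (kern al de lam mu) by exact: adm_kern.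
have anK := adm_norm aK; have g1 : adm T (gk 1) by exact: adm_gk.
have cK f N : adm T f -> (forall z, 0 < z <= T -> `|f z| <= N) -> `|convol (kern al de lam mu) f t| <= N * (C / mu).
  move=> af hf; have M0' : 0 <= N by apply: le_trans (hf T _); rewrite ?T0 ?lexx.
  apply: (@le_trans _ _ (N * convol (gk 1) (fun z => `|kern al de lam mu z|) t)).
    rewrite -(convolZr_adm N anK g1 tT') (convolC_adm _ g1 (admZ N anK)).
    apply: (@le_trans _ _ (convol (fun z => `|kern al de lam mu z|) (fun=> N) t)).
      apply: (@norm_convol_le_adm R T) => //; [exact: adm_measurable aK|exact: adm_measurable af|exact: adm_cst|].
      by move=> z /andP[z0 zt]; apply: hf; rewrite z0 (le_trans (ltW zt)).
    rewrite le_eqVlt; apply/orP; left; apply/eqP; rewrite !convolE; apply: eq_Rintegral => z _.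
    by rewrite gk1 mulr1 mulrC.
  by rewrite ler_wpM2l// h2.
split.
  rewrite /qmode (le_trans (ler_normD _ _))// mulrDr lerD//.
    rewrite normrM mulrCA ler_pM// h1//.
  by rewrite mulrCA cK.
by rewrite /umode -mulrA mulrCA cK//; exact: adm_amode.
Qed.

(** The condition 1 - al <= s makes g_(s+al) bounded: integration to the order s removes the
    singularity of [qmode] at 0. *)
Lemma fint_mode_bounds s : 1 - al <= s -> exists2 C, 0 <= C & forall mu a0 da M0 M B, 0 < mu -> adm T da ->
  `|a0| <= M0 -> (forall z, 0 < z <= T -> `|da z| <= M) -> (forall t, 0 < t <= T -> `|amode a0 da t| <= B) ->
  forall t, 0 < t <= T -> `|fint s (qmode al de lam mu a0 da) t| <= C * (M0 + M / mu).
Proof.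
move=> hs; have s0 : 0 <= s by apply: le_trans hs; rewrite subr_ge0.
have [C C0 hC] := mode_bounds; have sal : 1 <= s + al by lra.
have s1 : 1 <= s + 1 by rewrite lerDr.
have [C1 C10 hC1] := gk_le T ltr01 sal; have [C2 C20 hC2] := gk_le T ltr01 s1.
exists (C * (C1 + C2)); first by rewrite mulr_ge0 ?addr_ge0.
move=> mu a0 da M0 M B mu0 ada ha hda hA t tT; have /andP[t0 tT'] := tT.
have M00 : 0 <= M0 by exact: le_trans ha.
have MM : 0 <= M / mu by rewrite divr_ge0 ?(ltW mu0)// (le_trans _ (hda t tT)).
have gal : adm T (gk al) by exact: adm_gk. have g1 : adm T (gk 1) by exact: adm_gk.
apply: (@le_trans _ _ (fint s (fun z => C * M0 * gk al z + C * (M / mu) * gk 1 z) t)).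
  apply: (norm_fint_le (T := T)) => //.
  - by apply: (adm_measurable (T := T)); exact: adm_qmode.
  - by apply: admD; exact: admZ.
  - move=> z hz; rewrite gk1 mulr1 -mulrA -mulrDr.
    by have [] := hC mu a0 da M0 M B mu0 ada ha hda hA z hz.
rewrite (fintD s0 (admZ (C * M0) gal) (admZ (C * (M / mu)) g1) tT') (fintZ (C * M0) s0 gal tT') (fintZ (C * (M / mu)) s0 g1 tT').
rewrite !fint_gk//.
have k1 : gk (s + al) t <= C1 by have := hC1 t tT; rewrite gk1 mulr1.
have k2 : gk (s + 1) t <= C2 by have := hC2 t tT; rewrite gk1 mulr1.
have -> : C * (C1 + C2) * (M0 + M / mu) = C * M0 * C1 + C * (M / mu) * C2 + C * (M0 * C2 + M / mu * C1) by ring.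
rewrite -[leLHS]addr0; apply: lerD; last by rewrite mulr_ge0// addr_ge0// mulr_ge0.
by apply: lerD; rewrite ler_wpM2l// mulr_ge0.
Qed.

End ModeBounds.

Section KernelMittagLeffler.
Context {R : realType}.

Lemma kern_mittag_leffler (al be lam mu z : R) : 0 < al -> be < al -> 0 < z ->
  kern al (al - be) lam mu z =
  z `^ (al - 1) * mittag_leffler2 al be al (- lam * z `^ (al - be)) (- mu * z `^ al).
Proof.
move=> al0 ba z0; have de0 : 0 < al - be by rewrite subr_gt0.
have zn : z `^ (al - 1) != 0 by rewrite gt_eqF// powR_gt0.
have h := @kern_cvg R al (al - be) lam mu al0 de0 z z0.
rewrite /mittag_leffler2; set s := series _.
have sE n : s n = (z `^ (al - 1))^-1 * series (fun k => kterm al (al - be) lam mu k z) n.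
  rewrite /s /series /= mulr_sumr; apply: eq_bigr => k _.
  rewrite /kterm mulr_sumr; apply: eq_bigr => i _.
  have ik : (i <= k)%N by rewrite -ltnS.
  have pw (e : R) m : (z `^ e) ^+ m = z `^ (e * m%:R) by rewrite -powR_mulrn ?powR_ge0// -powRrM.
  rewrite !exprMn gkE !pw.
  rewrite (_ : al + al * k%:R - be * i%:R = kexp al (al - be) k i); last first.
    by rewrite /kexp natrB//; ring.
  rewrite (_ : kexp al (al - be) k i - 1 = (al - 1) + ((al - be) * i%:R + al * (k - i)%:R)); last first.
    by rewrite /kexp; ring.
  have pa (a b : R) : z `^ (a + b) = z `^ a * z `^ b by rewrite powRD// (gt_eqF z0) implybT.
  rewrite (pa (al - 1)) (pa ((al - be) * i%:R)).
  by move: ((Gamma _)^-1) ((- lam) ^+ i) ((- mu) ^+ _) => G e f; field.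
have : s n @[n --> \oo] --> (z `^ (al - 1))^-1 * kern al (al - be) lam mu z.
  have h2 : (z `^ (al - 1))^-1 * series (fun k => kterm al (al - be) lam mu k z) n @[n --> \oo] --> (z `^ (al - 1))^-1 * kern al (al - be) lam mu z.
    by apply: cvgMr.
  by apply: cvg_trans h2; apply: near_eq_cvg; apply: nearW => n; rewrite sE.
by move/cvg_lim => ->//; rewrite mulrA divff// mul1r.
Qed.

End KernelMittagLeffler.

Local Opaque Gamma Phi.

(** * Fourier-Bessel series with coefficients O(gamma_n^(-2)) *)

Section FourierBesselSeries.
Context {R : realType}.
Variable nu : R.
Hypothesis nu0 : 0 < nu.
Implicit Types (h k : R -> R) (c : nat -> R) (x y z B : R) (n m N : nat).
Local Notation ip := (@ip R).
Local Notation ef := (@ef R nu).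
Local Notation gam := (@gam R nu).
Local Notation green := (@green R nu).

Let nu0' : 0 <= nu. Proof. exact: ltW. Qed.
Let nu20 : 0 < 2 * nu. Proof. by rewrite mulr_gt0. Qed.

Lemma ef0 n : ef n 0 = 0.
Proof. by rewrite efE// /jf powR0 ?gt_eqF// mul0r mulr0. Qed.

Lemma itv01P x : 0 <= x <= 1 -> x = 0 \/ x = 1 \/ 0 < x < 1.
Proof.
move=> /andP[]; rewrite le_eqVlt => /predU1P[<-|x0]; first by left.
by rewrite le_eqVlt => /predU1P[->|x1]; right; [left|right; rewrite x0].
Qed.

Lemma ef_sum_sqr_le01 N x : 0 <= x <= 1 -> \sum_(n < N) (ef n x / gam n) ^+ 2 <= (2 * nu)^-1.
Proof.
move=> /itv01P[->|[->|]]; last exact: ef_sum_sqr_le.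
  by rewrite big1 ?invr_ge0 ?(ltW nu20)// => n _; rewrite ef0 mul0r expr0n.
by rewrite big1 ?invr_ge0 ?(ltW nu20)// => n _; rewrite (ef1 nu0) mul0r expr0n.
Qed.

Let ig n : R := (gam n ^+ 2)^-1.
Let ig_gt0 n : 0 < ig n. Proof. by rewrite invr_gt0 gam2_gt0. Qed.

Lemma nonneg_series_cvg (u : nat -> R) M : (forall n, 0 <= u n) -> (forall N, \sum_(n < N) u n <= M) ->
  cvgn (series u) /\ forall N, limn (series u) - series u N <= M.
Proof.
move=> u0 uM; have nd : nondecreasing_seq (series u) by apply: nondecreasing_series.
have sM N : series u N <= M by rewrite seriesEord /=; exact: uM.
have cv : cvgn (series u) by apply: nondecreasing_is_cvgn => //; exists M => _ [N _ <-].
split => // N; apply: (@le_trans _ _ (limn (series u))).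
  by rewrite lerBlDr lerDl seriesEord sumr_ge0.
by apply: (cvg_near_le _ cv); exact: nearW.
Qed.

Let cvg_ig : cvgn (series ig).
Proof. by have [] := @nonneg_series_cvg ig _ (fun n => ltW (ig_gt0 n)) (gam_sum_le nu0). Qed.

Let rt N : R := limn (series ig) - series ig N.

Let rt_gt0 N : 0 < rt N.
Proof.
rewrite /rt subr_gt0; apply: (@lt_le_trans _ _ (series ig N.+1)).
  by rewrite seriesSr /= ltrDl.
by apply: nondecreasing_cvgn_le => //; apply: nondecreasing_series => n _ _; exact: ltW.
Qed.

(** A rate of convergence independent of x. Bounding |e_n(x)| / gam_n^2 by s / gam_n^2 + (e_n(x) /
    gam_n)^2 / s leaves a tail at most s rt + 1 / (2 nu s), with rt that of the sum of gam_n^(-2);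
    the choice s = 1 / sqrt rt gives this expression. *)
Definition tau N : R := Num.sqrt (rt N) * (1 + (2 * nu)^-1).

Lemma tau_ge0 N : 0 <= tau N.
Proof. by rewrite mulr_ge0 ?sqrtr_ge0// addr_ge0 ?invr_ge0// ltW. Qed.

Lemma tau_cvg0 : tau N @[N --> \oo] --> 0.
Proof.
rewrite -(mul0r (1 + (2 * nu)^-1)); apply: cvgMl.
rewrite -sqrtr0; apply: continuous_cvg; first exact: sqrt_continuous.
rewrite -(subrr (limn (series ig))); apply: cvgB; first exact: cvg_cst.
exact: cvg_ig.
Qed.

Definition es c x : R := limn (series (fun n => c n * ef n x)).

Lemma es_tail c B x : (forall n, `|c n| <= B / gam n ^+ 2) -> 0 <= x <= 1 ->
  series (fun n => c n * ef n x) @ \oo --> es c x /\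
  forall N, `|es c x - \sum_(n < N) c n * ef n x| <= B * tau N.
Proof.
move=> cB x01; have B0 : 0 <= B.
  by have := le_trans (normr_ge0 _) (cB 0%N); rewrite pmulr_lge0// invr_gt0 gam2_gt0.
pose sq n := (ef n x / gam n) ^+ 2.
have [csq tsq] := @nonneg_series_cvg sq _ (fun n => sqr_ge0 _) (fun N => ef_sum_sqr_le01 N x01).
have dom s : 0 < s -> cvgn (series (fun n => c n * ef n x)) /\
    forall N, `|es c x - series (fun n => c n * ef n x) N| <= B * (s * rt N + s^-1 * (2 * nu)^-1).
  move=> s0; pose b n := B * (s * ig n + s^-1 * sq n).
  have bE : series b = (fun N => B * (s * series ig N + s^-1 * series sq N)).
    apply/funext => N; rewrite /series /= -mulr_sumr; congr (_ * _).
    by rewrite big_split /= -!mulr_sumr.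
  have cb : (fun N => B * (s * series ig N + s^-1 * series sq N)) @ \oo --> B * (s * limn (series ig) + s^-1 * limn (series sq)).
    by apply: cvgMr; apply: cvgD; apply: cvgMr.
  have ab n : `|c n * ef n x| <= b n.
    rewrite normrM; apply: (@le_trans _ _ (B * (ig n * `|ef n x|))).
      by rewrite mulrA ler_wpM2r// cB.
    rewrite /b ler_wpM2l//; have g0 := gam_gt0 nu0 n.
    have e : sq n = ig n * `|ef n x| ^+ 2 by rewrite /sq exprMn exprVn real_normK ?num_real// mulrC.
    rewrite e; have := sqr_ge0 (s - `|ef n x|); have i0 := ig_gt0 n.
    move: (ig n) `|ef n x| (normr_ge0 (ef n x)) i0 => i t t0 i0 h.
    have -> : s * i + s^-1 * (i * t ^+ 2) = i * (s + s^-1 * t ^+ 2) by ring.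
    rewrite ler_pM2l// -(ler_pM2l s0) mulrDr mulrA divff ?gt_eqF// mul1r.
    have : 0 <= s * t by rewrite mulr_ge0// ltW.
    by move: h; rewrite sqrrB !expr2 mulr2n; lra.
  have cvb : cvgn (series b) by rewrite bE; apply/cvg_ex; eexists; exact: cb.
  have [h1 h2] := series_dominated ab cvb; split => // N; apply: le_trans (h2 N) _.
  rewrite bE (cvg_lim _ cb)// -mulrBr ler_wpM2l// /rt.
  have := tsq N; have : 0 < s^-1 by rewrite invr_gt0.
  move: (s^-1) (limn (series sq)) (series sq N) (limn (series ig)) (series ig N) ((2 * nu)^-1) => si a a' b0 b' v si0 h.
  have : si * (a - a') <= si * v by rewrite ler_wpM2l// ltW.
  lra.
have [h1 _] := dom 1 ltr01; split; first exact: h1.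
move=> N; have r0 := rt_gt0 N; have s0 : 0 < (Num.sqrt (rt N))^-1 by rewrite invr_gt0 sqrtr_gt0.
have [_ /(_ N)] := dom _ s0; rewrite seriesEord => h; apply: le_trans h _.
rewrite ler_wpM2l// /tau invrK [leRHS]mulrDr mulr1 lerD2r.
have sr : 0 < Num.sqrt (rt N) by rewrite sqrtr_gt0.
by rewrite -{2}(sqr_sqrtr (ltW r0)) expr2 mulKf// gt_eqF.
Qed.

Lemma es_tail_oo c B x N : (forall n, `|c n| <= B / gam n ^+ 2) -> 0 < x < 1 ->
  `|es c x - \sum_(n < N) c n * ef n x| <= B * tau N.
Proof.
move=> cB /andP[x0 x1]; have x01 : 0 <= x <= 1 by rewrite !ltW.
by have [_] := es_tail cB x01.
Qed.

Lemma es_cvg (U : Type) (F : set_system U) {FF : Filter F} (c : nat -> U -> R) (l : nat -> R) (X : U -> R) x B :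
  (forall n, c n p @[p --> F] --> l n) -> (forall n, ef n (X p) @[p --> F] --> ef n x) ->
  (\forall p \near F, forall n, `|c n p| <= B / gam n ^+ 2) -> (\forall p \near F, 0 <= X p <= 1) ->
  (forall n, `|l n| <= B / gam n ^+ 2) -> 0 <= x <= 1 ->
  es (c ^~ p) (X p) @[p --> F] --> es l x.
Proof.
move=> cl cX cB X01 lB x01.
apply: (@cvg_unif_limit R U F FF (fun N p => \sum_(n < N) c n p * ef n (X p))
   (fun N => \sum_(n < N) l n * ef n x) _ _ (fun N => B * tau N)).
- by move=> N; apply: cvg_bigsum => n; apply: cvgM.
- move=> N; near=> p; rewrite distrC.
  have h1 : forall n, `|c n p| <= B / gam n ^+ 2 by near: p.
  have h2 : 0 <= X p <= 1 by near: p.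
  by have [_] := es_tail h1 h2.
- by move=> N; rewrite distrC; have [_] := es_tail lB x01.
- by rewrite -(mulr0 B); apply: cvgMr; exact: tau_cvg0.
Unshelve. all: by end_near. Qed.

Lemma es_bcont c B : (forall n, `|c n| <= B / gam n ^+ 2) -> bcont (es c).
Proof.
move=> cB; split.
  move=> x hx; have /andP[x0 x1] := hx.
  apply: (@es_cvg _ _ _ (fun n => cst (c n)) c (fun y => y) x B) => //.
  - by move=> n; exact: cvg_cst.
  - by move=> n; have [cn _] := bcont_ef nu0 n; exact: cn.
  - exact: nearW.
  - by near=> y; apply/andP; split; apply: ltW; near: y; [exact: lt_nbhsr|exact: lt_nbhsl].
  - by rewrite !ltW.
exists (B * tau 0) => x hx.
by have := es_tail_oo 0 cB hx; rewrite big_ord0 subr0.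
Unshelve. all: by end_near. Qed.

Lemma es_partial_bcont c N : bcont (fun x => \sum_(n < N) c n * ef n x).
Proof. by apply: bcont_sum => n; apply: bcontZ; exact: bcont_ef. Qed.

Lemma cvg_of_tail (a : nat -> R) l K : (forall N, `|a N - l| <= K * tau N) -> a N @[N --> \oo] --> l.
Proof.
move=> h; apply/cvgrPdist_le => e e0.
have ht : K * tau N @[N --> \oo] --> 0 by rewrite -(mulr0 K); apply: cvgMr; exact: tau_cvg0.
near=> N; rewrite distrC (le_trans (h N))// (le_trans (ler_norm _))//.
by near: N; exact: (cvgr0Pnorm_le _).1 ht _ e0.
Unshelve. all: by end_near. Qed.

Lemma es_coef c B m : (forall n, `|c n| <= B / gam n ^+ 2) -> ip (es c) (ef m) = c m.
Proof.
move=> cB; have bS := es_bcont cB; have be := bcont_ef nu0 m.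
have [_ [A hA]] := be.
pose S N x := \sum_(n < N) c n * ef n x.
have bN N := es_partial_bcont c N.
have cv : ip (S N) (ef m) @[N --> \oo] --> ip (es c) (ef m).
  apply: (@cvg_of_tail _ _ (B * A)) => N; rewrite distrC -ipBl//; last exact: bN.
  rewrite (_ : B * A * tau N = (B * tau N) * A); last by ring.
  apply: ip_norm_le => //; first by apply: bcontB => //; exact: bN.
  by move=> x hx; exact: es_tail_oo.
have cm : ip (S N) (ef m) @[N --> \oo] --> c m.
  apply: cvg_near_cst; exists m.+1 => // N /= mN.
  rewrite /S ip_suml//; last by move=> n; apply: bcontZ; exact: bcont_ef.
  rewrite (bigD1 (Ordinal mN))//= big1 ?addr0.
    by rewrite ipZl// ?ef_norm ?mulr1.
  move=> n nm; rewrite (ipZl _ (bcont_ef nu0 n) be).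
  by rewrite ef_orth ?mulr0.
exact: (@cvg_unique R (@Rhausdorff R) _ _ _ _ cv cm).
Qed.

Lemma es_expansion h B : bcont h -> (forall n, `|ip h (ef n)| <= B / gam n ^+ 2) ->
  forall x, 0 < x < 1 -> h x = es (fun n => ip h (ef n)) x.
Proof.
move=> bh hB x hx; apply/eqP; rewrite -subr_eq0; apply/eqP.
have bS := es_bcont hB.
apply: (@ef_complete R nu nu0 (fun x => h x - es (fun n => ip h (ef n)) x)) => //.
  exact: bcontB.
move=> n; rewrite ipBl//; last exact: bcont_ef.
by rewrite (es_coef n hB) subrr.
Qed.

(** G and h -> x (G h)' are bounded for the supremum norm, so that a uniformly convergent series
    passes through both. *)
Lemma green_norm_le h M x : bcont h -> (forall x, 0 < x < 1 -> `|h x| <= M) -> 0 < x < 1 ->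
  `|green h x| <= M /\ `|gD nu h x| <= (nu + 1) * M.
Proof.
move=> bh hM hx; have M0 : 0 <= M by apply: le_trans (hM x hx).
have /andP[x0 x1] := hx.
have hA y : 0 < y < 1 -> `|wA nu h y| <= M * y `^ (nu + 2).
  by move=> /andP[y0 y1]; apply: wA_le_bound => //; rewrite y0 ltW.
have hG : `|green h x| <= M.
  apply: le_trans (green_le nu0 bh M0 hA hx) _; rewrite ler_piMr// pow_le1//; last by rewrite !ltW.
  by rewrite le_min nu0' andbT; lra.
split => //; rewrite /gD (le_trans (ler_normB _ _))// mulrDl mul1r lerD//.
  by rewrite normrM (gtr0_norm nu0) ler_wpM2l.
rewrite normrM (ger0_norm (powR_ge0 _ _)).
apply: (@le_trans _ _ (x `^ (- nu) * (M * x `^ (nu + 2)))); first by rewrite ler_wpM2l ?powR_ge0// hA.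
rewrite mulrCA -pow_add// ler_piMr// pow_le1//; last by rewrite !ltW.
by rewrite addrA addNr add0r.
Qed.

Lemma gD_lin h k x : bcont h -> bcont k -> 0 < x < 1 -> gD nu (fun y => h y - k y) x = gD nu h x - gD nu k x.
Proof.
move=> bh bk /andP[x0 x1]; have bk' := bcontZ (-1) bk.
have E y : h y - k y = h y + -1 * k y by rewrite mulN1r.
have -> : (fun y => h y - k y) = (fun y => h y + -1 * k y) by apply/funext => y; exact: E.
have e1 := etrans (greenD nu0 bh bk' x0) (congr1 (fun z => green h x + z) (greenZ nu0 (-1) bk x0)).
have e2 := etrans (wAD nu0 bh bk' (ltW x1)) (congr1 (fun z => wA nu h x + z) (wAZ nu0 (-1) bk (ltW x1))).
transitivity (nu * (green h x + -1 * green k x) - x `^ (- nu) * (wA nu h x + -1 * wA nu k x)).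
  by rewrite /gD; congr (_ * _ - _ * _); [exact: e1|exact: e2].
by rewrite /gD; move: (green h x) (green k x) (wA nu h x) (wA nu k x) => a b d e; ring.
Qed.

Lemma gD_partial c N x : 0 < x < 1 ->
  gD nu (fun y => \sum_(n < N) c n * ef n y) x = \sum_(n < N) c n * gD nu (ef n) x.
Proof.
move=> hx; have /andP[x0 x1] := hx.
elim: N => [|N IH].
  rewrite big_ord0; have b0 := bcontZ 0 (bcont_cst (0 : R)).
  have -> : (fun y => \sum_(n < 0) c n * ef n y) = (fun y => 0 * 0 : R).
    by apply/funext => y; rewrite big_ord0 mul0r.
  rewrite /gD (greenZ nu0 _ (bcont_cst 0) x0) (wAZ nu0 _ (bcont_cst 0) (ltW x1)); ring.
rewrite big_ord_recr /= -IH.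
have bN := es_partial_bcont c N; have be := bcontZ (c N) (bcont_ef nu0 N).
have -> : (fun y => \sum_(n < N.+1) c n * ef n y) = (fun y => \sum_(n < N) c n * ef n y + c N * ef N y).
  by apply/funext => y; rewrite big_ord_recr.
pose S y := \sum_(n < N) c n * ef n y.
have e1 := etrans (greenD nu0 bN be x0) (congr1 (fun z => green S x + z) (greenZ nu0 (c N) (bcont_ef nu0 N) x0)).
have e2 := etrans (wAD nu0 bN be (ltW x1)) (congr1 (fun z => wA nu S x + z) (wAZ nu0 (c N) (bcont_ef nu0 N) (ltW x1))).
transitivity (nu * (green S x + c N * green (ef N) x) - x `^ (- nu) * (wA nu S x + c N * wA nu (ef N) x)).
  by rewrite /gD; congr (_ * _ - _ * _); [exact: e1|exact: e2].
by rewrite /gD; move: (green S x) (green (ef N) x) (wA nu S x) (wA nu (ef N) x) => a b d e; ring.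
Qed.

Lemma green_es c B x : (forall n, `|c n| <= B / gam n ^+ 2) -> 0 < x < 1 ->
  green (es c) x = es (fun n => c n / gam n ^+ 2) x /\
  forall N, `|gD nu (es c) x - \sum_(n < N) c n * gD nu (ef n) x| <= (nu + 1) * (B * tau N).
Proof.
move=> cB hx; have /andP[x0 x1] := hx; have bS := es_bcont cB.
have x01 : 0 <= x <= 1 by rewrite !ltW.
have B0 : 0 <= B.
  by have := le_trans (normr_ge0 _) (cB 0%N); rewrite pmulr_lge0// invr_gt0 gam2_gt0.
have bN N := es_partial_bcont c N.
have tl N y : 0 < y < 1 -> `|es c y - \sum_(n < N) c n * ef n y| <= B * tau N.
  exact: es_tail_oo.
have gN N : green (fun y => \sum_(n < N) c n * ef n y) x = \sum_(n < N) (c n / gam n ^+ 2) * ef n x.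
  rewrite green_sum//; last by move=> n; apply: bcontZ; exact: bcont_ef.
  apply: eq_bigr => n _; rewrite greenZ//; last exact: bcont_ef.
  by rewrite green_ef// mulrA mulrAC.
have H N := green_norm_le (bcontB bS (bN N)) (tl N) hx.
split; last first.
  by move=> N; rewrite -gD_partial// -gD_lin//; have [] := H N.
have cv : \sum_(n < N) (c n / gam n ^+ 2) * ef n x @[N --> \oo] --> green (es c) x.
  apply: (@cvg_of_tail _ _ B) => N; rewrite distrC -gN.
  have [+ _] := H N; have := greenD nu0 bS (bcontZ (-1) (bN N)) x0.
  rewrite (greenZ nu0 _ (bN N) x0) mulN1r => <-.
  rewrite (@eq_green _ _ (fun y => es c y - \sum_(n < N) c n * ef n y) (fun y => es c y + -1 * \sum_(n < N) c n * ef n y) _ x0)//.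
  by move=> y _; rewrite mulN1r.
apply/esym/cvg_lim => //; apply: cvg_trans cv; apply: near_eq_cvg; apply: nearW => N.
by rewrite seriesEord.
Qed.

(** The limit is taken within [0, 1] because [besselJ] is meant for nonnegative arguments only,
    which matters at x = 0. *)
Lemma ef_cvg_within n x : 0 <= x <= 1 -> ef n y @[y --> within `[0, 1] (nbhs x)] --> ef n x.
Proof.
move=> /andP[]; rewrite le_eqVlt => /predU1P[<-|x0] x1; last first.
  have c : efc nu n * (gam n / 2) `^ nu * jf nu (gam n ^+ 2) y @[y --> x] --> ef n x.
    by rewrite efE ?ltW//; apply: cvgMr; apply: is_derive_cvg (is_derive_jf _ nu0' x0).
  apply: cvg_within_filter; apply: cvg_trans c; apply: near_eq_cvg; near=> y.
  by rewrite efE// ltW//; near: y; exact: lt_nbhsr.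
rewrite ef0; have [M M0 hM] := jf_bound nu0 (gam n ^+ 2).
pose k := `|efc nu n * (gam n / 2) `^ nu|.
have kM y : 0 <= y <= 1 -> `|ef n y| <= k * M * y `^ nu.
  by move=> hy; have /andP[y0 _] := hy; rewrite efE// normrM -mulrA ler_wpM2l//; have [] := hM y hy.
apply/cvgr0Pnorm_le => e e0.
have ck : k * M * y `^ nu @[y --> 0^'+] --> 0.
  by rewrite -[X in _ --> X](mulr0 (k * M)); apply: cvgMr; exact: powR_cvg0.
have [d /= d0 hd] := (cvgr0Pnorm_le _).1 ck _ e0.
exists d => // y /= yd; rewrite in_itv /= => hy; have /andP[y0 _] := hy.
move: y0; rewrite le_eqVlt => /predU1P[<-|y0]; first by rewrite ef0 normr0 ltW.
by apply: le_trans (kM y hy) _; apply: le_trans (ler_norm _) _; exact: hd.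
Unshelve. all: by end_near. Qed.

End FourierBesselSeries.

Local Opaque Gamma.

Section Clip.
Context {R : realType}.
Implicit Types (a b c d x y t : R) (F : R -> R -> R).

(** Composition with these projections extends a function continuous on the closed rectangle to a
    continuous and bounded function on the plane, unchanged on the rectangle; two-sided limits then
    make sense at the boundary. *)
Definition clip a b x := Num.max a (Num.min b x).

Lemma clip_in a b x : a <= b -> a <= clip a b x <= b.
Proof. by move=> ab; rewrite /clip le_max lexx /= ge_max ab ge_min lexx. Qed.

Lemma clip_id a b x : a <= x <= b -> clip a b x = x.
Proof. by move=> /andP[ax xb]; rewrite /clip (min_idPr xb) (max_idPr ax). Qed.

Lemma continuous_clip a b : continuous (clip a b).
Proof.
move=> x; apply: continuous_max; first exact: cvg_cst.
by apply: continuous_min; [exact: cvg_cst|exact: cvg_id].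
Qed.

Lemma cvg_pairing (U : Type) (G : set_system U) {FG : Filter G} (f g : U -> R) x y :
  f s @[s --> G] --> x -> g s @[s --> G] --> y -> (f s, g s) @[s --> G] --> (x, y).
Proof. by move=> fx gy; exact: (cvg_pair fx gy). Qed.

Lemma clip2_continuous a b c d F : a <= b -> c <= d ->
  {within `[a, b] `*` `[c, d], continuous (fun p : R * R => F p.1 p.2)} ->
  continuous (fun p : R * R => F (clip a b p.1) (clip c d p.2)).
Proof.
move=> ab cd /subspace_continuousP cF p.
pose q := (clip a b p.1, clip c d p.2).
have Dq (r : R * R) : (`[a, b] `*` `[c, d]) (clip a b r.1, clip c d r.2) by split; rewrite /= in_itv /= clip_in.
have h := cF q (Dq p).
apply: (cvg_comp (fun p : R * R => (clip a b p.1, clip c d p.2)) (fun p : R * R => F p.1 p.2)) h.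
move=> A; rewrite /within /= => nA.
have : (fun p : R * R => (clip a b p.1, clip c d p.2)) @ p --> q.
  apply: cvg_pairing; (apply: cvg_comp; last exact: continuous_clip).
    exact: cvg_fst.
  exact: cvg_snd.
move=> /(_ _ nA); rewrite /nbhs /=; apply: (@filterS _ (nbhs p)) => r /= h1; exact: (h1 (Dq r)).
Qed.

Lemma clip2_bounded a b c d F : a <= b -> c <= d ->
  {within `[a, b] `*` `[c, d], continuous (fun p : R * R => F p.1 p.2)} ->
  exists2 M, 0 <= M & forall x t, a <= x <= b -> c <= t <= d -> `|F x t| <= M.
Proof.
move=> ab cd cF.
have K : compact (`[a, b] `*` `[c, d] : set (R * R)) by apply: compact_setX; exact: segment_compact.
have [M [_ hM]] := compact_bounded (continuous_compact cF K).
exists (`|M| + 1) => [|x t xab tcd]; first by rewrite addr_ge0.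
apply: (hM (`|M| + 1)); first by rewrite (le_lt_trans (ler_norm M))// ltrDl.
by exists (x, t) => //; split; rewrite /= in_itv.
Qed.

Lemma continuous_fst_section F t x : continuous (fun p : R * R => F p.1 p.2) -> F y t @[y --> x] --> F x t.
Proof.
move=> cF; apply: (cvg_comp (fun y : R => (y, t)) (fun p : R * R => F p.1 p.2) _ (cF (x, t))).
by apply: cvg_pairing; [exact: cvg_id|exact: cvg_cst].
Qed.

Lemma continuous_snd_section F t x : continuous (fun p : R * R => F p.1 p.2) -> F x s @[s --> t] --> F x t.
Proof.
move=> cF; apply: (cvg_comp (fun s : R => (x, s)) (fun p : R * R => F p.1 p.2) _ (cF (x, t))).
by apply: cvg_pairing; [exact: cvg_cst|exact: cvg_id].
Qed.
End Clip.

Section UnderIntegral.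
Context {R : realType}.
Notation leb := (@lebesgue_measure R).
Implicit Types (a b u v s x : R) (f df : R -> R -> R) (g : R -> R).

Lemma con_oint a b u v f g : (forall s, u < s < v -> ointb a b (f s)) ->
  (forall x, a < x < b -> con u v (f ^~ x)) -> ointb a b g ->
  (forall s x, u < s < v -> a < x < b -> `|f s x| <= g x) ->
  con u v (fun s => oint a b (f s)).
Proof.
move=> fi fc gi fg s suv.
apply: (@continuity_under_integral R _ _ leb f `]a, b[ _ u v _ _ g) => //.
- by apply: aeW => x /ooP xab y /set_mem /ooP yuv; exact: fc.
- by move=> y /ooP yuv; apply: aeW => x /ooP xab; exact: fg.
- by apply/mem_set/ooP.
Qed.

Lemma is_derive_oint a b u v f df g s : (forall s, u < s < v -> ointb a b (f s)) ->
  (forall s x, u < s < v -> a < x < b -> is_derive s 1 (f ^~ x) (df s x)) ->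
  (forall x, a < x < b -> 0 <= g x) -> ointb a b g ->
  (forall s x, u < s < v -> a < x < b -> `|df s x| <= g x) -> u < s < v ->
  is_derive s 1 (fun s => oint a b (f s)) (oint a b (df s)).
Proof.
move=> fi fd g0 gi dg suv.
have dE y x : u < y < v -> a < x < b -> partial1of2 f y x = df y x.
  by move=> yuv xab; rewrite partial1of2E; have ? := fd _ _ yuv xab; rewrite derive_val.
pose G := g \_ `]a, b[.
have iG : leb.-integrable `]a, b[ (EFin \o G).
  by apply: eq_ointb gi => x /ooP xab; rewrite /G patchE mem_set.
have G0 x : 0 <= G x.
  by rewrite /G patchE; case: ifP => // /set_mem /ooP xab; exact: g0.
have Gub y x : (`]u, v[%classic : set R) y -> (`]a, b[%classic : set R) x -> `|partial1of2 f y x| <= G x.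
  by move=> /ooP yuv xab; rewrite /G patchE mem_set//; move/ooP: xab => xab; rewrite dE//; exact: dg.
have Is : (`]u, v[%classic : set R) s by apply/ooP.
have If y : (`]u, v[%classic : set R) y -> leb.-integrable `]a, b[ (EFin \o f y) by move=> /ooP; exact: fi.
have Df y x : (`]u, v[%classic : set R) y -> (`]a, b[%classic : set R) x -> derivable (f ^~ x) y 1.
  by move=> /ooP yuv /ooP xab; have [] := fd _ _ yuv xab.
have mB : measurable (`]a, b[%classic : set (measurableTypeR R)) by exact: measurable_itv.
have dv := @derivable_under_integral R _ _ leb f _ mB s u v Is If Df G G0 iG Gub.
have ev := @differentiation_under_integral R _ _ leb f _ mB s u v Is If Df G G0 iG Gub.
have -> : oint a b (df s) = 'D_1 (fun s => oint a b (f s)) s.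
  by rewrite -derive1E /oint ev; apply: eq_Rintegral => x /set_mem /ooP xab; rewrite dE.
exact: DeriveDef.
Qed.
End UnderIntegral.

(** * The source term *)

Local Opaque Gamma Phi.

Section DerivableOn.
Context {R : realType}.
Implicit Types (a b x y : R) (g : R -> R).

Lemma derivable_on_cvg a b g x : derivable_on `[a, b] g x -> a <= x <= b ->
  g y @[y --> within `[a, b] (nbhs x)] --> g x.
Proof.
move=> d xab; pose l := derive_on `[a, b] g x.
have q : (g y - g x) / (y - x) @[y --> within `[a, b] x^'] --> l := d.
have h : g x + (y - x) * ((g y - g x) / (y - x)) @[y --> within `[a, b] x^'] --> g x.
  rewrite -[X in _ --> X]addr0; apply: cvgD; first exact: cvg_cst.
  rewrite -(mul0r l); apply: cvgM => //; rewrite -(subrr x); apply: cvgB; last exact: cvg_cst.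
  apply: cvg_trans (@nbhs_dnbhs _ x) => A; rewrite /within /=.
  by apply: (@filterS _ (x^')) => y Ay _.
move=> A Ag; have := h _ Ag; have Agx : A (g x) by exact: nbhs_singleton.
rewrite !nbhs_simpl /= /within /= /dnbhs /within /=.
apply: (@filterS _ (nbhs x)) => y hy yab; have [->//|yx] := eqVneq y x.
by have := hy yx yab; rewrite mulrCA divff ?subr_eq0// mulr1 addrC subrK.
Qed.

Lemma derivable_on_is_derive a b g x : derivable_on `[a, b] g x -> a < x < b ->
  is_derive x 1 g (derive_on `[a, b] g x).
Proof.
move=> d xab.
have q : (g y - g x) / (y - x) @[y --> x^'] --> derive_on `[a, b] g x.
  move=> A Al; have := d _ Al; rewrite !nbhs_simpl /= /within /=.
  have nx : \forall y \near x^', a < y < b by apply: nbhs_dnbhs; apply/near_in_itvoo; rewrite in_itv.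
  move=> h; near=> y; have yab : a < y < b by near: y.
  have : (`[a, b]%classic : set R) y -> A ((g y - g x) / (y - x)) by near: y.
  by apply; rewrite /= in_itv /=; case/andP: yab => /ltW -> /ltW ->.
have e : (fun h : R => h^-1 *: ((g \o shift x) (h *: 1) - g x)) = (fun y => (g y - g x) / (y - x)) \o shift x.
  by apply/funext => h; rewrite /= addrK [h *: 1]mulr1 mulrC.
have c : h^-1 *: ((g \o shift x) (h *: 1) - g x) @[h --> 0^'] --> derive_on `[a, b] g x.
  rewrite e; apply: cvg_comp q; move=> A; rewrite /dnbhs /within /=.
  rewrite [X in X -> _](near_shift (0 : R) x); apply: (@filterS _ (nbhs (0 : R))) => h hA h0.
  by move: hA; rewrite /= subr0; apply; rewrite -subr_eq0 addrK.
by split; [apply/cvg_ex; eexists; exact: c|exact: cvg_lim c].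
Unshelve. all: by end_near. Qed.

(** The mean value theorem on [0, x]: each integration from 0 gains a power of x. *)
Lemma flat_step g dg M n : 0 <= M -> (forall x, 0 <= x <= 1 -> derivable_on `[0, 1] g x) -> g 0 = 0 ->
  (forall x, derive_on `[0, 1] g x = dg x) ->
  (forall x, 0 <= x <= 1 -> `|dg x| <= M * x ^+ n) ->
  forall x, 0 <= x <= 1 -> `|g x| <= M * x ^+ n.+1.
Proof.
move=> M0 gd g0 gE dgM x /andP[x0 x1].
have [->|xn0] := eqVneq x 0; first by rewrite g0 normr0 mulr_ge0// exprn_ge0.
have {x0}x0 : 0 < x by rewrite lt_neqAle eq_sym xn0.
have der y : y \in `]0, x[ -> is_derive y 1 g (dg y).
  rewrite in_itv /= => /andP[y0 yx]; rewrite -gE.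
  by apply: derivable_on_is_derive; [apply: gd; rewrite (ltW y0) /= (le_trans (ltW yx))|rewrite y0 (lt_le_trans yx)].
have cg : {within `[0, x], continuous g}.
  have s : (`[0, x]%classic : set R) `<=` `[0, 1]%classic.
    by move=> y; rewrite /= !in_itv /= => /andP[-> yx]; exact: le_trans yx x1.
  apply: (continuous_subspaceW s); apply/subspace_continuousP => y; rewrite /= in_itv /= => y01.
  by apply: derivable_on_cvg => //; exact: gd.
have [c] := MVT x0 der cg; rewrite in_itv /= => /andP[c0 cx].
rewrite g0 !subr0 => ->; rewrite normrM (gtr0_norm x0) exprSr mulrA ler_wpM2r ?(ltW x0)//.
apply: le_trans (dgM _ _) _; first by rewrite (ltW c0) (le_trans (ltW cx)).
by rewrite ler_wpM2l// lerXn2r ?nnegrE// ltW.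
Qed.

End DerivableOn.

Section Source.
Context {R : realType}.
Variables (nu T : R) (f : R -> R -> R).
Hypotheses (nu0 : 0 < nu) (T0 : 0 < T) (hf : admissible_source T f).
Implicit Types (x y t s z B M : R) (n m : nat).
Local Notation ip := (@ip R).
Local Notation ef := (@ef R nu).
Local Notation gam := (@gam R nu).
Local Notation green := (@green R nu).

(** Four applications of [flat_step], starting from the bound on the fourth derivative. They make f
    / x^2 and f_x / x bounded, hence also L f. *)
Lemma source_flat : exists2 M, 0 <= M & forall t, 0 <= t <= T -> exists f1 f2 : R -> R,
  [/\ forall x, 0 < x < 1 -> is_derive x 1 (f ^~ t) (f1 x),
      forall x, 0 < x < 1 -> is_derive x 1 f1 (f2 x), con 0 1 f2,
      (forall x, 0 < x < 1 -> [/\ `|f x t| <= M * x ^+ 4, `|f1 x| <= M * x ^+ 3 & `|f2 x| <= M * x ^+ 2])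
    & f x t @[x --> 1^'-] --> 0].
Proof.
have [h1 h2 [M hM] _] := hf.
have M0 : 0 <= M.
  have := hM 0 0; rewrite !in_itv /= !lexx ler01 (ltW T0) => /(_ isT isT); exact: le_trans.
exists M => // t tT.
have tT' : t \in `[0, T] by rewrite in_itv.
pose F k := deriven_on `[0, 1] k (f ^~ t).
have Fd k : (k < 4)%N -> forall x, 0 <= x <= 1 -> derivable_on `[0, 1] (F k) x.
  by move=> k4 x x01; apply: h1 => //; rewrite in_itv.
have F0 k : (k < 4)%N -> F k 0 = 0 by move=> k4; have [b0 _] := h2 t tT'; exact: b0.
have FS k x : derive_on `[0, 1] (F k) x = F k.+1 x by rewrite /F /deriven_on iterS.
have b4 x : 0 <= x <= 1 -> `|F 4 x| <= M * x ^+ 0.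
  by move=> x01; rewrite expr0 mulr1; apply: hM => //; rewrite in_itv.
have b3 := flat_step M0 (Fd 3 isT) (F0 3 isT) (FS 3) b4.
have b2 := flat_step M0 (Fd 2 isT) (F0 2 isT) (FS 2) b3.
have b1 := flat_step M0 (Fd 1 isT) (F0 1 isT) (FS 1) b2.
have b0 := flat_step M0 (Fd 0 isT) (F0 0 isT) (FS 0) b1.
have W x : 0 < x < 1 -> 0 <= x <= 1 by case/andP => /ltW -> /ltW ->.
have D k : (k < 4)%N -> forall x, 0 < x < 1 -> is_derive x 1 (F k) (F k.+1 x).
  by move=> k4 x x01; rewrite -FS; apply: derivable_on_is_derive => //; apply: Fd => //; exact: W.
exists (F 1), (F 2); split.
- exact: (D 0).
- exact: (D 1).
- exact: (is_derive_con (D 2 isT)).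
- by move=> x /W x01; split; [exact: b0|exact: b1|exact: b2].
- have [_ /(_ 0 isT) e] := h2 t tT'; rewrite -[X in _ --> X]e.
  have c1 : F 0 y @[y --> within `[0, 1] (nbhs (1 : R))] --> F 0 1.
    by apply: derivable_on_cvg; [apply: Fd|]; rewrite ?ler01 ?lexx.
  apply: cvg_trans c1 => A; rewrite !nbhs_simpl /= /within /= => hA.
  near=> y; have : (`[0, 1]%classic : set R) y -> A (F 0 y).
    near: y; rewrite /at_left /within /=; move: hA; apply: (@filterS _ (nbhs (1 : R))) => y h _; exact: h.
  by apply; rewrite /= in_itv /=; apply/andP; split; near: y; [apply: nbhs_left_ge|apply: nbhs_left_le]; rewrite ?ltr01.
Unshelve. all: by end_near. Qed.

(** f(., t) is the Green potential of h = - L f, which is bounded by (nu^2 + 2) M uniformly in t. By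
    symmetry of G, the n-th coefficient of f is that of h divided by gam_n^2. *)
Lemma source_coef_bound : exists2 B, 0 <= B & forall t, 0 <= t <= T ->
  bcont (f ^~ t) /\ forall n, `|ip (f ^~ t) (ef n)| <= B / gam n ^+ 2.
Proof.
have [M M0 hM] := source_flat.
pose H := (nu ^+ 2 + 2) * M.
have H0 : 0 <= H by rewrite mulr_ge0// addr_ge0// sqr_ge0.
exists H => // t tT; have [f1 [f2 [d0 d1 c2 b f1l]]] := hM t tT.
have bf : bcont (f ^~ t).
  split; first exact: is_derive_con d0.
  exists M => x x01; have [h _ _] := b x x01; apply: le_trans h _.
  by rewrite ler_piMr// exprn_ile1 ?ltW//; case/andP: x01.
pose h x := nu ^+ 2 * (f x t / x ^+ 2) - f1 x / x - f2 x.
have hb x : 0 < x < 1 -> `|h x| <= H.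
  move=> x01; have [h0 h1 h2] := b x x01; case/andP: x01 => x0 x1.
  have xe k : x ^+ k <= 1 by rewrite exprn_ile1 ?ltW.
  have l0 : `|f x t / x ^+ 2| <= M.
    rewrite normrM normfV (gtr0_norm (exprn_gt0 2 x0)) ler_pdivrMr ?exprn_gt0//.
    by apply: le_trans h0 _; rewrite ler_wpM2l// (exprD _ 2 2) ler_piMr ?exprn_ge0// ltW.
  have l1 : `|f1 x / x| <= M.
    rewrite normrM normfV (gtr0_norm x0) ler_pdivrMr//.
    by apply: le_trans h1 _; rewrite ler_wpM2l// exprSr ler_piMl// ltW.
  have l2 : `|f2 x| <= M by apply: le_trans h2 _; rewrite ler_piMr.
  rewrite /h /H; apply: le_trans (ler_normB _ _) _; apply: le_trans (lerD (ler_normB _ _) (lexx _)) _.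
  rewrite normrM (ger0_norm (sqr_ge0 nu)); have := ler_wpM2l (sqr_ge0 nu) l0.
  by move: (`|f x t / _|) (`|f1 x / x|) (`|f2 x|) l0 l1 l2 => p q r; lra.
have bh : bcont h.
  split; last by exists H.
  move=> x x01; case/andP: (x01) => x0 _; have xn : x != 0 by rewrite gt_eqF.
  have vx : y^-1 @[y --> x] --> x^-1 by apply: cvgV => //; exact: cvg_id.
  have v2 : (y ^+ 2)^-1 @[y --> x] --> (x ^+ 2)^-1.
    by apply: cvgV; [rewrite expf_neq0|exact: exprn_continuous].
  apply: cvgB; last exact: c2.
  apply: cvgB; first by apply: cvgMr; apply: cvgM => //; exact: (is_derive_con d0).
  by apply: cvgM => //; exact: (is_derive_con d1).
split => // n.
have fg x : 0 < x < 1 -> f x t = green h x.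
  apply: (@green_unique R nu nu0 (f ^~ t) (fun x => x * f1 x) h ((nu + 1) * M)) => //.
  - move=> y y01; have [y0 _] := andP y01; rewrite mulrC mulKf ?gt_eqF//; exact: d0.
  - move=> y y01; have [y0 _] := andP y01.
    have e : nu ^+ 2 * f y t / y - y * h y = 1 * f1 y + y * f2 y.
      by rewrite /h; have y0' : y != 0 by [rewrite gt_eqF]; field.
    by apply: (derM (is_derive_id y 1) (d1 y y01)); rewrite e.
  - move=> y y01; have [h0 h1 _] := b y y01; case/andP: y01 => y0 y1.
    have xe k : y ^+ k <= 1 by rewrite exprn_ile1 ?ltW.
    have l0 : `|f y t| <= M by apply: le_trans h0 _; rewrite ler_piMr.
    have l1 : `|y * f1 y| <= M.
      rewrite normrM (gtr0_norm y0); apply: (@le_trans _ _ (1 * M)); last by rewrite mul1r.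
      apply: ler_pM => //; rewrite ?(ltW y0) ?(ltW y1)//.
      by apply: le_trans h1 _; rewrite ler_piMr.
    apply: le_trans (ler_normB _ _) _; rewrite [`|nu * _|]normrM (gtr0_norm nu0).
    have := ler_wpM2l (ltW nu0) l0; move: (`|y * f1 y|) (`|f y t|) l0 l1 => p q; lra.
rewrite (eq_ip fg (fun x _ => erefl (ef n x))) (green_sym nu0 bh (bcont_ef nu0 n)).
rewrite (eq_ip (fun x _ => erefl (h x)) (fun x x01 => green_ef nu0 n x01)).
have -> : ip h (fun x => ef n x / gam n ^+ 2) = (gam n ^+ 2)^-1 * ip h (ef n).
  rewrite ipC -(ipC (ef n)) -(ipZl _ (bcont_ef nu0 n) bh); apply: eq_ip => x _ //; exact: mulrC.
rewrite normrM ger0_norm ?invr_ge0 ?(ltW (gam2_gt0 nu0 n))// mulrC ler_wpM2r ?invr_ge0 ?(ltW (gam2_gt0 nu0 n))//.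
rewrite -(@ler_pXn2r _ 2) ?nnegrE// real_normK ?num_real//.
apply: le_trans (ip_cauchy bh (bcont_ef nu0 n)) _; rewrite (ef_norm nu0) mulr1 expr2.
by apply: le_trans (ler_norm _) _; exact: ip_norm_le.
Qed.

Let fc x t := f (clip 0 1 x) (clip 0 T t).
Let ft x t := derive_on `[0, T] (f (clip 0 1 x)) (clip 0 T t).

Let T0' : 0 <= T. Proof. exact: ltW. Qed.
Let c01 : (0 : R) <= 1. Proof. exact: ler01. Qed.

Let fc_cont : continuous (fun p : R * R => fc p.1 p.2).
Proof. by have [_ _ _ [h _ _]] := hf; exact: (clip2_continuous c01 T0' h). Qed.

Let ft_cont : continuous (fun p : R * R => ft p.1 p.2).
Proof. 
have [_ _ _ [_ _ h]] := hf.
exact: (@clip2_continuous R 0 1 0 T (fun x t => derive_on `[0, T] (f x) t) c01 T0' h).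
Qed.

Let fc_bd : exists2 M, 0 <= M & forall x t, `|fc x t| <= M.
Proof.
have [_ _ _ [h _ _]] := hf; have [M M0 hM] := clip2_bounded c01 T0' h.
by exists M => // x t; apply: hM; exact: clip_in.
Qed.

Let ft_bd : exists2 M, 0 <= M & forall x t, `|ft x t| <= M.
Proof.
have [_ _ _ [_ _ h]] := hf.
have [M M0 hM] := @clip2_bounded R 0 1 0 T (fun x t => derive_on `[0, T] (f x) t) c01 T0' h.
by exists M => // x t; apply: hM; exact: clip_in.
Qed.

Let slice g M t : continuous (fun p : R * R => g p.1 p.2) -> (forall x t, `|g x t| <= M) -> bcont (g ^~ t).
Proof. by move=> gc gM; split; [move=> x _; exact: continuous_fst_section|exists M => x _; exact: gM]. Qed.

Let wprod_le x a b M N : 0 < x < 1 -> `|a| <= M -> `|b| <= N -> `|x * (a * b)| <= M * N.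
Proof.
move=> /andP[x0 x1] aM bN; rewrite !normrM (gtr0_norm x0) -[leRHS]mul1r.
by apply: ler_pM; rewrite ?(ltW x0) ?(ltW x1) ?mulr_ge0//; exact: ler_pM.
Qed.

Let coef_con g M n : continuous (fun p : R * R => g p.1 p.2) -> (forall x t, `|g x t| <= M) ->
  continuous (fun t => ip (g ^~ t) (ef n)).
Proof.
move=> gc gM t; have [C C0 eC] := bcont_bound (bcont_ef nu0 n).
have := @con_oint R 0 1 (t - 1) (t + 1) (fun t x => x * (g x t * ef n x)) (fun=> M * C).
move/(_ _ _ (ointb_cst _ _ _) _ t); apply; last by rewrite ltrBlDr !ltrDl ltr01.
- by move=> s _; apply: bcont_ip; [exact: slice gM|exact: bcont_ef].
- by move=> x x01 s _; apply: cvgMr; apply: cvgMl; exact: continuous_snd_section.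
- by move=> s x _ x01; apply: wprod_le; [|exact: gM|exact: eC].
Qed.

Definition source_rate n t := ip (ft ^~ t) (ef n).

Lemma continuous_source_rate n : continuous (source_rate n).
Proof. by have [M M0 hM] := ft_bd; exact: coef_con hM. Qed.

(** Only continuity of f_t is known, so its coefficients are bounded but no decay in n is available;
    the factor 1 / mu in [mode_bounds] makes up for it. *)
Lemma source_rate_bound : exists2 M, 0 <= M & forall n t, `|source_rate n t| <= M.
Proof.
have [M M0 hM] := ft_bd; exists M => // n t; have bt := slice t ft_cont hM.
rewrite -(@ler_pXn2r _ 2) ?nnegrE// real_normK ?num_real//.
apply: le_trans (ip_cauchy bt (bcont_ef nu0 n)) _; rewrite (ef_norm nu0) mulr1 expr2.
by apply: le_trans (ler_norm _) _; apply: ip_norm_le => // x _; exact: hM.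
Qed.

Lemma adm_source_rate n : adm T (source_rate n).
Proof.
have [M _ hM] := source_rate_bound; apply: (@adm_bounded _ _ _ M) => [|z _]; last exact: hM.
by apply: open_continuous_measurable_fun; [exact: openT|move=> z _; exact: continuous_source_rate].
Qed.

(** Differentiation under the integral, followed by integration in time from 0. *)
Lemma source_coefE n t : 0 <= t <= T ->
  ip (f ^~ t) (ef n) = amode (ip (f ^~ 0) (ef n)) (source_rate n) t.
Proof.
move=> tT; pose A t := ip (fc ^~ t) (ef n).
have AE s : 0 <= s <= T -> A s = ip (f ^~ s) (ef n).
  move=> sT; apply: eq_ip => // x /andP[x0 x1]; rewrite /fc !clip_id// ?sT//.
  by rewrite (ltW x0) (ltW x1).
have [M M0 hM] := fc_bd; have [N N0 hN] := ft_bd.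
have Ac : continuous A by exact: coef_con hM.
have [C C0 eC] := bcont_bound (bcont_ef nu0 n).
have Ad s : 0 < s < T -> is_derive s 1 A (source_rate n s).
  move=> sT; apply: (@is_derive_oint R 0 1 0 T (fun t x => x * (fc x t * ef n x))
     (fun t x => x * (ft x t * ef n x)) (fun=> N * C)) => //.
  - by move=> z _; apply: bcont_ip; [exact: slice hM|exact: bcont_ef].
  - move=> z x zT x01; have fz : is_derive z 1 (fc x) (ft x z).
      have [_ _ _ [_ hd _]] := hf; have [z0 z1] := andP zT; have [x0 x1] := andP x01.
      have zz : 0 <= z <= T by rewrite (ltW z0) (ltW z1).
      have xx : 0 <= x <= 1 by rewrite (ltW x0) (ltW x1).
      have := derivable_on_is_derive (hd x z _ _) zT; rewrite !in_itv /= => /(_ xx zz) h.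
      rewrite /ft !clip_id//; apply: (near_eq_is_derive _ h).
      have := near_in_itvoo; move/(_ R 0 T z); rewrite in_itv => /(_ zT).
      apply: filterS => y; rewrite in_itv /= => /andP[y0 y1].
      by rewrite /fc !clip_id// (ltW y0) (ltW y1).
    apply: (derZ _ erefl); have -> : ft x z * ef n x = ft x z * ef n x + fc x z * 0 by rewrite mulr0 addr0.
    exact: derM fz (der_cst _ _) erefl.
  - by move=> x _; rewrite mulr_ge0.
  - exact: ointb_cst.
  - by move=> z x _ x01; apply: wprod_le; [|exact: hN|exact: eC].
rewrite -AE// -AE ?lexx// /amode; case/andP: tT; rewrite le_eqVlt => /predU1P[<- _|t0 tT].
  by rewrite convol_nonpos// addr0.
have [K _ hK] := source_rate_bound.
have e : oint 0 t (source_rate n) = A t - A 0.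
  apply: (@ftc_oo R 0 t A) => //.
  - by apply: (@con_ointb R 0 t _ K) => x _; [exact: continuous_source_rate|exact: hK].
  - by move=> x _; exact: continuous_source_rate.
  - by move=> x /andP[x0 xt]; apply: Ad; rewrite x0 (lt_le_trans xt).
  - by apply: cvg_at_right_filter; exact: Ac.
  - by apply: cvg_at_left_filter; exact: Ac.
suff -> : convol (gk 1) (source_rate n) t = oint 0 t (source_rate n) by rewrite e addrC subrK.
rewrite convolC ?convolE; [|exact: measurable_gk|exact: adm_measurable (adm_source_rate n)].
by apply: eq_Rintegral => z _; rewrite gk1 mulr1.
Qed.

Lemma source_expansion t x : 0 <= t <= T -> 0 < x < 1 -> f x t = es nu (fun n => ip (f ^~ t) (ef n)) x.
Proof.
move=> tT x01; have [B _ hB] := source_coef_bound; have [bf hb] := hB t tT.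
exact: (es_expansion nu0 bf hb).
Qed.
End Source.

(** * Existence *)

Local Opaque Gamma Phi.

Section TimeSeries.
Context {R : realType}.
Variables (nu T : R).
Hypotheses (nu0 : 0 < nu) (T0 : 0 < T).
Implicit Types (x y t s z B M : R) (n m N : nat).
Local Notation ef := (@ef R nu).
Local Notation gam := (@gam R nu).
Local Notation es := (@es R nu).
Variables (q : nat -> R -> R) (G : R -> R).
Hypotheses (aq : forall n, adm T (q n)) (aG : adm T G).
Hypothesis qG : forall n z, 0 < z <= T -> `|q n z| <= G z / gam n ^+ 2.

(** Put to 0 outside ]0, T], where the bounds on the coefficients say nothing, so that it is
    measurable on the whole line. *)
Definition ts x z : R := if 0 < z <= T then es (q ^~ z) x else 0.

Lemma tsE x z : 0 < z <= T -> ts x z = es (q ^~ z) x.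
Proof. by rewrite /ts => ->. Qed.

Let part N x z : R := \sum_(n < N) q n z * ef n x.

Let adm_part N x : adm T (part N x).
Proof. by apply: adm_sum => n; under eq_fun do rewrite mulrC; exact: admZ. Qed.

Let ts_tail N x z : 0 <= x <= 1 -> 0 < z <= T -> `|ts x z - part N x z| <= tau nu N * G z.
Proof. by move=> x01 zT; rewrite tsE// mulrC; have [_] := es_tail nu0 (fun n => qG n zT) x01; exact. Qed.

Lemma measurable_ts x : 0 <= x <= 1 -> measurable_fun setT (ts x).
Proof.
move=> x01; pose h N := fun z : R => if 0 < z <= T then part N x z else 0.
have mh N : measurable_fun setT (h N).
  apply: measurable_fun_ifT => //; last exact: adm_measurable (adm_part N x).
  by apply: measurable_and; [exact: measurable_fun_ltr|exact: measurable_fun_ler].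
apply: (measurable_fun_cvg mh) => z _; rewrite /h /ts; case: ifP => zT; last exact: cvg_cst.
have [cv _] := es_tail nu0 (fun n => qG n zT) x01.
apply: cvg_trans cv; apply: near_eq_cvg; apply: nearW => N.
by rewrite /part seriesEord.
Qed.

Lemma adm_ts x : 0 <= x <= 1 -> adm T (ts x).
Proof.
move=> x01; have [mG [a [C [a0 C0 hG]]]] := aG; split; first exact: measurable_ts.
exists a, (tau nu 0 * C); split => // [|z zT]; first by apply: mulr_ge0 => //; exact: tau_ge0.
have := ts_tail 0 x01 zT; rewrite /part big_ord0 subr0 => h; apply: le_trans h _.
rewrite -mulrA ler_wpM2l ?(tau_ge0 nu0)//; apply: le_trans (ler_norm _) _; exact: hG.
Qed.

Lemma fint_sum s N x t : 0 <= s -> t <= T ->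
  fint s (part N x) t = \sum_(n < N) fint s (q n) t * ef n x.
Proof.
move=> s0 tT; elim: N => [|N IH].
  rewrite big_ord0; have -> : part 0 x = (fun z => 0 * q 0%N z).
    by apply/funext => z; rewrite /part big_ord0 mul0r.
  by rewrite (fintZ (T := T))// mul0r.
rewrite big_ord_recr /= -IH; have -> : part N.+1 x = (fun z => part N x z + ef N x * q N z).
  by apply/funext => z; rewrite /part big_ord_recr /= [q N z * _]mulrC.
by rewrite (fintD (T := T))//; [rewrite (fintZ (T := T))// mulrC|exact: admZ].
Qed.

(** On ]0, T] the remainder after N terms is at most tau_N G, and fractional integration is
    monotone. This justifies the exchange even though G may be singular at 0. *)
Lemma fint_ts s x t : 0 <= s -> 0 <= x <= 1 -> 0 < t <= T ->
  fint s (ts x) t = es (fun n => fint s (q n) t) x.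
Proof.
move=> s0 x01 tT; have /andP[t0 tT'] := tT.
have main : (\sum_(n < N) fint s (q n) t * ef n x) @[N --> \oo] --> fint s (ts x) t.
  apply: (@cvg_of_tail R nu nu0 _ _ (fint s G t)) => N.
  rewrite -(fint_sum _ _ s0 tT') distrC.
  have -> : fint s (ts x) t - fint s (part N x) t = fint s (fun z => ts x z - part N x z) t.
    rewrite -[X in _ + X]mulN1r -(fintZ (T := T))// -(fintD (T := T))//; last first.
    - exact: admZ.
    - exact: adm_ts.
    by congr fint; apply/funext => z; rewrite mulN1r.
  rewrite mulrC -(fintZ (T := T))//.
  apply: (norm_fint_le (T := T)) => //; last by move=> z zT; exact: ts_tail.
  - by apply: adm_measurable (admB (adm_ts x01) (adm_part N x)).
  - exact: admZ.
apply/esym/cvg_lim => //; apply: cvg_trans main; apply: near_eq_cvg; apply: nearW => N.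
by rewrite seriesEord.
Qed.

Lemma ts_oint x t : 0 <= x <= 1 -> 0 < t <= T -> fint 1 (ts x) t = oint 0 t (ts x).
Proof.
move=> x01 tT; rewrite /fint oner_eq0 (convolC_adm _ (adm_gk T ltr01) (adm_ts x01)) convolE.
by apply: eq_oint => z _; rewrite gk1 mulr1.
Qed.

Hypothesis cq : forall n z, 0 < z < T -> {for z, continuous (q n)}.
Hypothesis cG : forall z, 0 < z < T -> {for z, continuous G}.

Lemma continuous_ts x t : 0 < x < 1 -> 0 < t < T -> {for t, continuous (ts x)}.
Proof.
move=> x01 tT; have /andP[t0 tT'] := tT; have [x0 x1] := andP x01.
have W z : 0 < z < T -> 0 < z <= T by case/andP => -> /ltW ->.
have x01' : 0 <= x <= 1 by rewrite (ltW x0) (ltW x1).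
have nT : \forall z \near t, 0 < z < T.
  by near=> z; apply/andP; split; near: z; [exact: lt_nbhsr|exact: lt_nbhsl].
suff : ts x z @[z --> t] --> ts x t by [].
rewrite (tsE x (W t tT)).
have nG : \forall z \near t, G z <= G t + 1.
  have := @cvgr_le _ _ _ _ _ _ (cG tT) (G t + 1); rewrite ltrDl ltr01; exact.
have c : es (q ^~ z) x @[z --> t] --> es (q ^~ t) x.
  apply: (@es_cvg R nu nu0 R (nbhs t) _ q (q ^~ t) (fun=> x) x (G t + 1)) => //.
  - by move=> n; exact: cq.
  - by move=> n; exact: cvg_cst.
  - near=> z => n; have zT : 0 < z < T by near: z.
    apply: le_trans (qG n (W _ zT)) _; rewrite ler_wpM2r ?invr_ge0 ?(ltW (gam2_gt0 nu0 n))//.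
    by near: z.
  - exact: nearW.
  - move=> n; apply: le_trans (qG n (W _ tT)) _.
    by rewrite ler_wpM2r ?invr_ge0 ?(ltW (gam2_gt0 nu0 n))// lerDl ler01.
apply: cvg_trans c; apply: near_eq_cvg; near=> z.
by rewrite tsE// W//; near: z.
Unshelve. all: by end_near. Qed.

Lemma is_derive_ts x t v : 0 < x < 1 -> 0 < t < T ->
  (forall z, 0 < z <= T -> v z = fint 1 (ts x) z) -> is_derive t 1 v (es (q ^~ t) x).
Proof.
move=> x01 tT vE; have /andP[t0 tT'] := tT; have [x0 x1] := andP x01.
have x01' : 0 <= x <= 1 by rewrite (ltW x0) (ltW x1).
rewrite -tsE ?t0 ?(ltW tT')//.
have d := ftc_deriv tT (ointb_adm (adm_ts x01')) (continuous_ts x01 tT).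
apply: near_eq_is_derive d; near=> z; have zT : 0 < z <= T.
  by apply/andP; split; near: z; [exact: lt_nbhsr|apply: filterS (lt_nbhsl tT') => s /ltW].
by rewrite vE// ts_oint.
Unshelve. all: by end_near. Qed.

End TimeSeries.

Local Opaque Gamma Phi.

(** For 0 < rho < 1 the definition of [caputo] is the convolution of dg with g_(1-rho); [fint]
    extends this to the end values, where it means the integral of dg, equal to g, and dg itself. *)
Lemma caputo_fint {R : realType} (rho T t : R) (g dg : R -> R) : 0 <= rho <= 1 -> 0 < t < T -> adm T dg ->
  (forall z, 0 < z < T -> is_derive z 1 g (dg z)) -> g t = fint 1 dg t ->
  caputo_derivable rho g t /\ caputo rho g t = fint (1 - rho) dg t.
Proof.
move=> /andP[r0 r1] tT ad gd gE; have [t0 tT'] := andP tT.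
have d1 z : 0 < z < T -> derive1 g z = dg z.
  by move=> zT; rewrite derive1E; have ? := gd z zT; rewrite derive_val.
rewrite /caputo_derivable /caputo; case: eqP => [->|/eqP rn0]; first by rewrite subr0.
case: eqP => [->|/eqP rn1].
  by have [? _] := gd t tT; rewrite d1// subrr /fint eqxx.
have s0 : 0 < 1 - rho by rewrite subr_gt0 lt_neqAle rn1.
have G0 := Gamma_gt0 s0.
have e z : 0 < z < t -> caputo_integrand rho g t z = Gamma (1 - rho) * (dg z * gk (1 - rho) (t - z)).
  move=> /andP[z0 zt]; rewrite /caputo_integrand d1 ?z0 ?(lt_trans zt)// gkE.
  have -> : 1 - rho - 1 = - rho by ring.
  by move: (_ `^ _) (dg z) (Gamma _) G0 => p q G G0; field; rewrite gt_eqF.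
have ci := cint_adm ad (adm_gk T s0) (ltW tT').
split.
  split; first by move=> z /andP[z0 zt]; have zT : 0 < z < T by [rewrite z0 (lt_trans zt)]; have [] := gd z zT.
  apply: (@eq_ointb R 0 t (fun z => Gamma (1 - rho) * (dg z * gk (1 - rho) (t - z)))); last exact: ointbZ.
  by move=> z zt; rewrite e.
rewrite /fint (gt_eqF s0) (convolC_adm _ (adm_gk T s0) ad) convolE.
have h : oint 0 t (caputo_integrand rho g t) = Gamma (1 - rho) * oint 0 t (fun z => dg z * gk (1 - rho) (t - z)).
  by rewrite -(ointZ _ ci); exact: eq_oint.
transitivity ((Gamma (1 - rho))^-1 * oint 0 t (caputo_integrand rho g t)) => //.
by rewrite h mulrA mulVf ?mul1r// gt_eqF.
Qed.

Lemma closed_oint {R : realType} (a b : R) (g : R -> R) : ointb a b g ->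
  \int[lebesgue_measure]_(x in `[a, b]) g x = oint a b g.
Proof.
move=> Ig; rewrite /oint /Rintegral; congr fine; apply: integral_itv_bndoo.
by apply/measurable_EFinP; exact: rint_measurable.
Qed.

Lemma within_sub_cont {R : realType} (C O : set (R * R)) (g h : R * R -> R) : O `<=` C ->
  (forall r, O r -> g r = h r) -> (forall p, O p -> h r @[r --> within C (nbhs p)] --> h p) ->
  {within O, continuous g}.
Proof.
move=> OC gh hc; apply/subspace_continuousP => p pO.
suff : g r @[r --> within O (nbhs p)] --> g p by exact.
rewrite gh// => A /(hc p pO); rewrite /nbhs /= /within /=.
by apply: (@filterS _ (nbhs p)) => r hr rO; rewrite gh//; apply: hr; exact: OC.
Qed.

Lemma cvg_within_fst {R : realType} (D E : set R) (p : R * R) (g : R -> R) (l : R) :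
  g s @[s --> within D (nbhs p.1)] --> l -> g r.1 @[r --> within (D `*` E) (nbhs p)] --> l.
Proof.
move=> c A /c hA; rewrite /nbhs /= /within /=.
have : nbhs p (fun r : R * R => D r.1 -> A (g r.1)) by exact: (@cvg_fst _ _ (nbhs p.1) (nbhs p.2) _ _ hA).
by apply: (@filterS _ (nbhs p)) => r h [Dr _]; exact: h.
Qed.

Lemma cvg_within_snd {R : realType} (D E : set R) (p : R * R) (g : R -> R) (l : R) :
  g s @[s --> within E (nbhs p.2)] --> l -> g r.2 @[r --> within (D `*` E) (nbhs p)] --> l.
Proof.
move=> c A /c hA; rewrite /nbhs /= /within /=.
have : nbhs p (fun r : R * R => E r.2 -> A (g r.2)) by exact: (@cvg_snd _ _ (nbhs p.1) (nbhs p.2) _ _ hA).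
by apply: (@filterS _ (nbhs p)) => r h [_ Er]; exact: h.
Qed.

Section Existence.
Context {R : realType}.
Variables (al be nu lam T : R) (f : R -> R -> R).
Hypotheses (be0 : 0 <= be) (beal : be < al) (al1 : al <= 1) (nu0 : 0 < nu) (T0 : 0 < T).
Hypothesis hf : admissible_source T f.
Implicit Types (x y t s z B M : R) (n m N : nat).
Local Notation ip := (@ip R).
Local Notation ef := (@ef R nu).
Local Notation gam := (@gam R nu).
Local Notation green := (@green R nu).
Local Notation es := (@es R nu).

Let al0 : 0 < al. Proof. exact: le_lt_trans beal. Qed.
Let de0 : 0 < al - be. Proof. by rewrite subr_gt0. Qed.
Let g0 n : 0 < gam n ^+ 2. Proof. exact: gam2_gt0. Qed.
Let ig0 n : 0 <= (gam n ^+ 2)^-1. Proof. by rewrite invr_ge0 ltW. Qed.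
Let W x : 0 < x < 1 -> 0 <= x <= 1. Proof. by case/andP => /ltW -> /ltW ->. Qed.
Let WT t : 0 < t < T -> 0 < t <= T. Proof. by case/andP => -> /ltW ->. Qed.

Let a0 n := ip (f ^~ 0) (ef n).
Let da n := source_rate nu T f n.
Let q n := qmode al (al - be) lam (gam n ^+ 2) (a0 n) (da n).
Let U n := umode al (al - be) lam (gam n ^+ 2) (a0 n) (da n).
Let ada n : adm T (da n). Proof. exact: adm_source_rate. Qed.
Let aq n : adm T (q n). Proof. exact: adm_qmode. Qed.
Let cda n z : 0 < z < T -> {for z, continuous (da n)}.
Proof. by move=> _; exact: continuous_source_rate. Qed.
Let cq n z : 0 < z < T -> {for z, continuous (q n)}.
Proof. by move=> zT; apply: (continuous_qmode al0 de0 (ada n)) zT => y; exact: cda. Qed.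

Let data_bound : exists B M, [/\ 0 <= B, 0 <= M, forall n, `|a0 n| <= B / gam n ^+ 2,
  forall n z, 0 < z <= T -> `|da n z| <= M &
  forall n t, 0 < t <= T -> `|amode (a0 n) (da n) t| <= B / gam n ^+ 2].
Proof.
have [B B0 hB] := source_coef_bound nu0 T0 hf; have [M M0 hM] := source_rate_bound nu0 T0 hf.
exists B, M; split => //.
- by move=> n; have [|_] := hB 0; [rewrite lexx ltW|exact].
- move=> n t /andP[/ltW t0 tT]; have tT' : 0 <= t <= T by rewrite t0.
  by rewrite -(source_coefE nu0 T0 hf n tT'); have [_] := hB t tT'.
Qed.

(** The singular factor g_al comes with the initial coefficient, which is O(gam_n^(-2)), and the
    other term carries 1 / mu = gam_n^(-2), so that one function of z dominates all the modes. *)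
Let q_bound : exists G : R -> R, [/\ adm T G, forall z, 0 < z < T -> {for z, continuous G} &
  forall n z, 0 < z <= T -> `|q n z| <= G z / gam n ^+ 2].
Proof.
have [B [M [B0 M0 h1 h2 h3]]] := data_bound.
have [C C0 hC] := mode_bounds lam al0 al1 de0 T0.
exists (fun z => C * B * gk al z + C * M); split.
- by apply: admD; [apply: admZ; exact: adm_gk|exact: adm_cst].
- move=> z /andP[z0 _]; apply: cvgD; last exact: cvg_cst.
  by apply: cvgMr; exact: continuous_gk.
- move=> n z zT; have [h _] := hC _ _ _ _ _ _ (g0 n) (ada n) (h1 n) (h2 n) (h3 n) z zT.
  apply: le_trans h _; rewrite le_eqVlt; apply/orP; left; apply/eqP.
  by move: (gk al z) (gam n ^- 2) => p r; ring.
Qed.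

(** The coefficients of f give one factor gam_n^(-2) and the mass of the kernel another: this is
    what allows L to be applied to the series. *)
Let U_bound : exists2 B, 0 <= B & forall n t, 0 <= t <= T -> `|gam n ^+ 2 * U n t| <= B / gam n ^+ 2.
Proof.
have [B [M [B0 M0 h1 h2 h3]]] := data_bound.
have [C C0 hC] := mode_bounds lam al0 al1 de0 T0.
exists (C * B) => [|n t]; first exact: mulr_ge0.
case/andP; rewrite le_eqVlt => /predU1P[<- _|t0 tT].
  by rewrite /U umode_nonpos// mulr0 normr0 mulr_ge0// mulr_ge0.
have tT' : 0 < t <= T by rewrite t0.
have [_ h] := hC _ _ _ _ _ _ (g0 n) (ada n) (h1 n) (h2 n) (h3 n) t tT'.
rewrite normrM (gtr0_norm (g0 n)); apply: (le_trans (ler_wpM2l (ltW (g0 n)) h)).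
by rewrite mulrC mulfVK ?gt_eqF// mulrA.
Qed.

Let fint_bound s : 1 - al <= s ->
  exists2 B, 0 <= B & forall n t, 0 < t <= T -> `|fint s (q n) t| <= B / gam n ^+ 2.
Proof.
move=> als; have [B [M [B0 M0 h1 h2 h3]]] := data_bound.
have [C C0 hC] := fint_mode_bounds lam al0 al1 de0 T0 als.
exists (C * (B + M)) => [|n t tT]; first by rewrite mulr_ge0// addr_ge0.
by have := hC _ _ _ _ _ _ (g0 n) (ada n) (h1 n) (h2 n) (h3 n) t tT; rewrite -mulrDl mulrA.
Qed.

Let U_cvg n t : 0 <= t <= T -> U n s @[s --> within `[0, T] (nbhs t)] --> U n t.
Proof.
move=> tT; suff /subspace_continuousP : {within `[0, T], continuous (U n)}.
  by apply; rewrite /= in_itv.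
have iq : ointb 0 T (q n) by exact: ointb_adm.
have UE s : 0 < s <= T -> U n s = oint 0 s (q n) by exact: umode_oint.
apply/continuous_within_itvP => //; split.
- move=> s; rewrite in_itv /= => sT.
  by apply: (@is_derive_cvg R _ (q n s)); apply: is_derive_umode => //; exact: cda.
- have -> : U n 0 = 0 by rewrite /U umode_nonpos.
  apply: cvg_trans (oint_cvg_left T0 iq); apply: near_eq_cvg; near=> s.
  by rewrite UE//; apply/andP; split; near: s; [exact: nbhs_right_gt|exact: nbhs_right_le].
- rewrite UE ?T0 ?lexx//.
  apply: cvg_trans (oint_cvg_right T0 iq); apply: near_eq_cvg; near=> s.
  by rewrite UE//; apply/andP; split; near: s; [exact: nbhs_left_gt|exact: nbhs_left_le].
Unshelve. all: by end_near. Qed.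


Let ig_le n : (gam n ^+ 2)^-1 <= (2 * nu)^-1.
Proof.
apply: le_trans (gam_sum_le nu0 n.+1); rewrite big_ord_recr /= lerDr sumr_ge0// => i _; exact: ig0.
Qed.

Let U_bound2 : exists2 B, 0 <= B & forall n t, 0 <= t <= T -> `|U n t| <= B / gam n ^+ 2.
Proof.
have [B B0 hB] := U_bound; exists (B * (2 * nu)^-1) => [|n t tT].
  by rewrite mulr_ge0// invr_ge0 mulr_ge0// ltW.
have := hB n t tT; rewrite normrM (gtr0_norm (g0 n)) mulrC -ler_pdivlMr// => h; apply: le_trans h _.
by rewrite ler_wpM2r// ler_wpM2l// ig_le.
Qed.

Definition fb_solution x t := es (fun n => U n t) x.
Let u := fb_solution.
(** The series of - L u. Since u is its Green potential, the derivatives of u in x come from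
    [green_pair]. *)
Let w x t := es (fun n => gam n ^+ 2 * U n t) x.

Let es_joint (c : nat -> R -> R) B (D : set R) (p : R * R) : (forall n s, D s -> `|c n s| <= B / gam n ^+ 2) ->
  (forall n s, D s -> c n r @[r --> within D (nbhs s)] --> c n s) -> 0 <= p.1 <= 1 -> D p.2 ->
  es (c ^~ r.2) r.1 @[r --> within (`[0, 1] `*` D) (nbhs p)] --> es (c ^~ p.2) p.1.
Proof.
move=> cB cc p1 p2.
have wD : \forall r \near within (`[0, 1] `*` D) (nbhs p), (`[0, 1] `*` D) r.
  by rewrite /within /=; exact: (@filterE _ (nbhs p)).
apply: (@es_cvg R nu nu0 _ _ _ (fun n (r : R * R) => c n r.2) _ (fun r : R * R => r.1) _ B) => //.
- by move=> n; apply: (cvg_within_snd `[0, 1]%classic); exact: cc.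
- by move=> n; apply: (cvg_within_fst D); exact: ef_cvg_within.
- by apply: filterS wD => r [_ Dr] n; exact: cB.
- by apply: filterS wD => r [+ _]; rewrite /= in_itv.
- by move=> n; exact: cB.
Qed.

Let u_cont : {within closed_rect T, continuous (fun p : R * R => u p.1 p.2)}.
Proof.
have [B B0 hB] := U_bound2.
apply/subspace_continuousP => p [p1 p2]; apply: (@es_joint U B `[0, T]%classic p) => //.
Qed.

Let wE t x : 0 <= t <= T -> 0 < x < 1 -> green (w ^~ t) x = u x t.
Proof.
move=> tT x01; have [B B0 hB] := U_bound; have [-> _] := green_es nu0 (fun n => hB n t tT) x01.
by congr es; apply/funext => n; rewrite mulrC mulKf// gt_eqF.
Qed.

Let w_bcont t : 0 <= t <= T -> bcont (w ^~ t).
Proof. by move=> tT; have [B B0 hB] := U_bound; exact: (es_bcont nu0 (fun n => hB n t tT)). Qed.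

Let u_d1 t x : 0 <= t <= T -> 0 < x < 1 -> is_derive x 1 (u ^~ t) (gD nu (w ^~ t) x / x).
Proof.
move=> tT x01; have [d _] := green_pair nu0 (w_bcont tT) x01; apply: near_eq_is_derive d.
have := near_in_itvoo; move/(_ R 0 1 x); rewrite in_itv => /(_ x01).
by apply: filterS => y; rewrite in_itv /= => y01; rewrite wE.
Qed.

Let u_xx x t : R := nu ^+ 2 / x ^+ 2 * u x t - w x t - gD nu (w ^~ t) x / x ^+ 2.

Let u_d2 t x : 0 <= t <= T -> 0 < x < 1 -> is_derive x 1 (derive1 (u ^~ t)) (u_xx x t).
Proof.
move=> tT x01; have [x0 _] := andP x01; have [_ d] := green_pair nu0 (w_bcont tT) x01.
have d' : is_derive x 1 (fun y => gD nu (w ^~ t) y * y^-1) (u_xx x t).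
  have xn : x != 0 by rewrite gt_eqF.
  have dd := derM d (der_inv xn erefl).
  apply: dd; rewrite wE// /u_xx; move: (gD _ _ _) (u x t) (w x t) => g v k.
  by field.
apply: near_eq_is_derive d'.
have := near_in_itvoo; move/(_ R 0 1 x); rewrite in_itv => /(_ x01).
apply: filterS => y; rewrite in_itv /= => y01; have ? := u_d1 tT y01.
by rewrite derive1E derive_val.
Qed.


Let open_closed : open_rect T `<=` closed_rect T.
Proof.
move=> p [/ooP /andP[x0 x1] /ooP /andP[t0 tT]].
by split; rewrite /= in_itv /= !ltW.
Qed.

(** Joint continuity of x u_x: by [green_es] the series of the x e_n' converges uniformly on the
    open rectangle. *)
Let gD_cvg p : open_rect T p ->
  gD nu (w ^~ r.2) r.1 @[r --> within (closed_rect T) (nbhs p)] --> gD nu (w ^~ p.2) p.1.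
Proof.
move=> pO; have [/ooP p1 /ooP p2] := pO.
have [B B0 hB] := U_bound.
have pC := open_closed pO; have [_ p2C] := pC; rewrite /= in_itv /= in p2C.
have nO : \forall r \near within (closed_rect T) (nbhs p), open_rect T r.
  apply: (@filterS _ (nbhs p) _ (open_rect T)) => //.
  exists (`]0, 1[%classic, `]0, T[%classic) => //; split => /=.
    by have := near_in_itvoo; move/(_ R 0 1 p.1); rewrite in_itv; exact.
  by have := near_in_itvoo; move/(_ R 0 T p.2); rewrite in_itv; exact.
apply: (@cvg_unif_limit R _ _ _ (fun N (r : R * R) => \sum_(n < N) gam n ^+ 2 * U n r.2 * gD nu (ef n) r.1)
  (fun N => \sum_(n < N) gam n ^+ 2 * U n p.2 * gD nu (ef n) p.1) _ _ (fun N => (nu + 1) * (B * tau nu N))).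
- move=> N; apply: cvg_bigsum => n; apply: cvgM.
    have hU : U n r.2 @[r --> within (closed_rect T) (nbhs p)] --> U n p.2.
      by apply: cvg_within_snd; exact: U_cvg.
    exact: (cvgMr hU).
  have [_ d] := green_pair nu0 (bcont_ef nu0 n) p1.
  have c := is_derive_cvg d.
  apply: cvg_within_filter; apply: (cvg_comp (fun r : R * R => r.1) (gD nu (ef n)) _ c).
  exact: (@cvg_fst _ _ (nbhs p.1) (nbhs p.2)).
- move=> N; apply: filterS nO => r [/ooP r1 /ooP r2]; rewrite distrC.
  have r2' : 0 <= r.2 <= T by case/andP: r2 => /ltW -> /ltW ->.
  by have [_] := green_es nu0 (fun n => hB n r.2 r2') r1; exact.
- move=> N; rewrite distrC.
  by have [_] := green_es nu0 (fun n => hB n p.2 p2C) p1; exact.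
- rewrite -(mulr0 (nu + 1)); apply: cvgMr; rewrite -(mulr0 B); apply: cvgMr; exact: tau_cvg0.
Qed.

Let w_cont : {within closed_rect T, continuous (fun p : R * R => w p.1 p.2)}.
Proof.
have [B B0 hB] := U_bound.
apply/subspace_continuousP => p [p1 p2]; apply: (@es_joint (fun n t => gam n ^+ 2 * U n t) B `[0, T]%classic p) => //.
by move=> n s; rewrite /= in_itv /= => sT; apply: cvgMr; exact: U_cvg.
Qed.

Let u_xxE x t : 0 < x < 1 -> 0 <= t <= T -> derive1n 2 (u ^~ t) x = u_xx x t.
Proof. by move=> x01 tT; have ? := u_d2 tT x01; rewrite /= derive1E derive_val. Qed.

Let u_xx_cont : {within open_rect T, continuous (fun p : R * R => derive1n 2 (u ^~ p.2) p.1)}.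
Proof.
have inO r : open_rect T r -> derive1n 2 (u ^~ r.2) r.1 = u_xx r.1 r.2.
  by move=> [/ooP r1 /ooP /andP[/ltW r2 /ltW r3]]; apply: u_xxE => //; rewrite r2.
apply: (within_sub_cont open_closed inO) => p pO.
have pC := open_closed pO; have [/ooP /andP[p0 _] _] := pO.
have c : u_xx r.1 r.2 @[r --> within (closed_rect T) (nbhs p)] --> u_xx p.1 p.2.
  have c1 : (r.1 ^+ 2)^-1 @[r --> within (closed_rect T) (nbhs p)] --> (p.1 ^+ 2)^-1.
    apply: cvg_within_filter; apply: (cvg_comp (fun r : R * R => r.1) (fun y : R => (y ^+ 2)^-1) (G := nbhs p.1)).
      exact: (@cvg_fst _ _ (nbhs p.1) (nbhs p.2)).
    by apply: cvgV; [rewrite expf_neq0 ?gt_eqF|exact: exprn_continuous].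
  apply: cvgB; last by apply: cvgM => //; exact: gD_cvg.
  apply: cvgB; last by have /subspace_continuousP := w_cont; exact.
  apply: cvgM; first exact: cvgMr.
  by have /subspace_continuousP := u_cont; exact.
exact: c.
Qed.

(** The integral of order 1 passes to the terms of the series of the [qmode], so u is the time
    integral of that series and [caputo_fint] applies. *)
Let u_caputo rho x t : 0 <= rho <= 1 -> 0 < x < 1 -> 0 < t < T ->
  caputo_derivable rho (u x) t /\ caputo rho (u x) t = es (fun n => fint (1 - rho) (q n) t) x.
Proof.
move=> r01 x01 tT; have [G [aG cG qG]] := q_bound; have x01' := W x01; have r1 : 0 <= 1 - rho.
  by rewrite subr_ge0; case/andP: r01.
have uE z : 0 < z <= T -> u x z = fint 1 (ts nu T q x) z.
  move=> zT; rewrite (fint_ts nu0 aq aG qG ler01 x01' zT); congr es; apply/funext => n.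
  by rewrite /fint oner_eq0; exact: umodeE.
rewrite -(fint_ts nu0 aq aG qG r1 x01' (WT tT)).
apply: (caputo_fint r01 tT (adm_ts nu0 aq aG qG x01')).
  move=> z zT; rewrite tsE ?WT//.
  exact: (is_derive_ts nu0 aq aG qG cq cG x01 zT uE).
by rewrite uE ?WT.
Qed.

Let u_equation : satisfies_equation al be nu lam T f u.
Proof.
move=> x t; rewrite !in_itv /= => x01 tT.
have tT' : 0 <= t <= T by case/andP: tT => /ltW -> /ltW ->.
have b1 : be <= 1 := le_trans (ltW beal) al1.
have al01 : 0 <= al <= 1 by rewrite (ltW al0).
have be01 : 0 <= be <= 1 by rewrite be0.
have [ca ea] := u_caputo al01 x01 tT; have [cb eb] := u_caputo be01 x01 tT.
have d1 := u_d1 tT' x01; have d2 := u_d2 tT' x01.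
have alb : 1 - al <= 1 - be by rewrite lerB// ltW.
split => //; rewrite ea eb; have -> : derive1 (derive1 (u ^~ t)) x = u_xx x t by rewrite derive1E (@derive_val _ _ _ _ _ _ _ d2).
rewrite derive1E (@derive_val _ _ _ _ _ _ _ d1).
rewrite (source_expansion nu0 T0 hf tT' x01).
have [B1 _ h1] := fint_bound (lexx _); have [B2 _ h2] := fint_bound alb.
have [B3 _ h3] := U_bound; have [B4 [_ [_ _ _ _ h4]]] := data_bound.
have [c1 _] := es_tail nu0 (fun n => h1 n t (WT tT)) (W x01).
have [c2 _] := es_tail nu0 (fun n => h2 n t (WT tT)) (W x01).
have [c3 _] := es_tail nu0 (fun n => h3 n t tT') (W x01).
have [c4 _] := es_tail nu0 (fun n => h4 n t (WT tT)) (W x01).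
have e4 : (fun n => ip (f ^~ t) (ef n)) = (fun n => amode (a0 n) (da n) t).
  by apply/funext => n; rewrite (source_coefE nu0 T0 hf n tT').
(* The sum of [mode_eq] over n; the equation then reduces to the definition of [u_xx]. *)
rewrite e4; have main : es (fun n => fint (1 - al) (q n) t) x + lam * es (fun n => fint (1 - be) (q n) t) x + w x t =
   es (fun n => amode (a0 n) (da n) t) x.
  have c : (fun N => series (fun n => fint (1 - al) (q n) t * ef n x) N +
     lam * series (fun n => fint (1 - be) (q n) t * ef n x) N + series (fun n => gam n ^+ 2 * U n t * ef n x) N) @ \oo -->
     es (fun n => fint (1 - al) (q n) t) x + lam * es (fun n => fint (1 - be) (q n) t) x + w x t.
    by apply: cvgD c3; apply: cvgD c1 _; exact: cvgMr.
  apply/esym/cvg_lim => //; apply: cvg_trans c.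
  apply: near_eq_cvg; apply: nearW => N; rewrite /series /= mulr_sumr -!big_split /=.
  apply: eq_bigr => n _; rewrite -(mode_eq lam (gam n ^+ 2) al0 al1 de0 (a0 n) (ada n) (WT tT)).
  by have -> : 1 - al + (al - be) = 1 - be by [ring]; rewrite /q /U; ring.
rewrite -main /u_xx; have [x0 _] := andP x01.
move: (es _ x) (es _ x) (w x t) (u x t) (gD _ _ _) => p r w' u' g.
by field; rewrite gt_eqF.
Qed.


Let u_caputo_cont : {within open_rect T, continuous (fun p : R * R => caputo al (u p.1) p.2)}.
Proof.
have al01 : 0 <= al <= 1 by rewrite (ltW al0).
have [B _ hB] := fint_bound (lexx _).
apply: (@within_sub_cont R (`[0, 1] `*` `]0, T[) _ _ (fun p : R * R => es (fun n => fint (1 - al) (q n) p.2) p.1)).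
- by move=> p [/ooP /W p1 p2]; split => //; rewrite /= in_itv.
- by move=> r [/ooP r1 /ooP r2]; have [_] := u_caputo al01 r1 r2.
- move=> p [/ooP /W p1 p2].
  apply: (@es_joint (fun n t => fint (1 - al) (q n) t) B `]0, T[%classic p) => //.
  + by move=> n s /ooP /WT sT; exact: hB.
  + move=> n s /ooP sT; apply: cvg_within_filter.
    by apply: (fint_continuous _ (aq n)) sT => [|z]; [rewrite subr_ge0|exact: cq].
Qed.

Let u_boundary : boundary_conditions T u.
Proof.
move=> t; rewrite in_itv /= => tT; have tT' : 0 <= t <= T by case/andP: tT => /ltW -> /ltW ->.
split; last first.
  apply/cvg_lim => //; apply: cvg_near_cst; apply: nearW => N.
  by rewrite /series /= big1// => n _; rewrite (ef1 nu0) mulr0.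
have bw := w_bcont tT'.
have c : gD nu (w ^~ t) x @[x --> 0^'+] --> 0.
  have c0 : nu * green (w ^~ t) x @[x --> 0^'+] --> 0.
    by rewrite -[X in _ --> X](mulr0 nu); apply: cvgMr; exact: green_cvg0.
  rewrite -[X in _ --> X](subr0 (0 : R)); apply: cvgB => //.
  have [M M0 hM] := wA_crude nu0 bw.
  apply: (@cvg0_dom_left R _ M 2) => // x x01; have [x0 _] := andP x01.
  rewrite normrM (gtr0_norm (powR_gt0 _ x0)); apply: (le_trans (ler_wpM2l (powR_ge0 _ _) (hM x x01))).
  by rewrite mulrCA -pow_add// addrA addNr add0r lexx.
apply: cvg_trans c; apply: near_eq_cvg; near=> x.
have x01 : 0 < x < 1 by apply/andP; split; near: x; [exact: nbhs_right_gt|exact: nbhs_right_lt].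
have d1 := u_d1 tT' x01; rewrite derive1E (@derive_val _ _ _ _ _ _ _ d1).
by rewrite mulrC divfK// gt_eqF//; case/andP: x01.
Unshelve. all: by end_near. Qed.

Let u_integrable t : t \in `]0, T[ ->
  (\int[lebesgue_measure]_(x in `[0%R, 1%R]) (Num.sqrt x * `|u x t|)%:E < +oo)%E.
Proof.
rewrite in_itv /= => tT; have tT' : 0 <= t <= T by case/andP: tT => /ltW -> /ltW ->.
have cu : continuous (fun x => Num.sqrt x * `|u (clip 0 1 x) t|).
  move=> x; apply: cvgM; first exact: sqrt_continuous.
  apply: cvg_norm; have h := clip2_continuous ler01 (ltW T0) u_cont.
  have := @continuous_fst_section R (fun x t => u (clip 0 1 x) (clip 0 T t)) t x h.
  by rewrite (clip_id tT').
have I := continuous_compact_integrable (@segment_compact R 0 1) (continuous_subspaceT cu).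
have /integrableP[_] := I; apply: le_lt_trans; rewrite le_eqVlt; apply/orP; left; apply/eqP.
apply: eq_integral => x /set_mem; rewrite /= in_itv /= => x01.
rewrite (clip_id x01); congr (_%:E); apply/esym/ger0_norm.
by apply: mulr_ge0 => //; exact: sqrtr_ge0.
Qed.

Lemma fb_solution_solution : solution al be nu lam T f fb_solution.
Proof.
split; [exact: u_equation|by split|exact: u_boundary|move=> x _].
apply/cvg_lim => //; apply: cvg_near_cst; apply: nearW => N.
by rewrite /series /= big1// => n _; rewrite /U umode_nonpos// mul0r.
Qed.

Lemma fb_solution_series x t : x \in `[0, 1] -> t \in `[0, T] ->
  series (fun n => solution_coef al be nu lam f n.+1 t * besselJ nu (besselJ_zero nu n.+1 * x)) @ \oo
  --> fb_solution x t.
Proof.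
rewrite !in_itv /= => x01 tT.
have [B _ hB] := U_bound2; have [c _] := es_tail nu0 (fun n => hB n t tT) x01.
suff E n : solution_coef al be nu lam f n.+1 t * besselJ nu (besselJ_zero nu n.+1 * x) = U n t * ef n x.
  by rewrite (_ : (fun n => _) = (fun n => U n t * ef n x))//; apply/funext.
have J0 : besselJ (nu + 1) (gam n) != 0 by exact: besselJ1_gam_neq0.
have ne0 : efc nu n != 0 by rewrite mulf_neq0 ?invr_eq0// sqrtr_eq0 -ltNge.
(* The normalization of the Fourier-Bessel coefficients is the square of the factor in e_n: one copy
   goes to the coefficient, the other to the function. *)
have e2 : 2 / besselJ (nu + 1) (gam n) ^+ 2 = efc nu n * efc nu n.
  by rewrite -expr2 /efc exprMn sqr_sqrtr// exprVn.
have cE s : 0 <= s <= T -> fourier_bessel_coef nu f n.+1 s = efc nu n * amode (a0 n) (da n) s.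
  move=> sT; have [B' _ /(_ s sT)[bf _]] := source_coef_bound nu0 T0 hf.
  rewrite -(source_coefE nu0 T0 hf n sT) /fourier_bessel_coef -[besselJ_zero nu n.+1]/(gam n) e2 -mulrA.
  congr (_ * _).
  have Ie := bcont_ip bf (bcont_ef nu0 n).
  have fe x' : 0 < x' < 1 -> (efc nu n)^-1 * (x' * (f x' s * ef n x')) = f x' s * x' * besselJ nu (gam n * x').
    move=> _; rewrite /ef; move: (besselJ _ _) (efc nu n) (f x' s) ne0 => p c' v ne; field; exact: ne.
  have Ij := eq_ointb fe (ointbZ (efc nu n)^-1 Ie).
  transitivity (efc nu n * oint 0 1 (fun x => f x s * x * besselJ nu (gam n * x))).
    by rewrite (closed_oint Ij).
  by rewrite -(eq_oint fe) (ointZ _ Ie) mulrA divff// mul1r.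
case/andP: tT; rewrite le_eqVlt => /predU1P[<- _|t0 tT].
  by rewrite /solution_coef set_itv1 Rintegral_set1 /U umode_nonpos// !mul0r.
have tT' : t <= T by [].
have aK : adm T (kern al (al - be) lam (gam n ^+ 2)) by exact: adm_kern.
have aA : adm T (amode (a0 n) (da n)) by exact: adm_amode.
have ci := cint_adm aK aA tT'.
rewrite /ef /U /umode convolE mulrA; congr (_ * _).
transitivity (efc nu n * oint 0 t (fun z => kern al (al - be) lam (gam n ^+ 2) z * amode (a0 n) (da n) (t - z))); last by rewrite mulrC.
have E z : 0 < z < t -> efc nu n * (kern al (al - be) lam (gam n ^+ 2) z * amode (a0 n) (da n) (t - z)) =
   z `^ (al - 1) * mittag_leffler2 al be al (- lam * z `^ (al - be)) (- gam n ^+ 2 * z `^ al) *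
   fourier_bessel_coef nu f n.+1 (t - z).
  move=> /andP[z0 zt]; rewrite cE ?subr_ge0 ?(ltW zt) ?lerBlDr ?ler_wpDr ?(ltW z0)//.
  by rewrite kern_mittag_leffler// mulrCA.
by rewrite -(ointZ _ ci) (eq_oint E) -(closed_oint (eq_ointb E (ointbZ _ ci))).
Qed.

End Existence.

(** * Uniqueness *)

Local Opaque Gamma Phi.

Section SwapIntegrals.
Context {R : realType}.
Notation leb := (@lebesgue_measure R).
Implicit Types (a b c d s x y z : R) (f g : R -> R) (F : R -> R -> R).

Lemma cvg0_le (U : Type) (G : set_system U) {FG : Filter G} (f h : U -> R) :
  (\forall r \near G, `|f r| <= h r) -> h r @[r --> G] --> 0 -> f r @[r --> G] --> 0.
Proof.
move=> fh h0; apply: norm_cvg0; apply: (squeeze_cvgr _ (cvg_cst 0) h0).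
by apply: filterS fh => r ->; rewrite normr_ge0.
Qed.

Lemma con_ointb_sub a b c d f : con a b f -> a < c -> d < b -> ointb c d f.
Proof.
move=> cf ac db; apply: (rintS (D := `[c, d])) => //; first exact: subset_itv_oo_cc.
apply: continuous_compact_integrable; first exact: segment_compact.
apply: continuous_in_subspaceT => x; rewrite inE /= in_itv /= => /andP[cx xd].
by apply: cf; rewrite (lt_le_trans ac cx) (le_lt_trans xd db).
Qed.

(** [F] is continuous in each variable separately and g only integrable; comparing derivatives in
    the upper bound of the outer integral avoids the joint measurability that Fubini's theorem asks
    for. *)
Lemma oint_swap a b c d g F C : a < b -> ointb c d g ->
  (forall x z, a < x < b -> c < z < d -> `|F x z| <= C) ->
  (forall x, a < x < b -> con c d (F x)) -> (forall z, c < z < d -> con a b (F ^~ z)) ->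
  oint a b (fun x => oint c d (fun z => g z * F x z)) = oint c d (fun z => g z * oint a b (F ^~ z)).
Proof.
move=> ab Ig FC cz cx.
have Ign : ointb c d (fun z => C * `|g z|) by apply/ointbZ/ointb_norm.
have dom k : con c d k -> (forall z, c < z < d -> `|k z| <= C) -> ointb c d (fun z => g z * k z).
  move=> ck kC; apply: rint_le Ign => //.
    by apply: measurable_funM; [exact: rint_measurable|exact: con_measurable].
  by move=> z /ooP zcd; rewrite normrM mulrC ler_wpM2r// kC.
have iF z s t : c < z < d -> a <= s -> t <= b -> ointb s t (F ^~ z).
  move=> zcd sa tb; apply: (@con_ointb R s t _ C); first exact: conS (cx z zcd).
  by move=> x /andP[sx xt]; apply: FC => //; rewrite (le_lt_trans sa sx) (lt_le_trans xt tb).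
pose H x := oint c d (fun z => g z * F x z).
pose N := oint c d (fun z => C * `|g z|).
have gN k : con c d k -> (forall z, c < z < d -> `|k z| <= C) -> `|oint c d (fun z => g z * k z)| <= N.
  move=> ck kC; apply: norm_oint_le => //; first exact: dom.
  by move=> z zcd; rewrite normrM mulrC ler_wpM2r// kC.
have HN x : a < x < b -> `|H x| <= N.
  by move=> xab; apply: gN => [|z zcd]; [exact: cz|exact: FC].
have cH : con a b H.
  apply: con_oint Ign _ => [x xab|z zcd x xab|x z xab zcd].
  - by apply: dom => [|z zcd]; [exact: cz|exact: FC].
  - by apply: cvgMr; exact: cx.
  - by rewrite normrM mulrC ler_wpM2r// FC.
have iH : ointb a b H by exact: con_ointb HN.
pose Q s t z := oint s t (F ^~ z).
have Qc s t : a <= s -> s <= t -> t <= b -> con c d (Q s t).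
  move=> sa st tb; apply: (@con_oint R s t c d (fun z x => F x z) (fun=> C)).
  - by move=> z zcd; exact: iF.
  - by move=> x /andP[sx xt]; apply: cz; rewrite (le_lt_trans sa sx) (lt_le_trans xt tb).
  - exact: ointb_cst.
  - by move=> z x zcd /andP[sx xt]; apply: FC => //; rewrite (le_lt_trans sa sx) (lt_le_trans xt tb).
have QC s t z : a <= s -> s <= t -> t <= b -> c < z < d -> `|Q s t z| <= C * (t - s).
  move=> sa st tb zcd; apply: norm_oint_le_cst => //; first exact: iF.
  by move=> x /andP[sx xt]; apply: FC => //; rewrite (le_lt_trans sa sx) (lt_le_trans xt tb).
have iQ s t : a <= s -> s <= t -> t <= b -> ointb c d (fun z => g z * Q s t z).
  move=> sa st tb; apply: rint_le (ointbZ (t - s) Ign) => //.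
    by apply: measurable_funM; [exact: rint_measurable|apply: con_measurable; exact: Qc].
  move=> z /ooP zcd; rewrite normrM mulrC mulrA [_ * C]mulrC ler_wpM2r//; exact: QC.
pose J s t := oint c d (fun z => g z * Q s t z).
have JN s t : a <= s -> s <= t -> t <= b -> `|J s t| <= (t - s) * N.
  move=> sa st tb; rewrite /N -(ointZ _ Ign); apply: norm_oint_le; [exact: iQ|exact: ointbZ|].
  move=> z zcd; rewrite normrM mulrC mulrA [_ * C]mulrC ler_wpM2r//; exact: QC.
(* Both sides have the same derivative in the upper bound s of the x-integral. *)
pose D s := oint a s H - J a s.
have dD s : a < s < b -> is_derive s 1 D 0.
  move=> sab; have d1 : is_derive s 1 (fun y => oint a y H) (H s) by exact: ftc_deriv sab iH (cH s sab).
  suff d2 : is_derive s 1 (J a) (H s) by exact: (derB d1 d2 (esym (subrr _))).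
  apply: (@is_derive_oint R c d a b (fun s z => g z * Q a s z) (fun s z => g z * F s z) (fun z => C * `|g z|)) => //.
  - by move=> x /andP[ax xb]; apply: iQ => //; exact: ltW.
  - move=> x z xab zcd; have iz := iF z a b zcd (lexx a) (lexx b).
    have dQ : is_derive x 1 (fun y => Q a y z) (F x z) by exact: ftc_deriv xab iz (cx z zcd x xab).
    exact: derZ dQ erefl.
  - move=> z zcd; rewrite mulr_ge0//; apply: le_trans (FC _ _ sab zcd); exact: normr_ge0.
  - by move=> x z xab zcd; rewrite normrM mulrC ler_wpM2r// FC.
have D0 s : a < s < b -> D s = 0.
  move=> sab; apply/esym; apply: (@near_cst_cvg_eq R R (a^'+) _ D); last first.
    apply: (@cvg0_le _ _ _ _ (fun r => `|oint a r H| + (r - a) * N)).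
      near=> r; have /andP[/ltW ar /ltW rb] : a < r < b.
        by apply/andP; split; near: r; [exact: nbhs_right_gt|exact: nbhs_right_lt].
      by apply: le_trans (ler_normB _ _) _; apply: lerD => //; exact: JN.
    rewrite -[X in _ --> X]addr0 -[X in _ --> _ + X](mul0r N); apply: cvgD.
      by rewrite -[X in _ --> X](normr0 R); apply: cvg_norm; exact: oint_cvg_left iH.
    apply: cvgMl; rewrite -[X in _ --> X](subrr a); apply: cvgB; last exact: cvg_cst.
    exact: cvg_at_right_filter.
  near=> r; apply: (oo_cst dD) => //.
  by apply/andP; split; near: r; [exact: nbhs_right_gt|exact: nbhs_right_lt].
suff : D b = 0 by move=> /eqP; rewrite subr_eq0 => /eqP.
(* Passage from D = 0 on ]a, b[ to D(b) = 0: the pieces of both integrals over ]s, b[ tend to 0. *)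
have h : \forall s \near b^'-, `|D b| <= `|oint s b H| + (b - s) * N.
  near=> s; have sab : a < s < b by apply/andP; split; near: s; [exact: nbhs_left_gt|exact: nbhs_left_lt].
  have [/ltW as_ /ltW sb] := andP sab.
  have -> : D b = oint s b H - J s b.
    rewrite -[LHS]subr0 -(D0 s sab) /D (oint_split sab iH).
    have -> : J a b = J a s + J s b; last by move: (oint _ _ _) (oint _ _ _) (J _ _) (J _ _) => p q r v; ring.
    rewrite /J -ointD; [|exact: iQ|exact: iQ]; apply: eq_oint => z zcd.
    by rewrite -mulrDr; congr (_ * _); apply: oint_split => //; exact: iF.
  by apply: le_trans (ler_normB _ _) _; apply: lerD => //; exact: JN.
have l : `|oint s b H| + (b - s) * N @[s --> b^'-] --> 0.
  rewrite -[X in _ --> X]addr0 -[X in _ --> _ + X](mul0r N); apply: cvgD.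
    by rewrite -[X in _ --> X](normr0 R); apply: cvg_norm; exact: oint_cvg_right0 iH.
  apply: cvgMl; rewrite -[X in _ --> X](subrr b); apply: cvgB; first exact: cvg_cst.
  exact: cvg_at_left_filter.
apply/eqP; rewrite -normr_le0.
have n : \forall s \near b^'-, - (`|oint s b H| + (b - s) * N) <= - `|D b|.
  by apply: filterS h => s; rewrite lerN2.
have q := cvg_near_le n (cvgN l); move: q; rewrite lerN2; exact.
Unshelve. all: by end_near. Qed.

End SwapIntegrals.

Local Opaque Gamma Phi.

(** * Integration of a Caputo derivative in time *)

Section CaputoIntegral.
Context {R : realType}.
Variables (rho T : R) (g gc : R -> R).
Hypotheses (rho0 : 0 <= rho) (rho1 : rho <= 1) (T0 : 0 < T).
Hypotheses (cgc : continuous gc) (bgc : exists M, forall t, `|gc t| <= M) (gc0 : gc 0 = 0).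
Hypothesis ggc : forall t, 0 < t < T -> g t = gc t.
Hypothesis dg : forall t, 0 < t < T -> caputo_derivable rho g t.
Hypothesis c1 : rho = 1 -> con 0 T (derive1 g).
Implicit Types (s t z y d : R).

Lemma fint1_oint f t : adm T f -> fint 1 f t = oint 0 t f.
Proof.
move=> af; rewrite /fint oner_eq0 (convolC_adm _ (adm_gk T ltr01) af) convolE.
by apply: eq_oint => z _; rewrite gk1 mulr1.
Qed.

Let mgc : measurable_fun setT gc.
Proof. by apply: open_continuous_measurable_fun; [exact: openT|move=> z _; exact: cgc]. Qed.

Let agc : adm T gc.
Proof. by have [M hM] := bgc; apply: (adm_bounded (M := M)). Qed.

Section Fractional.
Hypotheses (rho0' : 0 < rho) (rho1' : rho < 1).
Let s0 : 0 < 1 - rho. Proof. by rewrite subr_gt0. Qed.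

Let dgz z : 0 < z < T -> derivable g z 1.
Proof.
move=> /andP[z0 zT]; have m : 0 < (z + T) / 2 < T by apply/andP; split; lra.
have := dg m; rewrite /caputo_derivable (gt_eqF rho0') (lt_eqF rho1') => -[h _].
by apply: h; rewrite z0 /=; lra.
Qed.

Let Ic s : 0 < s < T -> ointb 0 s (caputo_integrand rho g s).
Proof. by move=> /dg; rewrite /caputo_derivable (gt_eqF rho0') (lt_eqF rho1') => -[_]. Qed.

(** The Caputo integrand at s is g' times (s - z)^(-rho), so multiplying back by the bounded (s -
    z)^rho shows that g' itself is integrable up to s. *)
Let Ip s : 0 < s < T -> ointb 0 s (derive1 g).
Proof.
move=> sT; apply: (@eq_ointb R 0 s (fun z => caputo_integrand rho g s z * (s - z) `^ rho)).
  move=> z /andP[z0 zs]; rewrite /caputo_integrand -mulrA -pow_add ?subr_gt0// addNr powRr0 mulr1//.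
apply: rint_le (ointbZ (s `^ rho) (ointb_norm (Ic sT))) => //.
  apply: measurable_funM; first exact: rint_measurable (Ic sT).
  exact: measurable_funTS (measurable_sub_comp s (measurable_powR_fun rho)).
move=> z /ooP /andP[z0 zs]; rewrite normrM mulrC ler_wpM2r// ger0_norm ?powR_ge0//.
by apply: ge0_ler_powR => //; rewrite ?nnegrE; lra.
Qed.

Variable t : R.
Hypothesis tT : 0 < t < T.
(** The derivative is only known to be integrable up to points before T, hence a cut-off halfway
    between t and T. *)
Let b := (t + T) / 2.
Let bT : 0 < b < T. Proof. by rewrite /b; case/andP: tT => *; apply/andP; split; lra. Qed.
Let tb : t < b. Proof. by rewrite /b; case/andP: tT => *; lra. Qed.
Let p := derive1 g \_ `]0, b[.

Let pE z : 0 < z < b -> p z = derive1 g z.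
Proof. by move=> zb; rewrite /p patchE mem_set//; apply/ooP. Qed.

Let mp : measurable_fun setT p.
Proof. by apply: rint_measurable; apply/rint_patch => //; exact: Ip. Qed.

Let zbT z : 0 < z <= t -> 0 < z < T /\ z < b.
Proof. by case/andP: tT => t0 tT' /andP[-> zt]; split; [exact: le_lt_trans tT'|exact: le_lt_trans tb]. Qed.

Let ip0 : ointb 0 b p. Proof. by apply: eq_ointb (Ip bT) => z zb; rewrite pE. Qed.

(** [ftc_derivable] applies on [c, z] for c > 0, since g' exists everywhere there and is integrable;
    then c tends to 0, where gc vanishes. *)
Let gE z : 0 < z <= t -> gc z = convol (gk 1) p z.
Proof.
move=> zt; have [zT zb] := zbT zt; have [z0 _] := andP zt.
rewrite convolC//; last exact: measurable_gk.
have -> : convol p (gk 1) z = oint 0 z p by rewrite convolE; apply: eq_oint => y _; rewrite gk1 mulr1.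
have ipz : ointb 0 z p by apply: ointbS ip0 => //; exact: ltW.
apply: (@near_cst_cvg_eq R R (0^'+) _ (fun c => oint 0 c p + (gc z - gc c))).
  near=> c; have c0 : 0 < c by near: c; exact: nbhs_right_gt.
  have cz : c < z by near: c; exact: nbhs_right_lt.
  rewrite (@oint_split R 0 z c p) ?c0//; congr (_ + _).
  have -> : oint c z p = oint c z (derive1 g).
    by apply: eq_oint => y /andP[cy yz]; rewrite pE// (lt_trans c0 cy) (lt_trans yz zb).
  rewrite -!ggc ?zT ?c0 ?(lt_trans cz)//; last by case/andP: zT.
  apply/esym; apply: (@ftc_derivable R g (derive1 g) 0 b) => //; first exact: Ip.
  move=> y /andP[y0 yb]; have dy : derivable g y 1.
    by apply: dgz; rewrite y0 (lt_trans yb)//; case/andP: bT.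
  by rewrite derive1E; exact: DeriveDef.
rewrite -[X in _ --> X]add0r -[X in _ --> 0 + X]subr0 -[X in _ --> 0 + (_ - X)]gc0.
have [b0 _] := andP bT; apply: cvgD; first exact: oint_cvg_left b0 ip0.
by apply: cvgB; [exact: cvg_cst|apply: cvg_at_right_filter; exact: cgc].
Unshelve. all: by end_near. Qed.

Let e z y : 0 < z <= t -> 0 < y < z -> p y * gk (1 - rho) (z - y) = (Gamma (1 - rho))^-1 * caputo_integrand rho g z y.
Proof.
move=> zt /andP[y0 yz]; have [_ zb] := zbT zt.
rewrite pE ?y0 ?(lt_trans yz)// /caputo_integrand gkE.
have -> : 1 - rho - 1 = - rho by ring.
by move: (_ `^ _) (derive1 g y) (Gamma _)^-1 => q r h; ring.
Qed.

Let cI z : 0 < z <= t -> cint p (gk (1 - rho)) z.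
Proof.
move=> zt; have [zT _] := zbT zt.
apply: (@eq_ointb R 0 z (fun y => (Gamma (1 - rho))^-1 * caputo_integrand rho g z y)).
  by move=> y yz; rewrite e.
by apply: ointbZ; exact: Ic.
Qed.

Let CE z : 0 < z <= t -> caputo rho g z = convol p (gk (1 - rho)) z.
Proof.
move=> zt; have [zT _] := zbT zt.
rewrite /caputo (gt_eqF rho0') (lt_eqF rho1') convolE.
transitivity ((Gamma (1 - rho))^-1 * oint 0 z (caputo_integrand rho g z)) => //.
by rewrite -(ointZ _ (Ic zT)); apply: eq_oint => y yz; rewrite e.
Qed.

(** By associativity 1 * (p * g_(1-rho)) = (1 * p) * g_(1-rho), and 1 * p is gc: the integral of the
    Caputo derivative is a fractional integral of the function itself, in which no derivative is
    left. *)
Let main z : 0 < z <= t -> ointb 0 z (caputo rho g) /\ oint 0 z (caputo rho g) = fint (1 - rho) gc z.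
Proof.
move=> zt; have [zT zb] := zbT zt; have [z0 zt'] := andP zt.
have mk : measurable_fun setT (gk (1 - rho)) by exact: measurable_gk.
have m1 : measurable_fun setT (gk 1 : R -> R) by exact: measurable_gk.
have sub y : 0 < y < z -> 0 < y <= t by case/andP => -> /ltW yz; rewrite (le_trans yz).
have i1 y : 0 < y < z -> cint (gk 1) p y.
  move=> yz; apply: cintC => //; apply: (@eq_ointb R 0 y p) => [x _|]; first by rewrite gk1 mulr1.
  by apply: ointbS ip0 => //; case/andP: yz => _ yz; exact: ltW (lt_trans yz zb).
have ipn := ointb_norm ip0.
have i3 : cint (convol (fun z => `|gk 1 z|) (fun z => `|p z|)) (fun z => `|gk (1 - rho) z|) z.
  apply: (@cint_le R _ _ (cst (oint 0 b (fun z => `|p z|))) (gk (1 - rho))).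
  - by apply: measurable_convol; exact: measurableT_comp.
  - exact: measurableT_comp.
  - move=> y /andP[y0 yz]; rewrite ger0_norm; last by apply: convol_ge0 => *; exact: normr_ge0.
    rewrite convolC; [|exact: measurableT_comp|exact: measurableT_comp].
    have -> : convol (fun z => `|p z|) (fun z => `|gk 1 z|) y = oint 0 y (fun z => `|p z|).
      by rewrite convolE; apply: eq_oint => x _; rewrite gk1 normr1 mulr1.
    rewrite (@oint_split R 0 b y) ?y0 ?(lt_trans yz)// lerDl; apply: oint_ge0 => *; exact: normr_ge0.
  - by move=> y /andP[y0 _]; rewrite normr_id ger0_norm// gk_ge0.
  - by apply: (@cint_adm _ T); [exact: adm_cst|exact: adm_gk|case/andP: zT => _ /ltW].
have [ci ei] := cint_convol_assoc m1 mp mk i1 (fun y yz => cI (sub y yz)) i3.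
have mC : measurable_fun setT (convol p (gk (1 - rho))) by exact: measurable_convol.
have ob : ointb 0 z (convol p (gk (1 - rho))).
  by apply: (eq_ointb _ (cintC m1 mC ci)) => y _; rewrite gk1 mulr1.
split; first by apply: eq_ointb ob => y yz; rewrite CE// sub.
rewrite /fint (gt_eqF s0) convolC//.
transitivity (convol (convol (gk 1) p) (gk (1 - rho)) z); last first.
  by apply: eq_convol => // y yz; rewrite -gE// sub.
rewrite ei convolC// convolE; apply: eq_oint => y yz.
by rewrite gk1 mulr1 CE// sub.
Qed.

Lemma caputo_oint_fractional d : 0 < d < t -> ointb d t (caputo rho g) /\
  oint d t (caputo rho g) = fint (1 - rho) gc t - fint (1 - rho) gc d.
Proof.
move=> dt; have [d0 dt'] := andP dt.
have t0 : 0 < t by exact: lt_trans dt'.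
have tt : 0 < t <= t by rewrite t0 lexx.
have dd : 0 < d <= t by rewrite d0 ltW.
have [It Et] := main tt; have [Id Ed] := main dd.
split; first by apply: ointbS It => //; exact: ltW.
by rewrite -Et -Ed (oint_split dt It) addrAC subrr add0r.
Qed.
End Fractional.

(** The orders 0 and 1 are separate clauses of [caputo]; for rho = 1 the continuity of g' is
    supplied by that of the Caputo derivative of order alpha in [regular]. *)
Lemma caputo_oint d t : 0 < d -> d < t -> t < T -> ointb d t (caputo rho g) /\
  oint d t (caputo rho g) = fint (1 - rho) gc t - fint (1 - rho) gc d.
Proof.
move=> d0 dt tT; have t0 := lt_trans d0 dt; have tT' : 0 < t < T by rewrite t0.
have dT := lt_trans dt tT; have dtT : 0 < d < t by rewrite d0.
have gcE z : d < z < t -> g z = gc z.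
  by move=> /andP[dz zt]; apply: ggc; rewrite (lt_trans d0) //= (lt_trans zt).
have [r0|rn0] := eqVneq rho 0.
  have e : caputo rho g = g by apply/funext => z; rewrite /caputo r0 eqxx.
  have ig : ointb d t gc.
    by have [M hM] := bgc; apply: (@con_ointb R d t gc M) => [z _|z _]; [exact: cgc|exact: hM].
  rewrite e r0 subr0 !fint1_oint//; split; first by apply: eq_ointb ig => z zt; rewrite gcE.
  rewrite (eq_oint gcE) (oint_split dtT); first by rewrite addrAC subrr add0r.
  by apply: ointbS (ointb_adm agc) => //; exact: ltW.
have [r1|rn1] := eqVneq rho 1.
  have e : caputo rho g = derive1 g by apply/funext => z; rewrite /caputo r1 oner_eq0 eqxx.
  have D z : 0 < z < T -> is_derive z 1 g (derive1 g z).
    move=> zT; have := dg zT; rewrite /caputo_derivable r1 oner_eq0 eqxx => dz.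
    by rewrite derive1E; exact: DeriveDef.
  have ig : ointb d t (derive1 g) by exact: con_ointb_sub (c1 r1) d0 tT.
  have cg := is_derive_con D.
  rewrite e r1 subrr /fint eqxx; split => //.
  rewrite -!ggc ?d0//; apply: (@ftc_oo R d t g) => //.
  - by apply: (@conS R 0 T d t); [exact: ltW|exact: ltW|exact: c1].
  - by move=> z /andP[dz zt]; apply: D; rewrite (lt_trans d0)//= (lt_trans zt).
  - by apply: cvg_at_right_filter; apply: cg; rewrite d0.
  - by apply: cvg_at_left_filter; exact: cg.
apply: caputo_oint_fractional => //; first by rewrite lt_neqAle eq_sym rn0.
by rewrite lt_neqAle rn1.
Qed.
End CaputoIntegral.

Local Opaque Gamma Phi.

Section BoundedUniqueness.
Context {R : realType}.
Variable nu : R.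
Hypothesis nu0 : 0 < nu.
Implicit Types (p D h : R -> R) (x y M : R).

(** The difference P from the Green potential satisfies Euler's homogeneous equation, whose
    solutions are combinations of x^nu and x^(-nu); c' and c are their coefficients up to factors,
    recovered as constants of motion. Boundedness removes x^(-nu), the limit at 1 removes x^nu. In
    contrast with [green_unique], no bound is asked of the derivative. *)
Lemma green_unique_bounded p D h M : bcont h ->
  (forall x, 0 < x < 1 -> is_derive x 1 p (D x / x)) ->
  (forall x, 0 < x < 1 -> is_derive x 1 D (nu ^+ 2 * p x / x - x * h x)) ->
  (forall x, 0 < x < 1 -> `|p x| <= M) ->
  p x @[x --> 1^'-] --> 0 -> forall x, 0 < x < 1 -> p x = green nu h x.
Proof.
move=> bh dp dD pM p1.
pose P x := p x - green nu h x; pose E x := D x - gD nu h x.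
have dP x : 0 < x < 1 -> is_derive x 1 P (E x / x).
  move=> x01; have [dg _] := green_pair nu0 bh x01.
  by apply: (derB (dp x x01) dg); rewrite /E mulrBl.
have dE x : 0 < x < 1 -> is_derive x 1 E (nu ^+ 2 * P x / x).
  move=> x01; have [_ dg] := green_pair nu0 bh x01.
  by apply: (derB (dD x x01) dg); rewrite /P; move: (p x) (green _ _ _) (h x) => a b c; ring.
have [N N0 gN] := bcont_bound (bcont_green nu0 bh).
have PM x : 0 < x < 1 -> `|P x| <= M + N.
  by move=> x01; apply: le_trans (ler_normB _ _) (lerD (pM x x01) (gN x x01)).
have half : 0 < (2^-1 : R) < 1 by apply/andP; split; lra.
pose c x := x `^ nu * (E x - nu * P x); pose c' x := x `^ (- nu) * (E x + nu * P x).
have dc x : 0 < x < 1 -> is_derive x 1 c 0.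
  move=> x01; have [x0 _] := andP x01; have xn : x != 0 by rewrite gt_eqF.
  have d2 := derB (dE x x01) (derZ (k := nu) (dP x x01) erefl) erefl.
  apply: (derM (der_powR (a := nu) x0 erefl) d2 _).
  by move: (_ `^ _) (E x) (P x) => a e q; field.
have dc' x : 0 < x < 1 -> is_derive x 1 c' 0.
  move=> x01; have [x0 _] := andP x01; have xn : x != 0 by rewrite gt_eqF.
  have d2 := derD (dE x x01) (derZ (k := nu) (dP x x01) erefl) erefl.
  apply: (derM (der_powR (a := - nu) x0 erefl) d2 _).
  by move: (_ `^ _) (E x) (P x) => a e q; field.
have sol x : 0 < x < 1 -> 2 * nu * P x = c' 2^-1 * x `^ nu - c 2^-1 * x `^ (- nu).
  move=> x01; have [x0 _] := andP x01.
  rewrite (oo_cst dc half x01) (oo_cst dc' half x01) /c /c'.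
  have h1 : x `^ nu * x `^ (- nu) = 1 by rewrite -pow_add// subrr powRr0.
  have -> : x `^ (- nu) * (E x + nu * P x) * x `^ nu - x `^ nu * (E x - nu * P x) * x `^ (- nu) =
    (x `^ nu * x `^ (- nu)) * (2 * nu * P x) by move: (x `^ nu) (x `^ (- nu)) (E x) (P x) => a b e q; ring.
  by rewrite h1 mul1r.
have c0 : c 2^-1 = 0.
  have l0 : x `^ nu * (c' 2^-1 * x `^ nu - 2 * nu * P x) @[x --> 0^'+] --> 0.
    apply: (@cvg0_dom_left R _ (`|c' 2^-1| + 2 * nu * (M + N)) nu) => // x x01; have [x0 x1] := andP x01.
    rewrite normrM (ger0_norm (powR_ge0 _ _)) mulrC ler_wpM2r ?powR_ge0//.
    apply: le_trans (ler_normB _ _) _; apply: lerD.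
      rewrite normrM (ger0_norm (powR_ge0 _ _)) ler_piMr// pow_le1// (ltW nu0, ltW x0) ?(ltW x1)//.
    by rewrite normrM gtr0_norm ?mulr_gt0// ler_wpM2l ?PM// mulr_ge0// ltW.
  apply/esym; apply: (near_cst_cvg_eq _ l0); near=> x.
  have x01 : 0 < x < 1 by apply/andP; split; near: x; [exact: nbhs_right_gt|exact: nbhs_right_lt].
  rewrite sol// opprB addrCA subrr addr0 mulrCA -pow_add; last by case/andP: x01.
  by rewrite subrr powRr0 mulr1.
have P1 : P x @[x --> 1^'-] --> 0.
  by rewrite -(subr0 (0 : R)); apply: cvgB => //; exact: green_cvg1.
have c'0 : c' 2^-1 = 0.
  have l0 : x `^ (- nu) * (2 * nu * P x) @[x --> 1^'-] --> 0.
    rewrite -[X in _ --> X](mulr0 (1 `^ (- nu))); apply: cvgM; last first.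
      by rewrite -[X in _ --> X](mulr0 (2 * nu)); exact: cvgMr.
    by apply: cvg_at_left_filter; apply: continuous_powR.
  apply/esym; apply: (near_cst_cvg_eq _ l0); near=> x.
  have x01 : 0 < x < 1 by apply/andP; split; near: x; [exact: nbhs_left_gt|exact: nbhs_left_lt].
  rewrite sol// c0 mul0r subr0 mulrCA -pow_add; last by case/andP: x01.
  by rewrite addNr powRr0 mulr1.
move=> x x01; apply/eqP; rewrite -subr_eq0; have := sol x x01; rewrite c0 c'0 !mul0r subr0 => /eqP.
by rewrite !mulf_eq0 (gt_eqF nu0) pnatr_eq0 /=.
Unshelve. all: by end_near. Qed.

(** The mean value theorem twice. Only v and v_xx are known to be continuous for a solution; this
    estimate yields the continuity in t and the local bounds of v_x. *)
Lemma diff_quotient_le (F f f2 : R -> R) (a b x h M : R) : (forall y, a < y < b -> is_derive y 1 F (f y)) ->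
  (forall y, a < y < b -> is_derive y 1 f (f2 y)) -> a < x -> 0 < h -> x + h < b ->
  (forall y, x <= y <= x + h -> `|f2 y| <= M) -> `|(F (x + h) - F x) / h - f x| <= M * h.
Proof.
move=> dF df ax h0 xhb fM; have xh : x < x + h by rewrite ltrDl.
have [c /andP[xc ch] ->] := oo_MVT dF ax xh xhb.
rewrite [x + h]addrC addrK mulfK ?gt_eqF//.
have [e /andP[xe ec] ->] := oo_MVT df ax xc (lt_trans ch xhb).
have M0 : 0 <= M by apply: le_trans (fM x _); rewrite ?normr_ge0// lexx ltW.
have cx : 0 < c - x by rewrite subr_gt0.
rewrite normrM (gtr0_norm cx); apply: ler_pM => //; first exact: ltW.
  by apply: fM; rewrite (ltW xe) ltW// (lt_trans ec).
by rewrite lerBlDr addrC ltW.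
Qed.
End BoundedUniqueness.

(** * Fourier-Bessel coefficients of an arbitrary solution *)

Section SolutionModes.
Context {R : realType}.
Variables (al be nu lam T : R) (f v : R -> R -> R).
Hypotheses (be0 : 0 <= be) (beal : be < al) (al1 : al <= 1) (nu0 : 0 < nu) (T0 : 0 < T).
Hypotheses (hf : admissible_source T f) (hv : solution al be nu lam T f v).
Implicit Types (x y t s z d M : R) (n : nat).
Local Notation ip := (@ip R).
Local Notation ef := (@ef R nu).
Local Notation gam := (@gam R nu).

Definition clipped x s := v (clip 0 1 x) (clip 0 T s).
Let vc := clipped.

Let vcE x s : 0 <= x <= 1 -> 0 <= s <= T -> vc x s = v x s.
Proof. by move=> x01 sT; rewrite /vc /clipped !clip_id. Qed.

Let ooI x (a b : R) : a < x < b -> x \in `]a, b[. Proof. by rewrite in_itv. Qed.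
Let W01 x : 0 < x < 1 -> 0 <= x <= 1. Proof. by case/andP => /ltW -> /ltW ->. Qed.
Let WT s : 0 < s < T -> 0 <= s <= T. Proof. by case/andP => /ltW -> /ltW ->. Qed.

Lemma clipped_continuous : continuous (fun p : R * R => clipped p.1 p.2).
Proof. by have [_ [h _ _ _] _ _] := hv; exact: (clip2_continuous ler01 (ltW T0) h). Qed.

Lemma clipped_bounded : exists2 M, 0 <= M & forall x s, `|clipped x s| <= M.
Proof.
have [_ [h _ _ _] _ _] := hv; have [M M0 hM] := clip2_bounded ler01 (ltW T0) h.
by exists M => // x s; apply: hM; apply: clip_in; rewrite ?ler01 ?ltW.
Qed.

Lemma clipped0 x s : s <= 0 -> clipped x s = 0.
Proof.
move=> s0; have [_ _ _ h] := hv; rewrite /clipped.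
have -> : clip 0 T s = 0 by rewrite /clip (min_idPr (le_trans s0 (ltW T0))) (max_idPl s0).
by apply: h; rewrite in_itv /=; apply: clip_in; exact: ler01.
Qed.

Let ct x : continuous (vc x).
Proof. by move=> s; exact: (@continuous_snd_section R clipped s x clipped_continuous). Qed.

Let cx s : continuous (vc ^~ s).
Proof. by move=> x; exact: (@continuous_fst_section R clipped s x clipped_continuous). Qed.

Let vx x s := derive1 (v ^~ s) x.
Let vxx x s := derive1n 2 (v ^~ s) x.

Let dv x s : 0 < x < 1 -> 0 < s < T -> is_derive x 1 (v ^~ s) (vx x s).
Proof.
move=> x01 sT; have [h _ _ _] := hv.
have [d1 _ _ _ _] := h x s (ooI x01) (ooI sT).
by rewrite /vx derive1E; exact: DeriveDef.
Qed.

Let dvx x s : 0 < x < 1 -> 0 < s < T -> is_derive x 1 (vx ^~ s) (vxx x s).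
Proof.
move=> x01 sT; have [h _ _ _] := hv.
have [_ d1 _ _ _] := h x s (ooI x01) (ooI sT).
by rewrite /vxx /= derive1E; exact: DeriveDef.
Qed.

Let section_con (g : R * R -> R) x : {within open_rect T, continuous g} -> 0 < x < 1 -> con 0 T (fun s => g (x, s)).
Proof.
move=> /subspace_continuousP cg x01 s sT.
have pO : open_rect T (x, s) by split; apply/ooP.
move=> A /(cg _ pO) h; have h' : nbhs (x, s) (fun r => open_rect T r -> A (g r)) := h.
have l : (x, y) @[y --> s] --> (x, s) by apply: cvg_pairing; [exact: cvg_cst|exact: cvg_id].
have := l _ h'; have := near_in_itvoo; move/(_ R 0 T s); rewrite in_itv => /(_ sT).
apply: filterS2 => y; rewrite in_itv /= => yT; apply; split; exact/ooP.
Qed.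

Let vxx_con x : 0 < x < 1 -> con 0 T (vxx x).
Proof. by have [_ [_ h _ _] _ _] := hv; exact: (section_con h). Qed.

Let box (a b c d : R) : 0 < a -> b < 1 -> 0 < c -> d < T -> `[a, b] `*` `[c, d] `<=` open_rect T.
Proof.
move=> a0 b1 c0 dT p [/=]; rewrite !in_itv /= => /andP[ap pb] /andP[cp pd].
by split; apply/ooP; apply/andP; split; [exact: lt_le_trans ap|exact: le_lt_trans b1|exact: lt_le_trans cp|exact: le_lt_trans dT].
Qed.

Let vxx_bd (a b c d : R) : 0 < a -> a <= b -> b < 1 -> 0 < c -> c <= d -> d < T ->
  exists2 M, 0 <= M & forall x s, a <= x <= b -> c <= s <= d -> `|vxx x s| <= M.
Proof.
move=> a0 ab b1 c0 cd dT; have [_ [_ h _ _] _ _] := hv.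
exact: (clip2_bounded ab cd (continuous_subspaceW (box a0 b1 c0 dT) h)).
Qed.

Let quot x h s := (vc (x + h) s - vc x s) / h.

Let quot_le x h s M : 0 < x -> 0 < h -> x + h < 1 -> 0 < s < T ->
  (forall y, x <= y <= x + h -> `|vxx y s| <= M) -> `|quot x h s - vx x s| <= M * h.
Proof.
move=> x0 h0 xh sT bM; rewrite /quot !vcE ?WT//; last 2 first.
- by rewrite ltW //= ltW// (lt_trans _ xh)// ltrDl.
- by rewrite addr_ge0 ?ltW.
exact: (@diff_quotient_le R (v ^~ s) (vx ^~ s) (vxx ^~ s) 0 1 x h M (fun y hy => dv hy sT) (fun y hy => dvx hy sT)).
Qed.


(** v_x(x, .) is the locally uniform limit of the difference quotients with steps h0 / (N + 1),
    which are continuous in t. *)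
Let vx_con x : 0 < x < 1 -> con 0 T (vx x).
Proof.
move=> x01 s sT; have [x0 x1] := andP x01; have [s0 s1] := andP sT.
pose h0 := (1 - x) / 2; have h00 : 0 < h0 by rewrite /h0; lra.
have xh : x + h0 < 1 by rewrite /h0; lra.
have [||||||M M0 hM] := @vxx_bd x (x + h0) (s / 2) ((s + T) / 2) => //; try lra.
pose h N : R := h0 * N.+1%:R^-1.
have hN N : 0 < h N <= h0.
  by rewrite /h mulr_gt0 ?invr_gt0//= ler_piMr ?(ltW h00)// invf_le1// ler1n.
have qN N r : s / 2 < r < (s + T) / 2 -> `|quot x (h N) r - vx x r| <= M * h N.
  move=> /andP[r0 r1]; have /andP[hN0 hN1] := hN N.
  apply: quot_le => //; first by apply: le_lt_trans xh; rewrite lerD2l.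
    by apply/andP; split; lra.
  by move=> y /andP[y0 y1]; apply: hM; [rewrite y0 (le_trans y1)// lerD2l|rewrite (ltW r0) (ltW r1)].
apply: (@cvg_unif_limit R R (nbhs s) _ (fun N => quot x (h N)) (fun N => quot x (h N) s) _ _ (fun N => M * h N)).
- by move=> N; apply: cvgMl; apply: cvgB; exact: ct.
- move=> N; near=> r; apply: qN; apply/andP; split; near: r; [apply: lt_nbhsr; lra|apply: lt_nbhsl; lra].
- by move=> N; apply: qN; apply/andP; split; lra.
- rewrite -[X in _ --> X](mulr0 M); apply: cvgMr; rewrite -[X in _ --> X](mulr0 h0); apply: cvgMr.
  exact: cvg_harmonic.
Unshelve. all: by end_near. Qed.

Let vx_bd (a b c d : R) : 0 < a -> a <= b -> b < 1 -> 0 < c -> c <= d -> d < T ->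
  exists2 M, 0 <= M & forall x s, a <= x <= b -> c <= s <= d -> `|vx x s| <= M.
Proof.
move=> a0 ab b1 c0 cd dT; pose h := (1 - b) / 2; have h0 : 0 < h by rewrite /h; lra.
have bh : b + h < 1 by rewrite /h; lra.
have abh : a <= b + h by lra.
have [M2 M20 hM2] := vxx_bd a0 abh bh c0 cd dT; have [M M0 hM] := clipped_bounded.
exists ((M + M) / h + M2 * h) => [|x s /andP[ax xb] /andP[cs sd]].
  by apply: addr_ge0; apply: mulr_ge0 => //; [exact: addr_ge0|rewrite invr_ge0 ltW|exact: ltW].
have x0 := lt_le_trans a0 ax; have xh : x + h < 1 by lra.
have sT : 0 < s < T by rewrite (lt_le_trans c0)// (le_lt_trans sd).
have q : `|quot x h s - vx x s| <= M2 * h.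
  apply: quot_le => // y /andP[xy yh]; apply: hM2; last by rewrite cs.
  by rewrite (le_trans ax)// (le_trans yh)// lerD2r.
have -> : vx x s = quot x h s - (quot x h s - vx x s) by rewrite opprB addrC subrK.
apply: le_trans (ler_normB _ _) _; apply: lerD => //.
rewrite /quot normrM normfV (gtr0_norm h0) ler_wpM2r ?invr_ge0 ?(ltW h0)//.
by apply: le_trans (ler_normB _ _) _; apply: lerD; exact: hM.
Qed.

Let fc x s := f (clip 0 1 x) (clip 0 T s).

Let fc_cont : continuous (fun p : R * R => fc p.1 p.2).
Proof. by have [_ _ _ [h _ _]] := hf; exact: (clip2_continuous ler01 (ltW T0) h). Qed.

Let fc_bd : exists2 M, 0 <= M & forall x s, `|fc x s| <= M.
Proof.
have [_ _ _ [h _ _]] := hf; have [M M0 hM] := clip2_bounded ler01 (ltW T0) h.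
by exists M => // x s; apply: hM; apply: clip_in; rewrite ?ler01 ?ltW.
Qed.

Let Z x s := fint (1 - al) (vc x) s + lam * fint (1 - be) (vc x) s.
Let Lv x s := vxx x s + x^-1 * vx x s - nu ^+ 2 / x ^+ 2 * vc x s.

Let cont_ointb (g : R -> R -> R) M x c d : continuous (fun p : R * R => g p.1 p.2) -> (forall x s, `|g x s| <= M) ->
  ointb c d (g x).
Proof.
move=> cg gM; apply: (@con_ointb R c d (g x) M) => // s _.
exact: (@continuous_snd_section R g s x cg).
Qed.

(** The equation integrated over [d, t]; [caputo_oint] turns the two Caputo terms into values of Z
    at the ends, which involve v but none of its time derivatives. *)
Let Lv_oint x d t : 0 < x < 1 -> 0 < d -> d < t -> t < T ->
  oint d t (Lv x) = Z x t - Z x d - oint d t (fc x).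
Proof.
move=> x01 d0 dt tT; have [M M0 hM] := clipped_bounded; have [N N0 hN] := fc_bd.
have [h [_ _ hca _] _ _] := hv.
have bM : exists M, forall s, `|vc x s| <= M by exists M.
have v0 : vc x 0 = 0 by exact: clipped0.
have vv s : 0 < s < T -> v x s = vc x s by move=> sT; rewrite vcE ?W01 ?WT.
have H s : 0 < s < T -> [/\ caputo_derivable al (v x) s, caputo_derivable be (v x) s &
    caputo al (v x) s + lam * caputo be (v x) s - fc x s = Lv x s].
  move=> sT; have [_ _ ca cb e] := h x s (ooI x01) (ooI sT); split => //.
  rewrite e /Lv -(vv s sT) /vx /vxx /fc !clip_id; [|exact: WT|exact: W01].
  by rewrite addrK.
have al0 : 0 <= al by exact: ltW (le_lt_trans be0 beal).
have be1 : be < 1 by exact: lt_le_trans al1.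
have c1 : al = 1 -> con 0 T (derive1 (v x)).
  move=> e; have := section_con hca x01; rewrite /caputo e oner_eq0 eqxx; exact.
have [I1 E1] := caputo_oint al0 al1 (@ct x) bM v0 vv (fun s sT => let: And3 a _ _ := H s sT in a) c1 d0 dt tT.
have c2 : be = 1 -> con 0 T (derive1 (v x)) by move=> e; move: be1; rewrite e ltxx.
have [I2 E2] := caputo_oint be0 (ltW be1) (@ct x) bM v0 vv (fun s sT => let: And3 _ b _ := H s sT in b) c2 d0 dt tT.
have If := cont_ointb x d t fc_cont hN.
transitivity (oint d t (fun s => caputo al (v x) s + lam * caputo be (v x) s - fc x s)).
  apply: eq_oint => s /andP[ds st]; have sT : 0 < s < T by rewrite (lt_trans d0)//= (lt_trans st).
  by have [_ _ ->] := H s sT.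
have I3 := ointbZ lam I2.
rewrite (ointB (ointbD I1 I3) If) (ointD I1 I3) (ointZ _ I2) E1 E2 /Z.
by move: (fint _ _ t) (fint _ _ d) (fint _ _ t) (fint _ _ d) (oint _ _ _) => *; ring.
Qed.

Let kernel_con (g : R -> R) (G : R -> R -> R) M c d : ointb c d g -> continuous (fun p : R * R => G p.1 p.2) ->
  (forall x s, `|G x s| <= M) -> bcont (fun x => oint c d (fun z => g z * G x z)) /\
  forall n, ip (fun x => oint c d (fun z => g z * G x z)) (ef n) = oint c d (fun z => g z * ip (G ^~ z) (ef n)).
Proof.
move=> Ig cG GM; have M0 : 0 <= M := le_trans (normr_ge0 _) (GM 0 0).
have Ign : ointb c d (fun z => M * `|g z|) by apply/ointbZ/ointb_norm.
have cs x z : G x s @[s --> z] --> G x z by exact: (@continuous_snd_section R G z x cG).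
have cf x z : G y z @[y --> x] --> G x z by exact: (@continuous_fst_section R G z x cG).
have I x : ointb c d (fun z => g z * G x z).
  apply: rint_le Ign => //.
    by apply: measurable_funM; [exact: rint_measurable|apply: con_measurable => z _; exact: cs].
  by move=> z _; rewrite normrM mulrC ler_wpM2r// GM.
split.
  split; last first.
    exists (oint c d (fun z => M * `|g z|)) => x _; apply: norm_oint_le => // z _.
    by rewrite normrM mulrC ler_wpM2r// GM.
  apply: con_oint Ign _ => [x _|z _ x _|x z _ _]; [exact: I|by apply: cvgMr; exact: cf|].
  by rewrite normrM mulrC ler_wpM2r// GM.
move=> n; have be_ := bcont_ef nu0 n; have [C C0 hC] := bcont_bound be_; have [ce _] := be_.
rewrite /ip -(@oint_swap R 0 1 c d g (fun x z => x * (G x z * ef n x)) (M * C)) ?ltr01//.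
- apply: eq_oint => x _; rewrite mulrCA mulrC -(ointZ _ (I x)); apply: eq_oint => z _.
  by move: (g z) (G x z) (ef n x) => *; ring.
- move=> x z /[dup] x01 /andP[x0 x1] _; rewrite normrM (gtr0_norm x0) -[leRHS]mul1r.
  apply: ler_pM => //; rewrite ?(ltW x0) ?(ltW x1)// normrM.
  exact: (ler_pM (normr_ge0 _) (normr_ge0 _) (GM x z) (hC x x01)).
- by move=> x _ z _; apply: cvgMr; apply: cvgMl; exact: cs.
- by move=> z _ x x01; apply: cvg_mul_id; apply: cvgM; [exact: cf|exact: ce].
Qed.

Definition mode_of n s := ip (clipped ^~ s) (ef n).

Let fint_modes r t : 0 <= r -> 0 < t -> bcont (fun x => fint r (vc x) t) /\
  forall n, ip (fun x => fint r (vc x) t) (ef n) = fint r (mode_of n) t.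
Proof.
rewrite le_eqVlt => /predU1P[<- t0|r0 t0]; have [M M0 hM] := clipped_bounded.
  rewrite /fint eqxx; split => //; split; first by move=> x _; exact: cx.
  by exists M => x _; exact: hM.
have Ig : ointb 0 t (gk r).
  by have := cint_adm (adm_gk t r0) (adm_gk t ltr01) (lexx t); apply: eq_ointb => z _; rewrite gk1 mulr1.
have cG : continuous (fun p : R * R => vc p.1 (t - p.2)).
  move=> p; suff h : (r.1, t - r.2) @[r --> p] --> (p.1, t - p.2).
    exact: (cvg_comp _ (fun r : R * R => clipped r.1 r.2) h (@clipped_continuous (p.1, t - p.2))).
  by apply: cvg_pairing; [exact: cvg_fst|apply: cvgB; [exact: cvg_cst|exact: cvg_snd]].
have [bc E] := @kernel_con (gk r) (fun x z => vc x (t - z)) M 0 t Ig cG (fun x s => hM _ _).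
have e : (fun x => fint r (vc x) t) = (fun x => oint 0 t (fun z => gk r z * vc x (t - z))).
  by apply/funext => x; rewrite /fint (gt_eqF r0) convolE.
rewrite e; split => // n; rewrite E /fint (gt_eqF r0) convolE; exact: eq_oint.
Qed.


Let bZ t : 0 < t -> bcont (Z ^~ t) /\
  forall n, ip (Z ^~ t) (ef n) = fint (1 - al) (mode_of n) t + lam * fint (1 - be) (mode_of n) t.
Proof.
move=> t0; have al0 : 0 <= 1 - al by rewrite subr_ge0.
have be1 : 0 <= 1 - be by rewrite subr_ge0 (le_trans (ltW beal)).
have [b1 e1] := fint_modes al0 t0; have [b2 e2] := fint_modes be1 t0.
have b3 := bcontZ lam b2; split; first exact: bcontD.
by move=> n; have bn := bcont_ef nu0 n; rewrite (ipDl b1 b3 bn) (ipZl _ b2 bn) e1 e2.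
Qed.

(* Integrating the equation over [d, t] leaves an ordinary differential equation in x for
   V x = int_d^t v x s ds, which has only one bounded solution vanishing at 1. *)
Section Window.
Variables d t : R.
Hypotheses (d0 : 0 < d) (dt : d < t) (tT : t < T).
Let sT s : d < s < t -> 0 < s < T.
Proof. by move=> /andP[ds st]; rewrite (lt_trans d0)//= (lt_trans st). Qed.

Let V x := oint d t (vc x).
Let V1 x := oint d t (vx x).
Let F x := oint d t (fc x).
Let k x := Z x d + F x - Z x t.

Let ivc x : ointb d t (vc x).
Proof. by have [M _ hM] := clipped_bounded; exact: cont_ointb clipped_continuous hM. Qed.

Let ivx x : 0 < x < 1 -> ointb d t (vx x).
Proof. by move=> x01; exact: con_ointb_sub (vx_con x01) d0 tT. Qed.

Let ivxx x : 0 < x < 1 -> ointb d t (vxx x).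
Proof. by move=> x01; exact: con_ointb_sub (vxx_con x01) d0 tT. Qed.

Let window x y : 0 < x < 1 -> x / 2 < y < (x + 1) / 2 -> 0 < y < 1.
Proof. by move=> /andP[x0 x1] /andP[y0 y1]; apply/andP; split; lra. Qed.

Let window0 x : 0 < x < 1 -> [/\ 0 < x / 2, x / 2 <= (x + 1) / 2, (x + 1) / 2 < 1 & x / 2 < x < (x + 1) / 2].
Proof. by move=> /andP[x0 x1]; split; try lra; apply/andP; split; lra. Qed.

Let dV x : 0 < x < 1 -> is_derive x 1 V (V1 x).
Proof.
move=> x01; have [w0 w1 w2 w3] := window0 x01.
have [M M0 hM] := vx_bd w0 w1 w2 d0 (ltW dt) tT.
apply: (@is_derive_oint R d t (x / 2) ((x + 1) / 2) vc vx (fun=> M) x _ _ _ _ _ w3).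
- by move=> y _; exact: ivc.
- move=> y s /(window x01) y01 st; have h := dv y01 (sT st).
  apply: near_eq_is_derive h; have := near_in_itvoo; move/(_ R 0 1 y); rewrite in_itv => /(_ y01).
  by apply: filterS => z; rewrite in_itv /= => z01; rewrite vcE ?W01// WT// sT.
- by move=> s _.
- exact: ointb_cst.
- by move=> y s /andP[y0 y1] /andP[s0 s1]; apply: hM; rewrite ltW//= ltW.
Qed.

Let dV1 x : 0 < x < 1 -> is_derive x 1 V1 (oint d t (vxx x)).
Proof.
move=> x01; have [w0 w1 w2 w3] := window0 x01.
have [M M0 hM] := vxx_bd w0 w1 w2 d0 (ltW dt) tT.
apply: (@is_derive_oint R d t (x / 2) ((x + 1) / 2) vx vxx (fun=> M) x _ _ _ _ _ w3).
- by move=> y /(window x01); exact: ivx.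
- by move=> y s /(window x01) y01 st; exact: dvx y01 (sT st).
- by move=> s _.
- exact: ointb_cst.
- by move=> y s /andP[y0 y1] /andP[s0 s1]; apply: hM; rewrite ltW//= ltW.
Qed.

Let Fk : bcont F.
Proof.
have [N N0 hN] := fc_bd.
have [b _] := @kernel_con (fun=> 1) fc N d t (ointb_cst _ _ _) fc_cont hN.
by apply: eq_bcont b => x _; apply: eq_oint => z _; rewrite mul1r.
Qed.

Let bk : bcont k.
Proof. by have [b1 _] := bZ d0; have [b2 _] := bZ (lt_trans d0 dt); apply: bcontB => //; exact: bcontD. Qed.

Let V_green x : 0 < x < 1 -> V x = green nu k x.
Proof.
have [M M0 hM] := clipped_bounded.
apply: (@green_unique_bounded R nu nu0 V (fun x => x * V1 x) k (M * (t - d)) bk).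
- by move=> y y01; rewrite mulrC mulKf ?gt_eqF//; [exact: dV|case/andP: y01].
- move=> y y01; have [y0 _] := andP y01; apply: (derM (is_derive_id y 1) (dV1 y01) _).
  have := Lv_oint y01 d0 dt tT; rewrite /Lv.
  rewrite (@ointB R d t (fun s => vxx y s + y^-1 * vx y s) (fun s => nu ^+ 2 / y ^+ 2 * vc y s)); last first.
  - exact: ointbZ.
  - by apply: ointbD; [exact: ivxx|apply: ointbZ; exact: ivx].
  rewrite (ointD (ivxx y01) (ointbZ _ (ivx y01))) (ointZ _ (ivx y01)) (ointZ _ (ivc y)).
  rewrite -/(V1 y) -/(V y) -/(F y) /k; move: (oint _ _ _) (V1 y) (V y) (F y) (Z y t) (Z y d) => p q r a b c E.
  have -> : p = b - c - a - y^-1 * q + nu ^+ 2 / y ^+ 2 * r by rewrite -E; ring.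
  by field; rewrite gt_eqF.
- move=> y _; apply: norm_oint_le_cst => //; first exact: ltW.
- have cV : con 0 2 V.
    apply: (@con_oint R d t 0 2 vc (fun=> M)) => //; last exact: ointb_cst.
    by move=> s _ y _; exact: cx.
  have V0 : V 1 = 0.
    rewrite /V (@eq_oint R d t _ (fun=> 0)); first by rewrite oint_cst ?mul0r// ltW.
    move=> s /sT st; rewrite vcE ?ler01 ?lexx ?WT//.
    by have [_ _ hb _] := hv; have [_] := hb s (ooI st).
  by rewrite -V0; apply: cvg_at_left_filter; apply: cV; rewrite ltr01 ltr1n.
Qed.

(** The projection of V = G k on e_n, with G e_n = e_n / gam_n^2. The source enters through a term
    that is the same for any two solutions and cancels in their difference. *)
Lemma mode_identity n : gam n ^+ 2 * oint d t (mode_of n) =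
  fint (1 - al) (mode_of n) d + lam * fint (1 - be) (mode_of n) d
  - (fint (1 - al) (mode_of n) t + lam * fint (1 - be) (mode_of n) t)
  + ip (fun x => oint d t (fun s => f (clip 0 1 x) (clip 0 T s))) (ef n).
Proof.
have [M M0 hM] := clipped_bounded; have bn := bcont_ef nu0 n.
have [_ E] := @kernel_con (fun=> 1) vc M d t (ointb_cst _ _ _) clipped_continuous hM.
have eV : ip V (ef n) = oint d t (mode_of n).
  rewrite (_ : V = fun x => oint d t (fun z => 1 * vc x z)).
    by rewrite E; apply: eq_oint => z _; rewrite mul1r.
  by apply/funext => x; apply: eq_oint => z _; rewrite mul1r.
have gn := gam2_gt0 nu0 n.
have [b1 e1] := bZ d0; have [b2 e2] := bZ (lt_trans d0 dt).
have ek : ip k (ef n) = ip (Z ^~ d) (ef n) + ip F (ef n) - ip (Z ^~ t) (ef n).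
  by rewrite (ipBl (bcontD b1 Fk) b2 bn) (ipDl b1 Fk bn).
rewrite -eV (eq_ip V_green (fun x _ => erefl (ef n x))) (green_sym nu0 bk bn).
rewrite (eq_ip (fun x _ => erefl (k x)) (fun x x01 => green_ef nu0 n x01)).
have -> : ip k (fun x => ef n x / gam n ^+ 2) = (gam n ^+ 2)^-1 * ip k (ef n).
  rewrite ipC -(ipC (ef n)) -(ipZl _ bn bk); apply: eq_ip => x _ //; exact: mulrC.
rewrite mulrA divff ?gt_eqF// mul1r ek e1 e2 /F /fc.
by move: (fint _ _ d) (fint _ _ d) (fint _ _ t) (fint _ _ t) (ip _ _) => *; ring.
Qed.
End Window.

Lemma continuous_mode_of n : continuous (mode_of n).
Proof.
move=> s; have [M M0 hM] := clipped_bounded; have bn := bcont_ef nu0 n; have [C C0 hC] := bcont_bound bn.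
have := @con_oint R 0 1 (s - 1) (s + 1) (fun s x => x * (vc x s * ef n x)) (fun=> M * C).
move/(_ _ _ (ointb_cst _ _ _) _ s); apply; last by rewrite ltrBlDr !ltrDl ltr01.
- by move=> r _; apply: bcont_ip => //; split; [move=> x _; exact: cx|exists M => x _; exact: hM].
- by move=> x _ r _; apply: cvgMr; apply: cvgMl; exact: ct.
- move=> r x _ /[dup] x01 /andP[x0 x1]; rewrite normrM (gtr0_norm x0) -[leRHS]mul1r normrM.
  apply: ler_pM; rewrite ?(ltW x0) ?(ltW x1) ?mulr_ge0//.
  exact: (ler_pM (normr_ge0 _) (normr_ge0 _) (hM x r) (hC x x01)).
Qed.

Lemma mode_of_bounded n : exists M, forall s, `|mode_of n s| <= M.
Proof.
have [M M0 hM] := clipped_bounded; have bn := bcont_ef nu0 n; have [C C0 hC] := bcont_bound bn.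
exists (M * C) => s; apply: ip_norm_le => //.
by split; [move=> x _; exact: cx|exists M => x _; exact: hM].
Qed.

Lemma mode_of_nonpos n s : s <= 0 -> mode_of n s = 0.
Proof.
move=> s0; rewrite /mode_of /ip (@eq_oint R 0 1 _ (fun=> 0)); first by rewrite oint_cst ?mul0r.
by move=> x _; rewrite clipped0// mul0r mulr0.
Qed.

End SolutionModes.

Local Opaque Gamma Phi.

(** * Vanishing of the modes of a difference of solutions *)

Section ModeZero.
Context {R : realType}.
Variables (al be lam mu T : R) (e : R -> R).
Hypotheses (be0 : 0 <= be) (beal : be < al) (al1 : al <= 1).
Hypotheses (ce : continuous e) (bde : exists M, forall s, `|e s| <= M) (e0 : e 0 = 0).
Implicit Types (s t d r : R).

Let al0 : 0 < al. Proof. exact: le_lt_trans beal. Qed.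
Let sal : 0 <= 1 - al. Proof. by rewrite subr_ge0. Qed.
Let sbe : 0 <= 1 - be. Proof. by rewrite subr_ge0 (le_trans (ltW beal)). Qed.

Let fe s := fint (1 - al) e s + lam * fint (1 - be) e s.

Hypothesis He : forall d t, 0 < d -> d < t -> t < T -> mu * oint d t e = fe d - fe t.

Let me : measurable_fun setT e.
Proof. by apply: open_continuous_measurable_fun; [exact: openT|move=> z _; exact: ce]. Qed.

Let ae (S : R) : adm S e. Proof. by have [M hM] := bde; apply: (adm_bounded (M := M)). Qed.

Let ie a b : ointb a b e.
Proof. by have [M hM] := bde; apply: (@con_ointb R a b e M) => s _; [exact: ce|exact: hM]. Qed.

Let fint_cvg0 s : 0 <= s -> fint s e d @[d --> 0^'+] --> 0.
Proof.
rewrite le_eqVlt => /predU1P[<-|s0].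
  by rewrite /fint eqxx -[X in _ --> X]e0; apply: cvg_at_right_filter; exact: ce.
have [M hM] := bde; apply: (@cvg0_dom_left R _ (M / Gamma (s + 1)) s) => // d /andP[d0 d1].
have d01 : 0 < d <= 1 by rewrite d0 ltW.
apply: (@le_trans _ _ (fint s (fun z => M * gk 1 z) d)).
  apply: (@norm_fint_le R 1 s e _ d (ltW s0) me) => //; first by apply: admZ; exact: adm_gk.
  by move=> z _; rewrite gk1 mulr1.
rewrite (@fintZ R 1 s M (gk 1) d (ltW s0) (adm_gk 1 ltr01) (ltW d1)) (fint_gk (ltW s0) ltr01 d0) gkE addrK.
by rewrite mulrAC -mulrA.
Qed.

(** The limit of the hypothesis as d tends to 0: the fractional integrals of e tend to 0 there, for
    the order 0 because e(0) = 0. *)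
Let step1 t : 0 < t < T -> mu * oint 0 t e + fe t = 0.
Proof.
move=> /andP[t0 tT]; apply/eqP; rewrite addr_eq0; apply/eqP.
apply: (@near_cst_cvg_eq R R (0^'+) _ (fun d => mu * (oint 0 t e - oint 0 d e) - fe d)).
  near=> d; have d0 : 0 < d by near: d; exact: nbhs_right_gt.
  have dt : d < t by near: d; exact: nbhs_right_lt.
  have -> : oint 0 t e - oint 0 d e = oint d t e by rewrite (@oint_split R 0 t d e) ?d0// addrAC subrr add0r.
  by rewrite He// addrAC subrr add0r.
rewrite -[X in _ --> X]subr0; apply: cvgB.
  apply: cvgMr; rewrite -[X in _ --> X]subr0; apply: cvgB; first exact: cvg_cst.
  exact: oint_cvg_left t0 (ie 0 t).
rewrite -[X in _ --> X]addr0 -[X in _ --> _ + X](mulr0 lam); apply: cvgD; first exact: fint_cvg0.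
by apply: cvgMr; exact: fint_cvg0.
Unshelve. all: by end_near. Qed.

Let Y := convol (gk 1) e.

Let YE t : Y t = oint 0 t e.
Proof. by rewrite -(fint1_oint t (ae t)) /fint oner_eq0. Qed.

Let convol_fint a s t : 0 < a -> 0 <= s -> convol (gk a) (fint s e) t = convol (gk (a + s)) e t.
Proof.
rewrite le_eqVlt => a0 /predU1P[<-|s0]; first by rewrite addr0 /fint eqxx.
by rewrite /fint (gt_eqF s0); apply: (convol_gkD a0 s0 (ae t)).
Qed.

(** Convolution with g_al turns [step1] into Y + lam (g_de * Y) + mu (g_al * Y) = 0 for Y = 1 * e
    and de = al - be, because al + (1 - al) = 1 and al + (1 - be) = de + 1. This is a Volterra
    equation with a bounded solution. *)
Let step2 t : 0 < t < T -> Y t = 0.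
Proof.
move=> /andP[t0 tT]; have de0 : 0 < al - be by rewrite subr_gt0.
have [M hM] := bde; have mY : measurable_fun setT Y by apply: measurable_convol => //; exact: measurable_gk.
apply: (@volterra_unique R al (al - be) lam mu t Y al0 de0 mY); last by rewrite t0 lexx.
  exists (M * t) => r /andP[r0 rt]; rewrite YE; apply: (@le_trans _ _ (M * (r - 0))).
    by apply: norm_oint_le_cst => //; exact: ltW.
  by rewrite subr0 ler_wpM2l// (le_trans _ (hM 0)).
move=> r /andP[r0 rt].
have aY : adm r Y by apply: adm_convol => //; exact: adm_gk.
have af1 : adm r (fint (1 - al) e) by exact: fint_adm.
have af2 : adm r (fint (1 - be) e) by exact: fint_adm.
have ag : adm r (gk al) by exact: adm_gk.
have z : convol (gk al) (fun s => fe s + mu * Y s) r = 0.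
  rewrite (@eq_convol R (gk al) (gk al) _ (fun s => 0 * e s) r) //.
    by rewrite (convolZr_adm 0 (ae r) ag (lexx r)) mul0r.
  move=> s /andP[s0 sr]; rewrite mul0r addrC YE; apply: step1; rewrite s0.
  exact: lt_trans sr (le_lt_trans rt tT).
move: z; rewrite (convolDr_adm (admD af1 (admZ lam af2)) (admZ mu aY) ag (lexx r)).
rewrite (convolDr_adm af1 (admZ lam af2) ag (lexx r)) (convolZr_adm lam af2 ag (lexx r)) (convolZr_adm mu aY ag (lexx r)).
rewrite !convol_fint//; have -> : al + (1 - al) = 1 by ring.
have -> : al + (1 - be) = al - be + 1 by ring.
by rewrite -(convol_gkD de0 ltr01 (ae r) (lexx r)).
Qed.

Lemma mode_zero t : 0 < t < T -> e t = 0.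
Proof.
move=> tT; have d := ftc_deriv tT (ie 0 T) (@ce t).
have z : is_derive t 1 (fun y => oint 0 y e) 0.
  have c := der_cst (0 : R) t; apply: near_eq_is_derive c.
  have := near_in_itvoo; move/(_ R 0 T t); rewrite in_itv => /(_ tT).
  by apply: filterS => y; rewrite in_itv /= => yT; rewrite -YE step2.
by rewrite -(@derive_val _ _ _ _ _ _ _ d) (@derive_val _ _ _ _ _ _ _ z).
Qed.
End ModeZero.

Section Uniqueness.
Context {R : realType}.
Variables (al be nu lam T : R) (f v1 v2 : R -> R -> R).
Hypotheses (be0 : 0 <= be) (beal : be < al) (al1 : al <= 1) (nu0 : 0 < nu) (T0 : 0 < T).
Hypotheses (hf : admissible_source T f).
Hypotheses (h1 : solution al be nu lam T f v1) (h2 : solution al be nu lam T f v2).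

Let modes_eq n t : 0 < t < T -> mode_of nu T v1 n t = mode_of nu T v2 n t.
Proof.
move=> tT; apply/eqP; rewrite -subr_eq0; apply/eqP.
pose e s := mode_of nu T v1 n s - mode_of nu T v2 n s.
have c1 := @continuous_mode_of R al be nu lam T f v1 nu0 T0 h1 n; have c2 := @continuous_mode_of R al be nu lam T f v2 nu0 T0 h2 n.
have [M1 b1] := mode_of_bounded nu0 T0 h1 n; have [M2 b2] := mode_of_bounded nu0 T0 h2 n.
have adm_m (m : R -> R) (M : R) : continuous m -> (forall s, `|m s| <= M) -> forall S, adm S m.
  move=> cm bm S; apply: (adm_bounded (M := M)) => //.
  by apply: open_continuous_measurable_fun; [exact: openT|move=> z _; exact: cm].
have a1 := adm_m _ _ c1 b1; have a2 := adm_m _ _ c2 b2.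
have fe (s r : R) : 0 <= s -> fint s e r = fint s (mode_of nu T v1 n) r - fint s (mode_of nu T v2 n) r.
  move=> s0; rewrite -[X in _ = _ + X]mulN1r -(fintZ _ s0 (a2 r) (lexx r)).
  rewrite -(fintD s0 (a1 r) (admZ _ (a2 r)) (lexx r)).
  by congr fint; apply/funext => z; rewrite mulN1r.
have sal : 0 <= 1 - al by rewrite subr_ge0.
have sbe : 0 <= 1 - be by rewrite subr_ge0 (le_trans (ltW beal)).
apply: (@mode_zero R al be lam (gam nu n ^+ 2) T e be0 beal al1) => //.
- by move=> s; apply: cvgB; [exact: c1|exact: c2].
- by exists (M1 + M2) => s; apply: le_trans (ler_normB _ _) _; exact: lerD.
- by rewrite /e !(@mode_of_nonpos R al be nu lam T f)// subr0.
- move=> d r d0 dr rT; have E1 := mode_identity be0 beal al1 nu0 T0 hf h1 d0 dr rT n.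
  have E2 := mode_identity be0 beal al1 nu0 T0 hf h2 d0 dr rT n.
  have io (m : R -> R) (M : R) : continuous m -> (forall s, `|m s| <= M) -> ointb d r m.
    by move=> cm bm; apply: (@con_ointb R d r m M) => s _; [exact: cm|exact: bm].
  rewrite (ointB (io _ _ c1 b1) (io _ _ c2 b2)) mulrBr E1 E2 !fe//.
  move: (fint _ _ d) (fint _ _ d) (fint _ _ d) (fint _ _ d) (fint _ _ r) (fint _ _ r) (fint _ _ r) (fint _ _ r) (ip _ _) => *; ring.
Qed.

Let open_eq x t : 0 < x < 1 -> 0 < t < T -> clipped T v1 x t = clipped T v2 x t.
Proof.
move=> x01 tT; apply/eqP; rewrite -subr_eq0; apply/eqP.
have bc v : solution al be nu lam T f v -> bcont (clipped T v ^~ t).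
  move=> hv; have [M _ hM] := clipped_bounded T0 hv; split; last by exists M => y _; exact: hM.
  by move=> y _; exact: (@continuous_fst_section R (clipped T v) t y (clipped_continuous T0 hv)).
have b1 := bc _ h1; have b2 := bc _ h2.
apply: (@ef_complete R nu nu0 (fun x => clipped T v1 x t - clipped T v2 x t) (bcontB b1 b2)) => // n.
rewrite (ipBl b1 b2 (bcont_ef nu0 n)); apply/eqP; rewrite subr_eq0; apply/eqP; exact: modes_eq.
Qed.

(** Equality on the open rectangle extends to the closed one by continuity, in x first and then in
    t; at t = 0 both initial values are 0. *)
Lemma solution_unique x t : x \in `[0, 1] -> t \in `[0, T] -> v1 x t = v2 x t.
Proof.
rewrite !in_itv /= => x01 tT.
suff E : clipped T v1 x t - clipped T v2 x t = 0 by apply/eqP; rewrite -subr_eq0 -E /clipped !clip_id.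
have cc : continuous (fun p : R * R => clipped T v1 p.1 p.2 - clipped T v2 p.1 p.2).
  move=> p; apply: cvgB; first exact: (@clipped_continuous R al be nu lam T f v1 T0 h1 p).
  exact: (@clipped_continuous R al be nu lam T f v2 T0 h2 p).
pose D x t := clipped T v1 x t - clipped T v2 x t.
have cx x' t' : D y t' @[y --> x'] --> D x' t' by exact: (@continuous_fst_section R D t' x' cc).
have ct x' t' : D x' s @[s --> t'] --> D x' t' by exact: (@continuous_snd_section R D t' x' cc).
have in_x t' : 0 < t' < T -> D x t' = 0.
  move=> t'T; have z y : 0 < y < 1 -> D y t' = 0 by move=> y01; rewrite /D open_eq// subrr.
  case/itv01P: x01 => [->|[->|]]; last exact: z.
    apply: (@near_cst_cvg_eq R R (0^'+) _ (D ^~ t')); last by apply: cvg_at_right_filter; exact: cx.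
    by near=> y; apply: z; apply/andP; split; near: y; [exact: nbhs_right_gt|exact: nbhs_right_lt].
  apply: (@near_cst_cvg_eq R R (1^'-) _ (D ^~ t')); last by apply: cvg_at_left_filter; exact: cx.
  by near=> y; apply: z; apply/andP; split; near: y; [exact: nbhs_left_gt|exact: nbhs_left_lt].
case/andP: tT; rewrite le_eqVlt => /predU1P[<- _|t0].
  by rewrite !(@clipped0 R al be nu lam T f)// subrr.
rewrite le_eqVlt => /predU1P[->|tT]; last by apply: in_x; rewrite t0.
apply: (@near_cst_cvg_eq R R (T^'-) _ (D x)); last by apply: cvg_at_left_filter; exact: ct.
by near=> y; apply: in_x; apply/andP; split; near: y; [exact: nbhs_left_gt|exact: nbhs_left_lt].
Unshelve. all: by end_near. Qed.
End Uniqueness.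

Theorem theorem1 (R : realType) (alpha beta nu lambda T : R) (f : R -> R -> R)
    (hbeta : 0 <= beta) (hbetaalpha : beta < alpha) (halpha : alpha <= 1)
    (hnu : 0 < nu) (hT : 0 < T) (hf : admissible_source T f) :
  exists u : R -> R -> R,
    [/\ solution alpha beta nu lambda T f u,
        forall v : R -> R -> R, solution alpha beta nu lambda T f v ->
          forall x t : R, x \in `[0, 1] -> t \in `[0, T] -> v x t = u x t
      & forall x t : R, x \in `[0, 1] -> t \in `[0, T] ->
          series (fun n : nat => solution_coef alpha beta nu lambda f n.+1 t *
                                 besselJ nu (besselJ_zero nu n.+1 * x)) @ \oo
          --> u x t].
Proof.
have hS := fb_solution_solution lambda hbeta hbetaalpha halpha hnu hT hf.
exists (fb_solution alpha beta nu lambda T f); split => //.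
- move=> v hv x t x01 tT.
  exact: (solution_unique hbeta hbetaalpha halpha hnu hT hf hv hS).
- by move=> x t; exact: fb_solution_series.
Qed.
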